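(* The series $\Omega(\tau_0,\tau_1,\tau_2,\ldots)$ is quasimodular of weight $0$, and the series $V(\tau_1,\tau_2,\ldots)$ is quasimodular of weight $-\tfrac12$.
   Context: For $k\ge 0$ put $q_k=e^{2\pi i\tau_k}$ and $q_k^a:=e^{2\pi i a\tau_k}$, with $\tau_1$ in the upper half-plane. Let $\xi(s)=\sum_{n\ge1}(n-\tfrac12)^{-s}=(2^s-1)\zeta(s)$, continued analytically (so $\xi(-2r)=0$ for $r\ge1$). Define $$\Omega(q_0,q_1,q_2,\ldots)=\prod_{r\ge1,\ r\text{ odd}}q_r^{-\xi(-r)}\prod_{n\ge0}\Big(1+\prod_{k\ge0}q_k^{(n+\frac12)^k}\Big)\Big(1+\prod_{k\ge0}q_k^{(-1)^{k+1}(n+\frac12)^k}\Big),$$ i.e. the factors are $1+q_0q_1^{n+1/2}q_2^{(n+1/2)^2}\cdots$ and $1+q_0^{-1}q_1^{n+1/2}q_2^{-(n+1/2)^2}q_3^{(n+1/2)^3}\cdots$. Let $V(q_1,q_2,\ldots)$ be the coefficient of $q_0^0$ in $\Omega$; explicitly $V=\prod_{r\text{ odd}}q_r^{-\xi(-r)}\sum_\lambda\prod_{r\ge1}q_r^{p_r(\lambda)}$, where $\lambda$ runs over all partitions, and if $\lambda$ has Frobenius coordinates $(m_1,\ldots,m_p\,|\,n_1,\ldots,n_p)$ (i.e. $p=\#\{i:\lambda_i\ge i\}$, $m_i=\lambda_i-i$, $n_i=\lambda'_i-i$ with $\lambda'$ the conjugate partition), $p_r(\lambda)=\sum_j (m_j+\tfrac12)^r+(-1)^{r+1}(n_j+\tfrac12)^r$.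 Quasimodular forms (Kaneko–Zagier): fix a finite-index subgroup $\Gamma\subset SL_2(\mathbb Z)$. An almost holomorphic modular form of weight $k$ is a function $F(\tau)=\sum_{m=0}^N f_m(\tau)y^{-m}$ on the upper half-plane ($y=\mathrm{Im}\,\tau$), each $f_m$ holomorphic with a convergent Fourier expansion $\sum_{n\ge0}a_ne^{2\pi i n\tau/\ell}$, satisfying $F(\frac{a\tau+b}{c\tau+d})=(c\tau+d)^kF(\tau)$ for all elements of $\Gamma$. A holomorphic $f$ is quasimodular of weight $k$ if $f=f_0$ for some such $F$ (for half-integral weight the automorphy factor is understood with a suitable multiplier system, as for $\eta(\tau)^{-1}$). A series $\sum_A f_A(\tau_1)\tau^A/A!$ in the variables $\tau_j$, $j\ne1$ (here $A=(a_0,a_2,a_3,\ldots)$ for $\Omega$ and $A=(a_2,a_3,\ldots)$ for $V$, almost all $a_j=0$, multi-index notation), is quasimodular of weight $w$ if each $f_A$ is quasimodular of weight $w+\mathrm{wt}(A)$, where $\mathrm{wt}(A)=\sum_j (j+1)a_j$; the subgroup $\Gamma$ is allowed to be any finite-index subgroup.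
   Formalization: Fourier expansions may have finitely many negative exponents: with n ≥ 0 only, the claim fails already for the constant terms 1/η of V and q^(-1/24)(1+...) of Ω; the values ξ(-r) are entered by their Bernoulli-number formula. *)

(* Defs.v *)
From mathcomp Require Import all_boot all_order all_algebra.
From mathcomp Require Import complex.
From mathcomp Require Import reals.
From mathcomp.analysis Require Import sequences exp trigo.
Set Implicit Arguments. Unset Strict Implicit. Unset Printing Implicit Defensive.
Import Order.TTheory GRing.Theory Num.Theory.
Local Open Scope ring_scope.
Local Open Scope complex_scope.

Fixpoint bernoulli_list (n : nat) : seq rat :=
  match n with
  | 0 => [:: 1]
  | n'.+1 => let s := bernoulli_list n' in
      rcons s (- (n'.+2)%:R^-1 * \sum_(k < n'.+1) ('C(n'.+2, k))%:R * nth 0 s k)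
  end.

Definition bernoulli (n : nat) : rat := nth 0 (bernoulli_list n) n.

(* zeta(-r) = - B_(r+1)/(r+1) for r >= 1 (value of the analytic continuation) *)
Definition zeta_neg (r : nat) : rat := - bernoulli r.+1 / (r.+1)%:R.

Definition xi_neg (r : nat) : rat := ((2 ^- r) - 1) * zeta_neg r.

Section Defs.
Variable R : realType.
Local Notation C := R[i].

Definition reC (z : C) : R := let: a +i* _ := z in a.
Definition imC (z : C) : R := let: _ +i* b := z in b.

Definition cexp (z : C) : C :=
  (expR (reC z))%:C * ((cos (imC z))%:C + 'i%C * (sin (imC z))%:C).

Definition ee (z : C) : C := cexp (2%:R * (pi : R)%:C * 'i%C * z).

Definition upper (t : C) : Prop := 0 < imC t.

Definition cvgC (u : nat -> C) (l : C) : Prop :=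
  forall eps : R, 0 < eps -> exists N : nat, forall n, (N <= n)%N ->
    `|u n - l| < eps%:C.

Definition holo_upper (f : C -> C) : Prop :=
  forall t, upper t -> exists l : C, forall eps : R, 0 < eps ->
    exists delta : R, 0 < delta /\ forall h : C, h != 0 -> `|h| < delta%:C ->
      `|(f (t + h) - f t) / h - l| < eps%:C.

Definition fourier_upper (f : C -> C) : Prop :=
  holo_upper f /\
  exists (l : nat) (n0 : nat) (a : nat -> C), (0 < l)%N /\
    forall t, upper t ->
      cvgC (fun N => \sum_(n < N) a n * ee ((n%:R - n0%:R) / l%:R * t)) (f t).

Definition SL2Z (g : 'M[int]_2) : Prop := \det g = 1.

Definition finite_index_subgroup (G : 'M[int]_2 -> Prop) : Prop :=
  [/\ forall g, G g -> SL2Z g,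
      G 1%:M,
      forall g h, G g -> G h -> G (g *m h),
      forall g, G g -> G (invmx g)
    & exists reps : seq 'M[int]_2, forall g, SL2Z g ->
        exists2 r, r \in reps & G (invmx r *m g)].

Definition mob (g : 'M[int]_2) (t : C) : C :=
  ((g 0 0)%:~R * t + (g 0 1)%:~R) / ((g 1 0)%:~R * t + (g 1 1)%:~R).

(* z^(k/2) : z^(k div 2) * sqrt(z)^(k mod 2).  For half-integral weight,
   the choice of square-root branch is absorbed by the multiplier system. *)
Definition halfpow (k : int) (z : C) : C :=
  z ^ (k %/ 2)%Z * (if (k %% 2 == 0)%Z then 1 else sqrtc z).

Definition jfac (k : int) (g : 'M[int]_2) (t : C) : C :=
  halfpow k ((g 1 0)%:~R * t + (g 1 1)%:~R).

(* f is quasimodular of weight k/2 (k : int) in the Kaneko--Zagier sense, for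
   some finite-index subgroup of SL_2(Z); for half-integral weight (k odd) the
   automorphy factor carries a multiplier system nu (|nu| = 1). *)
Definition quasimodular (k : int) (f : C -> C) : Prop :=
  exists (G : 'M[int]_2 -> Prop) (nu : 'M[int]_2 -> C)
         (M : nat) (fs : nat -> C -> C),
  [/\ finite_index_subgroup G,
      (forall g, G g -> if (k %% 2 == 0)%Z then nu g = 1 else `|nu g| = 1),
      (forall m, (m <= M)%N -> fourier_upper (fs m)),
      (forall t, upper t -> f t = fs 0%N t)
    & let F := fun t => \sum_(m < M.+1) fs m t * ((imC t) ^- m)%:C in
      forall g t, G g -> upper t ->
        F (mob g t) = nu g * jfac k g t * F t].

(* Formal power series in the variables tau_k (k <> 1), coefficients   *)
(* (functions of tau_1) in the basis tau^A / A!.  A multi-index is a    *)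
(* seq nat, A`_k = exponent of tau_k (missing entries are 0).           *)

Definition ser := seq nat -> C.

Fixpoint subidx (A : seq nat) : seq (seq nat) :=
  match A with
  | [::] => [:: [::]]
  | a :: A' => [seq b :: B | b <- iota 0 a.+1, B <- subidx A']
  end.

Definition binomA (A B : seq nat) : nat :=
  \prod_(i < size A) 'C(nth 0%N A i, nth 0%N B i).

Definition subA (A B : seq nat) : seq nat :=
  [seq (nth 0%N A i - nth 0%N B i)%N | i <- iota 0 (size A)].

(* product of exponential generating series *)
Definition smul (F G : ser) : ser := fun A =>
  \sum_(B <- subidx A) (binomA A B)%:R * F B * G (subA A B).

Definition sone : ser := fun A => if all (fun a => a == 0%N) A then 1 else 0.

Definition sadd (F G : ser) : ser := fun A => F A + G A.

Definition wt (A : seq nat) : nat := \sum_(j < size A) (j.+1 * nth 0%N A j)%N.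

(* The expansion of \prod_k q_k^(x_k) = exp(2 pi i \sum_k x_k tau_k) in the
   variables tau_k, k <> 1, at tau_1 = t. *)
Definition qmon (x : nat -> R) (t : C) : ser := fun A =>
  ee ((x 1%N)%:C * t) *
  \prod_(k < size A | k != 1%N :> nat)
     (2%:R * (pi : R)%:C * 'i%C * (x k)%:C) ^+ nth 0%N A k.

(* exponents of the prefactor \prod_(r odd) q_r^(-xi(-r)) *)
Definition xi_exp (r : nat) : R := if odd r then - ratr (xi_neg r) else 0.

Definition half (n : nat) : R := n%:R + 2%:R^-1.

(* exponents of 1 + \prod_k q_k^((n+1/2)^k) *)
Definition omx1 (n : nat) (k : nat) : R := half n ^+ k.
(* exponents of 1 + \prod_k q_k^((-1)^(k+1) (n+1/2)^k) *)
Definition omx2 (n : nat) (k : nat) : R := (-1) ^+ k.+1 * half n ^+ k.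

Definition OmegaN (N : nat) (t : C) : ser :=
  smul (qmon xi_exp t)
    (\big[smul/sone]_(n < N)
        smul (sadd sone (qmon (omx1 n) t)) (sadd sone (qmon (omx2 n) t))).

Definition is_partition (M : nat) (l : {ffun 'I_M -> 'I_M.+1}) : bool :=
  ((\sum_(i < M) (l i : nat))%N == M) &&
  [forall i : 'I_M, forall j : 'I_M, (i <= j)%N ==> (l j <= l i)%N].

(* Frobenius coordinates (0-based row index i, i.e. row i+1):
   the row contributes iff lambda_(i+1) >= i+1;
   m = lambda_(i+1) - (i+1),  n = lambda'_(i+1) - (i+1). *)
Definition frob_m (M : nat) (l : {ffun 'I_M -> 'I_M.+1}) (i : 'I_M) : nat :=
  (l i - i.+1)%N.
Definition frob_n (M : nat) (l : {ffun 'I_M -> 'I_M.+1}) (i : 'I_M) : nat :=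
  (#|[set j : 'I_M | (i.+1 <= l j)%N]| - i.+1)%N.

Definition pfrob (M : nat) (l : {ffun 'I_M -> 'I_M.+1}) (r : nat) : R :=
  \sum_(i < M | (i.+1 <= l i)%N)
     (half (frob_m l i) ^+ r + (-1) ^+ r.+1 * half (frob_n l i) ^+ r).

(* exponents for lambda: q_1^(p_1) q_2^(p_2) ... (no q_0) *)
Definition vx (M : nat) (l : {ffun 'I_M -> 'I_M.+1}) (r : nat) : R :=
  if r == 0%N then 0 else pfrob l r.

Definition VN (N : nat) (t : C) : ser :=
  smul (qmon xi_exp t)
    (fun A => \sum_(M < N) \sum_(l : {ffun 'I_M -> 'I_M.+1} | is_partition l)
                 qmon (vx l) t A).

End Defs.

(* Main.v *)
(** Expand the product over the sets of chosen factors (fermion states).  The states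
    of charge [c] correspond to partitions, and the exponent of [q_k] on such a
    state is a polynomial in [c] and in the [- xi(-j) + p_j(lambda)], [j <= k].  Summing over
    [c], every coefficient of Omega is the polynomial combination [Glim] of the
    theta series [sum_c c^e q^(c^2/2)] and of the coefficients [Vf] of V; the
    leading term is [theta_3 * Vf].

    The same coefficients obey a recursion through the cumulants of the independent
    two-valued factors, which sum to Lambert series.  Such a series is a
    [tau]-derivative of an Eisenstein series, and the Eisenstein series are rational
    combinations of the cumulants of theta_2, theta_3, theta_4.  Hence Omega is
    quasimodular, and V follows by induction, dividing by [theta_3].

    The level is handled as follows.  Poisson summation, obtained from Riemann sums
    of the Gaussian and a finite Fourier transform, gives the inversion of the three
    theta constants.  As [theta_2 theta_3 theta_4 = 2 eta^3], every element of SL2(Z)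
    permutes the theta constants and multiplies them and eta by [sqrt (c tau + d)] up
    to 24th roots of unity; the elements acting trivially on these data form a group
    of finite index.  The ring generated by its modular forms and by the
    logarithmic derivative of eta is closed under [d/dtau], and each of its elements
    is the constant term of a polynomial in [1/y] that transforms like a modular form. *)
Require Import Defs.
From mathcomp Require Import all_boot all_order all_algebra.
From mathcomp Require Import complex.
From mathcomp Require Import reals.
From mathcomp.analysis Require Import sequences exp trigo.
From mathcomp Require Import boolp classical_sets topology normedtype derive.
From mathcomp Require Import fingroup perm.
From mathcomp Require Import ring lra zify.
Import numFieldNormedType.Exports.
Import Order.TTheory GRing.Theory Num.Theory.
Local Open Scope ring_scope.
Set Implicit Arguments. Unset Strict Implicit. Unset Printing Implicit Defensive.
Local Open Scope complex_scope.

(** * Real-valued modulus on the complex numbers and limits of sequences *)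

Section ComplexNorm.
Variable R : realType.
Local Notation C := R[i].
Implicit Types (z w : C) (x y : R).

(** V alone has no usable recursion, whereas Omega is a product of independent factors with explicit
    logarithmic derivatives. V is recovered because passing from charge 0 to charge c changes every
    exponent by an explicit polynomial. That polynomial is exact thanks to the prefactor: -xi(-k) is
    the value at 1/2 of a Bernoulli polynomial divided by its degree, and the same number is the
    constant term that makes the Lambert series of a first derivative quasimodular. A signed Lambert
    series in n^s d^r q^(nd/2), n odd, is reached from two sides: for s > r as a derivative of an
    Eisenstein series, for s < r from a theta_3 cumulant. Parity leaves only odd s - r. Identities
    are proved at finite truncation and passed to the limit, so a majorant built from partition
    counts with polynomial factors accompanies them. The Gaussian integral is never computed: its
    value is forced by comparison at the fixed point t = i. No congruence subgroup is identified
    either: equality of finitely many transformation data gives finite index by pigeonhole. *)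

Definition nm z : R := Num.sqrt (reC z ^+ 2 + imC z ^+ 2).

Lemma nmE z : `|z| = (nm z)%:C.
Proof. by rewrite normc_def; case: z. Qed.

Lemma nm_ge0 z : 0 <= nm z. Proof. exact: sqrtr_ge0. Qed.

Lemma nmM z w : nm (z * w) = nm z * nm w.
Proof. by apply: (@complexI R); rewrite rmorphM /= -!nmE normrM. Qed.

Lemma nmD z w : nm (z + w) <= nm z + nm w.
Proof. by rewrite -lecR rmorphD /= -!nmE ler_normD. Qed.

Lemma nmN z : nm (- z) = nm z.
Proof. by apply: (@complexI R); rewrite -!nmE normrN. Qed.

Lemma nmB z w : nm (z - w) <= nm z + nm w.
Proof. by rewrite (le_trans (nmD _ _)) // nmN. Qed.

Lemma nmC z w : nm (z - w) = nm (w - z).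
Proof. by rewrite -nmN opprB. Qed.

Lemma nm0 : nm 0 = 0.
Proof. by apply: (@complexI R); rewrite -nmE normr0. Qed.

Lemma nm1 : nm 1 = 1.
Proof. by apply: (@complexI R); rewrite -nmE normr1. Qed.

Lemma nm_eq0 z : (nm z == 0) = (z == 0).
Proof. by rewrite -(inj_eq (@complexI R)) -nmE normr_eq0. Qed.

Lemma nm_gt0 z : (0 < nm z) = (z != 0).
Proof. by rewrite lt_def nm_eq0 nm_ge0 andbT. Qed.

Lemma nmV z : nm z^-1 = (nm z)^-1.
Proof. by apply: (@complexI R); rewrite -nmE normfV nmE fmorphV. Qed.

Lemma nmX z n : nm (z ^+ n) = nm z ^+ n.
Proof. by apply: (@complexI R); rewrite -nmE normrX nmE rmorphXn. Qed.

Lemma nm_real x : nm x%:C = `|x|.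
Proof. by rewrite /nm /= expr0n addr0 sqrtr_sqr. Qed.

Lemma nm_nat n : nm n%:R = n%:R.
Proof. by rewrite -(rmorph_nat (real_complex R)) nm_real ger0_norm. Qed.

Lemma nm_sum (I : Type) (r : seq I) (P : pred I) (F : I -> C) :
  nm (\sum_(i <- r | P i) F i) <= \sum_(i <- r | P i) nm (F i).
Proof.
elim/big_ind2 : _ => [|a b c d h1 h2|i _]; rewrite ?nm0 //.
by apply: le_trans (nmD _ _) _; apply: lerD.
Qed.

Lemma nm_dist z w : nm z - nm w <= nm (z - w).
Proof. by rewrite lerBlDr -{1}(subrK w z) nmD. Qed.

Lemma reC_le z : `|reC z| <= nm z.
Proof. by rewrite /nm -sqrtr_sqr ler_wsqrtr // lerDl sqr_ge0. Qed.

Lemma imC_le z : `|imC z| <= nm z.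
Proof. by rewrite /nm -sqrtr_sqr ler_wsqrtr // lerDr sqr_ge0. Qed.

Lemma nm_le_reim z : nm z <= `|reC z| + `|imC z|.
Proof.
have h : 0 <= `|reC z| + `|imC z| by apply: addr_ge0.
rewrite /nm -{1}(ger0_norm h) -sqrtr_sqr ler_wsqrtr //.
rewrite sqrrD !real_normK ?num_real //.
have : 0 <= `|reC z| * `|imC z| by apply: mulr_ge0.
lra.
Qed.

Lemma reCD z w : reC (z + w) = reC z + reC w. Proof. by case: z; case: w. Qed.
Lemma imCD z w : imC (z + w) = imC z + imC w. Proof. by case: z; case: w. Qed.
Lemma reCN z : reC (- z) = - reC z. Proof. by case: z. Qed.
Lemma imCN z : imC (- z) = - imC z. Proof. by case: z. Qed.
Lemma reCB z w : reC (z - w) = reC z - reC w. Proof. by rewrite reCD reCN. Qed.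
Lemma imCB z w : imC (z - w) = imC z - imC w. Proof. by rewrite imCD imCN. Qed.
Lemma reCM z w : reC (z * w) = reC z * reC w - imC z * imC w.
Proof. by case: z; case: w. Qed.
Lemma imCM z w : imC (z * w) = reC z * imC w + imC z * reC w.
Proof. by case: z; case: w. Qed.
Lemma reC_real x : reC x%:C = x. Proof. by []. Qed.
Lemma imC_real x : imC x%:C = 0. Proof. by []. Qed.
Lemma reCMr x z : reC (x%:C * z) = x * reC z.
Proof. by rewrite reCM /= mul0r subr0. Qed.
Lemma imCMr x z : imC (x%:C * z) = x * imC z.
Proof. by rewrite imCM /= mul0r addr0. Qed.
Lemma reC_sum (I : Type) (r : seq I) (P : pred I) (F : I -> C) :
  reC (\sum_(i <- r | P i) F i) = \sum_(i <- r | P i) reC (F i).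
Proof. by rewrite (big_morph (@reC R) reCD (erefl : reC 0 = 0)). Qed.
Lemma imC_sum (I : Type) (r : seq I) (P : pred I) (F : I -> C) :
  imC (\sum_(i <- r | P i) F i) = \sum_(i <- r | P i) imC (F i).
Proof. by rewrite (big_morph (@imC R) imCD (erefl : imC 0 = 0)). Qed.

Lemma C_ext z w : reC z = reC w -> imC z = imC w -> z = w.
Proof. by case: z => a b; case: w => c d /= -> ->. Qed.

Lemma natC n : (n%:R : C) = (n%:R : R)%:C.
Proof. by rewrite rmorph_nat. Qed.

Definition cvc (u : nat -> C) (l : C) : Prop :=
  forall e : R, 0 < e -> exists N, forall n, (N <= n)%N -> nm (u n - l) < e.

Lemma cvcE u l : cvgC u l <-> cvc u l.
Proof.
split=> h e e0; have [N hN] := h e e0; exists N => n /hN; by rewrite nmE ltcR.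
Qed.

(** One-sided, so it expresses convergence to 0 only for non-negative sequences; it serves for error
    bounds. *)
Definition null (r : nat -> R) := forall e : R, 0 < e -> exists N, forall n, (N <= n)%N -> r n < e.

Lemma cvc_null u l r : (forall n, nm (u n - l) <= r n) -> null r -> cvc u l.
Proof.
move=> h hr e e0; have [N hN] := hr e e0; exists N => n /hN; exact: le_lt_trans.
Qed.

Lemma cvc_null_ev u l r N0 : (forall n, (N0 <= n)%N -> nm (u n - l) <= r n) -> null r -> cvc u l.
Proof.
move=> h hr e e0; have [N hN] := hr e e0; exists (maxn N0 N) => n.
rewrite geq_max => /andP[h1 h2]; apply: le_lt_trans (h _ h1) (hN _ h2).
Qed.

Lemma cvc_nm u l : cvc u l -> null (fun n => nm (u n - l)).
Proof. by []. Qed.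

Lemma null_le r s : (forall n, r n <= s n) -> null s -> null r.
Proof. move=> h hs e /hs[N hN]; exists N => n /hN; exact: le_lt_trans. Qed.

Lemma nullD r s : null r -> null s -> null (fun n => r n + s n).
Proof.
move=> hr hs e e0; have e2 : 0 < e / 2 by lra.
have [N1 h1] := hr _ e2; have [N2 h2] := hs _ e2; exists (maxn N1 N2) => n.
rewrite geq_max => /andP[/h1 ? /h2 ?]; lra.
Qed.

Lemma nullZ r c : 0 <= c -> (forall n, 0 <= r n) -> null r -> null (fun n => c * r n).
Proof.
move=> c0 r0 hr e e0; have ce : 0 < e / (c + 1) by apply: divr_gt0 => //; lra.
have [N h] := hr _ ce; exists N => n /h; rewrite ltr_pdivlMr ?mulrDr; last by lra.
rewrite mulr1 mulrC; have := r0 n; lra.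
Qed.

Lemma null_inv : null (fun n => n.+1%:R^-1).
Proof.
move=> e e0; have [N hN] : exists N : nat, e^-1 < N%:R.
  by exists (Num.truncn e^-1).+1; rewrite truncnS_gt // ltW // invr_gt0.
exists N => n Nn; rewrite invf_plt ?posrE // (lt_le_trans hN) // ler_nat ltnW //.
Qed.

Lemma cvc_cst l : cvc (fun _ => l) l.
Proof. by move=> e e0; exists 0%N => n _; rewrite subrr nm0. Qed.

Lemma cvcD u v l m : cvc u l -> cvc v m -> cvc (fun n => u n + v n) (l + m).
Proof.
move=> h1 h2; apply: cvc_null (nullD (cvc_nm h1) (cvc_nm h2)) => n.
by rewrite opprD addrACA nmD.
Qed.

Lemma cvcN u l : cvc u l -> cvc (fun n => - u n) (- l).
Proof. by move=> h; apply: cvc_null (cvc_nm h) => n; rewrite -opprD nmN. Qed.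

Lemma cvcB u v l m : cvc u l -> cvc v m -> cvc (fun n => u n - v n) (l - m).
Proof. by move=> h1 h2; apply: cvcD => //; apply: cvcN. Qed.

Lemma cvcM u v l m : cvc u l -> cvc v m -> cvc (fun n => u n * v n) (l * m).
Proof.
move=> h1 h2; have [N0 hN] := h1 1 ltr01.
apply: (@cvc_null_ev _ _ (fun n => (nm l + 1) * nm (v n - m) + nm m * nm (u n - l)) N0); last first.
  apply: nullD; apply: nullZ => //; rewrite ?addr_ge0 ?nm_ge0 // => n; exact: nm_ge0.
move=> n /hN hn; have -> : u n * v n - l * m = u n * (v n - m) + m * (u n - l) by ring.
apply: le_trans (nmD _ _) _; rewrite !nmM lerD2r ler_wpM2r ?nm_ge0 //.
have := nm_dist (u n) l; lra.
Qed.

Lemma cvcZ u l c : cvc u l -> cvc (fun n => c * u n) (c * l).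
Proof. by move=> h; apply: cvcM => //; apply: cvc_cst. Qed.

Lemma cvcX u l k : cvc u l -> cvc (fun n => u n ^+ k) (l ^+ k).
Proof.
move=> h; elim: k => [|k IH].
  by under eq_fun do rewrite expr0; rewrite expr0; apply: cvc_cst.
by under eq_fun do rewrite exprS; rewrite exprS; apply: cvcM.
Qed.

Lemma cvcV u l : l != 0 -> cvc u l -> cvc (fun n => (u n)^-1) l^-1.
Proof.
rewrite -nm_gt0 => l0 h.
have l2 : 0 < nm l / 2 by lra.
have [N0 hN] := h _ l2.
apply: (@cvc_null_ev _ _ (fun n => (2 / nm l ^+ 2) * nm (u n - l)) N0); last first.
  apply: nullZ => //; first by rewrite divr_ge0 // sqr_ge0.
  by move=> n; apply: nm_ge0.
move=> n /hN; rewrite nmC => hn; have hu : nm l / 2 <= nm (u n) by have := nm_dist l (u n); lra.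
have u0 : 0 < nm (u n) by lra.
have un0 : u n != 0 by rewrite -nm_gt0.
have ln0 : l != 0 by rewrite -nm_gt0.
have -> : (u n)^-1 - l^-1 = (l - u n) * ((u n)^-1 * l^-1) by field; apply/andP.
rewrite !nmM !nmV nmC mulrC ler_wpM2r ?nm_ge0 // -invfM -[2 / _]invf_div.
rewrite lef_pV2 ?posrE ?divr_gt0 ?exprn_gt0 ?mulr_gt0 //.
by rewrite expr2; nra.
Qed.
End ComplexNorm.

(** * Absolutely convergent series and dominated convergence *)

Section Series.
Variable R : realType.
Local Notation C := R[i].
Implicit Types (a : nat -> C) (b : nat -> R).

Lemma cvc_unique (u : nat -> C) (l m : C) : cvc u l -> cvc u m -> l = m.
Proof.
move=> h1 h2; apply/eqP; rewrite -subr_eq0 -nm_eq0; apply/negPn/negP => n0.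
have e0 : 0 < nm (l - m) / 2 by rewrite divr_gt0 // lt_def n0 nm_ge0.
have [N1 a1] := h1 _ e0; have [N2 a2] := h2 _ e0.
have := a1 (maxn N1 N2) (leq_maxl _ _); have := a2 (maxn N1 N2) (leq_maxr _ _).
set w := u _; have -> : l - m = (w - m) - (w - l) by ring.
have := nmB (w - m) (w - l); lra.
Qed.

Lemma cvc_sub (u : nat -> C) l (k : nat -> nat) :
  (forall m, exists N, forall n, (N <= n)%N -> (m <= k n)%N) -> cvc u l -> cvc (fun n => u (k n)) l.
Proof.
move=> hk h e e0; have [N hN] := h e e0; have [N' hN'] := hk N.
by exists N' => n /hN' /hN.
Qed.

Lemma cvc_shift (u : nat -> C) l m : cvc u l -> cvc (fun n => u (n + m)%N) l.
Proof. by apply: cvc_sub => k; exists k => n h; rewrite (leq_trans h) ?leq_addr. Qed.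

Lemma cvc_ext (u v : nat -> C) l N0 : (forall n, (N0 <= n)%N -> u n = v n) -> cvc u l -> cvc v l.
Proof.
move=> h hu e e0; have [N hN] := hu e e0; exists (maxn N0 N) => n.
by rewrite geq_max => /andP[h1 h2]; rewrite -h // hN.
Qed.

Lemma cvc_eq (u v : nat -> C) l : u =1 v -> cvc u l -> cvc v l.
Proof. by move=> h; apply: (@cvc_ext _ _ _ 0%N) => n _. Qed.

Lemma cvc_sumI (I : Type) (r : seq I) (u : I -> nat -> C) (l : I -> C) :
  (forall i, cvc (u i) (l i)) -> cvc (fun n => \sum_(i <- r) u i n) (\sum_(i <- r) l i).
Proof.
move=> h; elim: r => [|i r IH].
  by rewrite big_nil; apply: cvc_eq (cvc_cst 0) => n; rewrite big_nil.
rewrite big_cons; apply: cvc_eq (cvcD (h i) IH) => n; by rewrite big_cons.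
Qed.

Lemma cvc_le (u : nat -> C) l K : (forall n, nm (u n) <= K) -> cvc u l -> nm l <= K.
Proof.
move=> h hu; rewrite leNgt; apply/negP => lt.
have e0 : 0 < nm l - K by rewrite subr_gt0.
have [N hN] := hu _ e0; have := hN _ (leqnn N); have := h N.
by have := nm_dist l (u N); rewrite nmC; lra.
Qed.

(** For non-negative terms this is convergence. Bounded partial sums are the form in which every
    majorant is carried. *)
Definition bdd b := exists K : R, forall N, \sum_(n < N) b n <= K.
Definition asum a := bdd (fun n => nm (a n)).

Lemma bdd_le b b' : (forall n, b n <= b' n) -> bdd b' -> bdd b.
Proof. by move=> h [K hK]; exists K => N; apply: le_trans (hK N); apply: ler_sum. Qed.

Lemma bddD b b' : bdd b -> bdd b' -> bdd (fun n => b n + b' n).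
Proof. by move=> [K h] [K' h']; exists (K + K') => N; rewrite big_split lerD. Qed.

Lemma bddZ b c : 0 <= c -> bdd b -> bdd (fun n => c * b n).
Proof. by move=> c0 [K h]; exists (c * K) => N; rewrite -mulr_sumr ler_wpM2l. Qed.

Lemma bdd_geo r : 0 <= r -> r < 1 -> bdd (fun n => r ^+ n).
Proof.
move=> r0 r1; exists (1 - r)^-1 => N.
have := subrX1 r N; rewrite -(big_mkord xpredT (fun i => r ^+ i)) big_mkord => e.
rewrite -[(1 - r)^-1]mul1r ler_pdivlMr ?subr_gt0 //.
have -> : (\sum_(n < N) r ^+ n) * (1 - r) = 1 - r ^+ N by lra.
by rewrite gerBl exprn_ge0.
Qed.

Lemma bdd_tail b : (forall n, 0 <= b n) -> bdd b -> forall e : R, 0 < e ->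
  exists N0, forall N, \sum_(N0 <= n < N) b n < e.
Proof.
move=> b0 [K hK] e e0.
pose S := [set x | exists N, x = \sum_(n < N) b n]%classic.
have hs : has_sup S by split; [exists 0, 0%N; rewrite big_ord0|exists K => x [N ->]].
have [x [N0 ->] hx] := sup_adherent e0 hs.
exists N0 => N; have [le|/ltnW le] := leqP N N0; first by rewrite big_geq.
have : \sum_(n < N) b n <= sup S by apply: (ub_le_sup hs.2); exists N.
rewrite -(big_mkord xpredT b) (@big_cat_nat _ _ _ N0) //= big_mkord.
by move: hx; lra.
Qed.

Lemma bdd_cvc b : (forall n, 0 <= b n) -> bdd b ->
  exists l : R, forall e : R, 0 < e -> exists N, forall n, (N <= n)%N -> `|\sum_(i < n) b i - l| < e.
Proof.
move=> b0 [K hK].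
pose S := [set x | exists N, x = \sum_(n < N) b n]%classic.
have hs : has_sup S by split; [exists 0, 0%N; rewrite big_ord0|exists K => x [N ->]].
exists (sup S) => e e0; have [x [N0 ->] hx] := sup_adherent e0 hs.
exists N0 => N le.
have h1 : \sum_(n < N) b n <= sup S by apply: (ub_le_sup hs.2); exists N.
have h2 : \sum_(n < N0) b n <= \sum_(n < N) b n.
  by rewrite -!(big_mkord xpredT b) (@big_cat_nat _ _ _ N0 0 N) //= lerDl sumr_ge0.
rewrite distrC ger0_norm; lra.
Qed.

(** Adding the majorant [b'] makes the terms non-negative; the limit is a difference of two monotone
    limits. *)
Lemma bdd_cvc_signed b b' : (forall n, `|b n| <= b' n) -> bdd b' ->
  exists l : R, forall e : R, 0 < e -> exists N, forall n, (N <= n)%N -> `|\sum_(i < n) b i - l| < e.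
Proof.
move=> h hb'.
have b0 n : 0 <= b' n by apply: le_trans (h n).
have h0 n : 0 <= b n + b' n by have := h n; rewrite ler_norml => /andP[]; lra.
have [l1 H1] := bdd_cvc b0 hb'.
have [l2 H2] : exists l : R, forall e : R, 0 < e -> exists N, forall n, (N <= n)%N -> `|\sum_(i < n) (b i + b' i) - l| < e.
  apply: (@bdd_cvc (fun n => b n + b' n)) => //; apply: (@bdd_le _ (fun n => b' n + b' n)); last by apply: bddD.
  by move=> n; have := h n; rewrite ler_norml => /andP[]; lra.
exists (l2 - l1) => e e0; have e2 : 0 < e / 2 by lra.
have [N1 a1] := H1 _ e2; have [N2 a2] := H2 _ e2; exists (maxn N1 N2) => n.
rewrite geq_max => /andP[/a1 + /a2]; rewrite big_split /=.
set x := \sum_(i < n) b i; set y := \sum_(i < n) b' i => k1 k2.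
have -> : x - (l2 - l1) = (x + y - l2) - (y - l1) by ring.
have := ler_normB (x + y - l2) (y - l1); lra.
Qed.

(** A chosen limit, with default value 0 for divergent sequences, so that infinite sums are total
    functions. *)
Definition clim (u : nat -> C) : C := xget 0 [set l | cvc u l]%classic.
Definition csum a : C := clim (fun N => \sum_(n < N) a n).

Lemma clim_eq u l : cvc u l -> clim u = l.
Proof. by move=> h; apply: cvc_unique (h); apply: (@xgetPex _ 0 [set l | cvc u l]%classic); exists l. Qed.

Lemma asum_cvc a : asum a -> cvc (fun N => \sum_(n < N) a n) (csum a).
Proof.
move=> h.
have [x hx] := bdd_cvc_signed (fun n => reC_le (a n)) h.
have [y hy] := bdd_cvc_signed (fun n => imC_le (a n)) h.
suff H : cvc (fun N => \sum_(n < N) a n) (x +i* y) by rewrite /csum (clim_eq H).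
move=> e e0; have e2 : 0 < e / 2 by lra.
have [N1 a1] := hx _ e2; have [N2 a2] := hy _ e2; exists (maxn N1 N2) => n.
rewrite geq_max => /andP[/a1 k1 /a2 k2].
apply: le_lt_trans (nm_le_reim _) _; rewrite reCB imCB reC_sum imC_sum /=; lra.
Qed.

Lemma csum_eqP a l : cvc (fun N => \sum_(n < N) a n) l -> csum a = l.
Proof. exact: clim_eq. Qed.

Lemma eq_csum a a' : a =1 a' -> csum a = csum a'.
Proof. by move=> h; congr csum; apply/funext. Qed.

Lemma asumD a a' : asum a -> asum a' -> asum (fun n => a n + a' n).
Proof. by move=> h h'; apply: bdd_le (bddD h h') => n; apply: nmD. Qed.

Lemma asumZ c a : asum a -> asum (fun n => c * a n).
Proof. by move=> h; apply: bdd_le (bddZ (nm_ge0 c) h) => n; rewrite nmM. Qed.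

Lemma csumD a a' : asum a -> asum a' -> csum (fun n => a n + a' n) = csum a + csum a'.
Proof.
move=> h h'; apply: csum_eqP; apply: cvc_eq (cvcD (asum_cvc h) (asum_cvc h')) => N.
by rewrite big_split.
Qed.

Lemma csumZ c a : asum a -> csum (fun n => c * a n) = c * csum a.
Proof.
move=> h; apply: csum_eqP; apply: cvc_eq (cvcZ c (asum_cvc h)) => N.
by rewrite mulr_sumr.
Qed.

Lemma asumN a : asum a -> asum (fun n => - a n).
Proof. by move=> [K h]; exists K => N; under eq_bigr do rewrite nmN. Qed.

Lemma asumB a a' : asum a -> asum a' -> asum (fun n => a n - a' n).
Proof. by move=> h h'; apply: asumD => //; apply: asumN. Qed.

Lemma csumB a a' : asum a -> asum a' -> csum (fun n => a n - a' n) = csum a - csum a'.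
Proof.
move=> h h'; apply: csum_eqP; apply: cvc_eq (cvcB (asum_cvc h) (asum_cvc h')) => N.
by rewrite sumrB.
Qed.

Lemma csum_finite a N0 : (forall n, (N0 <= n)%N -> a n = 0) -> csum a = \sum_(n < N0) a n.
Proof.
move=> h; apply: csum_eqP; apply: (@cvc_ext (fun _ => \sum_(n < N0) a n) _ _ N0); last exact: cvc_cst.
move=> n le; rewrite -!(big_mkord xpredT a) (@big_cat_nat _ _ _ N0 0 n) //= [X in _ = _ + X]big_nat_cond [X in _ = _ + X]big1 ?addr0 //.
by move=> i /andP[/andP[/h]].
Qed.

Lemma asum_finite a N0 : (forall n, (N0 <= n)%N -> a n = 0) -> asum a.
Proof.
move=> h; exists (\sum_(n < N0) nm (a n)) => N.
have [le|/ltnW le] := leqP N N0.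
  rewrite -!(big_mkord xpredT (fun n => nm (a n))) (@big_cat_nat _ _ _ N 0 N0) //= lerDl sumr_ge0 // => i _; exact: nm_ge0.
rewrite -!(big_mkord xpredT (fun n => nm (a n))) (@big_cat_nat _ _ _ N0 0 N) //= [X in _ + X]big_nat_cond [X in _ + X]big1 ?addr0 //.
by move=> i /andP[/andP[/h -> _] _]; rewrite nm0.
Qed.

Lemma csum_head a : asum a -> csum a = a 0%N + csum (fun n => a n.+1).
Proof.
move=> h; have h' : asum (fun n => a n.+1).
  have [K hK] := h; exists K => N; apply: le_trans (hK N.+1).
  by rewrite big_ord_recl /= lerDr nm_ge0.
apply: csum_eqP; apply: (@cvc_ext (fun N => a 0%N + \sum_(n < N.-1) a n.+1) _ _ 1).
  by case=> // n _; rewrite [RHS]big_ord_recl.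
apply: cvcD; first exact: cvc_cst.
apply: (@cvc_sub (fun N => \sum_(n < N) a n.+1) _ predn); last exact: asum_cvc.
by move=> m; exists m.+1 => -[].
Qed.

Lemma nm_csum_le a b K : (forall n, nm (a n) <= b n) -> (forall N, \sum_(n < N) b n <= K) -> nm (csum a) <= K.
Proof.
move=> h hK; have ha : asum a by apply: bdd_le h _; exists K.
apply: cvc_le (asum_cvc ha) => N; apply: le_trans (nm_sum _ _ _) _.
by apply: le_trans (hK N); apply: ler_sum.
Qed.

Lemma csum_split a N0 : asum a -> csum a = \sum_(n < N0) a n + csum (fun n => a (n + N0)%N).
Proof.
elim: N0 a => [|N0 IH] a h.
  by rewrite big_ord0 add0r; apply: eq_csum => n; rewrite addn0.
have h' : asum (fun n => a n.+1).
  have [K hK] := h; exists K => N; apply: le_trans (hK N.+1).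
  by rewrite big_ord_recl /= lerDr nm_ge0.
rewrite csum_head // (IH _ h') big_ord_recl /= addrA; congr (_ + _).
by apply: eq_csum => n; rewrite addnS.
Qed.

(** Dominated convergence for series: beyond some [N0] the majorant bounds both tails by [e / 3],
    and the finite head converges term by term. *)
Lemma tannery (a : nat -> nat -> C) b (l : nat -> C) :
  (forall K n, nm (a K n) <= b n) -> bdd b -> (forall n, cvc (fun K => a K n) (l n)) ->
  cvc (fun K => csum (a K)) (csum l).
Proof.
move=> hb [B hB] hl e e0; have e3 : 0 < e / 3 by lra.
have b0 n : 0 <= b n by apply: le_trans (nm_ge0 _) (hb 0%N n).
have [N0 hN0] := bdd_tail b0 (ex_intro _ B hB) e3.
have haK K : asum (a K) by apply: bdd_le (hb K) _; exists B.
have hlb n : nm (l n) <= b n by apply: cvc_le (hl n).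
have hal : asum l by apply: bdd_le hlb _; exists B.
have tl N : \sum_(n < N) b (n + N0)%N <= e / 3.
  have := hN0 (N + N0)%N; rewrite -{1}[N0]add0n big_addn addnK big_mkord; exact: ltW.
have := @cvc_sumI _ (index_enum 'I_N0) (fun n K => a K n) (fun n : 'I_N0 => l n) (fun n => hl n).
move=> /(_ _ e3)[K0 hK0]; exists K0 => K /hK0 h.
rewrite (csum_split N0 (haK K)) (csum_split N0 hal).
have t1 : nm (csum (fun n => a K (n + N0)%N)) <= e / 3 by exact: (nm_csum_le (fun n => hb K (n + N0)%N) tl).
have t2 : nm (csum (fun n => l (n + N0)%N)) <= e / 3 by exact: (nm_csum_le (fun n => hlb (n + N0)%N) tl).
move: h t1 t2; set A := \sum_(n < N0) _; set A' := \sum_(n < N0) _; set B1 := csum _; set B2 := csum _.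
move=> h t1 t2; have -> : A + B1 - (A' + B2) = (A - A') + (B1 - B2) by ring.
have := nmD (A - A') (B1 - B2); have := nmB B1 B2; lra.
Qed.

(** The summation range grows with [K]; extension by 0 reduces this to full series. Truncated sums
    over states pass to the limit in this form. *)
Lemma tannery_fin (a : nat -> nat -> C) b (l : nat -> C) (k : nat -> nat) :
  (forall m, exists N, forall n, (N <= n)%N -> (m <= k n)%N) ->
  (forall K n, (n < k K)%N -> nm (a K n) <= b n) -> (forall n, 0 <= b n) ->
  bdd b -> (forall n, cvc (fun K => a K n) (l n)) ->
  cvc (fun K => \sum_(n < k K) a K n) (csum l).
Proof.
move=> hk hb b0 hB hl.
pose a' K n := if (n < k K)%N then a K n else 0.
have := @tannery a' b l; set P := cvc _ _ => H.
have {}H : P.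
  apply: H => //.
    by move=> K n; rewrite /a'; case: ifP => [/hb //|_]; rewrite nm0.
  move=> n; have [N hN] := hk n.+1; apply: (@cvc_ext (fun K => a K n) _ _ N) (hl n) => K /hN h.
  by rewrite /a' h.
apply: cvc_eq H => K; rewrite (@csum_finite _ (k K)) => [|n le].
  by apply: eq_bigr => i _; rewrite /a' ltn_ord.
by rewrite /a' ltnNge le.
Qed.

End Series.

(** * Elementary bounds for real sine, cosine and exponential *)

Section RealBounds.
Variable R : realType.
Implicit Types x y : R.

Lemma is_derive_eps (g : R -> R) (s d : R) :
  (forall e : R, 0 < e -> exists2 r : R, 0 < r & forall h, `|h| < r -> `|g (s + h) - g s - d * h| <= e * `|h|) ->
  is_derive s 1 g d.
Proof.
move=> H.
have cv : ((fun h => h^-1 *: ((g \o shift s) (h *: 1) - g s)) @ 0^' --> d)%classic.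
  apply/cvgrPdist_le => e e0.
  have [r r0 hr] := H e e0.
  near=> h.
  have h0 : h != 0 by near: h; exact: nbhs_dnbhs_neq.
  have hr' : `|h| < r by near: h; apply: dnbhs0_lt.
  have := hr _ hr'; rewrite /= /shift /= [h *: 1]mulr1 [h + s]addrC => k.
  rewrite -(ler_pM2r (x := `|h|)) ?normr_gt0 // -normrM (le_trans _ k) //.
  have -> : (d - h^-1 *: (g (s + h) - g s)) * h = - (g (s + h) - g s - d * h).
    by rewrite /GRing.scale /=; field.
  by rewrite normrN.
apply: DeriveDef; first by apply/cvg_ex; exists d.
exact: cvg_lim cv.
Unshelve. all: by end_near. Qed.

Lemma MVT_bound (f df : R -> R) (x B : R) : 0 <= x ->
  (forall y, is_derive y 1 f (df y)) -> (forall y, 0 <= y <= x -> `|df y| <= B) -> `|f x - f 0| <= B * x.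
Proof.
move=> x0 hf hb.
have [|c + ->] := @MVT_segment R f df 0 x x0 (fun y _ => hf y).
  by apply: derivable_within_continuous => y _; apply: ex_derive.
by rewrite in_itv /= => hc; rewrite subr0 normrM (ger0_norm x0) ler_wpM2r // hb.
Qed.

Lemma sin_le x : `|sin x| <= `|x|.
Proof.
wlog x0 : x / 0 <= x.
  move=> H; have [/H//|/ltW x0] := leP 0 x.
  by rewrite -[`|sin x|]normrN -sinN -[`|x|]normrN H // oppr_ge0.
have := @MVT_bound sin cos x 1 x0 (fun y => is_derive_sin y) (fun y _ => cos_max y).
by rewrite sin0 subr0 mul1r (ger0_norm x0).
Qed.

Lemma cos_sub1 x : `|cos x - 1| <= x ^+ 2.
Proof.
wlog x0 : x / 0 <= x.
  move=> H; have [/H//|/ltW x0] := leP 0 x.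
  by rewrite -cosN -sqrrN H // oppr_ge0.
have := @MVT_bound cos (fun y => - sin y) x x x0 (fun y => is_derive_cos y).
rewrite cos0 -expr2; apply => y /andP[y0 yx]; rewrite normrN (le_trans (sin_le y)) //.
by rewrite ger0_norm.
Qed.

Lemma sin_subx x : `|x| <= 1 -> `|sin x - x| <= x ^+ 2.
Proof.
wlog x0 : x / 0 <= x.
  move=> H; have [/H//|/ltW x0] := leP 0 x => h.
  by have := H (- x); rewrite sinN sqrrN normrN oppr_ge0 -opprD normrN; apply.
rewrite (ger0_norm x0) => x1.
have D y : is_derive y 1 (fun z : R => sin z - z) (cos y - 1).
  exact: is_deriveB.
have := @MVT_bound (fun z => sin z - z) (fun y => cos y - 1) x (x ^+ 2) x0 D.
rewrite sin0 !subr0 => H; apply: le_trans (H _) _.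
  by move=> y /andP[y0 yx]; apply: le_trans (cos_sub1 y) _; rewrite lerXn2r // nnegrE.
by rewrite ler_piMr // sqr_ge0.
Qed.

(** Only [1 + x <= exp x] is used, at [x] and at [-x]; the latter gives the upper bound
    [(1 - x) exp x <= 1]. *)
Lemma expR_sub1x x : `|x| <= 1 / 2 -> `|expR x - 1 - x| <= 2 * x ^+ 2.
Proof.
rewrite ler_norml => /andP[h1 h2]; have := expR_ge1Dx x; have := expR_ge1Dx (- x).
rewrite expRN; set E := expR x => a b.
have E0 : 0 < E by apply: expR_gt0.
have c : (1 - x) * E <= 1 by have := ler_wpM2r (ltW E0) a; rewrite mulVf ?lt0r_neq0.
rewrite ger0_norm; last by lra.
nra.
Qed.
End RealBounds.

(** * Complex differentiation *)

Section ComplexDerivative.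
Variable R : realType.
Local Notation C := R[i].
Implicit Types (f g : C -> C) (z w h l : C).

(** The difference quotient is cleared, so [h = 0] needs no exclusion and error bounds can be added
    and composed directly. *)
Definition cder f z l := forall e : R, 0 < e -> exists2 d : R, 0 < d &
  forall h, nm h < d -> nm (f (z + h) - f z - l * h) <= e * nm h.

Lemma cder_loc f g z l r : 0 < r -> (forall h, nm h < r -> f (z + h) = g (z + h)) ->
  cder f z l -> cder g z l.
Proof.
move=> r0 E H e e0; have [d d0 hd] := H e e0.
exists (Num.min d r); first by rewrite lt_min d0.
move=> h; rewrite lt_min => /andP[h1 h2]; rewrite -E //.
have := E 0; rewrite nm0 addr0 => <- //; exact: hd.
Qed.

Lemma cder_eq f g z l : f =1 g -> cder f z l -> cder g z l.
Proof. by move=> E; apply: (@cder_loc _ _ _ _ 1) => // h _. Qed.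

Lemma cder_upper f g z l : upper z -> (forall w, upper w -> f w = g w) -> cder f z l -> cder g z l.
Proof.
move=> uz E; apply: (@cder_loc _ _ _ _ (imC z)) => // h hh; apply: E.
by rewrite /upper imCD; have := imC_le h; rewrite ler_norml => /andP[]; lra.
Qed.

Lemma cder_cst (c : C) z : cder (fun _ => c) z 0.
Proof. by move=> e e0; exists 1 => // h _; rewrite mul0r subrr subr0 nm0 mulr_ge0 ?nm_ge0 // ltW. Qed.

Lemma cder_id z : cder id z 1.
Proof.
move=> e e0; exists 1 => // h _; rewrite mul1r; have -> : id (z + h) - id z - h = 0 by rewrite /=; ring.
rewrite nm0 mulr_ge0 ?nm_ge0 // ltW //.
Qed.

Lemma cderD f g z l m : cder f z l -> cder g z m -> cder (fun w => f w + g w) z (l + m).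
Proof.
move=> H1 H2 e e0; have e2 : 0 < e / 2 by lra.
have [d1 d10 h1] := H1 _ e2; have [d2 d20 h2] := H2 _ e2.
exists (Num.min d1 d2); first by rewrite lt_min d10.
move=> h; rewrite lt_min => /andP[/h1 a1 /h2 a2].
have -> : f (z + h) + g (z + h) - (f z + g z) - (l + m) * h =
  (f (z + h) - f z - l * h) + (g (z + h) - g z - m * h) by ring.
by apply: le_trans (nmD _ _) _; lra.
Qed.

Lemma cderZ c f z l : cder f z l -> cder (fun w => c * f w) z (c * l).
Proof.
move=> H e e0; have k0 : 0 < nm c + 1 by have := nm_ge0 c; lra.
have [d d0 hd] := H (e / (nm c + 1)) (divr_gt0 e0 k0).
exists d => // h /hd a; have -> : c * f (z + h) - c * f z - c * l * h = c * (f (z + h) - f z - l * h) by ring.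
rewrite nmM; apply: le_trans (ler_wpM2l (nm_ge0 c) a) _.
have e1 : 0 <= e / (nm c + 1) * nm h by rewrite mulr_ge0 ?nm_ge0 ?divr_ge0 // ltW.
have -> : e * nm h = (nm c + 1) * (e / (nm c + 1) * nm h) by field; rewrite lt0r_neq0.
by nra.
Qed.

Lemma cderN f z l : cder f z l -> cder (fun w => - f w) z (- l).
Proof.
move=> h; rewrite -[- l]mulN1r; apply: cder_eq (cderZ (-1) h) => w; by rewrite mulN1r.
Qed.

Lemma cderB f g z l m : cder f z l -> cder g z m -> cder (fun w => f w - g w) z (l - m).
Proof. by move=> h1 h2; apply: cderD => //; apply: cderN. Qed.

Lemma cder_lip f z l : cder f z l -> exists2 d : R, 0 < d &
  forall h, nm h < d -> nm (f (z + h) - f z) <= (nm l + 1) * nm h.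
Proof.
move=> H; have [d d0 hd] := H 1 ltr01; exists d => // h /hd a.
have -> : f (z + h) - f z = (f (z + h) - f z - l * h) + l * h by ring.
by apply: le_trans (nmD _ _) _; rewrite nmM; lra.
Qed.

Lemma cder_comp f g z l m : cder g z m -> cder f (g z) l -> cder (fun w => f (g w)) z (l * m).
Proof.
move=> H1 H2 e e0; have e2 : 0 < e / 2 by lra.
have [d0 d00 h0] := cder_lip H1.
have km : 0 < nm m + 1 by have := nm_ge0 m; lra.
have kl : 0 < nm l + 1 by have := nm_ge0 l; lra.
have [d1 d10 h1] := H2 (e / 2 / (nm m + 1)) (divr_gt0 e2 km).
have [d2 d20 h2] := H1 (e / 2 / (nm l + 1)) (divr_gt0 e2 kl).
exists (Num.min (Num.min d0 d2) (d1 / (nm m + 1))); first by rewrite !lt_min d00 d20 divr_gt0.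
move=> h; rewrite !lt_min -andbA => /and3P[/h0 a0 /h2 a2 a1].
have nh := nm_ge0 h.
set k := g (z + h) - g z; have ek : g (z + h) = g z + k by rewrite /k; ring.
rewrite -/k in a0 a2.
have kd : nm k < d1.
  by apply: le_lt_trans a0 _; move: a1; rewrite ltr_pdivlMr // mulrC.
have a3 := h1 _ kd; rewrite ek.
have -> : f (g z + k) - f (g z) - l * m * h = (f (g z + k) - f (g z) - l * k) + l * (k - m * h) by ring.
apply: le_trans (nmD _ _) _; rewrite nmM.
have -> : e * nm h = (e / 2 / (nm m + 1)) * ((nm m + 1) * nm h) + (nm l + 1) * (e / 2 / (nm l + 1) * nm h).
  by field; rewrite !lt0r_neq0.
apply: lerD.
  apply: le_trans a3 _; rewrite ler_wpM2l // ?divr_ge0 ?ltW //; lra.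
apply: ler_pM; rewrite ?nm_ge0 //; lra.
Qed.

Lemma cder_sqr z : cder (fun w => w ^+ 2) z (2%:R * z).
Proof.
move=> e e0; exists e => // h hh.
have -> : (z + h) ^+ 2 - z ^+ 2 - 2%:R * z * h = h * h by ring.
by rewrite nmM ler_wpM2r ?nm_ge0 // ltW.
Qed.

(** Polarization [f g = ((f + g)^2 - (f - g)^2) / 4] reduces the product rule to the square and the
    chain rule. *)
Lemma cderM f g z l m : cder f z l -> cder g z m -> cder (fun w => f w * g w) z (l * g z + f z * m).
Proof.
move=> H1 H2.
have S := cder_comp (cderD H1 H2) (cder_sqr (f z + g z)).
have D := cder_comp (cderB H1 H2) (cder_sqr (f z - g z)).
have := cderZ (4%:R^-1) (cderB S D).
have -> : 4%:R^-1 * (2%:R * (f z + g z) * (l + m) - 2%:R * (f z - g z) * (l - m)) = l * g z + f z * m.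
  by field.
by apply: cder_eq => w; field.
Qed.

Lemma cder_inv z : z != 0 -> cder (fun w => w^-1) z (- z ^- 2).
Proof.
move=> z0 e e0; have n0 : 0 < nm z by rewrite nm_gt0.
have c0 : 0 < e * nm z ^+ 3 / 2 by rewrite divr_gt0 // mulr_gt0 // exprn_gt0.
exists (Num.min (nm z / 2) (e * nm z ^+ 3 / 2)); first by rewrite lt_min c0 divr_gt0.
move=> h; rewrite lt_min => /andP[a1 a2]; have nh := nm_ge0 h.
have nzh : nm z / 2 <= nm (z + h) by have := nmB (z + h) h; rewrite addrK; lra.
have zh0 : z + h != 0 by rewrite -nm_gt0; lra.
have -> : (z + h)^-1 - z^-1 - - z ^- 2 * h = (h * h) / (z ^+ 2 * (z + h)) by field; apply/andP.
rewrite !nmM nmV nmM nmX -mulrA [e * _]mulrC ler_wpM2l //.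
rewrite ler_pdivrMr ?mulr_gt0 ?exprn_gt0 //; last by lra.
apply: le_trans (ltW a2) _.
have -> : e * nm z ^+ 3 / 2 = e * nm z ^+ 2 * (nm z / 2) by field.
by rewrite -mulrA ler_wpM2l ?(ltW e0) // ler_wpM2l // sqr_ge0.
Qed.

Lemma cderV f z l : f z != 0 -> cder f z l -> cder (fun w => (f w)^-1) z (- (f z) ^- 2 * l).
Proof. by move=> f0 H; apply: (cder_comp H); apply: cder_inv. Qed.

Lemma cderX f z l n : cder f z l -> cder (fun w => f w ^+ n) z (n%:R * f z ^+ n.-1 * l).
Proof.
move=> H; elim: n => [|n IH].
  by rewrite !mul0r; apply: cder_eq (cder_cst 1 z) => w.
have := cderM H IH.
have -> : l * f z ^+ n + f z * (n%:R * f z ^+ n.-1 * l) = n.+1%:R * f z ^+ n.+1.-1 * l.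
  case: n {IH} => [|n] /=; first by rewrite !expr0; ring.
  by rewrite [f z ^+ n.+1]exprS; ring.
by apply: cder_eq => w; rewrite exprS.
Qed.

Lemma cder_sum (I : Type) (r : seq I) (f : I -> C -> C) (l : I -> C) z :
  (forall i, cder (f i) z (l i)) -> cder (fun w => \sum_(i <- r) f i w) z (\sum_(i <- r) l i).
Proof.
move=> H; elim: r => [|i r IH].
  by rewrite big_nil; apply: cder_eq (cder_cst 0 z) => w; rewrite big_nil.
by rewrite big_cons; apply: cder_eq (cderD (H i) IH) => w; rewrite big_cons.
Qed.

Lemma cder_unique f z l m : cder f z l -> cder f z m -> l = m.
Proof.
move=> H1 H2; apply/eqP; rewrite -subr_eq0 -nm_eq0; apply/negPn/negP => n0.
have e0 : 0 < nm (l - m) / 4 by rewrite divr_gt0 // lt_def n0 nm_ge0.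
have [d1 d10 h1] := H1 _ e0; have [d2 d20 h2] := H2 _ e0.
pose x := Num.min d1 d2 / 2.
have x0 : 0 < Num.min d1 d2 by rewrite lt_min d10.
have xp : 0 < x by rewrite /x divr_gt0.
have nx : nm (x%:C) = x by rewrite nm_real ger0_norm // ltW.
have [x1 x2] : x < d1 /\ x < d2.
  have : x < Num.min d1 d2 by rewrite /x; lra.
  by rewrite lt_min => /andP.
have := h1 x%:C; have := h2 x%:C; rewrite nx => /(_ x2) a2 /(_ x1) a1.
have := nmB (f (z + x%:C) - f z - m * x%:C) (f (z + x%:C) - f z - l * x%:C).
have -> : (f (z + x%:C) - f z - m * x%:C) - (f (z + x%:C) - f z - l * x%:C) = (l - m) * x%:C by ring.
rewrite nmM nx => a3.
have k0 : 0 < nm (l - m) by rewrite lt_def n0 nm_ge0.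
nra.
Qed.

Lemma holo_cder f : (forall t, upper t -> exists l, cder f t l) -> holo_upper f.
Proof.
move=> H t ut; have [l hl] := H t ut; exists l => e e0.
have e2 : 0 < e / 2 by lra.
have [d d0 hd] := hl _ e2; exists d; split => // h h0; rewrite nmE ltcR => /hd a.
rewrite nmE ltcR; have hp : 0 < nm h by rewrite nm_gt0.
have -> : (f (t + h) - f t) / h - l = (f (t + h) - f t - l * h) / h by field.
rewrite nmM nmV ltr_pdivrMr //; apply: le_lt_trans a _; rewrite ltr_pM2r //; lra.
Qed.

(** Multiplication by the unit number [u] that turns [f b - f a] into its modulus reduces the
    inequality to the real mean value theorem for a real part along the segment. *)
Lemma cder_mv f (df : R -> C) (a b : C) (B : R) :
  (forall s : R, 0 <= s <= 1 -> cder f (a + s%:C * (b - a)) (df s)) ->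
  (forall s : R, 0 <= s <= 1 -> nm (df s) <= B) -> nm (f b - f a) <= B * nm (b - a).
Proof.
move=> H hB.
have B0 : 0 <= B by apply: le_trans (nm_ge0 _) (hB 0 _); rewrite lexx ler01.
have [->|n0] := eqVneq (f b - f a) 0; first by rewrite nm0 mulr_ge0 ?nm_ge0.
pose u := ((f b - f a)^*)%C / (nm (f b - f a))%:C.
have np : 0 < nm (f b - f a) by rewrite nm_gt0.
have nu : nm u = 1.
  rewrite nmM nmV nm_real (ger0_norm (nm_ge0 _)).
  have -> : nm ((f b - f a)^*)%C = nm (f b - f a) by case: (f b - f a) => x y; rewrite /nm /= sqrrN.
  by rewrite divff // gt_eqF.
have uE : reC (u * (f b - f a)) = nm (f b - f a).
  rewrite /u mulrAC -fmorphV mulrC reCMr.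
  have -> : reC ((f b - f a)^*%C * (f b - f a)) = nm (f b - f a) ^+ 2.
    case: (f b - f a) => x y; rewrite /nm /= sqr_sqrtr ?addr_ge0 ?sqr_ge0 //; ring.
  by rewrite expr2 mulrA mulVf ?mul1r // gt_eqF.
pose g (s : R) := reC (u * f (a + s%:C * (b - a))).
have D (s : R) : 0 <= s <= 1 -> is_derive s 1 g (reC (u * df s * (b - a))).
  move=> hs; apply: is_derive_eps => e e0.
  have k0 : 0 < nm (b - a) + 1 by have := nm_ge0 (b - a); lra.
  have [d d0 hd] := H s hs (e / (nm (b - a) + 1)) (divr_gt0 e0 k0).
  exists (d / (nm (b - a) + 1)); first exact: divr_gt0.
  move=> h; rewrite ltr_pdivlMr // => hh.
  have nk : nm (h%:C * (b - a)) < d.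
    rewrite nmM nm_real; apply: le_lt_trans hh; rewrite ler_wpM2l //; lra.
  have {nk} := hd _ nk; set k := h%:C * (b - a) => q.
  have -> : g (s + h) - g s - reC (u * df s * (b - a)) * h =
    reC (u * (f (a + s%:C * (b - a) + k) - f (a + s%:C * (b - a)) - df s * k)).
    rewrite /g /k [reC _ * h]mulrC -reCMr -!reCB rmorphD /=; congr reC.
    have -> : a + (s%:C + h%:C) * (b - a) = a + s%:C * (b - a) + h%:C * (b - a) by ring.
    by ring.
  apply: le_trans (reC_le _) _; rewrite nmM nu mul1r; apply: le_trans q _.
  rewrite /k nmM nm_real.
  have -> : e * `|h| = e / (nm (b - a) + 1) * (`|h| * (nm (b - a) + 1)) by field; rewrite lt0r_neq0.
  apply: ler_wpM2l; first by rewrite divr_ge0 // ltW.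
  by apply: ler_wpM2l => //; lra.
have [||c + gE] := @MVT_segment R g (fun s => reC (u * df s * (b - a))) 0 1 ler01.
- by move=> s; rewrite in_itv /= => /andP[s0 s1]; apply: D; rewrite !ltW.
- apply: derivable_within_continuous => s; rewrite in_itv /= => hs.
  exact: (@ex_derive _ _ _ _ _ _ _ (D s hs)).
rewrite in_itv /= => hc.
have <- : g 1 - g 0 = nm (f b - f a).
  rewrite /g mul0r addr0 mul1r -uE -reCB -mulrBr; congr (reC (u * (f _ - f a))); ring.
rewrite gE subr0 mulr1; apply: le_trans (ler_norm _) _; apply: le_trans (reC_le _) _.
by rewrite [nm (u * _ * _)]nmM [nm (u * _)]nmM nu mul1r ler_wpM2r ?nm_ge0 // hB.
Qed.

Lemma upper_segment (a b : C) (s : R) : upper a -> upper b -> 0 <= s <= 1 -> upper (a + s%:C * (b - a)).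
Proof.
rewrite /upper imCD imCMr imCB => ha hb /andP[s0 s1].
have -> : imC a + s * (imC b - imC a) = (1 - s) * imC a + s * imC b by ring.
have [->|sn] := eqVneq s 0; first by rewrite subr0 mul1r mul0r addr0.
have sp : 0 < s by rewrite lt_def sn.
have : 0 < s * imC b by rewrite mulr_gt0.
have : 0 <= (1 - s) * imC a by rewrite mulr_ge0 ?subr_ge0 // ltW.
lra.
Qed.

Lemma cder0_const f : (forall t, upper t -> cder f t 0) ->
  forall a b, upper a -> upper b -> f a = f b.
Proof.
move=> H a b ha hb; apply/eqP; rewrite eq_sym -subr_eq0 -nm_eq0 eq_le nm_ge0 andbT.
have := @cder_mv f (fun _ => 0) a b 0; rewrite mul0r; apply => s hs; rewrite ?nm0 //.
by apply: H; apply: upper_segment.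
Qed.

End ComplexDerivative.

(** * The complex exponential and [ee z = exp(2 pi i z)] *)

Section Exponential.
Variable R : realType.
Local Notation C := R[i].
Implicit Types (z w h : C).

Lemma reC_cexp z : reC (cexp z) = expR (reC z) * cos (imC z).
Proof. by rewrite /cexp reCMr reCD /= !mul0r !mul1r subr0 addr0. Qed.
Lemma imC_cexp z : imC (cexp z) = expR (reC z) * sin (imC z).
Proof. by rewrite /cexp imCMr imCD /=; ring. Qed.

Lemma cexpD z w : cexp (z + w) = cexp z * cexp w.
Proof.
by apply: C_ext; rewrite !(reCM, imCM, reC_cexp, imC_cexp, reCD, imCD) expRD (cosD, sinD); ring.
Qed.

Lemma cexp0 : cexp (0 : C) = 1.
Proof. by apply: C_ext; rewrite !(reC_cexp, imC_cexp) /= expR0 ?cos0 ?sin0 ?mulr1 ?mulr0. Qed.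

Lemma nm_cexp z : nm (cexp z) = expR (reC z).
Proof.
rewrite /nm reC_cexp imC_cexp !exprMn -mulrDr cos2Dsin2 mulr1 sqrtr_sqr ger0_norm //.
exact: expR_ge0.
Qed.

(** The constant 7 rounds up 7/2 for the real part plus 3 for the imaginary part. *)
Lemma cexp_taylor h : nm h <= 1 / 2 -> nm (cexp h - 1 - h) <= 7 * nm h ^+ 2.
Proof.
move=> hh; have ha := le_trans (reC_le h) hh; have hb := le_trans (imC_le h) hh.
apply: le_trans (nm_le_reim _) _; rewrite !reCB !imCB reC_cexp imC_cexp /= subr0.
move: (reC_le h) (imC_le h) ha hb; set a := reC h; set b := imC h; set n := nm h => an bn ha hb.
have n0 : 0 <= n by apply: nm_ge0.
have e1 := expR_sub1x ha.
have s1 := sin_le b; have c1 := cos_sub1 b.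
have s2 : `|sin b - b| <= b ^+ 2 by apply: sin_subx; lra.
have cm := cos_max b.
have a2 : a ^+ 2 <= n ^+ 2 by rewrite -[a ^+ 2]real_normK ?num_real // lerXn2r ?nnegrE.
have b2 : b ^+ 2 <= n ^+ 2 by rewrite -[b ^+ 2]real_normK ?num_real // lerXn2r ?nnegrE.
have n2 : 0 <= n ^+ 2 by apply: sqr_ge0.
have -> : expR a * cos b - 1 - a = (expR a - 1 - a) * cos b + (1 + a) * (cos b - 1) by ring.
have -> : expR a * sin b - b = (expR a - 1 - a) * sin b + a * sin b + (sin b - b) by ring.
have t1 : `|(expR a - 1 - a) * cos b + (1 + a) * (cos b - 1)| <= 2 * n ^+ 2 * 1 + (1 + 1/2) * n ^+ 2.
  apply: le_trans (ler_normD _ _) _; rewrite !normrM; apply: lerD; apply: ler_pM => //.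
  - lra.
  - by have := ler_normD 1 a; rewrite normr1; lra.
  - lra.
have hs : `|sin b| <= 1 / 2 by lra.
have t2 : `|(expR a - 1 - a) * sin b + a * sin b + (sin b - b)| <= 2 * n ^+ 2 * (1/2) + n * n + n ^+ 2.
  apply: le_trans (ler_normD _ _) _; apply: lerD; last by lra.
  apply: le_trans (ler_normD _ _) _; rewrite !normrM; apply: lerD; apply: ler_pM => //; try lra.
have : n * n = n ^+ 2 by rewrite expr2.
move=> nn; lra.
Qed.

Lemma cder_cexp z : cder (@cexp R) z (cexp z).
Proof.
move=> e e0; have k0 : 0 < 7 * nm (cexp z) + 1 by have := nm_ge0 (cexp z); lra.
exists (Num.min (1 / 2) (e / (7 * nm (cexp z) + 1))); first by rewrite lt_min !divr_gt0.
move=> h; rewrite lt_min => /andP[h1 h2]; have nh := nm_ge0 h; have nz := nm_ge0 (cexp z).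
rewrite cexpD; have -> : cexp z * cexp h - cexp z - cexp z * h = cexp z * (cexp h - 1 - h) by ring.
rewrite nmM; apply: le_trans (ler_wpM2l nz (cexp_taylor (ltW h1))) _.
move: h2; rewrite ltr_pdivlMr // => h2.
rewrite expr2; have -> : nm (cexp z) * (7 * (nm h * nm h)) = (nm h * (7 * nm (cexp z))) * nm h by ring.
rewrite ler_wpM2r //; lra.
Qed.

Definition tpi : C := 2%:R * (pi : R)%:C * 'i%C.

Lemma eeE z : ee z = cexp (tpi * z). Proof. by []. Qed.

Lemma tpiE : tpi = 0 +i* (2 * pi).
Proof.
rewrite /tpi natC -rmorphM /=; apply: C_ext; rewrite ?reCMr ?imCMr /=; ring.
Qed.

Lemma tpi_neq0 : tpi != 0.
Proof.
rewrite tpiE eq_complex /= eqxx /= mulf_eq0 negb_or; apply/andP; split; first by rewrite pnatr_eq0.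
by rewrite gt_eqF // pi_gt0.
Qed.

Lemma eeD z w : ee (z + w) = ee z * ee w.
Proof. by rewrite !eeE mulrDr cexpD. Qed.

Lemma ee0 : ee (0 : C) = 1.
Proof. by rewrite eeE mulr0 cexp0. Qed.

Lemma nm_ee z : nm (ee z) = expR (- (2 * pi * imC z)).
Proof. by rewrite eeE nm_cexp tpiE reCM /= mul0r add0r. Qed.

Lemma ee_neq0 z : ee z != 0.
Proof. by rewrite -nm_gt0 nm_ee expR_gt0. Qed.

Lemma eeN z : ee (- z) = (ee z)^-1.
Proof. by apply: (mulIf (ee_neq0 z)); rewrite mulVf ?ee_neq0 // -eeD addNr ee0. Qed.

Lemma eeX z n : ee z ^+ n = ee (n%:R * z).
Proof.
elim: n => [|n IH]; first by rewrite mul0r ee0.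
by rewrite exprS IH -eeD; congr ee; ring.
Qed.

Lemma ee1 : ee (1 : C) = 1.
Proof.
apply: C_ext; rewrite eeE mulr1 tpiE !(reC_cexp, imC_cexp) /= expR0 mul1r mulr_natl ?cos2pi ?sin2pi //.
Qed.

Lemma ee_nat n : ee (n%:R : C) = 1.
Proof. by rewrite -[n%:R]mulr1 -eeX ee1 expr1n. Qed.

Lemma ee_int (m : int) : ee (m%:~R : C) = 1.
Proof.
case: m => n; first exact: ee_nat.
by rewrite NegzE mulrNz eeN ee_nat invr1.
Qed.

Lemma ee_half : ee (2%:R^-1 : C) = -1.
Proof.
have -> : (2%:R^-1 : C) = (2%:R^-1)%:C by rewrite fmorphV rmorph_nat.
have e : tpi * (2^-1)%:C = 0 +i* pi :> C.
  by rewrite tpiE; apply: C_ext; rewrite (reCM, imCM) /=; field.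
by apply: C_ext; rewrite eeE e (reC_cexp, imC_cexp) /= expR0 mul1r (cospi, sinpi) ?oppr0.
Qed.

Lemma cder_ee z : cder (@ee R) z (tpi * ee z).
Proof.
have := cder_comp (cderZ tpi (cder_id z)) (cder_cexp (tpi * z)).
by rewrite mulr1 mulrC; apply: cder_eq.
Qed.

Lemma cder_eeZ c z : cder (fun w => ee (c * w)) z (tpi * c * ee (c * z)).
Proof.
have := cder_comp (cderZ c (cder_id z)) (cder_ee (c * z)).
by rewrite mulr1 mulrAC; apply: cder_eq.
Qed.

Lemma nm_ee_real (x : R) : nm (ee x%:C) = 1.
Proof. by rewrite nm_ee /= mulr0 oppr0 expR0. Qed.

Lemma iC_neq0 : ('i%C : C) != 0.
Proof. by rewrite eq_complex /= negb_and oner_eq0 orbT. Qed.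

Lemma upper_neq0 (t : C) : upper t -> t != 0.
Proof. by move=> h; apply: contraTneq h => ->; rewrite /upper ltxx. Qed.

End Exponential.

(** * Power series on the unit disc *)

Section PowerSeries.
Variable R : realType.
Local Notation C := R[i].
Implicit Types (a b : nat -> C) (u z : C).

(** Absolute convergence in the open unit disc, phrased so that bounds on coefficients transfer
    termwise. *)
Definition growth a := forall r : R, 0 <= r -> r < 1 -> bdd (fun n => nm (a n) * r ^+ n).
Definition ev a u : C := csum (fun n => a n * u ^+ n).
Definition conv a b n : C := \sum_(k < n.+1) a k * b (n - k)%N.

Lemma growth_asum a u : growth a -> nm u < 1 -> asum (fun n => a n * u ^+ n).
Proof. by move=> h hu; apply: bdd_le (h _ (nm_ge0 u) hu) => n; rewrite nmM nmX. Qed.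

Lemma growth_le a (c : nat -> R) : (forall n, nm (a n) <= c n) ->
  (forall r : R, 0 <= r -> r < 1 -> bdd (fun n => c n * r ^+ n)) -> growth a.
Proof. by move=> h hc r r0 r1; apply: bdd_le (hc r r0 r1) => n; rewrite ler_wpM2r ?exprn_ge0. Qed.

Lemma growthD a b : growth a -> growth b -> growth (fun n => a n + b n).
Proof.
move=> ha hb r r0 r1; apply: bdd_le (bddD (ha r r0 r1) (hb r r0 r1)) => n.
by rewrite -mulrDl ler_wpM2r ?exprn_ge0 // nmD.
Qed.

Lemma growthZ c a : growth a -> growth (fun n => c * a n).
Proof.
move=> ha r r0 r1; apply: bdd_le (bddZ (nm_ge0 c) (ha r r0 r1)) => n.
by rewrite nmM mulrA.
Qed.

Lemma evD a b u : growth a -> growth b -> nm u < 1 -> ev (fun n => a n + b n) u = ev a u + ev b u.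
Proof.
move=> ha hb hu; rewrite -csumD; try exact: growth_asum.
by apply: eq_csum => n; rewrite mulrDl.
Qed.

Lemma evZ c a u : growth a -> nm u < 1 -> ev (fun n => c * a n) u = c * ev a u.
Proof.
move=> ha hu; rewrite -csumZ; last exact: growth_asum.
by apply: eq_csum => n; rewrite mulrA.
Qed.

(** Each of the first [n] powers [x^i] is at least [x^n], so [n x^n] lies below the geometric
    sum. *)
Lemma poly_geo (x : R) n : 0 <= x -> x < 1 -> n%:R * x ^+ n <= (1 - x)^-1.
Proof.
move=> x0 x1; have [K hK] := bdd_geo x0 x1.
have e : (1 - x) * \sum_(i < n) x ^+ i = 1 - x ^+ n by have := subrX1 x n; lra.
have p : 0 < 1 - x by lra.
have h : \sum_(i < n) x ^+ i <= (1 - x)^-1.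
  rewrite -[(1 - x)^-1]mulr1 ler_pdivlMl // e; have := exprn_ge0 n x0; lra.
apply: le_trans h; rewrite mulr_natl -[n in _ *+ n]card_ord -sumr_const; apply: ler_sum => i _.
by apply: ler_wiXn2l; rewrite ?(ltW x1) // ltnW.
Qed.

(** A factor [n] costs only a slightly larger radius [s = (1 + r) / 2], because [n (r/s)^n] is
    bounded. *)
Lemma bdd_poly (c : nat -> R) : (forall n, 0 <= c n) ->
  (forall r : R, 0 <= r -> r < 1 -> bdd (fun n => c n * r ^+ n)) ->
  (forall r : R, 0 <= r -> r < 1 -> bdd (fun n => n%:R * c n * r ^+ n)).
Proof.
move=> c0 hc r r0 r1.
pose s := (1 + r) / 2; have s0 : 0 < s by rewrite /s; lra.
have s1 : s < 1 by rewrite /s; lra.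
have x0 : 0 <= r / s by rewrite divr_ge0 // ltW.
have x1 : r / s < 1 by rewrite ltr_pdivrMr // mul1r /s; lra.
have k0 : 0 <= (1 - r / s)^-1 by rewrite invr_ge0; lra.
apply: bdd_le (bddZ k0 (hc s (ltW s0) s1)) => n.
have -> : n%:R * c n * r ^+ n = (n%:R * (r / s) ^+ n) * (c n * s ^+ n).
  by rewrite exprMn exprVn; field; rewrite ?expf_neq0 // lt0r_neq0.
rewrite ler_wpM2r ?poly_geo // mulr_ge0 // exprn_ge0 // ltW //.
Qed.

Lemma growth_poly a : growth a -> growth (fun n => n%:R * a n).
Proof.
move=> ha; apply: (@growth_le _ (fun n => n%:R * nm (a n))) => [n|]; first by rewrite nmM nm_nat.
by apply: bdd_poly => // n; exact: nm_ge0.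
Qed.

Lemma sum_conv (S : comNzRingType) (x y : nat -> S) N :
  \sum_(n < N) \sum_(k < n.+1) x k * y (n - k)%N = \sum_(k < N) x k * \sum_(j < N - k) y j.
Proof.
elim: N => [|N IH]; first by rewrite !big_ord0.
rewrite big_ord_recr /= IH.
transitivity (\sum_(k < N.+1) (x k * (\sum_(j < N - k) y j) + x k * y (N - k)%N)).
  rewrite big_split /=; congr (_ + _).
  by rewrite big_ord_recr /= subnn big_ord0 mulr0 addr0.
apply: eq_bigr => k _; rewrite -mulrDr subSn ?big_ord_recr //.
by rewrite -ltnS.
Qed.

Lemma asum_conv a b : asum a -> asum b -> asum (conv a b).
Proof.
move=> [K hK] [L hL]; exists (K * L) => N.
have L0 : 0 <= L by apply: le_trans (hL 0%N); rewrite big_ord0.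
apply: (@le_trans _ _ (\sum_(n < N) \sum_(k < n.+1) nm (a k) * nm (b (n - k)%N))).
  by apply: ler_sum => n _; apply: le_trans (nm_sum _ _ _) _; apply: ler_sum => k _; rewrite nmM.
rewrite (sum_conv (fun k => nm (a k)) (fun k => nm (b k))).
apply: (@le_trans _ _ (\sum_(k < N) nm (a k) * L)).
  by apply: ler_sum => k _; rewrite ler_wpM2l ?nm_ge0.
by rewrite -mulr_suml ler_wpM2r.
Qed.

(** Partial sums of the Cauchy product are [sum_k a_k (sum_(j < N - k) b_j)]; dominated convergence
    in [k] replaces the inner sums by their limit. *)
Lemma csum_conv a b : asum a -> asum b -> csum (conv a b) = csum a * csum b.
Proof.
move=> ha hb; have [K hK] := hb.
have -> : csum a * csum b = csum (fun n => csum b * a n) by rewrite csumZ // mulrC.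
apply: csum_eqP; apply: (@cvc_eq _ (fun N => \sum_(k < N) a k * \sum_(j < N - k) b j)).
  by move=> N; rewrite -sum_conv.
apply: (@tannery_fin _ (fun N k => a k * \sum_(j < N - k) b j) (fun k => K * nm (a k)) _ id).
- by move=> m; exists m.
- move=> N k _; rewrite nmM mulrC ler_wpM2r ?nm_ge0 //.
  by apply: le_trans (nm_sum _ _ _) _; apply: hK.
- by move=> n; rewrite mulr_ge0 ?nm_ge0 //; apply: le_trans (hK 0%N); rewrite big_ord0.
- by apply: bddZ => //; apply: le_trans (hK 0%N); rewrite big_ord0.
move=> k; rewrite mulrC; apply: cvcZ.
apply: (@cvc_sub _ (fun N => \sum_(j < N) b j) _ (fun N => (N - k)%N)); last exact: asum_cvc.
by move=> m; exists (m + k)%N => n h; rewrite -(addnK k m) leq_sub2r.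
Qed.

Lemma conv_expr a b u : (fun n => conv a b n * u ^+ n) =1 conv (fun n => a n * u ^+ n) (fun n => b n * u ^+ n).
Proof.
move=> n; rewrite /conv mulr_suml; apply: eq_bigr => k _.
have kn : (k <= n)%N by rewrite -ltnS.
have -> : u ^+ n = u ^+ k * u ^+ (n - k) by rewrite -exprD subnKC.
by ring.
Qed.

Lemma growth_conv a b : growth a -> growth b -> growth (conv a b).
Proof.
move=> ha hb r r0 r1.
have nr : nm r%:C < 1 by rewrite nm_real ger0_norm.
have := asum_conv (growth_asum ha nr) (growth_asum hb nr).
apply: bdd_le => n; rewrite -conv_expr nmM nmX nm_real (ger0_norm r0) //.
Qed.

Lemma ev_conv a b u : growth a -> growth b -> nm u < 1 -> ev (conv a b) u = ev a u * ev b u.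
Proof.
move=> ha hb hu; rewrite -csum_conv; try exact: growth_asum.
by apply: eq_csum => n; rewrite conv_expr.
Qed.

Definition shift1 a n : C := if n is n'.+1 then a n' else 0.

Lemma growth_shift1 a : growth a -> growth (shift1 a).
Proof.
move=> ha r r0 r1; have [K hK] := ha r r0 r1; exists K => -[|N].
  by rewrite big_ord0; apply: le_trans (hK 0%N); rewrite big_ord0.
rewrite big_ord_recl /= nm0 mul0r add0r; apply: le_trans (hK N); apply: ler_sum => n _.
by rewrite exprS mulrCA ler_piMl ?mulr_ge0 ?nm_ge0 ?exprn_ge0 // ltW.
Qed.

Lemma ev_shift1 a u : growth a -> nm u < 1 -> ev (shift1 a) u = u * ev a u.
Proof.
move=> ha hu; rewrite /ev csum_head; last exact: growth_asum (growth_shift1 ha) hu.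
rewrite mul0r add0r -csumZ; last exact: growth_asum.
by apply: eq_csum => n; rewrite exprS mulrCA.
Qed.

(** The factor [r^2] on the left avoids the exponent [n - 2]; the quadratic remainder is bounded by
    induction on [n]. *)
Lemma taylor_expr u h (r : R) n : 0 <= r -> nm u <= r -> nm (u + h) <= r ->
  r ^+ 2 * nm ((u + h) ^+ n - u ^+ n - n%:R * u ^+ n.-1 * h) <= (n%:R) ^+ 2 * r ^+ n * nm h ^+ 2.
Proof.
move=> r0 hu huh; elim: n => [|n IH].
  by rewrite !expr0 !mul0r subr0 subrr nm0 mulr0 expr0n /= !mul0r.
set E := (u + h) ^+ n - _ - _ in IH.
have -> : (u + h) ^+ n.+1 - u ^+ n.+1 - n.+1%:R * u ^+ n.+1.-1 * h = (u + h) * E + n%:R * (u ^+ n.-1 * h ^+ 2).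
  rewrite /E; case: n {IH E} => [|n] /=; first by rewrite !expr0; ring.
  by rewrite !exprS; ring.
have h2 : 0 <= nm h ^+ 2 by apply: sqr_ge0.
have t1 : r ^+ 2 * nm ((u + h) * E) <= n%:R ^+ 2 * r ^+ n.+1 * nm h ^+ 2.
  rewrite nmM mulrCA [r ^+ n.+1]exprS; apply: (@le_trans _ _ (r * (r ^+ 2 * nm E))).
    by rewrite ler_wpM2r // mulr_ge0 ?nm_ge0 ?sqr_ge0.
  have -> : n%:R ^+ 2 * (r * r ^+ n) * nm h ^+ 2 = r * (n%:R ^+ 2 * r ^+ n * nm h ^+ 2) by ring.
  by rewrite ler_wpM2l.
have t2 : r ^+ 2 * nm (n%:R * (u ^+ n.-1 * h ^+ 2)) <= n%:R * r ^+ n.+1 * nm h ^+ 2.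
  rewrite !nmM nm_nat !nmX; case: n {IH E t1} => [|n] /=; first by rewrite !mul0r mulr0.
  have -> : r ^+ 2 * (n.+1%:R * (nm u ^+ n * nm h ^+ 2)) = n.+1%:R * (r ^+ 2 * nm u ^+ n) * nm h ^+ 2 by ring.
  rewrite ler_wpM2r // ler_wpM2l // -[n.+2]add2n exprD ler_wpM2l ?sqr_ge0 //.
  by rewrite lerXn2r // nnegrE // nm_ge0.
apply: le_trans (ler_wpM2l (sqr_ge0 r) (nmD ((u + h) * E) (n%:R * (u ^+ n.-1 * h ^+ 2)))) _.
rewrite [_ * (nm _ + _)]mulrDr; apply: le_trans (lerD t1 t2) _.
rewrite -!mulrDl ler_wpM2r // ler_wpM2r ?exprn_ge0 //.
by rewrite -[n.+1]addn1 natrD; have : 0 <= n%:R :> R by []; nra.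
Qed.

Definition dcoef a n : C := n.+1%:R * a n.+1.

Lemma growth_dcoef a : growth a -> growth (dcoef a).
Proof.
move=> ha r r0 r1; pose s := (1 + r) / 2; have s0 : 0 < s by rewrite /s; lra.
have s1 : s < 1 by rewrite /s; lra.
have [K hK] := growth_poly ha (ltW s0) s1; exists (s^-1 * K) => N.
apply: (@le_trans _ _ (s^-1 * \sum_(n < N.+1) nm (n%:R * a n) * s ^+ n)); last first.
  by rewrite ler_wpM2l // invr_ge0 ltW.
rewrite big_ord_recl /= mul0r nm0 mul0r add0r mulr_sumr; apply: ler_sum => n _.
have -> : s^-1 * (nm ((bump 0 n)%:R * a (bump 0 n)) * s ^+ bump 0 n) = nm (dcoef a n) * s ^+ n.
  by rewrite /bump /= add1n exprS /dcoef; field; rewrite lt0r_neq0.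
rewrite ler_wpM2l ?nm_ge0 //.
by rewrite lerXn2r ?nnegrE // /s; lra.
Qed.

Lemma cder_ev a u : growth a -> nm u < 1 -> cder (ev a) u (ev (dcoef a) u).
Proof.
move=> ha hu; pose r := (1 + nm u) / 2; have nu := nm_ge0 u.
have r0 : 0 < r by rewrite /r; lra.
have r1 : r < 1 by rewrite /r; lra.
have [K hK] := growth_poly (growth_poly ha) (ltW r0) r1.
have K0 : 0 <= K by apply: le_trans (hK 0%N); rewrite big_ord0.
have kp : 0 < K / r ^+ 2 + 1.
  have : 0 <= K / r ^+ 2 by rewrite divr_ge0 // sqr_ge0.
  by lra.
move=> e e0; exists (Num.min (r - nm u) (e / (K / r ^+ 2 + 1))).
  by rewrite lt_min divr_gt0 // andbT /r; lra.
move=> h; rewrite lt_min => /andP[h1 h2].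
have huh : nm (u + h) <= r by have := nmD u h; lra.
have hur : nm u <= r by rewrite /r; lra.
have huh1 : nm (u + h) < 1 by lra.
have -> : ev a (u + h) - ev a u - ev (dcoef a) u * h =
   csum (fun n => a n * ((u + h) ^+ n - u ^+ n - n%:R * u ^+ n.-1 * h)).
  have s1 := growth_asum ha huh1; have s2 := growth_asum ha hu.
  have s3 := growth_asum (growth_dcoef ha) hu.
  have s4 : asum (fun n => n%:R * a n * u ^+ n.-1).
    have [L hL] := s3; exists L => -[|N]; first by rewrite big_ord0; apply: le_trans (hL 0%N); rewrite big_ord0.
    by rewrite big_ord_recl /= mul0r mul0r nm0 add0r; exact: hL.
  have -> : ev (dcoef a) u = csum (fun n => n%:R * a n * u ^+ n.-1).
    by rewrite [RHS]csum_head // !mul0r add0r.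
  rewrite [_ * h]mulrC -(csumZ h s4) /ev -(csumB s1 s2) -(csumB (asumB s1 s2) (asumZ h s4)).
  by apply: eq_csum => n; ring.
have B : nm (csum (fun n => a n * ((u + h) ^+ n - u ^+ n - n%:R * u ^+ n.-1 * h))) <= K / r ^+ 2 * nm h ^+ 2.
  apply: (@nm_csum_le _ _ (fun n => (nm h ^+ 2 / r ^+ 2) * (nm (n%:R * (n%:R * a n)) * r ^+ n))) => [n|N].
    have -> : nm h ^+ 2 / r ^+ 2 * (nm (n%:R * (n%:R * a n)) * r ^+ n) =
      (nm (a n) * (n%:R ^+ 2 * r ^+ n * nm h ^+ 2)) / r ^+ 2 by rewrite !nmM nm_nat; ring.
    rewrite ler_pdivlMr ?exprn_gt0 // [nm (a n * _)]nmM -[_ * nm _ * _]mulrA.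
    apply: ler_wpM2l; first exact: nm_ge0.
    by rewrite mulrC taylor_expr // ltW.
  rewrite -mulr_sumr; have -> : K / r ^+ 2 * nm h ^+ 2 = nm h ^+ 2 / r ^+ 2 * K by ring.
  by rewrite ler_wpM2l // divr_ge0 // sqr_ge0.
apply: le_trans B _; rewrite expr2 mulrA ler_wpM2r ?nm_ge0 //.
move: h2; rewrite ltr_pdivlMr // => h2; have := nm_ge0 h; nra.
Qed.

(** Rearrangement of a double series: [A j] starts at order [j], so each coefficient of the total is
    a finite sum that stabilizes. *)
Lemma ev_triangular (A : nat -> nat -> C) :
  (forall j n, (n < j)%N -> A j n = 0) ->
  (forall r : R, 0 <= r -> r < 1 -> bdd (fun n => (\sum_(j < n.+1) nm (A j n)) * r ^+ n)) ->
  growth (fun n => \sum_(j < n.+1) A j n) /\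
  forall u, nm u < 1 -> cvc (fun M => \sum_(j < M) ev (A j) u) (ev (fun n => \sum_(j < n.+1) A j n) u).
Proof.
move=> hA hb.
have gA j : growth (A j).
  apply: growth_le hb => n; have [lt|le] := ltnP n j.
    by rewrite hA // nm0 sumr_ge0 // => i _; exact: nm_ge0.
  have jn : (j < n.+1)%N by [].
  by rewrite (bigD1 (Ordinal jn)) //= lerDl sumr_ge0 // => i _; exact: nm_ge0.
split; first by apply: growth_le hb => n; exact: nm_sum.
move=> u hu.
have sb M n : nm (\sum_(j < M) A j n) <= \sum_(j < n.+1) nm (A j n).
  apply: le_trans (nm_sum _ _ _) _; have [le|/ltnW le] := leqP M n.+1.
    rewrite -!(big_mkord xpredT (fun j => nm (A j n))) (@big_cat_nat _ _ _ M 0 n.+1) //= lerDl.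
    by rewrite sumr_ge0 // => i _; exact: nm_ge0.
  rewrite -!(big_mkord xpredT (fun j => nm (A j n))) (@big_cat_nat _ _ _ n.+1 0 M) //=.
  rewrite [X in _ + X]big_nat_cond [X in _ + X]big1 ?addr0 // => i /andP[/andP[ni _] _].
  by rewrite hA // nm0.
apply: (@cvc_eq _ (fun M => csum (fun n => (\sum_(j < M) A j n) * u ^+ n))).
  move=> M; elim: M => [|M IH].
    by rewrite big_ord0 (@csum_finite _ _ 0) ?big_ord0 // => n _; rewrite big_ord0 mul0r.
  rewrite big_ord_recr /= -IH -[RHS]csumD.
  - by apply: eq_csum => n; rewrite big_ord_recr mulrDl.
  - apply: (@growth_asum (fun n => \sum_(j < M) A j n)) => //.
    by apply: growth_le hb => n; exact: sb.
  - exact: growth_asum.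
apply: (@tannery _ _ (fun n => (\sum_(j < n.+1) nm (A j n)) * nm u ^+ n)).
- by move=> M n; rewrite nmM nmX ler_wpM2r ?exprn_ge0 ?nm_ge0.
- exact: hb (nm_ge0 u) hu.
move=> n; apply: (@cvc_ext _ (fun _ => (\sum_(j < n.+1) A j n) * u ^+ n) _ _ n.+1); last exact: cvc_cst.
move=> M le; congr (_ * _).
rewrite -!(big_mkord xpredT (fun j => A j n)) (@big_cat_nat _ _ _ n.+1 0 M) //=.
rewrite [X in _ = _ + X]big_nat_cond [X in _ = _ + X]big1 ?addr0 // => i /andP[/andP[ni _] _].
by rewrite hA.
Qed.

End PowerSeries.

(** * Laurent expansions in [exp(2 pi i t / 24)] *)

Section Fourier.
Variable R : realType.
Local Notation C := R[i].
Implicit Types (f g : C -> C) (t : C) (a b : nat -> C).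

(** The denominator 24 serves eta (1/24), theta_2 (1/8) and theta_3, theta_4 (1/2) at once. *)
Definition q24 t : C := ee (24%:R^-1 * t).

Lemma nm_q24 t : upper t -> nm (q24 t) < 1.
Proof.
rewrite /upper => h; rewrite nm_ee expR_lt1 oppr_lt0 mulr_gt0 ?mulr_gt0 ?pi_gt0 //.
have -> : (24%:R^-1 : C) = (24%:R^-1)%:C by rewrite fmorphV rmorph_nat.
by rewrite imCMr mulr_gt0 // invr_gt0.
Qed.

Lemma q24X t n : q24 t ^+ n = ee (n%:R / 24%:R * t).
Proof. by rewrite eeX mulrA. Qed.

(* Laurent series in exp(2 pi i t / 24), converging in the upper half-plane. *)
Definition fou f := exists (n0 : nat) a, growth a /\
  forall t, upper t -> f t = ee (- (n0%:R / 24%:R) * t) * ev a (q24 t).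

Lemma fou_ext f g : (forall t, upper t -> f t = g t) -> fou f -> fou g.
Proof. by move=> h [n0 [a [ha e]]]; exists n0, a; split => // t ut; rewrite -h // e. Qed.

(** Shifting the coefficients raises the declared pole order, so that two expansions can be added
    over a common one. *)
Lemma fou_up f n0 a m : growth a -> (forall t, upper t -> f t = ee (- (n0%:R / 24%:R) * t) * ev a (q24 t)) ->
  exists b, growth b /\ forall t, upper t -> f t = ee (- ((n0 + m)%:R / 24%:R) * t) * ev b (q24 t).
Proof.
move=> ha e; elim: m => [|m [b [hb eb]]]; first by rewrite addn0; exists a.
exists (shift1 b); split; first exact: growth_shift1.
move=> t ut; rewrite ev_shift1 ?nm_q24 // eb // mulrA /q24 -eeD; congr (ee _ * _).
by rewrite addnS -[(_ + m).+1]addn1 [(_ + 1)%:R]natrD; field.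
Qed.

Lemma fouD f g : fou f -> fou g -> fou (fun t => f t + g t).
Proof.
move=> [n [a [ha ea]]] [m [b [hb eb]]].
have [a' [ha' ea']] := fou_up m ha ea; have [b' [hb' eb']] := fou_up n hb eb.
exists (n + m)%N, (fun n => a' n + b' n); split; first exact: growthD.
by move=> t ut; rewrite ea' // eb' // addnC evD ?nm_q24 // mulrDr.
Qed.

Lemma fouM f g : fou f -> fou g -> fou (fun t => f t * g t).
Proof.
move=> [n [a [ha ea]]] [m [b [hb eb]]].
exists (n + m)%N, (conv a b); split; first exact: growth_conv.
move=> t ut; rewrite ea // eb // ev_conv ?nm_q24 // mulrACA -eeD; congr (ee _ * _).
by rewrite natrD; field.
Qed.

Lemma fouZ c f : fou f -> fou (fun t => c * f t).
Proof.
move=> [n [a [ha ea]]]; exists n, (fun n => c * a n); split; first exact: growthZ.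
by move=> t ut; rewrite ea // evZ ?nm_q24 // mulrCA.
Qed.

Lemma fou_mon (k : nat) : fou (fun t => ee (k%:R / 24%:R * t)).
Proof.
exists 0%N, (fun n => (n == k)%:R); split.
  move=> r r0 r1; exists 1 => N; apply: (@le_trans _ _ (\sum_(n < N) (n == k :> nat)%:R)).
    apply: ler_sum => n _; rewrite nm_nat -[X in _ <= X]mulr1 ler_wpM2l //.
    by rewrite exprn_ile1 // ltW.
  have [lt|le] := ltnP k N.
    rewrite (bigD1 (Ordinal lt)) //= eqxx big1 ?addr0 // => i ik.
    by case: eqP => // e; case/eqP: ik; apply: val_inj.
  rewrite big1 // => i _; case: eqP => // e; by have := ltn_ord i; rewrite e ltnNge le.
move=> t ut; rewrite /ev (@csum_finite _ _ k.+1); last first.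
  by move=> n nk; rewrite gtn_eqF // mul0r.
rewrite big_ord_recr /= eqxx big1; last first.
  by move=> i _; rewrite (ltn_eqF (ltn_ord i)) mul0r.
by rewrite add0r mul1r q24X -eeD; congr ee; field.
Qed.

Lemma fou_cst c : fou (fun _ => c).
Proof.
apply: fou_ext (fouZ c (fou_mon 0)) => t ut; by rewrite !mul0r ee0 mulr1.
Qed.

Lemma fou_der f : fou f -> exists g, fou g /\ forall t, upper t -> cder f t (g t).
Proof.
move=> [n0 [a [ha ea]]].
pose b n := tpi R / 24%:R * (shift1 (dcoef a) n - n0%:R * a n).
have gb : growth b.
  apply: growthZ; apply: growthD; first exact: growth_shift1 (growth_dcoef ha).
  by have := growthZ (- n0%:R) ha; apply: growth_le => n; rewrite -mulNr.
exists (fun t => ee (- (n0%:R / 24%:R) * t) * ev b (q24 t)); split; first by exists n0, b.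
move=> t ut; have hu := nm_q24 ut.
have D1 := cder_eeZ (- (n0%:R / 24%:R)) t.
have D2 := cder_comp (cder_eeZ (24%:R^-1) t) (cder_ev ha hu).
have := cderM D1 D2.
have -> : tpi R * - (n0%:R / 24%:R) * ee (- (n0%:R / 24%:R) * t) * ev a (ee (24%:R^-1 * t)) +
   ee (- (n0%:R / 24%:R) * t) * (ev (dcoef a) (q24 t) * (tpi R * 24%:R^-1 * ee (24%:R^-1 * t))) =
   ee (- (n0%:R / 24%:R) * t) * ev b (q24 t).
  have g1 := growth_shift1 (growth_dcoef ha); have g2 := growthZ (- n0%:R) ha.
  have -> : ev b (q24 t) = tpi R / 24%:R * (q24 t * ev (dcoef a) (q24 t) - n0%:R * ev a (q24 t)).
    rewrite /b evZ //; last by apply: growth_le (growthD g1 g2) => n; rewrite mulNr.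
    congr (_ * _); rewrite -mulNr -(ev_shift1 (growth_dcoef ha) hu) -(evZ _ ha hu) -(evD g1 g2 hu).
    by apply: eq_csum => n; rewrite mulNr.
  rewrite /q24; ring.
by apply: cder_upper ut _ => w uw; rewrite ea.
Qed.

Lemma fou_fourier f : fou f -> fourier_upper f.
Proof.
move=> h; split.
  by apply: holo_cder => t ut; have [g [_ hg]] := fou_der h; exists (g t); apply: hg.
have [n0 [a [ha ea]]] := h; exists 24%N, n0, a; split => // t ut.
apply/cvcE; rewrite ea //.
have := cvcZ (ee (- (n0%:R / 24%:R) * t)) (asum_cvc (growth_asum ha (nm_q24 ut))).
apply: cvc_eq => N; rewrite mulr_sumr; apply: eq_bigr => n _.
by rewrite q24X mulrCA -eeD; congr (_ * ee _); field.
Qed.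

Lemma fou_sum (I : Type) (r : seq I) (f : I -> C -> C) :
  (forall i, fou (f i)) -> fou (fun t => \sum_(i <- r) f i t).
Proof.
move=> h; elim: r => [|i r IH].
  by apply: fou_ext (fou_cst 0) => t _; rewrite big_nil.
by apply: fou_ext (fouD (h i) IH) => t _; rewrite big_cons.
Qed.

Lemma fouX f n : fou f -> fou (fun t => f t ^+ n).
Proof.
move=> h; elim: n => [|n IH]; first by apply: fou_ext (fou_cst 1) => t _.
by apply: fou_ext (fouM h IH) => t _; rewrite exprS.
Qed.

End Fourier.

(** * Riemann sums of the Gaussian under complex affine changes of variable *)

Section Riemann.
Variable R : realType.
Local Notation C := R[i].

Definition wgt (x : R) : R := (1 + x ^+ 2)^-1.

Lemma wgt_pos (x : R) : 0 < 1 + x ^+ 2.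
Proof. by have := sqr_ge0 x; lra. Qed.

Lemma wgt_ge0 x : 0 <= wgt x.
Proof. by rewrite invr_ge0 ltW // wgt_pos. Qed.

Lemma wgt_le1 x : wgt x <= 1.
Proof. by rewrite invf_le1 ?wgt_pos // lerDl sqr_ge0. Qed.

Lemma wgt_near x y : `|y - x| <= 1 -> wgt y <= 3 * wgt x.
Proof.
rewrite ler_norml => /andP[h1 h2]; rewrite /wgt.
rewrite -[3]invrK -invfM lef_pV2 ?posrE ?wgt_pos ?mulr_gt0 ?invr_gt0 ?wgt_pos //.
have d1 : (y - x) ^+ 2 <= 1 by nra.
have d2 : 0 <= (2 * y - x) ^+ 2 by apply: sqr_ge0.
by rewrite ler_pdivrMl //; nra.
Qed.

Let half_mul (a n : R) : n != 0 -> a / 2 = n * (a / (2 * n)).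
Proof. by move=> n0; field. Qed.

(** Half of the quadratic exponent absorbs the linear term by completing the square. The other half
    dominates [(d W)^(k+1)], where [W = 1 + x^2], by raising [exp u >= 1 + u] to the power
    [k + 1]. *)
Lemma envelope (c M M0 : R) (k : nat) : 0 < c -> 0 <= M -> exists2 B : R, 0 <= B &
  forall x : R, (1 + `|x|) ^+ k * expR (- (c * x ^+ 2) + M * `|x| + M0) <= B * wgt x.
Proof.
move=> c0 M_ge0.
pose n : R := k.+1%:R; have n0 : 0 < n by rewrite ltr0n.
pose d := Num.min 1 (c / (2 * n)).
have d0 : 0 < d by rewrite lt_min ltr01 divr_gt0 // mulr_gt0.
pose B := 2 ^+ k * expR (M ^+ 2 / (2 * c) + M0) / d ^+ k.+1.
have B0 : 0 <= B by rewrite divr_ge0 ?mulr_ge0 ?exprn_ge0 ?expR_ge0 // ltW.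
exists B => // x; have wp := wgt_pos x; set W := 1 + x ^+ 2 in wp *.
have h1 : (1 + `|x|) ^+ k <= (2 * W) ^+ k.
  apply: lerXn2r; rewrite ?nnegrE ?addr_ge0 ?mulr_ge0 ?(ltW wp) //.
  have : 0 <= (`|x| - 1) ^+ 2 by apply: sqr_ge0.
  rewrite /W -[x ^+ 2]real_normK ?num_real //; have := normr_ge0 x; nra.
have h2 : expR (- (c * x ^+ 2) + M * `|x| + M0) <= expR (M ^+ 2 / (2 * c) + M0) * (expR (c * x ^+ 2 / 2))^-1.
  rewrite -expRN -expRD ler_expR -[x ^+ 2]real_normK ?num_real //.
  have : 0 <= (c / 2) * (`|x| - M / c) ^+ 2 by rewrite mulr_ge0 ?sqr_ge0 // divr_ge0 // ltW.
  have -> : (c / 2) * (`|x| - M / c) ^+ 2 = c / 2 * `|x| ^+ 2 - M * `|x| + M ^+ 2 / (2 * c).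
    by field; rewrite lt0r_neq0.
  lra.
have h3 : (d * W) ^+ k.+1 <= expR (c * x ^+ 2 / 2).
  rewrite (half_mul _ (lt0r_neq0 n0)).
  rewrite expRM_natl; apply: lerXn2r; rewrite ?nnegrE ?mulr_ge0 ?(ltW d0) ?(ltW wp) ?expR_ge0 //.
  apply: le_trans (expR_ge1Dx _); rewrite /W mulrDr mulr1.
  have d1 : d <= 1 by rewrite ge_min lexx.
  have d2 : d <= c / (2 * n) by rewrite ge_min lexx orbT.
  have -> : c * x ^+ 2 / (2 * n) = c / (2 * n) * x ^+ 2 by ring.
  by apply: lerD => //; apply: ler_wpM2r => //; apply: sqr_ge0.
have h4 : (expR (c * x ^+ 2 / 2))^-1 <= ((d * W) ^+ k.+1)^-1.
  by rewrite lef_pV2 ?posrE ?expR_gt0 // exprn_gt0 // mulr_gt0.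
have E0 := expR_ge0 (M ^+ 2 / (2 * c) + M0).
apply: (@le_trans _ _ ((2 * W) ^+ k * (expR (M ^+ 2 / (2 * c) + M0) * ((d * W) ^+ k.+1)^-1))).
  apply: ler_pM => //; rewrite ?exprn_ge0 ?addr_ge0 ?expR_ge0 //.
  by apply: le_trans h2 _; apply: ler_wpM2l.
rewrite le_eqVlt; apply/orP; left; apply/eqP; rewrite /B /wgt -/W !exprMn !exprS.
by field; rewrite !expf_neq0 ?lt0r_neq0.
Qed.

(** The bound is uniform in [N] and [L]: [N^-1 wgt((j+1)/N)] is at most twice the difference of
    consecutive values of [1 / (1 + x)], so the sum telescopes. The 5 is 2 for right end points plus
    3 for left ones, which include [x = 0]. *)
Lemma riemann_weight (N L : nat) : (0 < N)%N ->
  \sum_(j < L) N%:R^-1 * (wgt (j%:R / N%:R) + wgt (j.+1%:R / N%:R)) <= 5.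
Proof.
move=> N0; have n0 : 0 < N%:R :> R by rewrite ltr0n.
have n1 : 1 <= N%:R :> R by rewrite ler1n.
pose h (j : nat) : R := (1 + j%:R / N%:R)^-1.
have hp j : 0 < 1 + j%:R / N%:R :> R.
  have : 0 <= j%:R / N%:R :> R by rewrite divr_ge0 // ltW.
  by lra.
have step j : N%:R^-1 * wgt (j.+1%:R / N%:R) <= 2 * (h j - h j.+1).
  have -> : h j - h j.+1 = N%:R^-1 * ((1 + j%:R / N%:R) * (1 + j.+1%:R / N%:R))^-1.
    rewrite /h -[j.+1]addn1 natrD; field.
    have a := hp j; have b := hp j.+1.
    have a' : 0 < N%:R + j%:R :> R by rewrite ltr_pwDl.
    have b' : 0 < N%:R + j%:R + 1 :> R by rewrite addr_gt0.
    by rewrite !lt0r_neq0 // addrA.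
  rewrite mulrCA ler_wpM2l ?invr_ge0 ?(ltW n0) // /wgt -[2]invrK -invfM.
  rewrite lef_pV2 ?posrE ?mulr_gt0 ?invr_gt0 ?wgt_pos //.
  have := hp j; set a := j%:R / _; set b := _ / _ => aj.
  have ab : a <= b by rewrite ler_pdivrMr // divfK ?lt0r_neq0 // ler_nat.
  have a0 : 0 <= a by rewrite divr_ge0 // ltW.
  rewrite ler_pdivrMl // {aj}.
  have ba : b - a <= 1 by rewrite /a /b -[j.+1]addn1 natrD mulrDl addrAC subrr add0r mul1r invf_le1.
  have := sqr_ge0 (b - 1); nra.
have tel L' : \sum_(j < L') 2 * (h j - h j.+1) <= 2.
  rewrite -mulr_sumr -{2}[2]mulr1 ler_wpM2l // -(big_mkord xpredT (fun j => h j - h j.+1)).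
  rewrite -[X in X <= _]opprK -sumrN; under eq_bigr do rewrite opprB.
  rewrite telescope_sumr // opprB /h mul0r addr0 invr1 gerBl invr_ge0 ltW // hp.
under eq_bigr do rewrite mulrDr; rewrite big_split /=.
have s2 L' : \sum_(j < L') N%:R^-1 * wgt (j.+1%:R / N%:R) <= 2.
  by apply: le_trans (tel L'); apply: ler_sum.
have s1 : \sum_(j < L) N%:R^-1 * wgt (j%:R / N%:R) <= 3.
  case: L => [|L]; first by rewrite big_ord0.
  rewrite big_ord_recl /=; have := s2 L.
  have : N%:R^-1 * wgt (0%:R / N%:R) <= 1.
    by apply: mulr_ile1; [rewrite invr_ge0 ltW|exact: wgt_ge0|rewrite invf_le1|exact: wgt_le1].
  under eq_bigr => i do rewrite /bump /= add1n.
  by lra.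
have := s2 L; lra.
Qed.

(** The mean value inequality is used twice, for [f1] and for [f z - z f1(x)]. *)
Lemma taylor2 (f f1 f2 : C -> C) (x h B : R) :
  (forall z, cder f z (f1 z)) -> (forall z, cder f1 z (f2 z)) ->
  (forall s : R, 0 <= s <= 1 -> nm (f2 (x + s * h)%:C) <= B) ->
  nm (f (x + h)%:C - f x%:C - h%:C * f1 x%:C) <= B * h ^+ 2.
Proof.
move=> D1 D2 hB.
have seg s : x%:C + s%:C * ((x + h)%:C - x%:C) = (x + s * h)%:C :> C.
  by rewrite !rmorphD !rmorphM /=; ring.
have hh : (x + h)%:C - x%:C = h%:C :> C by rewrite rmorphD /=; ring.
have B0 : 0 <= B by apply: le_trans (nm_ge0 _) (hB 0 _); rewrite lexx ler01.
have b1 s : 0 <= s <= 1 -> nm (f1 (x + s * h)%:C - f1 x%:C) <= B * `|h|.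
  move=> /andP[s0 s1]; apply: le_trans (_ : B * nm ((x + s * h)%:C - x%:C) <= _).
    apply: (@cder_mv _ _ (fun r => f2 (x + r * (s * h))%:C)) => r /andP[r0 r1].
      have -> : x%:C + r%:C * ((x + s * h)%:C - x%:C) = (x + r * (s * h))%:C :> C.
        by rewrite !rmorphD !rmorphM /=; ring.
      exact: D2.
    rewrite mulrA; apply: hB; rewrite mulr_ge0 //=; nra.
  have -> : (x + s * h)%:C - x%:C = (s * h)%:C :> C by rewrite rmorphD /=; ring.
  rewrite nm_real normrM (ger0_norm s0); apply: ler_wpM2l => //; rewrite ler_piMl //.
have -> : f (x + h)%:C - f x%:C - h%:C * f1 x%:C =
   (f (x + h)%:C - (x + h)%:C * f1 x%:C) - (f x%:C - x%:C * f1 x%:C) by rewrite rmorphD /=; ring.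
have := @cder_mv _ (fun z => f z - z * f1 x%:C) (fun s => f1 (x + s * h)%:C - f1 x%:C) x%:C (x + h)%:C (B * `|h|).
rewrite hh nm_real -mulrA -expr2 real_normK ?num_real //; apply => s hs; last exact: b1.
rewrite -[s%:C * h%:C]rmorphM -rmorphD /=.
apply: cderB; first exact: D1.
by have := cderZ (f1 x%:C) (cder_id (x + s * h)%:C); rewrite mulr1; apply: cder_eq => w; rewrite mulrC.
Qed.

(** This is [exp(- pi z^2)]. *)
Definition gau (z : C) : C := ee ('i%C / 2%:R * z ^+ 2).
Let p : C := (2 * pi)%:C.

Lemma cder_gau z : cder gau z (- (p * z) * gau z).
Proof.
have := cder_comp (cderZ ('i%C / 2%:R) (cder_sqr z)) (cder_ee _).
have -> : tpi R * ee ('i%C / 2%:R * z ^+ 2) * ('i%C / 2%:R * (2%:R * z)) = - (p * z) * gau z; last exact.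
rewrite /gau; have -> : p = - (tpi R * 'i%C).
  by rewrite tpiE /p; apply: C_ext; rewrite (reCN, imCN) (reCM, imCM) /=; ring.
by field.
Qed.

Lemma nm_gau z : nm (gau z) = expR (- (pi * reC (z ^+ 2))).
Proof.
rewrite /gau nm_ee; congr (expR (- _)).
have -> : 'i%C / 2%:R * z ^+ 2 = (2^-1)%:C * ('i%C * z ^+ 2) :> C.
  by rewrite fmorphV rmorph_nat; ring.
by rewrite imCMr imCM /=; field.
Qed.

Section Path.
Variables lam mu : C.
(** The sector is convex and contains 1, so the Gaussian decays along the whole segment from 1 to
    [lam]. *)
Hypothesis sector : `|imC lam| < reC lam.
Let al := lam - 1.
Let La (s : C) := 1 + s * al.
Let vv (x : C) := al * x + mu.
Let zz (s x : C) := x + s * vv x.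
(** [F1] is both the [x]-derivative of [F] and the [s]-derivative of [La s * gau (zz s x)]; [F2] is
    the next [x]-derivative. *)
Let F s x := vv x * gau (zz s x).
Let F1 s x := gau (zz s x) * (al - p * vv x * La s * zz s x).
Let F2 s x := gau (zz s x) *
  (- p * La s * zz s x * (al - p * vv x * La s * zz s x) - p * La s * (al * zz s x + vv x * La s)).

Let D_zz s x : cder (zz s) x (La s).
Proof.
have := cderD (cder_id x) (cderZ s (cderD (cderZ al (cder_id x)) (cder_cst mu x))).
by rewrite addr0 mulr1.
Qed.

Let D_vv x : cder vv x al.
Proof. by have := cderD (cderZ al (cder_id x)) (cder_cst mu x); rewrite addr0 mulr1. Qed.

Let D_g s x : cder (fun x => gau (zz s x)) x (- p * La s * zz s x * gau (zz s x)).
Proof.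
have := cder_comp (D_zz s x) (cder_gau (zz s x)).
by have -> : - (p * zz s x) * gau (zz s x) * La s = - p * La s * zz s x * gau (zz s x) by ring.
Qed.

Let D_F s x : cder (F s) x (F1 s x).
Proof.
have := cderM (D_vv x) (D_g s x).
by have -> : al * gau (zz s x) + vv x * (- p * La s * zz s x * gau (zz s x)) = F1 s x by rewrite /F1; ring.
Qed.

Let D_F1 s x : cder (F1 s) x (F2 s x).
Proof.
have D := cderB (cder_cst al x) (cderM (cderZ (p * La s) (D_vv x)) (D_zz s x)).
have := cderM (D_g s x) D.
have -> : - p * La s * zz s x * gau (zz s x) * (al - p * La s * vv x * zz s x) +
  gau (zz s x) * (0 - (p * La s * al * zz s x + p * La s * vv x * La s)) = F2 s x by rewrite /F2; ring.
by apply: cder_eq => w; rewrite /F1; ring.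
Qed.

Let D_s s x : cder (fun s => La s * gau (zz s x)) s (F1 s x).
Proof.
have D1 : cder La s al.
  have := cderD (cder_cst 1 s) (cderZ al (cder_id s)); rewrite add0r mulr1.
  by apply: cder_eq => w; rewrite /La mulrC.
have D2 : cder (fun s => zz s x) s (vv x).
  have := cderD (cder_cst x s) (cderZ (vv x) (cder_id s)); rewrite add0r mulr1.
  by apply: cder_eq => w; rewrite /zz [vv x * _]mulrC.
have := cderM D1 (cder_comp D2 (cder_gau (zz s x))).
by have -> : al * gau (zz s x) + La s * (- (p * zz s x) * gau (zz s x) * vv x) = F1 s x by rewrite /F1; ring.
Qed.

Let bounds : exists2 B : R, 0 <= B & forall (s x : R), 0 <= s <= 1 ->
  [/\ nm (F s%:C x%:C) <= B * wgt x, nm (F2 s%:C x%:C) <= B * wgt x & nm (gau (zz s%:C x%:C)) <= B * wgt x].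
Proof.
pose M := 1 + nm al + nm mu; have na := nm_ge0 al; have nu := nm_ge0 mu.
have M1 : 1 <= M by rewrite /M; lra.
pose de := Num.min 1 (reC lam - `|imC lam|).
have de0 : 0 < de by rewrite lt_min ltr01 subr_gt0.
have pp := @pi_gt0 R.
have c0 : 0 < pi * de ^+ 2 by rewrite mulr_gt0 // exprn_gt0.
have M2 : 0 <= pi * (2 * M ^+ 2) by rewrite !mulr_ge0 ?ltW ?exprn_gt0 //; lra.
have [B B0 hB] := envelope (pi * M ^+ 2) 3 c0 M2.
pose q : R := 2 * pi.
pose K := q * M ^+ 2 * (M + q * M ^+ 3) + 2 * q * M ^+ 3 + M.
have q0 : 0 <= q by rewrite /q mulr_ge0 // ltW.
have M0 : 0 <= M by lra.
have Mn n : 0 <= M ^+ n by apply: exprn_ge0.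
have K1 : 0 <= q * M ^+ 2 * (M + q * M ^+ 3) by apply: mulr_ge0; [apply: mulr_ge0|apply: addr_ge0 => //; apply: mulr_ge0].
have K2 : 0 <= 2 * q * M ^+ 3 by apply: mulr_ge0 => //; apply: mulr_ge0.
exists (K * B); first by rewrite mulr_ge0 // /K; lra.
move=> s x /andP[s0 s1]; set X := 1 + `|x|.
have X1 : 1 <= X by rewrite /X lerDl.
have X0 : 0 <= X by lra.
have nL : nm (La s%:C) <= M.
  apply: le_trans (nmD _ _) _; rewrite nm1 nmM nm_real ger0_norm //.
  have : s * nm al <= nm al by apply: ler_piMl.
  by rewrite /M; lra.
have nv : nm (vv x%:C) <= M * X.
  apply: le_trans (nmD _ _) _; rewrite nmM nm_real /M /X.
  have := normr_ge0 x; nra.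
have nz : nm (zz s%:C x%:C) <= M * X.
  apply: le_trans (nmD _ _) _; rewrite nmM !nm_real (ger0_norm s0).
  have h : nm (vv x%:C) <= nm al * `|x| + nm mu by apply: le_trans (nmD _ _) _; rewrite nmM nm_real.
  have : s * nm (vv x%:C) <= nm (vv x%:C) by apply: ler_piMl => //; apply: nm_ge0.
  rewrite /M /X; have := normr_ge0 x; nra.
have np : nm p = q by rewrite nm_real ger0_norm.
have ng : X ^+ 3 * nm (gau (zz s%:C x%:C)) <= B * wgt x.
  apply: le_trans (hB x); rewrite ler_wpM2l ?exprn_ge0 // nm_gau ler_expR.
  have zE : zz s%:C x%:C = La s%:C * x%:C + s%:C * mu by rewrite /zz /vv /La; ring.
  have -> : zz s%:C x%:C ^+ 2 = (x ^+ 2)%:C * La s%:C ^+ 2 + ((2 * x)%:C * (La s%:C * (s%:C * mu)) + (s%:C * mu) ^+ 2).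
    by rewrite zE rmorphXn rmorphM rmorph_nat /=; ring.
  rewrite reCD reCMr reCD reCMr.
  (* [Re (La^2) = (Re La)^2 - (Im La)^2], and [Re La - |Im La|] is at least [de] on the whole
     segment. *)
  have r1 : de ^+ 2 <= reC (La s%:C ^+ 2).
    have -> : reC (La s%:C ^+ 2) = reC (La s%:C) ^+ 2 - imC (La s%:C) ^+ 2 by rewrite expr2 reCM; ring.
    have -> : reC (La s%:C) = (1 - s) + s * reC lam by rewrite /La reCD reCMr /al reCB /=; ring.
    have -> : imC (La s%:C) = s * imC lam by rewrite /La imCD imCMr /al imCB /=; ring.
    rewrite -[(s * imC lam) ^+ 2]real_normK ?num_real // normrM (ger0_norm s0).
    have d1 : de <= 1 by rewrite ge_min lexx.
    have d2 : de <= reC lam - `|imC lam| by rewrite ge_min lexx orbT.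
    have i0 := normr_ge0 (imC lam).
    set a := reC lam in d2 *; set b := `|imC lam| in d2 i0 *.
    have h1 : de <= (1 - s) + s * a - s * b by nra.
    have h2 : 0 <= s * b by apply: mulr_ge0.
    nra.
  have smu : nm (s%:C * mu) <= M.
    rewrite nmM nm_real ger0_norm //.
    have : s * nm mu <= nm mu by apply: ler_piMl.
    by rewrite /M; lra.
  have r2 : `|reC (La s%:C * (s%:C * mu))| <= M ^+ 2.
    by apply: le_trans (reC_le _) _; rewrite nmM expr2; apply: ler_pM => //; apply: nm_ge0.
  have r3 : `|reC ((s%:C * mu) ^+ 2)| <= M ^+ 2.
    by apply: le_trans (reC_le _) _; rewrite nmX; apply: lerXn2r => //; rewrite nnegrE ?nm_ge0.
  set A := reC (La s%:C ^+ 2) in r1 *; set A1 := reC _ in r2 *; set A2 := reC _ in r3 *.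
  have x2 : 0 <= x ^+ 2 by apply: sqr_ge0.
  have e1 : de ^+ 2 * x ^+ 2 <= x ^+ 2 * A by rewrite mulrC ler_wpM2l.
  have e2 : - (2 * M ^+ 2 * `|x|) <= 2 * x * A1.
    have : `|2 * x * A1| <= 2 * `|x| * M ^+ 2.
      have n2 : `|2 : R| = 2 by rewrite ger0_norm.
      by rewrite !normrM n2; apply: ler_wpM2l => //; apply: mulr_ge0.
    rewrite ler_norml => /andP[h _]; lra.
  have e3 : - M ^+ 2 <= A2 by move: r3; rewrite ler_norml => /andP[].
  have -> : - (pi * de ^+ 2 * x ^+ 2) + pi * (2 * M ^+ 2) * `|x| + pi * M ^+ 2 =
    - (pi * (de ^+ 2 * x ^+ 2 - (2 * M ^+ 2 * `|x|) - M ^+ 2)) by ring.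
  by rewrite lerN2 ler_pM2l //; lra.
have X13 : X <= X ^+ 3 by rewrite !exprS expr0; nra.
have ng0 := nm_ge0 (gau (zz s%:C x%:C)).
set G := nm (gau _) in ng ng0 *.
have KB k : 0 <= k -> k <= K * X ^+ 3 -> G * k <= K * B * wgt x.
  move=> k0 kK; apply: (@le_trans _ _ (K * (X ^+ 3 * G))).
    by rewrite mulrA [G * k]mulrC ler_wpM2r.
  by rewrite -mulrA ler_wpM2l // /K; lra.
have X3 : 0 <= X ^+ 3 by rewrite exprn_ge0.
have nv0 := nm_ge0 (vv x%:C); have nz0 := nm_ge0 (zz s%:C x%:C); have nL0 := nm_ge0 (La s%:C).
split.
- rewrite nmM mulrC; apply: KB => //; apply: le_trans nv _.
  apply: (@le_trans _ _ (M * X ^+ 3)); first by rewrite ler_wpM2l.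
  by rewrite ler_wpM2r // /K; lra.
- rewrite nmM; apply: KB; first exact: nm_ge0.
  apply: le_trans (nmB _ _) _; rewrite !nmM nmN np.
  have naM : nm al <= M by rewrite /M; lra.
  have b1 : nm (al - p * vv x%:C * La s%:C * zz s%:C x%:C) <= (M + q * M ^+ 3) * X ^+ 2.
    apply: le_trans (nmB _ _) _; rewrite !nmM np mulrDl; apply: lerD.
      apply: le_trans naM _; rewrite ler_peMr // expr2; nra.
    have -> : q * M ^+ 3 * X ^+ 2 = q * (M * X) * M * (M * X) by ring.
    by do ![exact: lexx | assumption | exact: nm_ge0 | apply: ler_pM | apply: mulr_ge0].
  have b2 : nm (al * zz s%:C x%:C + vv x%:C * La s%:C) <= 2 * M ^+ 2 * X.
    apply: le_trans (nmD _ _) _; rewrite !nmM.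
    have t1 : nm al * nm (zz s%:C x%:C) <= M * (M * X) by apply: ler_pM.
    have t2 : nm (vv x%:C) * nm (La s%:C) <= M * X * M by apply: ler_pM.
    have -> : 2 * M ^+ 2 * X = M * (M * X) + M * X * M by ring.
    exact: lerD.
  have u1 : q * nm (La s%:C) * nm (zz s%:C x%:C) * nm (al - p * vv x%:C * La s%:C * zz s%:C x%:C) <=
     q * M ^+ 2 * (M + q * M ^+ 3) * X ^+ 3.
    have -> : q * M ^+ 2 * (M + q * M ^+ 3) * X ^+ 3 = q * M * (M * X) * ((M + q * M ^+ 3) * X ^+ 2) by ring.
    by do ![exact: lexx | assumption | exact: nm_ge0 | apply: ler_pM | apply: mulr_ge0].
  have u2 : q * nm (La s%:C) * nm (al * zz s%:C x%:C + vv x%:C * La s%:C) <= 2 * q * M ^+ 3 * X ^+ 3.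
    apply: (@le_trans _ _ (q * M * (2 * M ^+ 2 * X))).
      by do ![exact: lexx | assumption | exact: nm_ge0 | apply: ler_pM | apply: mulr_ge0].
    have -> : q * M * (2 * M ^+ 2 * X) = 2 * q * M ^+ 3 * X by ring.
    by rewrite ler_wpM2l.
  apply: le_trans (lerD u1 u2) _.
  have -> : K * X ^+ 3 = (q * M ^+ 2 * (M + q * M ^+ 3) * X ^+ 3 + 2 * q * M ^+ 3 * X ^+ 3) + M * X ^+ 3.
    by rewrite /K; ring.
  by rewrite lerDl mulr_ge0.
- rewrite -[G]mulr1; apply: KB => //.
  have K1' : 1 <= K by rewrite /K; lra.
  have X31 : 1 <= X ^+ 3 by apply: exprn_ege1.
  nra.
Qed.

(* Riemann sums of an exact derivative are small; along the path
   lam_s x + s mu, lam_s = 1 + s (lam - 1), the s-derivative of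
   lam_s gau (lam_s x + s mu) is exact in x. *)
Lemma riemann_path : exists2 B : R, 0 <= B & forall N L : nat, (0 < N)%N ->
  nm (lam * (\sum_(j < L) N%:R^-1 * (gau (lam * (j%:R / N%:R) + mu) + gau (lam * (- j.+1%:R / N%:R) + mu)))
      - \sum_(j < L) N%:R^-1 * (gau (j%:R / N%:R) + gau (- j.+1%:R / N%:R))) <= B * (wgt (L%:R / N%:R) + N%:R^-1).
Proof.
have [B B0 hB] := bounds.
(* 15 is 3, from moving the weight by at most one step, times the 5 of [riemann_weight]. *)
exists (15 * B); first by rewrite mulr_ge0.
move=> N L N0; have n0 : 0 < N%:R :> R by rewrite ltr0n.
have n1 : N%:R^-1 <= 1 :> R by rewrite invf_le1 // ler1n.
pose xp (j : nat) : R := j%:R / N%:R; pose xn (j : nat) : R := - j.+1%:R / N%:R.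
have xpE j : (j%:R / N%:R : C) = (xp j)%:C by rewrite /xp rmorphM fmorphV !rmorph_nat.
have xnE j : (- j.+1%:R / N%:R : C) = (xn j)%:C by rewrite /xn rmorphM fmorphV rmorphN !rmorph_nat.
have NE : (N%:R^-1 : C) = (N%:R^-1)%:C by rewrite fmorphV rmorph_nat.
pose H (s : C) := \sum_(j < L) (N%:R^-1 * (La s * gau (zz s (xp j)%:C)) + N%:R^-1 * (La s * gau (zz s (xn j)%:C))).
pose dH (s : R) := \sum_(j < L) (N%:R^-1 * F1 s%:C (xp j)%:C + N%:R^-1 * F1 s%:C (xn j)%:C).
have DH s : cder H s%:C (dH s).
  by apply: cder_sum => j; apply: cderD; apply: cderZ; exact: D_s.
have small (s x : R) : 0 <= s <= 1 -> nm (F s%:C (x + N%:R^-1)%:C - F s%:C x%:C - N%:R^-1 * F1 s%:C x%:C) <= 3 * B * wgt x * N%:R^-1 ^+ 2.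
  move=> hs; rewrite NE; apply: taylor2 (D_F s%:C) (D_F1 s%:C) _ => r /andP[r0 r1].
  have [_ + _] := hB s (x + r * N%:R^-1) hs; move/le_trans; apply.
  rewrite [3 * B]mulrC -mulrA; apply: ler_wpM2l => //; apply: wgt_near.
  rewrite addrC addKr ger0_norm ?mulr_ge0 ?invr_ge0 ?(ltW n0) //.
  by apply: mulr_ile1 => //; rewrite invr_ge0; exact: ltW.
have bd s : 0 <= s <= 1 -> nm (dH s) <= 15 * B * (wgt (L%:R / N%:R) + N%:R^-1).
  move=> hs.
  (* The increments of [F] over the cells telescope to its values at [L/N] and [-L/N]; each differs
     from [F1 / N] by a second-order error. *)
  pose T j := (F s%:C (xp j + N%:R^-1)%:C - F s%:C (xp j)%:C) + (F s%:C (xn j + N%:R^-1)%:C - F s%:C (xn j)%:C).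
  have tel L' : \sum_(j < L') T j = F s%:C (xp L')%:C - F s%:C (- xp L')%:C.
    elim: L' => [|k IH]; first by rewrite big_ord0 /xp mul0r oppr0 subrr.
    rewrite big_ord_recr IH /T /=.
    have -> : xp k + N%:R^-1 = xp k.+1 by rewrite /xp -[k.+1]addn1 natrD mulrDl mul1r.
    have -> : xn k = - xp k.+1 by rewrite /xn /xp mulNr.
    have -> : - xp k.+1 + N%:R^-1 = - xp k by rewrite /xp -[k.+1]addn1 natrD mulrDl mul1r opprD addrNK.
    by ring.
  have -> : dH s = (F s%:C (xp L)%:C - F s%:C (- xp L)%:C) -
     \sum_(j < L) ((F s%:C (xp j + N%:R^-1)%:C - F s%:C (xp j)%:C - N%:R^-1 * F1 s%:C (xp j)%:C) +
        (F s%:C (xn j + N%:R^-1)%:C - F s%:C (xn j)%:C - N%:R^-1 * F1 s%:C (xn j)%:C)).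
    rewrite -tel -sumrB; apply: eq_bigr => j _; rewrite /T; ring.
  apply: le_trans (nmB _ _) _.
  have b1 : nm (F s%:C (xp L)%:C - F s%:C (- xp L)%:C) <= 2 * B * wgt (L%:R / N%:R).
    apply: le_trans (nmB _ _) _; have [h1 _ _] := hB s (xp L) hs; have [h2 _ _] := hB s (- xp L) hs.
    have wN : wgt (- xp L) = wgt (xp L) by rewrite /wgt sqrrN.
    by move: h1 h2; rewrite wN /xp; lra.
  have b2 : nm (\sum_(j < L) ((F s%:C (xp j + N%:R^-1)%:C - F s%:C (xp j)%:C - N%:R^-1 * F1 s%:C (xp j)%:C) +
        (F s%:C (xn j + N%:R^-1)%:C - F s%:C (xn j)%:C - N%:R^-1 * F1 s%:C (xn j)%:C))) <= 15 * B * N%:R^-1.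
    apply: le_trans (nm_sum _ _ _) _.
    apply: (@le_trans _ _ (\sum_(j < L) (3 * B * N%:R^-1) * (N%:R^-1 * (wgt (j%:R / N%:R) + wgt (j.+1%:R / N%:R))))).
      apply: ler_sum => j _; apply: le_trans (nmD _ _) _; apply: le_trans (lerD (small _ _ hs) (small _ _ hs)) _.
      have -> : wgt (xn j) = wgt (j.+1%:R / N%:R) by rewrite /wgt /xn mulNr sqrrN.
      by rewrite /xp le_eqVlt; apply/orP; left; apply/eqP; ring.
    rewrite -mulr_sumr; have -> : 15 * B * N%:R^-1 = 3 * B * N%:R^-1 * 5 by ring.
    by apply: ler_wpM2l; rewrite ?riemann_weight // !mulr_ge0 // invr_ge0 ltW.
  have := wgt_ge0 (L%:R / N%:R); nra.
have := @cder_mv _ H dH 0 1 (15 * B * (wgt (L%:R / N%:R) + N%:R^-1)).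
rewrite subr0 nm1 mulr1 => mv.
have -> : lam * (\sum_(j < L) N%:R^-1 * (gau (lam * (j%:R / N%:R) + mu) + gau (lam * (- j.+1%:R / N%:R) + mu)))
      - \sum_(j < L) N%:R^-1 * (gau (j%:R / N%:R) + gau (- j.+1%:R / N%:R)) = H 1 - H 0.
  rewrite /H mulr_sumr; congr (_ - _); apply: eq_bigr => j _; rewrite xpE xnE.
    have z1 (x : C) : zz 1 x = lam * x + mu by rewrite /zz /vv /al; ring.
    by rewrite !z1 /La /al; ring.
  have z0 (x : C) : zz 0 x = x by rewrite /zz; ring.
  by rewrite !z0 /La; ring.
apply: mv => s hs; last exact: bd.
by rewrite add0r mulr1; exact: DH.
Qed.

Lemma gau_bounds : exists2 B : R, 0 <= B & forall x : R, nm (gau (lam * x%:C + mu)) <= B * wgt x.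
Proof.
have [B B0 hB] := bounds; exists B => // x.
have e : zz 1%:C x%:C = lam * x%:C + mu by rewrite /zz /vv /al; ring.
by have [|_ _] := hB 1 x; rewrite ?lexx ?ler01 // e.
Qed.

End Path.
End Riemann.

(** * Sums over the integers *)

Section TwoSided.
Variable R : realType.
Local Notation C := R[i].
Implicit Types (a : int -> C).

(** [Negz j] is [-(j + 1)], so the partial sums run over [-L <= m < L]. *)
Definition zsum a : C := csum (fun j => a (Posz j) + a (Negz j)).
Definition zasum a := asum (fun j => a (Posz j)) /\ asum (fun j => a (Negz j)).

Lemma zasum_pair a : zasum a -> asum (fun j => a (Posz j) + a (Negz j)).
Proof. by case=> h1 h2; apply: asumD. Qed.

Lemma zsum_cvc a : zasum a -> cvc (fun L => \sum_(j < L) (a (Posz j) + a (Negz j))) (zsum a).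
Proof. by move=> /zasum_pair /asum_cvc. Qed.

Lemma zsum_eqP a l : cvc (fun L => \sum_(j < L) (a (Posz j) + a (Negz j))) l -> zsum a = l.
Proof. exact: csum_eqP. Qed.

Lemma eq_zsum a b : a =1 b -> zsum a = zsum b.
Proof. by move=> h; apply: eq_csum => j; rewrite !h. Qed.

Lemma zasumD a b : zasum a -> zasum b -> zasum (fun m => a m + b m).
Proof. by case=> h1 h2 [h3 h4]; split; apply: asumD. Qed.

Lemma zasumZ c a : zasum a -> zasum (fun m => c * a m).
Proof. by case=> h1 h2; split; apply: asumZ. Qed.

Lemma zasumB a b : zasum a -> zasum b -> zasum (fun m => a m - b m).
Proof. by case=> h1 h2 [h3 h4]; split; apply: asumB. Qed.

Lemma zsumD a b : zasum a -> zasum b -> zsum (fun m => a m + b m) = zsum a + zsum b.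
Proof.
move=> /zasum_pair ha /zasum_pair hb; rewrite /zsum -csumD //; apply: eq_csum => j; ring.
Qed.

Lemma zsumZ c a : zasum a -> zsum (fun m => c * a m) = c * zsum a.
Proof.
move=> /zasum_pair ha; rewrite /zsum -csumZ //; apply: eq_csum => j; ring.
Qed.

Lemma zsumB a b : zasum a -> zasum b -> zsum (fun m => a m - b m) = zsum a - zsum b.
Proof.
move=> ha hb; rewrite -[- zsum b]mulN1r -zsumZ // -zsumD //; last exact: zasumZ.
by apply: eq_zsum => m; rewrite mulN1r.
Qed.

Lemma zasum_sum (I : Type) (r : seq I) (F : I -> int -> C) :
  (forall i, zasum (F i)) -> zasum (fun m => \sum_(i <- r) F i m).
Proof.
move=> h; elim: r => [|i r IH].
  by split; apply: (@asum_finite _ _ 0) => n _; rewrite big_nil.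
have -> : (fun m => \sum_(j <- i :: r) F j m) = (fun m => F i m + \sum_(j <- r) F j m).
  by apply/funext => m; rewrite big_cons.
exact: zasumD.
Qed.

Lemma zsum_sum (I : Type) (r : seq I) (F : I -> int -> C) :
  (forall i, zasum (F i)) -> zsum (fun m => \sum_(i <- r) F i m) = \sum_(i <- r) zsum (F i).
Proof.
move=> h; elim: r => [|i r IH].
  rewrite big_nil; apply: zsum_eqP; apply: cvc_eq (cvc_cst 0) => L.
  by rewrite big1 // => j _; rewrite !big_nil addr0.
rewrite big_cons -IH -zsumD //; last exact: zasum_sum.
by apply: eq_zsum => m; rewrite big_cons.
Qed.

Lemma asum_null (u : nat -> C) : asum u -> cvc u 0.
Proof.
move=> h; have c := asum_cvc h.
have := cvcB (cvc_shift 1 c) c; rewrite subrr; apply: cvc_eq => n.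
by rewrite addn1 big_ord_recr /= addrAC subrr add0r.
Qed.

(** A shift changes the partial sum by the two boundary terms [a L - a (-L)], which tend to 0. *)
Lemma zsum_shift a : zasum a -> zsum (fun m => a (m + 1)) = zsum a.
Proof.
move=> ha; apply: zsum_eqP.
have n1 := asum_null ha.1; have n2 := asum_null ha.2.
pose f L := \sum_(j < L) (a (Posz j) + a (Negz j)) + a (Posz L) - a (if L is L'.+1 then Negz L' else Posz 0).
have E L : \sum_(j < L) (a (Posz j + 1) + a (Negz j + 1)) = f L.
  elim: L => [|L IH]; first by rewrite /f !big_ord0 add0r subrr.
  rewrite big_ord_recr /= IH /f big_ord_recr /=.
  have -> : Posz L + 1 = Posz L.+1 by rewrite -addn1.
  have -> : Negz L + 1 = if L is L'.+1 then Negz L' else Posz 0.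
    by case: L {IH} => [|L] //; rewrite !NegzE; lia.
  by ring.
apply: cvc_eq (fun L => esym (E L)) _.
rewrite -[zsum a]addr0 -[zsum a + 0]subr0; apply: cvcB.
  by apply: cvcD => //; apply: zsum_cvc.
apply: (@cvc_ext _ (fun L => a (Negz L.-1)) _ _ 1); first by case.
by apply: (@cvc_sub _ (fun L => a (Negz L)) _ predn) => // m; exists m.+1 => -[].
Qed.

(** A block of [N] consecutive indices contains one multiple of [N]: the first entry of a [Posz]
    block, the last of a [Negz] block. *)
Lemma zsum_multiples (N : nat) a : (0 < N)%N -> zasum a ->
  zsum (fun m => if (N%:Z %| m)%Z then a m else 0) = zsum (fun n => a (N%:Z * n)).
Proof.
move=> N0 ha; pose c m := if (N%:Z %| m)%Z then a m else 0.
have hc : zasum c.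
  by case: ha => h1 h2; split; [apply: bdd_le h1|apply: bdd_le h2] => j; rewrite /c; case: ifP => _ //; rewrite nm0 nm_ge0.
have lim := @cvc_sub _ _ _ (fun L => N * L)%N _ (zsum_cvc hc).
apply/esym; apply: zsum_eqP; apply: cvc_eq (lim _); last first.
  by move=> m; exists m => n h; rewrite (leq_trans h) // leq_pmull.
elim=> [|L IH]; first by rewrite muln0 !big_ord0.
rewrite mulnS addnC big_split_ord /= IH [RHS]big_ord_recr /=; congr (_ + _).
rewrite big_split /=; congr (_ + _).
  rewrite (bigD1 (Ordinal N0)) //= addn0 /c PoszM dvdz_mulr ?dvdzz // big1 ?addr0 // => i i0.
  rewrite dvdzE /= dvdn_addr ?dvdn_mulr //; case: ifP => // /dvdn_leq h.
  by rewrite -(inj_eq val_inj) /= -lt0n in i0; have := h i0; rewrite leqNgt ltn_ord.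
have N1 : (N.-1 < N)%N by rewrite prednK.
rewrite (bigD1 (Ordinal N1)) //= big1 ?addr0 => [|i].
  have -> : Negz (N * L + N.-1) = N%:Z * Negz L by rewrite !NegzE; nia.
  by rewrite /c dvdz_mulr ?dvdzz.
rewrite -(inj_eq val_inj) /= /c => i0; case: ifP => // /dvdzP[q]; rewrite NegzE; have := ltn_ord i.
move/eqP: i0 => i0 h1 h2; exfalso.
have : (N%:Z %| (N * L + i).+1%:Z)%Z by apply/dvdzP; exists (- q); lia.
rewrite dvdzE /= -addnS dvdn_addr ?dvdn_mulr // => /dvdn_leq; lia.
Qed.

End TwoSided.

(** * Poisson summation and the inversion of theta series *)

Section Poisson.
Variable R : realType.
Local Notation C := R[i].

Lemma reC_ee_real (s : R) : reC (ee s%:C) = cos (2 * pi * s).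
Proof. by rewrite eeE tpiE reC_cexp reCM imCM /= !mulr0 mul0r subrr add0r expR0 mul1r. Qed.

Lemma imC_ee_real (s : R) : imC (ee s%:C) = sin (2 * pi * s).
Proof. by rewrite eeE tpiE imC_cexp reCM imCM /= !mulr0 mul0r subrr add0r expR0 mul1r. Qed.

Lemma ee_imag (x : R) : ee (x%:C * 'i%C) = (expR (- (2 * pi * x)))%:C.
Proof.
have e : tpi R * (x%:C * 'i%C) = (- (2 * pi * x))%:C.
  by rewrite tpiE; apply: C_ext; rewrite !(reCM, imCM) /=; ring.
by rewrite eeE e; apply: C_ext; rewrite (reC_cexp, imC_cexp) [reC _]/= [imC _]/= (cos0, sin0) (mulr1, mulr0).
Qed.

(** With [x = 2 pi |s|]: for [x <= 1/2] the modulus of the imaginary part is at least [x / 2]; for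
    larger [x], up to [pi], the real part [1 - cos x] is at least [1 - cos(1/2)]. *)
Lemma ee_away_from_one : exists2 k : R, 0 < k & forall s : R, `|s| <= 1 / 2 -> k * `|s| <= nm (1 - ee s%:C).
Proof.
have pp := @pi_gt0 R; have p2 := @pi_ge2 R.
pose c0 : R := 1 - cos (1 / 2).
have c0p : 0 < c0.
  rewrite subr_gt0 -[X in _ < X](@cos0 R) ltr_cos ?in_itv /= ?lexx ?ltW //; lra.
pose k := Num.min (1 / 2) (c0 / pi) * (2 * pi).
exists k; first by rewrite !mulr_gt0 // lt_min divr_gt0 // divr_gt0.
move=> s hs; rewrite /k -mulrA; set x := 2 * pi * `|s|.
have x0 : 0 <= x by rewrite !mulr_ge0 // ltW.
have xpi : x <= pi by rewrite /x; nra.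
have E1 : `|sin (2 * pi * s)| = `|sin x|.
  rewrite /x; have [s0|s0] := leP 0 s; first by rewrite (ger0_norm s0).
  by rewrite (ltr0_norm s0) mulrN sinN normrN.
have E2 : cos (2 * pi * s) = cos x.
  rewrite /x; have [s0|s0] := leP 0 s; first by rewrite (ger0_norm s0).
  by rewrite (ltr0_norm s0) mulrN cosN.
have [xs|xl] := leP x (1 / 2).
  apply: le_trans (imC_le _); rewrite imCB [imC 1]/= sub0r normrN imC_ee_real E1.
  have := @sin_subx R x; rewrite ger0_norm // => /(_ _)H; have {}H := H (le_trans xs _).
  have h : `|sin x - x| <= x ^+ 2 by apply: H; lra.
  have h1 : x - `|sin x| <= x ^+ 2.
    apply: le_trans h; have := ler_normB (sin x) (sin x - x).
    by rewrite opprB addrC subrK (ger0_norm x0); lra.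
  apply: (@le_trans _ _ (1 / 2 * x)); last by nra.
  by apply: ler_wpM2r => //; rewrite ge_min lexx.
apply: le_trans (reC_le _); rewrite reCB [reC 1]/= reC_ee_real E2.
have h : cos x <= cos (1 / 2).
  have : cos x < cos (1 / 2) by rewrite ltr_cos ?in_itv /= ?x0 ?xpi //; lra.
  exact: ltW.
apply: le_trans (ler_norm _); apply: (@le_trans _ _ c0); last by rewrite /c0; lra.
apply: (@le_trans _ _ (c0 / pi * x)).
  by apply: ler_wpM2r => //; rewrite ge_min lexx orbT.
by rewrite -mulrA ler_piMr ?(ltW c0p) // ler_pdivrMl // mulr1.
Qed.

Lemma ee_root_unity (N r : nat) : (0 < r < N)%N -> ee (r%:R / N%:R : C) != 1.
Proof.
move=> /andP[r0 rN]; have N0 : (0 < N)%N by apply: leq_trans rN.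
have n0 : 0 < N%:R :> R by rewrite ltr0n.
have [k k0 hk] := ee_away_from_one.
pose s : R := r%:R / N%:R.
have sE : (r%:R / N%:R : C) = s%:C by rewrite /s rmorphM fmorphV !rmorph_nat.
have s0 : 0 < s by rewrite divr_gt0 // ltr0n.
have s1 : s < 1 by rewrite ltr_pdivrMr // mul1r ltr_nat.
suff : 0 < nm (1 - ee s%:C) by rewrite nm_gt0 subr_eq0 eq_sym sE.
have [h|h] := leP s (1 / 2).
  by apply: lt_le_trans (hk s _); rewrite ?mulr_gt0 ?normr_gt0 ?gt_eqF // ger0_norm // ltW.
have -> : ee s%:C = ee (s - 1)%:C.
  by rewrite -[RHS]mulr1 -(@ee1 R) -eeD rmorphB /= subrK.
apply: lt_le_trans (hk (s - 1) _).
  by rewrite mulr_gt0 // normr_gt0 subr_eq0 lt_eqF.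
rewrite ler0_norm; lra.
Qed.

Lemma nm_invN (N : nat) (z : C) : nm (N%:R^-1 * z) = N%:R^-1 * nm z.
Proof. by rewrite nmM nmV nm_nat. Qed.

Lemma nm_mul_ee (z : C) (x : R) : nm (z * ee x%:C) = nm z.
Proof. by rewrite nmM nm_ee_real mulr1. Qed.

Definition xx (N : nat) (m : int) : R := m%:~R / N%:R.

Lemma wgt_xxN N j : wgt (xx N (Negz j)) = wgt (j.+1%:R / N%:R).
Proof. by rewrite /wgt /xx NegzE mulrNz mulNr sqrrN. Qed.

Lemma zasum_wgt (N : nat) (a : int -> C) (K : R) : (0 < N)%N -> 0 <= K ->
  (forall m, nm (a m) <= K * (N%:R^-1 * wgt (xx N m))) -> zasum a /\ nm (zsum a) <= K * 5.
Proof.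
move=> N0 K0 h.
have n0 : 0 <= N%:R^-1 :> R by rewrite invr_ge0.
have hb L : \sum_(j < L) (K * (N%:R^-1 * wgt (xx N (Posz j))) + K * (N%:R^-1 * wgt (xx N (Negz j)))) <= K * 5.
  under eq_bigr do rewrite -mulrDr -mulrDr wgt_xxN.
  by rewrite -mulr_sumr; apply: ler_wpM2l => //; exact: riemann_weight.
have nn m : 0 <= K * (N%:R^-1 * wgt (xx N m)) by rewrite !mulr_ge0 // wgt_ge0.
split.
  split; exists (K * 5) => L; apply: le_trans (hb L); apply: ler_sum => j _; apply: le_trans (h _) _; rewrite ?lerDl ?lerDr //.
apply: nm_csum_le hb => j; apply: le_trans (nmD _ _) _; exact: lerD.
Qed.

(** Riemann sum of the Gaussian with step [1/N]. Its limit becomes known only inside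
    [theta_inversion]. *)
Definition sR (N : nat) : C := zsum (fun m => N%:R^-1 * gau (xx N m)%:C).

Section Fixed.
Variable t : C.
Hypothesis ut : upper t.
Variable lam : C.
Hypothesis lam2 : lam ^+ 2 = - 'i%C * t.
Hypothesis lam_sector : `|imC lam| < reC lam.

Lemma lam_neq0 : lam != 0.
Proof. by apply: contraTneq lam_sector => ->; rewrite /= normr0 ltxx. Qed.

Lemma gau_zasum mu : exists2 B : R, 0 <= B & forall N : nat, (0 < N)%N ->
  zasum (fun m => N%:R^-1 * gau (lam * (xx N m)%:C + mu)) /\
  nm (zsum (fun m => N%:R^-1 * gau (lam * (xx N m)%:C + mu))) <= B.
Proof.
have [B B0 hB] := gau_bounds mu lam_sector; exists (B * 5); first by rewrite mulr_ge0.
move=> N N0; apply: (@zasum_wgt N _ B) => // m.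
by rewrite nm_invN mulrCA ler_wpM2l ?invr_ge0.
Qed.

(** Rotation and translation of the contour without integrals: [riemann_path] with [L] sent to
    infinity, where the boundary weight vanishes. *)
Lemma riemann_limit mu : exists2 B : R, 0 <= B & forall N : nat, (0 < N)%N ->
  nm (lam * zsum (fun m => N%:R^-1 * gau (lam * (xx N m)%:C + mu)) - sR N) <= B * N%:R^-1.
Proof.
have [B B0 hB] := riemann_path mu lam_sector.
have [B' B'0 hB'] := gau_zasum mu.
have sec1 : `|imC (1 : C)| < reC (1 : C) by rewrite /= normr0 ltr01.
have [B1 B10 hB1] := gau_bounds 0 sec1.
exists B => // N N0.
have z1 : zasum (fun m => N%:R^-1 * gau (xx N m)%:C).
  apply: (@zasum_wgt N _ B1 N0 B10 _).1 => m.
  by have := hB1 (xx N m); rewrite mul1r addr0 nm_invN mulrCA => h; rewrite ler_wpM2l ?invr_ge0.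
have z2 := (hB' N N0).1.
have lim := cvcB (cvcZ lam (zsum_cvc z2)) (zsum_cvc z1).
rewrite leNgt; apply/negP => lt.
set l := lam * _ - _ in lt lim.
pose e := (nm l - B * N%:R^-1) / 2; have e0 : 0 < e by rewrite /e; lra.
have [L0 hL0] := lim e e0.
have n0 : 0 < N%:R :> R by rewrite ltr0n.
have be : 0 < e / (B + 1) by rewrite divr_gt0 //; lra.
have [L1 hL1] : exists L1, forall L : nat, (L1 <= L)%N -> wgt (L%:R / N%:R) < e / (B + 1).
  have [L1 h1] := @null_inv R _ be; exists (N * L1.+1)%N => L hL.
  apply: le_lt_trans (h1 L1 _) => //.
  rewrite /wgt lef_pV2 ?posrE ?wgt_pos //.
  have h : L1.+1%:R <= L%:R / N%:R :> R by rewrite ler_pdivlMr // mulrC -natrM ler_nat.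
  have h' : 1 <= L1.+1%:R :> R by rewrite ler1n.
  nra.
pose L := maxn L0 L1.
have a1 := hL0 L (leq_maxl _ _); have a2 := hL1 L (leq_maxr _ _).
have a3 := hB N L N0.
move: a1 a3; rewrite -/l.
have xP j : (xx N (Posz j))%:C = j%:R / N%:R :> C by rewrite /xx rmorphM fmorphV !rmorph_nat.
have xN j : (xx N (Negz j))%:C = - j.+1%:R / N%:R :> C.
  by rewrite /xx NegzE mulrNz rmorphM rmorphN fmorphV -pmulrn !rmorph_nat.
have -> : \sum_(j < L) N%:R^-1 * (gau (lam * (j%:R / N%:R) + mu) + gau (lam * (- j.+1%:R / N%:R) + mu)) =
   \sum_(j < L) (N%:R^-1 * gau (lam * (xx N (Posz j))%:C + mu) + N%:R^-1 * gau (lam * (xx N (Negz j))%:C + mu)).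
  by apply: eq_bigr => j _; rewrite xP xN mulrDr.
have -> : \sum_(j < L) N%:R^-1 * (gau (j%:R / N%:R : C) + gau (- j.+1%:R / N%:R)) =
   \sum_(j < L) (N%:R^-1 * gau (xx N (Posz j))%:C + N%:R^-1 * gau (xx N (Negz j))%:C).
  by apply: eq_bigr => j _; rewrite xP xN mulrDr.
set u := lam * _ - _ => a1 a3.
have a4 := nm_dist l u; rewrite nmC in a1.
have a5 : B * wgt (L%:R / N%:R) <= e.
  apply: (@le_trans _ _ (B * (e / (B + 1)))); first by apply: ler_wpM2l => //; exact: ltW.
  rewrite mulrA ler_pdivrMr; last by lra.
  by rewrite mulrC ler_wpM2l ?(ltW e0) //; lra.
rewrite mulrDr in a3.
have : nm l - B * N%:R^-1 = 2 * e by rewrite /e; field; rewrite lt0r_neq0.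
lra.
Qed.

(** Riemann sum for the Fourier transform of [gau (lam x)] at frequency [b]. *)
Let RN N (b : R) : C := zsum (fun m => N%:R^-1 * (gau (lam * (xx N m)%:C) * ee (b * xx N m)%:C)).

Lemma complete_square (b x : R) :
  gau (lam * x%:C) * ee (b * x)%:C = ee (- (b ^+ 2)%:C / (2%:R * t)) * gau (lam * x%:C + - 'i%C * b%:C / lam).
Proof.
have l0 := lam_neq0; have t0 := upper_neq0 ut.
rewrite /gau -!eeD; congr ee.
have i2 : ('i%C : C) ^+ 2 = -1 by exact: sqr_i.
have i0 := iC_neq0 R.
set X := lam * x%:C; set Y := - 'i%C * b%:C / lam.
have hX : X * Y = - 'i%C * (b * x)%:C by rewrite /X /Y rmorphM; field.
have hY : Y ^+ 2 = - (b ^+ 2)%:C / (- 'i%C * t).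
  by rewrite -lam2 /Y !exprMn exprVn sqrrN i2 rmorphXn mulN1r.
have -> : 'i%C / 2%:R * (X + Y) ^+ 2 = 'i%C / 2%:R * X ^+ 2 + 'i%C * (X * Y) + 'i%C / 2%:R * Y ^+ 2 by field.
rewrite hX hY.
have -> : 'i%C * (- 'i%C * (b * x)%:C) = (b * x)%:C.
  by transitivity (- ('i%C ^+ 2) * (b * x)%:C); [ring|rewrite i2 opprK mul1r].
have -> : 'i%C / 2%:R * (- (b ^+ 2)%:C / (- 'i%C * t)) = (b ^+ 2)%:C / (2%:R * t) by field; rewrite t0 i0.
by rewrite mulNr; ring.
Qed.

Lemma RN_limit (b : R) : exists2 B : R, 0 <= B & forall N : nat, (0 < N)%N ->
  nm (RN N b - lam^-1 * ee (- (b ^+ 2)%:C / (2%:R * t)) * sR N) <= B * N%:R^-1.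
Proof.
have [B B0 hB] := riemann_limit (- 'i%C * b%:C / lam).
have [B' _ hz] := gau_zasum (- 'i%C * b%:C / lam).
set E := ee (- _ / _).
exists (nm (lam^-1 * E) * B); first by rewrite mulr_ge0 ?nm_ge0.
move=> N N0; have [z _] := hz N N0.
have -> : RN N b = E * zsum (fun m => N%:R^-1 * gau (lam * (xx N m)%:C + - 'i%C * b%:C / lam)).
  by rewrite -zsumZ //; apply: eq_zsum => m; rewrite complete_square mulrCA.
have l0 := lam_neq0.
have -> : forall w, E * w - lam^-1 * E * sR N = (lam^-1 * E) * (lam * w - sR N) by move=> w; field.
rewrite [nm (lam^-1 * E * _)]nmM -[_ * B / _]mulrA; apply: ler_wpM2l; [exact: nm_ge0|exact: hB].
Qed.

Let RN_zasum N b : (0 < N)%N -> zasum (fun m => N%:R^-1 * (gau (lam * (xx N m)%:C) * ee (b * xx N m)%:C)).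
Proof.
move=> N0; have [B B0 hB] := gau_bounds 0 lam_sector.
apply: (@zasum_wgt N _ B N0 B0 _).1 => m.
have := hB (xx N m); rewrite addr0 nm_invN nm_mul_ee mulrCA => h.
by rewrite ler_wpM2l ?invr_ge0.
Qed.

(** Decay in [b] uniform in [N]: two summations by parts turn [(1 - om)^2 RN] into a sum of second
    differences of size [N^-2], and [|1 - om|] is at least a multiple of [|b| / N] because
    [|b / N| <= 1/2]. *)
Lemma RN_bound : exists2 K : R, 0 <= K & forall (N : nat) (b : R), (0 < N)%N -> `|b| <= N%:R / 2 ->
  (1 + b ^+ 2) * nm (RN N b) <= K.
Proof.
have [B B0 hB] := gau_bounds 0 lam_sector.
have [k k0 hk] := ee_away_from_one.
have [Q QE] : exists Q : C, Q = (2 * pi)%:C * lam ^+ 2 by exists ((2 * pi)%:C * lam ^+ 2).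
pose f (z : C) := gau (lam * z).
pose f1 (z : C) := - Q * (z * f z).
pose f2 (z : C) := - Q * (f z + z * f1 z).
have D0 z : cder f z (f1 z).
  have := cder_comp (cderZ lam (cder_id z)) (cder_gau (lam * z)); rewrite mulr1.
  by have -> : - ((2 * pi)%:C * (lam * z)) * gau (lam * z) * lam = f1 z by rewrite /f1 /f QE; ring.
have D1 z : cder f1 z (f2 z).
  have := cderZ (- Q) (cderM (cder_id z) (D0 z)); by rewrite mul1r.
have [B2 B20 hB2] : exists2 B2 : R, 0 <= B2 & forall x : R, nm (f2 x%:C) <= B2 * wgt x.
  have rl : 0 < pi * reC (lam ^+ 2).
    by rewrite mulr_gt0 ?pi_gt0 // lam2 mulNr reCN reCM /= mul0r mul1r sub0r opprK; exact: ut.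
  have [B3 B30 hB3] := envelope 0 2 rl (lexx 0).
  have [q qE] : exists q, q = nm Q by exists (nm Q).
  have q0 : 0 <= q by rewrite qE; apply: nm_ge0.
  exists (q * (1 + q) * B3); first by rewrite !mulr_ge0 ?addr_ge0.
  move=> x; have -> : f2 x%:C = - Q * ((1 + x%:C * (- Q * x%:C)) * f x%:C) by rewrite /f2 /f1; ring.
  have e1 : nm (f x%:C) * (1 + `|x|) ^+ 2 <= B3 * wgt x.
    apply: le_trans (hB3 x); rewrite mulrC ler_wpM2l ?exprn_ge0 ?addr_ge0 // nm_gau ler_expR.
    have -> : (lam * x%:C) ^+ 2 = (x ^+ 2)%:C * lam ^+ 2 by rewrite rmorphXn; ring.
    by rewrite reCMr; lra.
  rewrite 2!nmM nmN -qE -2!mulrA ler_wpM2l //.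
  have e2 : nm (1 + x%:C * (- Q * x%:C)) <= (1 + q) * (1 + `|x|) ^+ 2.
    apply: le_trans (nmD _ _) _; rewrite nm1 !nmM nmN -qE nm_real.
    have := normr_ge0 x; set y := `|x| => y0.
    have y1 : 0 <= q * y by rewrite mulr_ge0.
    have y2 : 0 <= q * (y * y) by rewrite !mulr_ge0.
    nra.
  apply: le_trans (ler_wpM2r (nm_ge0 _) e2) _; rewrite -mulrA ler_wpM2l ?addr_ge0 //.
  by rewrite mulrC.
pose K2 := 90 * B2 / k ^+ 2.
have K20 : 0 <= K2 by rewrite divr_ge0 ?sqr_ge0 ?mulr_ge0.
have K0 : 0 <= B * 5 + K2 by rewrite addr_ge0 // mulr_ge0.
exists (B * 5 + K2) => // N b N0 hb.
have n0 : 0 < N%:R :> R by rewrite ltr0n.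
have n0C : (N%:R : C) != 0 by rewrite pnatr_eq0 -lt0n.
rewrite mulrDl mul1r; apply: lerD.
  apply: (@zasum_wgt N _ B N0 B0 _).2 => m.
  have := hB (xx N m); rewrite addr0 nm_invN nm_mul_ee mulrCA => h.
  by rewrite ler_wpM2l ?invr_ge0.
pose om := ee (b / N%:R)%:C.
pose u (m : int) := N%:R^-1 * (f (xx N m)%:C * ee (b * xx N m)%:C).
have zu : zasum u by exact: RN_zasum.
have xS m : xx N (m + 1) = xx N m + N%:R^-1 by rewrite /xx rmorphD mulrDl mul1r.
have shz (a : int -> C) : zasum a -> zasum (fun m : int => a (m + 1 : int)).
  move=> [[P hP] [P' hQ]]; split.
    exists P => L; apply: le_trans (hP L.+1); rewrite big_ord_recl /=.
    have -> : \sum_(n < L) nm (a (Posz n + 1)) = \sum_(i < L) nm (a (Posz (bump 0 i))).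
      by apply: eq_bigr => i _; rewrite /bump /= add1n -addn1 PoszD.
    by rewrite lerDr nm_ge0.
  exists (nm (a 0) + P') => -[|L]; first by rewrite big_ord0; have := hQ 0%N; rewrite big_ord0; have := nm_ge0 (a 0); lra.
  rewrite big_ord_recl /=; apply: lerD => //; apply: le_trans (hQ L); apply: ler_sum => j _.
  by have -> : Negz (bump 0 j) + 1 = Negz j by rewrite /bump /= add1n !NegzE; lia.
have z1 := shz _ zu; have z2 := shz _ z1.
have key : (1 - om) ^+ 2 * RN N b = zsum (fun m => u (m + 1 + 1) - 2%:R * om * u (m + 1) + om ^+ 2 * u m).
  have za := zasumZ (2%:R * om) z1; have zb := zasumZ (om ^+ 2) zu.
  rewrite (zsumD (zasumB z2 za) zb) (zsumB z2 za) (zsumZ _ z1) (zsumZ _ zu) (zsum_shift z1) (zsum_shift zu).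
  by rewrite /RN -/(zsum u); ring.
have pt m : nm (u (m + 1 + 1) - 2%:R * om * u (m + 1) + om ^+ 2 * u m) <= (18 * B2 / N%:R ^+ 2) * (N%:R^-1 * wgt (xx N m)).
  set x := xx N m; set h : R := N%:R^-1.
  have h1 : h <= 1 by rewrite invf_le1 // ler1n.
  have h0 : 0 < h by rewrite invr_gt0.
  have eS y : ee (b * (y + h))%:C = ee (b * y)%:C * om.
    by rewrite mulrDr rmorphD eeD.
  have -> : u (m + 1 + 1) - 2%:R * om * u (m + 1) + om ^+ 2 * u m =
    N%:R^-1 * (om ^+ 2 * ee (b * x)%:C) * ((f (x + h + h)%:C - f (x + h)%:C - h%:C * f1 (x + h)%:C) +
       (f (x + h + - h)%:C - f (x + h)%:C - (- h)%:C * f1 (x + h)%:C)).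
    rewrite /u !xS -/x -/h !eS addrK rmorphN /=; ring.
  rewrite -mulrA nm_invN [nm (_ * _ * _)]nmM nm_mul_ee nmX nm_ee_real expr1n mul1r.
  have tay (h' : R) : `|h'| = h -> nm (f (x + h + h')%:C - f (x + h)%:C - h'%:C * f1 (x + h)%:C) <= 3 * B2 * wgt (x + h) * h' ^+ 2.
    move=> hh; apply: taylor2 D0 D1 _ => s /andP[s0 s1]; apply: le_trans (hB2 _) _.
    have := @wgt_near R (x + h) (x + h + s * h'); rewrite addrC addKr normrM hh (ger0_norm s0) => w.
    rewrite [3 * B2]mulrC -mulrA ler_wpM2l //; apply: w; apply: mulr_ile1 => //; exact: ltW.
  rewrite -/h [18 * _ / _ * _]mulrCA; apply: ler_wpM2l; first exact: ltW.
  apply: le_trans (nmD _ _) _.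
  have t1 := tay h (ger0_norm (ltW h0)); have t2 := tay (- h); rewrite normrN (ger0_norm (ltW h0)) sqrrN in t2.
  have {}t2 := t2 erefl.
  have w : wgt (x + h) <= 3 * wgt x.
    by apply: wgt_near; rewrite addrC addKr ger0_norm // ltW.
  apply: le_trans (lerD t1 t2) _.
  have -> : 18 * B2 / N%:R ^+ 2 * wgt x = 3 * B2 * (3 * wgt x) * h ^+ 2 + 3 * B2 * (3 * wgt x) * h ^+ 2.
    by rewrite /h; field; rewrite lt0r_neq0.
  have w' : 3 * B2 * wgt (x + h) * h ^+ 2 <= 3 * B2 * (3 * wgt x) * h ^+ 2.
    by apply: ler_wpM2r; [exact: sqr_ge0|apply: ler_wpM2l => //; apply: mulr_ge0].
  exact: lerD.
have kb : 0 <= 18 * B2 / N%:R ^+ 2 by rewrite divr_ge0 ?sqr_ge0 ?mulr_ge0.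
have := (@zasum_wgt N _ _ N0 kb pt).2; rewrite -key nmM nmX => h.
have bN : `|b / N%:R| <= 1 / 2.
  by rewrite normrM normfV (ger0_norm (ltW n0)) ler_pdivrMr //; lra.
have h2 := hk _ bN; rewrite -/om in h2.
have h3 : (k * `|b / N%:R|) ^+ 2 <= nm (1 - om) ^+ 2.
  by apply: lerXn2r => //; rewrite nnegrE ?nm_ge0 // mulr_ge0 // ltW.
have h4 : (k * `|b / N%:R|) ^+ 2 * nm (RN N b) <= 18 * B2 / N%:R ^+ 2 * 5.
  by apply: le_trans h; apply: ler_wpM2r => //; apply: nm_ge0.
have -> : b ^+ 2 * nm (RN N b) = (N%:R ^+ 2 / k ^+ 2) * ((k * `|b / N%:R|) ^+ 2 * nm (RN N b)).
  rewrite [(k * _) ^+ 2]exprMn real_normK ?num_real //; field.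
  by rewrite !lt0r_neq0.
have -> : K2 = (N%:R ^+ 2 / k ^+ 2) * (18 * B2 / N%:R ^+ 2 * 5).
  by rewrite /K2; field; rewrite !lt0r_neq0.
by apply: ler_wpM2l => //; rewrite divr_ge0 ?sqr_ge0.
Qed.

(** The frequencies [b - K, ..., b + K - 1] shift [b] by a complete residue system mod [N = 2K];
    summing the characters over it keeps exactly the sample points [m / N] that are integers. *)
Lemma discrete_poisson (K : nat) (b : R) : (0 < K)%N ->
  zsum (fun m => gau (lam * m%:~R) * ee (b * m%:~R)%:C) =
  \sum_(k < K) (RN (2 * K) (b + k%:R) + RN (2 * K) (b - k.+1%:R)).
Proof.
move=> K0; set N := (2 * K)%N; have N0 : (0 < N)%N by rewrite muln_gt0.
have n0 : (N%:R : C) != 0 by rewrite pnatr_eq0 -lt0n.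
have n0R : (N%:R : R) != 0 by rewrite pnatr_eq0 -lt0n.
pose G (m : int) := gau (lam * (xx N m)%:C) * ee (b * xx N m)%:C.
pose om (m : int) := ee (xx N m)%:C.
pose u (k : 'I_K) (m : int) := N%:R^-1 * (gau (lam * (xx N m)%:C) * ee ((b + k%:R) * xx N m)%:C)
   + N%:R^-1 * (gau (lam * (xx N m)%:C) * ee ((b - k.+1%:R) * xx N m)%:C).
have zu k : zasum (u k) by apply: zasumD; exact: RN_zasum.
transitivity (zsum (fun m => \sum_(k < K) u k m)); last first.
  rewrite zsum_sum //; apply: eq_bigr => k _; rewrite zsumD //; exact: RN_zasum.
have zG : zasum G.
  have := zasumZ N%:R (RN_zasum b N0); congr zasum; apply/funext => m.
  by rewrite mulrA divff // mul1r.
have om0 m : om m != 0 by exact: ee_neq0.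
have omN m : om m ^+ N = 1.
  rewrite eeX natC -rmorphM /=; have -> : N%:R * xx N m = m%:~R by rewrite /xx mulrC divfK.
  by rewrite -[RHS](ee_int R m) rmorph_int.
(* A geometric sum whose ends [om^K] and [om^-K] agree, since [om^(2K) = 1]. *)
have geo m : (om m - 1) * \sum_(k < K) (om m ^+ k + (om m ^+ k.+1)^-1) = 0.
  transitivity (om m ^+ K - (om m ^+ K)^-1).
    elim: (K) => [|k IH]; first by rewrite big_ord0 mulr0 expr0 invr1 subrr.
    rewrite big_ord_recr mulrDr IH /= !exprS; field; rewrite om0 expf_neq0 //.
  apply: (mulIf (expf_neq0 K (om0 m))); rewrite mul0r mulrBl mulVf ?expf_neq0 // -exprD addnn -mul2n.
  by rewrite -/N omN subrr.
have uE m : \sum_(k < K) u k m = N%:R^-1 * G m * \sum_(k < K) (om m ^+ k + (om m ^+ k.+1)^-1).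
  rewrite mulr_sumr; apply: eq_bigr => k _; rewrite /u /G.
  have -> : ee ((b + k%:R) * xx N m)%:C = ee (b * xx N m)%:C * om m ^+ k.
    by rewrite mulrDl rmorphD eeD eeX [_%:R * (xx N m)%:C]mulrC natC -rmorphM [xx N m * _]mulrC.
  have -> : ee ((b - k.+1%:R) * xx N m)%:C = ee (b * xx N m)%:C * (om m ^+ k.+1)^-1.
    by rewrite mulrBl rmorphB eeD eeX eeN [_%:R * (xx N m)%:C]mulrC natC -rmorphM [xx N m * _]mulrC.
  ring.
have mult m : \sum_(k < K) u k m = if (N%:Z %| m)%Z then G m else 0.
  rewrite uE; case: ifP => [/dvdzP[q ->]|ndiv].
    have -> : om (q * N%:Z) = 1.
      by rewrite /om /xx intrM -pmulrn mulfK // rmorph_int ee_int.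
    under eq_bigr do rewrite !expr1n invr1.
    have -> : \sum_(k < K) (1 + 1) = N%:R :> C by rewrite sumr_const card_ord -[1 + 1]/(1 *+ 2) -mulrnA.
    by rewrite mulrC mulrA divff // mul1r.
  have -> : \sum_(k < K) (om m ^+ k + (om m ^+ k.+1)^-1) = 0; last by rewrite mulr0.
  have /eqP := geo m; rewrite mulf_eq0 => /orP[|/eqP //].
  rewrite subr_eq0 => /eqP om1; exfalso.
  pose r := `|(m %% N%:Z)%Z|%N.
  have rE : r%:Z = (m %% N%:Z)%Z by rewrite /r gez0_abs // modz_ge0 // gt_eqF.
  have rN : (r < N)%N by rewrite -ltz_nat rE ltz_pmod.
  have r0 : (0 < r)%N.
    by rewrite lt0n; apply: contraFN ndiv => /eqP r0; apply/dvdz_mod0P; rewrite -rE r0.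
  have := @ee_root_unity N r; rewrite r0 rN => /(_ isT) /eqP; apply.
  have xE : xx N m = (m %/ N%:Z)%Z%:~R + r%:R / N%:R.
    by rewrite /xx {1}(divz_eq m N%:Z) -rE intrD intrM mulrDl -!pmulrn mulfK.
  rewrite -[RHS]om1 /om xE [(_ + _)%:C]rmorphD eeD rmorph_int ee_int mul1r.
  by congr ee; rewrite rmorphM fmorphV !rmorph_nat.
have -> : (fun m => \sum_(k < K) u k m) = (fun m => if (N%:Z %| m)%Z then G m else 0) by apply/funext.
rewrite zsum_multiples //; apply: eq_zsum => m.
have xN : xx N (N%:Z * m) = m%:~R by rewrite /xx intrM -pmulrn mulrC mulKf.
by rewrite /G xN (rmorph_int (real_complex R)).
Qed.

Lemma gauE (m b : R) : gau (lam * m%:C) * ee (b * m)%:C = ee (b * m)%:C * ee ((m ^+ 2)%:C / 2%:R * t).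
Proof.
rewrite mulrC; congr (_ * _); rewrite /gau; congr ee.
transitivity (- ('i%C ^+ 2) * ((m%:C) ^+ 2 / 2%:R * t)); first by rewrite exprMn lam2; ring.
by rewrite sqr_i opprK mul1r rmorphXn.
Qed.

Lemma ee_gauss_wgt : exists2 B : R, 0 <= B & forall b : R, nm (ee (- (b ^+ 2)%:C / (2%:R * t))) <= B * wgt b.
Proof.
have t0 := upper_neq0 ut.
pose w := - t^-1; have w0 : 0 < imC w.
  rewrite /w; case: (t) ut => x y; rewrite /upper /= => y0.
  by rewrite opprK divr_gt0 // ltr_pwDr ?sqr_ge0 // exprn_gt0.
have [B B0 hB] := envelope 0 0 (mulr_gt0 (@pi_gt0 R) w0) (lexx 0).
exists B => // b; apply: le_trans (hB b); rewrite expr0 mul1r nm_ee ler_expR.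
have -> : - (b ^+ 2)%:C / (2%:R * t) = (b ^+ 2 / 2)%:C * w.
  by rewrite /w [(b ^+ 2 / 2)%:C]rmorphM fmorphV rmorph_nat; field.
by rewrite imCMr; lra.
Qed.

(** Each frequency term tends to its transform and is dominated by a multiple of [wgt k], so the
    finite identity passes to the limit. The factor [sR] stays because its limit is not yet
    known. *)
Lemma poisson_limit (b : R) : 0 <= b <= 1 / 2 ->
  zasum (fun m : int => ee (- ((m%:~R + b) ^+ 2)%:C / (2%:R * t))) /\
  cvc (fun K => zsum (fun m => gau (lam * m%:~R) * ee (b * m%:~R)%:C) -
    lam^-1 * sR (2 * K) * \sum_(k < K) (ee (- ((k%:~R + b) ^+ 2)%:C / (2%:R * t)) + ee (- (((Negz k)%:~R + b) ^+ 2)%:C / (2%:R * t)))) 0.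
Proof.
move=> /andP[b0 b1].
pose E (x : R) := ee (- (x ^+ 2)%:C / (2%:R * t)).
have [B B0 hE] := ee_gauss_wgt.
have [K1 K10 hR] := RN_bound.
have [B2 B20 hS'] := riemann_limit 0; have [B3 B30 hz] := gau_zasum 0.
pose B4 := nm lam * B3 + B2.
have B40 : 0 <= B4 by rewrite addr_ge0 ?mulr_ge0 ?nm_ge0.
have hS N : (0 < N)%N -> nm (sR N) <= B4.
  move=> N0; have h1 := hS' N N0; have [_ h2] := hz N N0.
  set z := zsum _ in h1 h2; have -> : sR N = lam * z - (lam * z - sR N) by ring.
  apply: le_trans (nmB _ _) _; rewrite nmM; apply: lerD; first by apply: ler_wpM2l => //; apply: nm_ge0.
  apply: le_trans h1 _; rewrite ler_piMr // invf_le1 ?ler1n // ltr0n //.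
have wk (x : R) k : k%:R <= `|x| -> wgt x <= wgt k%:R.
  move=> h; rewrite /wgt lef_pV2 ?posrE ?wgt_pos // lerD2l -[x ^+ 2]real_normK ?num_real //.
  by apply: lerXn2r; rewrite ?nnegrE.
have pP (k : nat) : k%:R <= `|k%:R + b| by rewrite ger0_norm ?addr_ge0 // lerDl.
have pN (k : nat) : k%:R <= `|b - k.+1%:R|.
  rewrite ler0_norm; last by rewrite -[k.+1]addn1 natrD; have : 0 <= k%:R :> R by []; lra.
  by rewrite -[k.+1]addn1 natrD; lra.
have mP (k : nat) : (k%:~R + b : R) = k%:R + b by rewrite -pmulrn.
have mN (k : nat) : ((Negz k)%:~R + b : R) = b - k.+1%:R by rewrite NegzE mulrNz -pmulrn addrC.
have bw : bdd (fun k : nat => wgt (k%:R : R)).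
  exists 5 => L; apply: le_trans (@riemann_weight R 1 L isT); apply: ler_sum => k _.
  by rewrite invr1 !mulr1 mul1r lerDl wgt_ge0.
split.
  split; apply: bdd_le (bddZ B0 bw) => k.
    by rewrite mP; apply: le_trans (hE _) _; rewrite ler_wpM2l // wk.
  by rewrite mN; apply: le_trans (hE _) _; rewrite ler_wpM2l // wk.
pose T K x := RN (2 * K) x - lam^-1 * E x * sR (2 * K).
pose A K k := T K (b + k%:R) + T K (b - k.+1%:R).
pose BB := 2 * (K1 + nm lam^-1 * B * B4).
have TB K x k : (k < K)%N -> `|x| <= (2 * K)%:R / 2 -> k%:R <= `|x| -> nm (T K x) <= (K1 + nm lam^-1 * B * B4) * wgt k%:R.
  move=> kK hx kx; have N0 : (0 < 2 * K)%N by rewrite muln_gt0 /= (leq_trans _ kK).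
  apply: (@le_trans _ _ ((K1 + nm lam^-1 * B * B4) * wgt x)); last first.
    by apply: ler_wpM2l; rewrite ?wk // addr_ge0 // !mulr_ge0 // nm_ge0.
  apply: le_trans (nmB _ _) _; rewrite mulrDl; apply: lerD.
    by rewrite /wgt ler_pdivlMr ?wgt_pos // mulrC; apply: hR.
  rewrite [nm (_ * _ * sR _)]nmM [nm (_ * E x)]nmM.
  have -> : nm lam^-1 * B * B4 * wgt x = nm lam^-1 * (B * wgt x) * B4 by ring.
  apply: ler_pM; rewrite ?mulr_ge0 ?nm_ge0 ?hS //.
  by apply: ler_wpM2l; [exact: nm_ge0|exact: hE].
have lim : cvc (fun K => \sum_(k < K) A K k) (csum (fun _ => 0)).
  apply: (@tannery_fin _ A (fun k => BB * wgt k%:R) (fun _ => 0) id).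
  - by move=> m; exists m.
  - move=> K k kK; apply: le_trans (nmD _ _) _; rewrite /BB -mulrA mulr_natl mulr2n.
    have kr : k.+1%:R <= K%:R :> R by rewrite ler_nat.
    have kk : k.+1%:R = k%:R + 1 :> R by rewrite -addn1 natrD.
    have k0 : 0 <= k%:R :> R by [].
    have NK : (2 * K)%:R / 2 = K%:R :> R by rewrite natrM mulrAC divff ?mul1r // pnatr_eq0.
    by apply: lerD; apply: TB; rewrite ?NK //; [rewrite ger0_norm; lra|rewrite addrC|rewrite ler0_norm; lra].
  - by move=> k; rewrite !mulr_ge0 ?wgt_ge0 // addr_ge0 // !mulr_ge0 ?nm_ge0.
  - by apply: bddZ => //; rewrite !mulr_ge0 // addr_ge0 // !mulr_ge0 ?nm_ge0.
  have T0 x : cvc (fun K => T K x) 0.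
    have [B5 B50 h5] := RN_limit x.
    apply: (@cvc_null_ev _ _ _ (fun K => B5 * K.-1.+1%:R^-1) 1).
      case=> // K _; rewrite subr0; apply: le_trans (h5 _ _) _; rewrite ?muln_gt0 //.
      by apply: ler_wpM2l => //; rewrite lef_pV2 ?posrE ?ltr0n ?muln_gt0 // ler_nat; lia.
    apply: nullZ => // [n|]; first by rewrite invr_ge0.
    by move=> e /(@null_inv R)[N0 h]; exists N0.+1 => -[//|n] /h.
  by move=> k; rewrite -[0]addr0; apply: cvcD.
rewrite (@csum_finite _ _ 0) // big_ord0 in lim.
apply: (@cvc_ext _ _ _ _ 1) lim => -[//|K] _.
rewrite (@discrete_poisson K.+1 b) // mulr_sumr -sumrB; apply: eq_bigr => k _.
by rewrite /A /T mP mN [k%:R + b]addrC /E; ring.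
Qed.

End Fixed.

(** The root with non-negative real part is taken; [Re (lam^2) = Im t > 0] then gives the sector
    condition. *)
Lemma lam_exists (t : C) : upper t -> exists2 lam : C, lam ^+ 2 = - 'i%C * t & `|imC lam| < reC lam.
Proof.
move=> ut; set z := - 'i%C * t; have s2 := sqr_sqrtc z.
have rz : 0 < reC z by rewrite /z mulNr reCN reCM /= mul0r mul1r sub0r opprK.
pose l := sqrtc z; have l2 : l ^+ 2 = z by exact: s2.
pose l' := if 0 <= reC l then l else - l.
have l'2 : l' ^+ 2 = z by rewrite /l'; case: ifP => _; rewrite ?sqrrN.
have r0 : 0 <= reC l'.
  by rewrite /l'; case: ifP => // /negbT; rewrite -ltNge reCN oppr_ge0 => /ltW.
exists l' => //; move: rz; rewrite -l'2 expr2 reCM => h.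
rewrite -(ger0_norm r0) -ltr_sqr ?nnegrE // !real_normK ?num_real //; rewrite !expr2; lra.
Qed.

Definition thetaB (b : R) (t : C) : C := zsum (fun m => ee (b * m%:~R)%:C * ee ((m%:~R ^+ 2)%:C / 2%:R * t)).
Definition thetaS (b : R) (t : C) : C := zsum (fun m => ee (((m%:~R + b) ^+ 2)%:C / 2%:R * t)).

(** Normalization at [t = i], [lam = 1], [b = 0]: both theta sums are then the same number [P], of
    real part at least 1, which forces [sR (2K)] to tend to 1. *)
Lemma theta_inversion (t : C) : upper t -> exists2 lam : C, lam ^+ 2 = - 'i%C * t &
  0 < reC lam /\ forall b : R, 0 <= b <= 1 / 2 -> thetaS b (- t^-1) = lam * thetaB b t.
Proof.
have gen (s l : C) (us : upper s) (l2 : l ^+ 2 = - 'i%C * s) (ls : `|imC l| < reC l) (b : R) : 0 <= b <= 1 / 2 ->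
   cvc (fun K => sR (2 * K)) (1 : C) -> thetaS b (- s^-1) = l * thetaB b s.
  move=> hb hs; have [z lim] := poisson_limit us l2 ls hb.
  have s0 := upper_neq0 us; have l0 := lam_neq0 ls.
  have h := cvcM hs (zsum_cvc z).
  have E : zsum (fun m : int => ee (- ((m%:~R + b) ^+ 2)%:C / (2%:R * s))) = thetaS b (- s^-1).
    by apply: eq_zsum => m; congr ee; field.
  rewrite E mul1r in h.
  have h' := cvcZ l^-1 h.
  have Z : zsum (fun m => gau (l * m%:~R) * ee (b * m%:~R)%:C) = thetaB b s.
    by apply: eq_zsum => m; rewrite -(rmorph_int (real_complex R)) (gauE l2).
  rewrite Z in lim.
  have := cvcD lim h'; rewrite add0r => lim2.
  have -> : thetaB b s = l^-1 * thetaS b (- s^-1).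
    apply: cvc_unique lim2; apply: cvc_eq (cvc_cst _) => K; ring.
  by rewrite mulVKf.
have ui : upper ('i%C : C) by rewrite /upper /= ltr01.
have l1 : (1 : C) ^+ 2 = - 'i%C * 'i%C by rewrite expr1n mulNr -expr2 sqr_i opprK.
have s1 : `|imC (1 : C)| < reC (1 : C) by rewrite /= normr0 ltr01.
have hS : cvc (fun K => sR (2 * K)) (1 : C).
  have hb : 0 <= (0 : R) <= 1 / 2 by rewrite lexx divr_ge0.
  have [z lim] := poisson_limit ui l1 s1 hb.
  set P := zsum _ in lim.
  pose u (m : int) : C := ee (- ((m%:~R + 0) ^+ 2)%:C / (2%:R * 'i%C)).
  have i0 := iC_neq0 R.
  have ii : ('i%C : C) ^+ 2 = -1 by exact: sqr_i.
  have iV : ('i%C : C)^-1 = - 'i%C by apply: (mulIf i0); rewrite mulVf // mulNr -expr2 ii opprK.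
  have uE m : u m = (expR (- pi * m%:~R ^+ 2))%:C.
    have -> : u m = ee ((m%:~R ^+ 2 / 2)%:C * 'i%C).
      by rewrite /u addr0; congr ee; rewrite invfM iV [(_ / 2)%:C]rmorphM fmorphV rmorph_nat; ring.
    by rewrite ee_imag; congr (expR _)%:C; field.
  have PE : P = zsum u.
    apply: eq_zsum => m; rewrite mul1r mul0r ee0 mulr1 /gau /u addr0; congr ee.
    by rewrite invfM iV rmorphXn rmorph_int; ring.
  have P0 : P != 0.
    suff : 1 <= reC P by move=> h; apply: contraTneq h => ->; rewrite -ltNge ltr01.
    rewrite leNgt; apply/negP => lt; have e0 : 0 < 1 - reC P by lra.
    have [L0 hL] := zsum_cvc z e0; have := hL L0.+1 (leqnSn _).
    rewrite -/(zsum u) -PE => h; have := reC_le (\sum_(j < L0.+1) (u j + u (Negz j)) - P).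
    have : 1 <= reC (\sum_(j < L0.+1) (u j + u (Negz j))).
      have uR j : reC (u (Posz j) + u (Negz j)) = expR (- pi * (Posz j)%:~R ^+ 2) + expR (- pi * (Negz j)%:~R ^+ 2).
        by rewrite reCD !uE.
      rewrite reC_sum; under eq_bigr do rewrite uR.
      rewrite big_ord_recl.
      have -> : expR (- pi * (Posz (@ord0 L0))%:~R ^+ 2) = 1 :> R by rewrite expr2 mul0r mulr0 expR0.
      rewrite -addrA lerDl addr_ge0 ?expR_ge0 //.
      by apply: sumr_ge0 => i _; rewrite addr_ge0 ?expR_ge0.
    by rewrite reCB => h1 h2; have := ler_norm (reC (\sum_(j < L0.+1) (u j + u (Negz j))) - reC P); lra.
  have hP := zsum_cvc z; rewrite -/(zsum u) -PE in hP.
  have h := cvcM (cvcV P0 hP) (cvcB (cvc_cst P) lim).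
  rewrite subr0 mulVf // in h.
  have nz : exists K0, forall K, (K0 <= K)%N -> \sum_(j < K) (u j + u (Negz j)) != 0.
    have p2 : 0 < nm P / 2 by rewrite divr_gt0 // nm_gt0.
    have [K0 hK] := hP _ p2; exists K0 => K /hK h'.
    rewrite -nm_gt0; have := nm_dist P (\sum_(j < K) (u j + u (Negz j))); rewrite nmC.
    have : 0 < nm P by rewrite nm_gt0.
    rewrite /u in h' *; lra.
  have [K0 hK0] := nz.
  apply: (@cvc_ext _ _ _ _ K0) h => K /hK0 n0.
  by rewrite invr1 mul1r opprD opprK addrA subrr add0r mulrCA mulVf // mulr1.
move=> ut; have [lam l2 ls] := lam_exists ut; exists lam => //; split.
  by apply: le_lt_trans ls.
by move=> b hb; apply: gen.
Qed.

End Poisson.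

(** * Exponential generating series indexed by words, and cumulants *)

Section Shuffle.
Variable K : comNzRingType.
Implicit Types (F G H : seq nat -> K).

(** The letters of [ks] are distributed in all ways between [F] and [G]: the Leibniz rule for a
    mixed derivative of a product. *)
Fixpoint shc (ks : seq nat) F G : K :=
  if ks is k :: ks' then shc ks' (fun a => F (k :: a)) G + shc ks' F (fun b => G (k :: b))
  else F [::] * G [::].

Lemma eq_shc ks F F' G G' : F =1 F' -> G =1 G' -> shc ks F G = shc ks F' G'.
Proof. by move=> h1 h2; congr shc; apply/funext. Qed.

Lemma shcC ks F G : shc ks F G = shc ks G F.
Proof.
elim: ks F G => [|k ks IH] F G /=; first by rewrite mulrC.
by rewrite addrC; congr (_ + _); exact: IH.
Qed.

Lemma shcDl ks F F' G : shc ks (fun a => F a + F' a) G = shc ks F G + shc ks F' G.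
Proof.
elim: ks F F' G => [|k ks IH] F F' G /=; first by rewrite mulrDl.
by rewrite (IH (fun a => F (k :: a))) IH addrACA.
Qed.

Lemma shcZl ks c F G : shc ks (fun a => c * F a) G = c * shc ks F G.
Proof.
elim: ks F G => [|k ks IH] F G /=; first by rewrite mulrA.
by rewrite (IH (fun a => F (k :: a))) IH mulrDr.
Qed.

Lemma shcDr ks F G G' : shc ks F (fun a => G a + G' a) = shc ks F G + shc ks F G'.
Proof. by rewrite shcC shcDl !(shcC _ _ F). Qed.

Lemma shcZr ks c F G : shc ks F (fun a => c * G a) = c * shc ks F G.
Proof. by rewrite shcC shcZl (shcC _ _ F). Qed.

Lemma shcA ks F G H : shc ks (fun a => shc a F G) H = shc ks F (fun b => shc b G H).
Proof.
elim: ks F G H => [|k ks IH] F G H /=; first by rewrite mulrA.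
by rewrite shcDl shcDr !IH addrA.
Qed.

(** The coefficients of [exp(sum_k x_k tau_k)]; [del0] is the unit series. *)
Definition mon (x : nat -> K) (ks : seq nat) : K := \prod_(k <- ks) x k.
Definition del0 (ks : seq nat) : K := (ks == [::])%:R.

Lemma mon_nil (x : nat -> K) : mon x [::] = 1. Proof. by rewrite /mon big_nil. Qed.
Lemma mon_cons (x : nat -> K) k ks : mon x (k :: ks) = x k * mon x ks. Proof. by rewrite /mon big_cons. Qed.

Lemma shc_mon (x y : nat -> K) ks : shc ks (mon x) (mon y) = mon (fun k => x k + y k) ks.
Proof.
elim: ks => [|k ks IH] /=; first by rewrite !mon_nil mulr1.
rewrite mon_cons (@eq_shc ks _ (fun a => x k * mon x a) _ (mon y) (mon_cons x k)) //.
rewrite (@eq_shc ks (mon x) (mon x) (fun b => mon y (k :: b)) (fun b => y k * mon y b)) //; last exact: mon_cons.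
by rewrite shcZl shcZr IH mulrDl.
Qed.

Lemma shc_del0 ks G : shc ks del0 G = G ks.
Proof.
elim: ks G => [|k ks IH] G /=; first by rewrite /del0 eqxx mul1r.
rewrite IH (@eq_shc _ _ (fun a => 0 * del0 a) _ G) // ?shcZl ?mul0r ?add0r //.
by move=> a; rewrite mul0r.
Qed.

(* [c n] is the cumulant of order [n+1] of the two-point measure with weights 1 (at 0) and [w] (at 1). *)
Definition cumul (w : K) (c : nat -> K) : Prop :=
  forall n, c n + w * \sum_(j < n.+1) 'C(n, j)%:R * c j = w.

(** Apart from the factor [mon y ks] only the number of letters matters, and Pascal's rule produces
    the binomials. The shift [m] makes the induction go through. *)
Lemma shc_cum (y c : nat -> K) m ks :
  shc ks (fun a => mon y a * c (size a + m)%N) (mon y) =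
  mon y ks * \sum_(j < (size ks).+1) 'C(size ks, j)%:R * c (j + m)%N.
Proof.
elim: ks m => [|k ks IH] m /=.
  by rewrite !mon_nil !mul1r mulr1 big_ord_recl big_ord0 bin0 mul1r addr0.
rewrite (@eq_shc _ _ (fun a => y k * (mon y a * c (size a + m.+1)%N)) _ (mon y)) //; last first.
  by move=> a; rewrite mon_cons /= addSnnS mulrA.
rewrite (@eq_shc _ (fun a => mon y a * c (size a + m)%N) (fun a => mon y a * c (size a + m)%N) (fun b => mon y (k :: b)) (fun b => y k * mon y b)) //; last first.
  by move=> b; rewrite mon_cons.
rewrite shcZl shcZr !IH mon_cons -!mulrA -mulrDr -mulrDr; congr (_ * (_ * _)).
set n := size ks; rewrite [RHS]big_ord_recl bin0 /=.
under [X in _ = _ + X]eq_bigr => i _ do rewrite /bump /= add1n binS natrD mulrDl.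
rewrite big_split /= addrA [RHS]addrC; congr (_ + _).
  by apply: eq_bigr => i _; rewrite addSnnS.
rewrite big_ord_recl bin0 /= [in RHS]big_ord_recr /= bin_small // mul0r addr0; congr (_ + _).
Qed.

(** The [tau_k]-derivative of [1 + w exp(sum_j y_j tau_j)] is its logarithmic derivative times
    itself. *)
Lemma cumul_factor (w : K) c (y : nat -> K) : cumul w c -> forall k ks,
  del0 (k :: ks) + w * mon y (k :: ks) =
  shc ks (fun a => y k * (mon y a * c (size a))) (fun b => del0 b + w * mon y b).
Proof.
move=> hc k ks; rewrite /del0 add0r shcDr shcZr (shcC _ _ (fun b => _)) shc_del0 shcZl.
have := shc_cum y c 0 ks; rewrite (@eq_shc _ _ (fun a => mon y a * c (size a)) _ (mon y)) //; last first.
  by move=> a; rewrite addn0.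
move=> ->; under eq_bigr do rewrite addn0.
rewrite mon_cons -{1}(hc (size ks)); ring.
Qed.

Section FermionSum.
Variable I : Type.

(** Each [i] in [r] is either left out or adds [y i] to the state: a sum over the fermion states
    generated from [x0]. *)
Fixpoint fsum (T : nmodType) (V : zmodType) (y : I -> nat -> V) (r : seq I) (x0 : nat -> V) (F : (nat -> V) -> T) : T :=
  if r is i :: r' then fsum y r' x0 F + fsum y r' (fun k => x0 k + y i k) F else F x0.

Variable (chi : (nat -> K) -> K).
Hypothesis chiD : forall x y, chi (fun k => x k + y k) = chi x * chi y.

Definition Zst (y : I -> nat -> K) r (x0 : nat -> K) ks := fsum y r x0 (fun x => chi x * mon x ks).

Lemma Zst_shift (y : I -> nat -> K) r x0 z ks :
  Zst y r (fun k => x0 k + z k) ks = chi z * shc ks (mon z) (Zst y r x0).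
Proof.
rewrite /Zst; elim: r x0 => [|i r IH] x0 /=.
  by rewrite chiD shcZr shc_mon mulrA [chi z * _]mulrC; congr (_ * mon _ _); apply/funext => k; rewrite addrC.
rewrite IH shcDr mulrDr; congr (_ + _); rewrite -IH; congr fsum.
by apply/funext => k; rewrite addrAC.
Qed.

Lemma Zst_cons (y : I -> nat -> K) i r x0 ks :
  Zst y (i :: r) x0 ks = shc ks (fun a => del0 a + chi (y i) * mon (y i) a) (Zst y r x0).
Proof. by rewrite shcDl shc_del0 shcZl -Zst_shift. Qed.

(** Coefficients of the [tau_k]-derivative of the logarithm of the product: the linear part from
    [x0] plus the cumulants of the independent factors. *)
Definition Lcum (y : I -> nat -> K) (c : I -> nat -> K) r (x0 : nat -> K) k (ks : seq nat) : K :=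
  x0 k * del0 ks + \sum_(i <- r) y i k * (mon (y i) ks * c i (size ks)).

(** [Z' = (log Z)' Z], expanded by Leibniz. The induction adds one factor at a time through
    associativity of [shc]. *)
Lemma Zst_rec (y : I -> nat -> K) (c : I -> nat -> K) r x0 : (forall i, cumul (chi (y i)) (c i)) -> forall k ks,
  Zst y r x0 (k :: ks) = shc ks (Lcum y c r x0 k) (Zst y r x0).
Proof.
move=> hc k; elim: r => [|i r IH] ks.
  rewrite (@eq_shc _ _ (fun a => x0 k * del0 a) _ (Zst y [::] x0)) //; last first.
    by move=> a; rewrite /Lcum big_nil addr0.
  by rewrite shcZl shc_del0 /Zst /= mon_cons mulrCA.
rewrite Zst_cons /=.
rewrite (eq_shc _ (cumul_factor (y i) (hc i) k) (fun _ => erefl)) (eq_shc _ (fun _ => erefl) IH).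
set f := fun b => _ + chi (y i) * _; set Zr := Zst y r x0.
rewrite (@eq_shc ks (Lcum y c (i :: r) x0 k) (fun a => Lcum y c r x0 k a + y i k * (mon (y i) a * c i (size a))) _ (fun b => shc b f Zr)); last first.
- by move=> a; rewrite Zst_cons.
- by move=> a; rewrite /Lcum big_cons addrCA addrC.
rewrite shcDl addrC; congr (_ + _).
  rewrite -shcA -shcA; apply: eq_shc => // a; exact: shcC.
by rewrite shcA.
Qed.

End FermionSum.
End Shuffle.

(** * Sums over fermion states as sums over subsets *)

Section FermionSets.
Variables (T : nmodType) (V : zmodType).

(** Particle-hole duality: start from the fully occupied state and record removals. *)
Lemma fsum_flip (I : Type) (y : I -> nat -> V) r x0 (F : (nat -> V) -> T) :
  fsum y r x0 F = fsum (fun i k => - y i k) r (fun k => x0 k + \sum_(i <- r) y i k) F.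
Proof.
elim: r x0 => [|i r IH] x0 /=.
  by congr F; apply/funext => k; rewrite big_nil addr0.
rewrite !IH addrC; congr (_ + _); congr fsum; apply/funext => k; rewrite big_cons; first by rewrite addrA.
by rewrite (addrC (y i k)) !addrA addrK.
Qed.

Lemma fsum_cat (I : Type) (y : I -> nat -> V) r1 r2 x0 (F : (nat -> V) -> T) :
  fsum y (r1 ++ r2) x0 F = fsum y r1 x0 (fun x => fsum y r2 x F).
Proof. by elim: r1 x0 => [|i r IH] x0 //=; rewrite !IH. Qed.

Lemma fsum_ext (I : Type) (y y' : I -> nat -> V) r x0 (F F' : (nat -> V) -> T) :
  (forall i k, y i k = y' i k) -> (forall x, F x = F' x) -> fsum y r x0 F = fsum y' r x0 F'.
Proof.
move=> h1 h2; have -> : y = y' by apply/funext => i; apply/funext => k.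
by have -> : F = F' by apply/funext.
Qed.

Lemma fsum_map (I J : Type) (g : J -> I) (y : I -> nat -> V) r x0 (F : (nat -> V) -> T) :
  fsum y (map g r) x0 F = fsum (fun j => y (g j)) r x0 F.
Proof. by elim: r x0 => [|j r IH] x0 //=; rewrite !IH. Qed.

Lemma fsum_sets (I : finType) (y : I -> nat -> V) r x0 (F : (nat -> V) -> T) : uniq r ->
  fsum y r x0 F = \sum_(X : {set I} | X \subset [set i in r]) F (fun k => x0 k + \sum_(i in X) y i k).
Proof.
elim: r x0 => [|i r IH] x0 /=.
  move=> _; rewrite (big_pred1 finset.set0) => [|X].
    by congr F; apply/funext => k; rewrite finset.big_set0 addr0.
  have -> : [set i in [::]] = finset.set0 :> {set I} by apply/finset.setP => j; rewrite !inE.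
  by rewrite finset.subset0.
move=> /andP[ir ur]; rewrite !IH // [RHS](bigID (fun X : {set I} => i \in X)) /= addrC; congr (_ + _).
  rewrite [RHS](reindex_onto (fun X => i |: X) (fun X => X :\ i)) => [|X /andP[_ iX]]; last by rewrite finset.setD1K.
  apply: eq_big => X.
    apply/idP/idP => [sX|/andP[/andP[sX _] /eqP eX]].
      have iX : i \notin X by apply: contra ir => iX; have := fintype.subsetP sX i iX; rewrite inE.
      rewrite finset.setU11 andbT finset.setU1K // eqxx andbT finset.subUset finset.sub1set !inE eqxx /=.
      by apply/fintype.subsetP => j /(fintype.subsetP sX); rewrite !inE => ->; rewrite orbT.
    apply/fintype.subsetP => j jX; have : j \in (i |: X) :\ i by rewrite eX.
    rewrite finset.in_setD1 => /andP[ji _]; have := fintype.subsetP sX j; rewrite !inE jX orbT => /(_ isT).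
    by rewrite (negPf ji).
  move=> sX; have iX : i \notin X by apply: contra ir => iX; have := fintype.subsetP sX i iX; rewrite inE.
  by congr F; apply/funext => k; rewrite finset.big_setU1 //= addrA.
apply: eq_bigl => X; apply/idP/idP => [sX|/andP[sX iX]].
  rewrite (contra _ ir) ?andbT; last by move=> iX; have := fintype.subsetP sX i iX; rewrite inE.
  by apply/fintype.subsetP => j /(fintype.subsetP sX); rewrite !inE => ->; rewrite orbT.
apply/fintype.subsetP => j jX; have := fintype.subsetP sX j jX; rewrite !inE => /orP[/eqP ji|//].
by rewrite -ji jX in iX.
Qed.

End FermionSets.

(** * Partitions in a box and subsets of an interval *)

Definition part (M : nat) (l : {ffun 'I_M -> 'I_M.+1}) (i : nat) : nat :=
  oapp (fun j => l j : nat) 0%N (insub i).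

Lemma part_ord M (l : {ffun 'I_M -> 'I_M.+1}) (i : 'I_M) : part l i = l i.
Proof. by rewrite /part valK. Qed.

Lemma part_out M (l : {ffun 'I_M -> 'I_M.+1}) i : (M <= i)%N -> part l i = 0%N.
Proof. by move=> h; rewrite /part insubF //= ltnNge h. Qed.

Lemma part_anti M (l : {ffun 'I_M -> 'I_M.+1}) i j : is_partition l ->
  (i <= j)%N -> (part l j <= part l i)%N.
Proof.
move=> /andP[_ /forallP h] ij; have [jM|jM] := ltnP j M; last by rewrite part_out.
have iM := leq_ltn_trans ij jM.
have := h (Ordinal iM) => /forallP/(_ (Ordinal jM)) /implyP /(_ ij).
by rewrite -!part_ord.
Qed.

Lemma part_sum M (l : {ffun 'I_M -> 'I_M.+1}) : is_partition l -> (\sum_(i < M) part l i = M)%N.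
Proof. by move=> /andP[/eqP h _]; rewrite -[RHS]h; apply: eq_bigr => i _; rewrite part_ord. Qed.

Lemma sum_trunc (T : nmodType) (f : nat -> T) a b :
  (forall i, (a <= i)%N -> f i = 0) -> (forall i, (b <= i)%N -> f i = 0) ->
  \sum_(i < a) f i = \sum_(i < b) f i.
Proof.
have H m n : (m <= n)%N -> (forall i, (m <= i)%N -> f i = 0) -> \sum_(i < m) f i = \sum_(i < n) f i.
  move=> mn h; rewrite -!(big_mkord xpredT f) (big_cat_nat (leq0n m) mn) /=.
  by rewrite [X in _ = _ + X]big_nat_cond [X in _ = _ + X]big1 ?addr0 // => i /andP[/andP[/h]].
by move=> ha hb; have [ab|ba] := leqP a b; [exact: H | rewrite (H b a) // ltnW].
Qed.

Lemma sorted_enum_ord n (X : {set 'I_n}) : sorted ltn (map val (enum X)).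
Proof.
apply: (subseq_sorted ltn_trans _ (iota_ltn_sorted 0 n)); rewrite -val_enum_ord.
by apply: map_subseq; rewrite [enum 'I_n]enumT; exact: filter_subseq.
Qed.

Section Beta.
Variables (n l0 : nat).
Hypothesis l0n : (l0 <= n)%N.

Definition inbox M (l : {ffun 'I_M -> 'I_M.+1}) : bool :=
  [forall i : 'I_M, ((l0 <= i)%N ==> (l i == 0%N :> nat)) && (l i <= n - l0)%N].

(** The beta-numbers [lambda_i + l0 - 1 - i], listed in increasing order through
    [j = l0 - 1 - i]. *)
Definition bseq M (l : {ffun 'I_M -> 'I_M.+1}) : seq nat :=
  mkseq (fun j => part l (l0.-1 - j) + j)%N l0.

Definition beta M (l : {ffun 'I_M -> 'I_M.+1}) : {set 'I_n} := [set a : 'I_n | val a \in bseq l].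

Lemma inbox_part M (l : {ffun 'I_M -> 'I_M.+1}) i : inbox l ->
  ((l0 <= i)%N -> part l i = 0%N) /\ (part l i <= n - l0)%N.
Proof.
move=> /forallP h; have [iM|iM] := ltnP i M; last by rewrite part_out.
have := h (Ordinal iM); rewrite -part_ord /= => /andP[/implyP h1 h2]; split => // /h1.
by move/eqP.
Qed.

Lemma bseq_sorted M (l : {ffun 'I_M -> 'I_M.+1}) : is_partition l -> sorted ltn (bseq l).
Proof.
move=> hl; apply/(sortedP 0%N) => i; rewrite size_mkseq => hi.
rewrite !nth_mkseq //; last exact: ltnW.
by rewrite /= addnS ltnS leq_add2r; apply: part_anti => //; exact: leq_sub2l.
Qed.

Lemma bseq_lt M (l : {ffun 'I_M -> 'I_M.+1}) : inbox l -> forall x, x \in bseq l -> (x < n)%N.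
Proof.
move=> hl x /mapP[j]; rewrite mem_iota /= add0n => hj ->.
have [_ h] := inbox_part (l0.-1 - j) hl; lia.
Qed.

Lemma enum_beta M (l : {ffun 'I_M -> 'I_M.+1}) : is_partition l -> inbox l ->
  map val (enum (beta l)) = bseq l.
Proof.
move=> h1 h2; apply: (irr_sorted_eq ltn_trans ltnn _ (bseq_sorted h1)).
  exact: sorted_enum_ord.
move=> x; apply/mapP/idP => [[a]|hx].
  by rewrite mem_enum inE => h ->.
by exists (Ordinal (bseq_lt h2 hx)); rewrite // mem_enum inE.
Qed.

Lemma big_beta (T : nmodType) M (l : {ffun 'I_M -> 'I_M.+1}) (F : nat -> T) :
  is_partition l -> inbox l ->
  \sum_(a in beta l) F a = \sum_(i < l0) F (part l i + (l0.-1 - i))%N.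
Proof.
move=> h1 h2; rewrite -big_enum /= -(big_map val xpredT F) enum_beta //.
rewrite /bseq /mkseq big_map -{1}(subn0 l0) -/(index_iota 0 l0) big_mkord (reindex_inj rev_ord_inj) /=.
by apply: eq_bigr => i _; congr F; case: i => i /= hi; congr (part l _ + _)%N; lia.
Qed.

Lemma card_beta M (l : {ffun 'I_M -> 'I_M.+1}) : is_partition l -> inbox l -> #|beta l| = l0.
Proof. by move=> h1 h2; rewrite cardE -(size_map val) enum_beta // size_mkseq. Qed.

Lemma sum_rev_ord (k : nat) : (\sum_(i < k) (k.-1 - i) = 'C(k, 2))%N.
Proof.
rewrite -bin2_sum big_mkord (reindex_inj rev_ord_inj) /=.
by apply: eq_bigr => i _; case: i => i /= hi; lia.
Qed.

Lemma part_sum_box M (l : {ffun 'I_M -> 'I_M.+1}) : is_partition l -> inbox l ->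
  (\sum_(i < l0) part l i = M)%N.
Proof.
move=> h1 h2; rewrite -[RHS](part_sum h1).
by apply: (@sum_trunc nat (part l)) => i hi; [apply: (inbox_part i h2).1 | exact: part_out].
Qed.

Lemma sum_beta M (l : {ffun 'I_M -> 'I_M.+1}) : is_partition l -> inbox l ->
  (\sum_(a in beta l) (a : nat) = M + 'C(l0, 2))%N.
Proof.
move=> h1 h2; rewrite (@big_beta nat M l id h1 h2) big_split /= sum_rev_ord.
by rewrite part_sum_box.
Qed.

Section Inverse.
Variable X : {set 'I_n}.
Hypothesis cX : #|X| = l0.
Let s := map val (enum X).

(** Inverse of the beta-numbers: an element of [X] minus its rank, that is the number of smaller
    integers missing from [X]. *)
Definition gap (i : nat) : nat := if (i < l0)%N then (nth 0%N s (l0.-1 - i) - (l0.-1 - i))%N else 0%N.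

Lemma enumX_size : size s = l0. Proof. by rewrite size_map -cardE. Qed.

Lemma enumX_sorted : sorted ltn s. Proof. exact: sorted_enum_ord. Qed.

Lemma enumX_step j d : (j + d < l0)%N -> (nth 0%N s j + d <= nth 0%N s (j + d))%N.
Proof.
elim: d => [|d IH] h; first by rewrite !addn0.
have /(sortedP 0%N) /(_ (j + d)%N) := enumX_sorted; rewrite enumX_size => /(_ ltac:(lia)) /=.
rewrite -addnS => h1; have := IH ltac:(lia); lia.
Qed.

Lemma enumX_lt j : (j < l0)%N -> (nth 0%N s j < n)%N.
Proof.
move=> hj; have : nth 0%N s j \in s by rewrite mem_nth // enumX_size.
by case/mapP => a _ ->; exact: ltn_ord.
Qed.

Lemma gap_id i : (i < l0)%N -> (gap i + (l0.-1 - i) = nth 0%N s (l0.-1 - i))%N.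
Proof.
move=> h; rewrite /gap h subnK //.
have := @enumX_step 0 (l0.-1 - i)%N; rewrite add0n; lia.
Qed.

Lemma gap_anti i j : (i <= j)%N -> (gap j <= gap i)%N.
Proof.
move=> ij; have [jl|jl] := ltnP j l0; last by rewrite {1}/gap ltnNge jl.
have il := leq_ltn_trans ij jl.
have := gap_id il; have := gap_id jl; have := @enumX_step (l0.-1 - j)%N (j - i)%N ltac:(lia).
have -> : (l0.-1 - j + (j - i) = l0.-1 - i)%N by lia.
lia.
Qed.

Lemma gap_box i : (gap i <= n - l0)%N.
Proof.
have [il|il] := ltnP i l0; last by rewrite /gap ltnNge il.
have := gap_id il; have := @enumX_step (l0.-1 - i)%N i ltac:(lia).
have := @enumX_lt (l0.-1 - i + i)%N ltac:(lia); lia.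
Qed.

Lemma sum_gap : (\sum_(i < l0) gap i + 'C(l0, 2) = \sum_(a in X) (a : nat))%N.
Proof.
rewrite -sum_rev_ord -big_split /= -[RHS]big_enum /= -(@big_map _ _ _ _ _ val _ xpredT id) -/s.
rewrite (big_nth 0%N) enumX_size big_mkord [RHS](reindex_inj rev_ord_inj) /=.
apply: eq_bigr => i _; rewrite gap_id //; congr nth; case: i => i /= hi; lia.
Qed.

Variable M : nat.
Hypothesis sX : (\sum_(a in X) (a : nat) = M + 'C(l0, 2))%N.

Lemma gap_sum : (\sum_(i < l0) gap i = M)%N.
Proof. by have := sum_gap; rewrite sX => /addIn. Qed.

Lemma gap_out i : (l0 <= i)%N -> gap i = 0%N.
Proof. by rewrite /gap ltnNge => ->. Qed.

Lemma gap_le i : (gap i <= M)%N.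
Proof.
have [il|/gap_out -> //] := ltnP i l0.
by rewrite -gap_sum (bigD1 (Ordinal il)) //= leq_addr.
Qed.

Lemma gap_end i : (M <= i)%N -> gap i = 0%N.
Proof.
move=> hi; have [il|/gap_out -> //] := ltnP i l0.
apply/eqP; rewrite -leqn0 leqNgt; apply/negP => h.
have : (i.+1 <= \sum_(j < l0) gap j)%N; last by rewrite gap_sum; lia.
rewrite -(big_mkord xpredT gap) (big_cat_nat (leq0n i.+1) il) /=.
apply: leq_trans (leq_addr _ _); rewrite big_mkord -{1}(card_ord i.+1) -sum1_card.
by apply: leq_sum => j _; apply: leq_trans h _; apply: gap_anti; rewrite -ltnS.
Qed.

Definition unbeta : {ffun 'I_M -> 'I_M.+1} := [ffun i : 'I_M => inord (gap i)].

Lemma part_unbeta i : part unbeta i = gap i.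
Proof.
have [iM|iM] := ltnP i M; last by rewrite part_out // gap_end.
have := part_ord unbeta (Ordinal iM); rewrite ffunE inordK //= ltnS; exact: gap_le.
Qed.

Lemma unbeta_partition : is_partition unbeta.
Proof.
apply/andP; split.
  apply/eqP; rewrite -[RHS]gap_sum.
  under eq_bigr => i _ do rewrite -part_ord part_unbeta.
  exact: (@sum_trunc nat gap _ _ gap_end gap_out).
apply/forallP => i; apply/forallP => j; apply/implyP => ij.
by rewrite -!part_ord !part_unbeta gap_anti.
Qed.

Lemma unbeta_inbox : inbox unbeta.
Proof.
apply/forallP => i; rewrite -!part_ord !part_unbeta gap_box andbT.
by apply/implyP => /gap_out ->.
Qed.

Lemma beta_unbeta : beta unbeta = X.
Proof.
have e : map val (enum (beta unbeta)) = map val (enum X).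
  rewrite enum_beta ?unbeta_partition ?unbeta_inbox // -/s.
  apply: (@eq_from_nth _ 0%N); rewrite size_mkseq ?enumX_size // => i il.
  rewrite nth_mkseq // part_unbeta.
  have := @gap_id (l0.-1 - i)%N ltac:(lia); have -> : (l0.-1 - (l0.-1 - i) = i)%N by lia.
  by [].
have e' := inj_map val_inj e.
by apply/finset.setP => a; rewrite -mem_enum e' mem_enum.
Qed.

End Inverse.

Lemma unbeta_beta M (l : {ffun 'I_M -> 'I_M.+1}) : is_partition l -> inbox l ->
  unbeta (beta l) M = l.
Proof.
move=> h1 h2; apply/ffunP => i; apply/val_inj; rewrite /= -!part_ord part_unbeta ?card_beta ?sum_beta //.
have [il|il] := ltnP i l0; last by rewrite gap_out // (inbox_part i h2).1.
have := gap_id (card_beta h1 h2) il; rewrite enum_beta // nth_mkseq; last lia.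
have -> : (l0.-1 - (l0.-1 - i) = i)%N by lia.
by move/addIn.
Qed.

(** [beta] and [unbeta] are mutually inverse. The shift ['C(l0, 2)] is the sum of the smallest
    [l0]-subset, which belongs to the empty partition. *)
Lemma sum_sector_level (T : nmodType) (F : {set 'I_n} -> T) M :
  \sum_(X : {set 'I_n} | (#|X| == l0) && (\sum_(a in X) (a : nat) == M + 'C(l0, 2))%N) F X =
  \sum_(l : {ffun 'I_M -> 'I_M.+1} | is_partition l && inbox l) F (beta l).
Proof.
rewrite (reindex_onto (@beta M) (fun X => unbeta X M)) => [|X /andP[/eqP h1 /eqP h2]]; last first.
  exact: beta_unbeta.
apply: eq_bigl => l; apply/idP/idP => [/andP[/andP[/eqP h1 /eqP h2] /eqP <-]|/andP[h1 h2]].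
  by rewrite unbeta_partition ?unbeta_inbox.
by rewrite card_beta ?sum_beta ?unbeta_beta ?eqxx.
Qed.

Lemma sum_sector (T : nmodType) (F : {set 'I_n} -> T) :
  \sum_(X : {set 'I_n} | #|X| == l0) F X =
  \sum_(M < (n * n).+1) \sum_(l : {ffun 'I_M -> 'I_M.+1} | is_partition l && inbox l) F (beta l).
Proof.
pose h (X : {set 'I_n}) : 'I_(n * n).+1 := inord (\sum_(a in X) (a : nat) - 'C(l0, 2))%N.
rewrite (partition_big h xpredT) //=; apply: eq_bigr => M _.
rewrite -sum_sector_level; apply: eq_bigl => X; case: eqP => //= cX.
(* This bound shows that the range [M <= n * n] catches every subset. *)
have b : (\sum_(a in X) (a : nat) <= n * n)%N.
  apply: (@leq_trans (\sum_(a in X) n)%N); first by apply: leq_sum => a _; apply: ltnW.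
  rewrite sum_nat_const leq_mul2r; have := max_card (mem X); rewrite card_ord => ->; exact: orbT.
have := sum_gap cX; set S := (\sum_(a in X) _)%N in b *; set g := (\sum_(i < l0) _)%N => e.
rewrite -val_eqE /= /h inordK; [|lia].
apply/eqP/eqP; lia.
Qed.

End Beta.

(** * Frobenius coordinates and power sums *)

Section Frobenius.
Variable R : realType.
Variables (M : nat) (l : {ffun 'I_M -> 'I_M.+1}).
Hypothesis lP : is_partition l.

Let lA (i j : 'I_M) : (i <= j)%N -> (l j <= l i)%N.
Proof. by move: lP => /andP[_ /forallP/(_ i)/forallP/(_ j)/implyP]. Qed.

Definition conjp (j : nat) : nat := #|[set k : 'I_M | (j.+1 <= l k)%N]|.

Lemma card_ord_lt (i : nat) : (i <= M)%N -> #|[set k : 'I_M | (k < i)%N]| = i.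
Proof.
move=> h; have wi : injective (widen_ord h) by move=> a b /(congr1 val) /= /val_inj.
rewrite -[RHS](card_ord i) -cardsT -(card_imset _ wi).
apply: eq_card => k; rewrite !inE; apply/idP/imsetP => [ki|[a _ ->]]; last by rewrite /= ltn_ord.
by exists (Ordinal ki); rewrite ?inE //; apply/val_inj.
Qed.

Lemma conjpP (i : 'I_M) j : (i < conjp j)%N = (j < l i)%N.
Proof.
apply/idP/idP => [|h].
  apply: contraTT; rewrite -!leqNgt => h.
  rewrite -(card_ord_lt (ltnW (ltn_ord i))); apply: subset_leq_card.
  apply/fintype.subsetP => k; rewrite !inE => hk.
  by rewrite ltnNge; apply/negP => /lA h1; have := leq_trans hk (leq_trans h1 h); rewrite ltnn.
rewrite -[X in (X <= _)%N](card_ord_lt (ltn_ord i)); apply: subset_leq_card.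
by apply/fintype.subsetP => k; rewrite !inE ltnS => /lA; exact: leq_trans.
Qed.

Lemma conjp_le j : (conjp j <= M)%N.
Proof. by rewrite -[X in (_ <= X)%N](card_ord M) max_card. Qed.

(** Rows that meet the diagonal give their Frobenius legs; the values of the other rows complete
    these to a permutation of [0, ..., M - 1]. *)
Definition legs (i : 'I_M) : nat := if (i < l i)%N then (conjp i - i.+1)%N else (i - l i)%N.

Lemma legs_lt i : (legs i < M)%N.
Proof. by rewrite /legs; have := conjp_le i; have := ltn_ord i; case: ifP; lia. Qed.

(** Within each kind of row the values are strictly monotone. For rows of different kinds, [conjpP]
    decides on which side of the boundary the box [(i, j)] lies, and either answer excludes
    equality. *)
Lemma legs_inj : injective (fun i => Ordinal (legs_lt i)).
Proof.
have mixed (i j : 'I_M) : (l i <= i)%N -> (j < l j)%N -> legs i <> legs j.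
  move=> hi hj; rewrite /legs hj ltnNge hi /=.
  have h1 := conjpP i j; have h2 := conjpP j j; rewrite hj in h2.
  case: (ltnP j (l i)) h1 => h; case: ltnP => //; lia.
have incr (i j : 'I_M) : (i < j)%N -> (l i <= i)%N -> (l j <= j)%N -> legs i <> legs j.
  by move=> ij hi hj; rewrite /legs !ltnNge hi hj /=; have := lA (ltnW ij); lia.
have decr (i j : 'I_M) : (i < j)%N -> (i < l i)%N -> (j < l j)%N -> legs i <> legs j.
  move=> ij hi hj; rewrite /legs hi hj.
  have h1 := conjpP j j; rewrite hj in h1.
  have : (conjp j <= conjp i)%N.
    by apply: subset_leq_card; apply/fintype.subsetP => k; rewrite !inE; apply: leq_ltn_trans; exact: ltnW.
  lia.
move=> i j [e]; apply/val_inj => /=.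
case: (ltngtP i j) => // ij.
- case: (ltnP i (l i)) => hi; case: (ltnP j (l j)) => hj.
  + by case: (decr _ _ ij hi hj).
  + by case: (mixed _ _ hj hi).
  + by case: (mixed _ _ hi hj).
  + by case: (incr _ _ ij hi hj).
- case: (ltnP i (l i)) => hi; case: (ltnP j (l j)) => hj.
  + by case: (decr _ _ ij hj hi).
  + by case: (mixed _ _ hj hi).
  + by case: (mixed _ _ hi hj).
  + by case: (incr _ _ ij hj hi).
Qed.

(* The legs of the boxes below the diagonal fill the gaps of the sequence [i - l i]. *)
Lemma pfrobE r : pfrob R l r =
  \sum_(i < M) (((l i)%:R - i%:R - 2%:R^-1) ^+ r - (- i%:R - 2%:R^-1) ^+ r).
Proof.
rewrite sumrB /= [X in _ = _ - X](reindex_inj legs_inj) /= (bigID (fun i : 'I_M => (i < l i)%N)) /=.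
rewrite [X in _ = _ - X](bigID (fun i : 'I_M => (i < l i)%N)) /=.
have e2 : \sum_(i < M | ~~ (i < l i)%N) ((l i)%:R - i%:R - 2%:R^-1) ^+ r =
          \sum_(i < M | ~~ (i < l i)%N) (- (legs i)%:R - 2%:R^-1) ^+ r :> R.
  apply: eq_bigr => i hi; rewrite /legs (negPf hi) natrB; last by rewrite leqNgt.
  by rewrite opprB.
rewrite e2 [X in _ = _ - X]addrC opprD addrA addrK -sumrB /pfrob.
apply: eq_bigr => i hi; rewrite /frob_m /frob_n /legs hi -/(conjp i).
have h1 := conjpP i i; rewrite hi in h1.
have -> : Defs.half R (l i - i.+1) = (l i)%:R - i%:R - 2%:R^-1.
  by rewrite /Defs.half natrB // -natr1; lra.
have -> : (- (conjp i - i.+1)%:R - 2%:R^-1 = -1 * Defs.half R (conjp i - i.+1))%R.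
  by rewrite /Defs.half; lra.
by rewrite exprMn exprS mulN1r mulNr.
Qed.

End Frobenius.

(** * Multi-indices, and coefficients as sums over states *)

Section MultiIndex.
Variable R : realType.
Notation C := R[i].
Implicit Types (A B : seq nat) (F G : ser R).

(** No power of [tau_1], which is the modular variable and not an expansion variable. [qmon] skips
    the index 1, so identities between series are stated on such multi-indices. *)
Definition good A : Prop := nth 0%N A 1 = 0%N.

Lemma subidx_cons a A : subidx (a :: A) = [seq b :: B | b <- iota 0 a.+1, B <- subidx A].
Proof. by []. Qed.

Lemma subidx_le A B i : B \in subidx A -> (nth 0%N B i <= nth 0%N A i)%N.
Proof.
elim: A B i => [|a A IH] B i; first by rewrite inE => /eqP ->.
rewrite subidx_cons => /allpairsP[[b B'] /= [hb /IH h ->]]; case: i => [|i] //=.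
by move: hb; rewrite -[_ :: _]/(iota 0 a.+1) mem_iota add0n ltnS.
Qed.

Lemma good_sub A B : good A -> B \in subidx A -> good B.
Proof. by move=> h /(subidx_le 1); rewrite h leqn0 => /eqP. Qed.

Lemma good_subA A B : good A -> good (subA A B).
Proof.
rewrite /good /subA => h; have [s|s] := ltnP 1 (size A); last by rewrite nth_default // size_map size_iota.
by rewrite (nth_map 0%N) ?size_iota // nth_iota // h.
Qed.

Definition geq F G : Prop := forall A, good A -> F A = G A.

Lemma geq_smul F F' G G' : geq F F' -> geq G G' -> geq (smul F G) (smul F' G').
Proof.
move=> h1 h2 A hA; rewrite /smul; rewrite big_seq_cond [RHS]big_seq_cond; apply: eq_bigr => B.
by rewrite andbT => hB; rewrite h1 ?h2 //; [exact: good_subA | exact: good_sub hB].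
Qed.

Lemma smulDl F F' G A : smul (fun A => F A + F' A) G A = smul F G A + smul F' G A.
Proof. by rewrite /smul -big_split /=; apply: eq_bigr => B _; rewrite mulrDr mulrDl. Qed.

Lemma smulDr F G G' A : smul F (fun A => G A + G' A) A = smul F G A + smul F G' A.
Proof. by rewrite /smul -big_split /=; apply: eq_bigr => B _; rewrite mulrDr. Qed.

Definition mpow (X : nat -> C) A : C := \prod_(k < size A) X k ^+ nth 0%N A k.

Lemma mpow_cons X a A : mpow X (a :: A) = X 0%N ^+ a * mpow (fun k => X k.+1) A.
Proof. by rewrite /mpow big_ord_recl. Qed.

Lemma binomA_cons a A b B : binomA (a :: A) (b :: B) = ('C(a, b) * binomA A B)%N.
Proof. by rewrite /binomA big_ord_recl. Qed.

Lemma subA_cons a A b B : subA (a :: A) (b :: B) = (a - b)%N :: subA A B.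
Proof.
by rewrite /subA /=; congr (_ :: _); rewrite (iotaDl 1 0) -map_comp; apply: eq_map.
Qed.

Lemma mpow_binomial (X Y : nat -> C) A :
  \sum_(B <- subidx A) (binomA A B)%:R * mpow X B * mpow Y (subA A B) = mpow (fun k => X k + Y k) A.
Proof.
elim: A X Y => [|a A IH] X Y.
  by rewrite /= big_seq1 /binomA /mpow !big_ord0 !mul1r.
rewrite subidx_cons big_allpairs_dep mpow_cons /= -IH addrC exprDn big_distrl /=.
rewrite -[_ :: _]/(index_iota 0 a.+1) big_mkord; apply: eq_bigr => b _.
rewrite big_distrr /=; apply: eq_bigr => B _.
rewrite binomA_cons subA_cons !mpow_cons natrM -mulr_natr; ring.
Qed.

Lemma qmonE (x : nat -> R) t A : good A ->
  qmon x t A = ee ((x 1%N)%:C * t) * mpow (fun k => tpi R * (x k)%:C) A.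
Proof.
move=> hA; rewrite /qmon /mpow; congr (_ * _); rewrite big_mkcond /=.
apply: eq_bigr => k _; case: eqP => //= ->; first by rewrite hA expr0.
Qed.

Lemma smul_qmon (x y : nat -> R) t : geq (smul (qmon x t) (qmon y t)) (qmon (fun k => x k + y k) t).
Proof.
move=> A hA; rewrite qmonE // rmorphD mulrDl eeD.
rewrite (_ : mpow _ A = mpow (fun k => tpi R * (x k)%:C + tpi R * (y k)%:C) A); last first.
  by congr mpow; apply/funext => k; rewrite rmorphD mulrDr.
rewrite -mpow_binomial /smul big_distrr /= big_seq_cond [RHS]big_seq_cond.
apply: eq_bigr => B; rewrite andbT => hB.
rewrite !qmonE; try exact: good_subA; try exact: (good_sub hA hB).
by move: (ee _) (ee _) (mpow _ _) (mpow _ _) => *; ring.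
Qed.

Lemma sone_qmon t : geq (@sone R) (qmon (fun=> 0) t).
Proof.
move=> A hA; rewrite qmonE // mul0r ee0 mul1r /sone /mpow.
case: ifPn => [/(all_nthP 0%N) h|/allPn[a /(nthP 0%N) [i hi <-] h]].
  by rewrite big1 // => k _; rewrite (eqP (h k (ltn_ord k))).
by rewrite (bigD1 (Ordinal hi)) //= mulr0 expr0n (negPf h) mul0r.
Qed.

Section States.
Variables (I : Type) (y : I -> nat -> R) (t : C).

Definition sst (r : seq I) x0 : ser R := fun A => fsum y r x0 (fun x => qmon x t A).

Lemma smul_sst r1 r2 x1 x2 :
  geq (smul (sst r1 x1) (sst r2 x2)) (sst (r1 ++ r2) (fun k => x1 k + x2 k)).
Proof.
move=> A hA; elim: r1 x1 => [|i r1 IH] x1; last first.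
  have -> : sst (i :: r1) x1 = fun A => sst r1 x1 A + sst r1 (fun k => x1 k + y i k) A by apply/funext.
  rewrite smulDl !IH /sst /=; congr (_ + _); congr fsum; apply/funext => k; exact: addrAC.
elim: r2 x2 => [|i r2 IH] x2; first exact: smul_qmon.
have -> : sst (i :: r2) x2 = fun A => sst r2 x2 A + sst r2 (fun k => x2 k + y i k) A by apply/funext.
rewrite smulDr !IH /sst /=; congr (_ + _); congr fsum; apply/funext => k; by rewrite addrA.
Qed.

Lemma sst1 i : geq (sadd (@sone R) (qmon (y i) t)) (sst [:: i] (fun=> 0)).
Proof.
move=> A hA; rewrite /sadd /sst [RHS]/= -(sone_qmon t hA).
by have -> : (fun k => 0 + y i k) = y i by apply/funext => k; rewrite add0r.
Qed.
End States.

(** The flag [true] marks the factor of charge 1, [false] that of charge -1. *)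
Definition modes (N : nat) : seq (bool * nat) := flatten [seq [:: (true, n); (false, n)] | n <- iota 0 N].
Definition modex (i : bool * nat) : nat -> R := if i.1 then omx1 R i.2 else omx2 R i.2.

Lemma OmegaN_sst N t : geq (OmegaN N t) (sst modex t (modes N) (@xi_exp R)).
Proof.
have H (r : seq nat) : geq (\big[@smul R/@sone R]_(n <- r)
    smul (sadd (@sone R) (qmon (omx1 R n) t)) (sadd (@sone R) (qmon (omx2 R n) t)))
    (sst modex t (flatten [seq [:: (true, n); (false, n)] | n <- r]) (fun=> 0)).
  elim: r => [|n r IH]; first by rewrite big_nil /=; exact: sone_qmon.
  rewrite big_cons => A hA /=.
  have h1 := @sst1 _ modex t (true, n); have h2 := @sst1 _ modex t (false, n).
  have h12 := @smul_sst _ modex t [:: (true, n)] [:: (false, n)] (fun=> 0) (fun=> 0).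
  have h A (gA : good A) := etrans (geq_smul h1 h2 gA) (h12 A gA).
  rewrite (geq_smul h IH hA) smul_sst //=; congr sst; apply/funext => k; by rewrite !add0r.
move=> A hA; rewrite /OmegaN -(big_mkord xpredT (fun n => smul (sadd (@sone R) (qmon (omx1 R n) t)) (sadd (@sone R) (qmon (omx2 R n) t)))).
have h0 : geq (qmon (@xi_exp R) t) (sst modex t [::] (@xi_exp R)) by [].
rewrite (geq_smul h0 (H _) hA) smul_sst // /index_iota subn0; congr sst; apply/funext => k; by rewrite addr0.
Qed.

(** The word containing each letter [k] with multiplicity [A_k]. It turns multi-index coefficients
    into word coefficients, where derivatives are taken one letter at a time. *)
Definition ksA A : seq nat := flatten [seq nseq (nth 0%N A k) k | k <- iota 0 (size A)].

Lemma prod_ksA (X : nat -> C) A : mon X (ksA A) = mpow X A.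
Proof.
rewrite /mon /ksA big_flatten big_map /mpow -(big_mkord xpredT (fun k => X k ^+ nth 0%N A k)).
rewrite /index_iota subn0; apply: eq_bigr => k _.
by elim: (nth 0%N A k) => [|n IH] /=; rewrite ?big_nil // big_cons IH exprS.
Qed.

Lemma wt_ksA A : wt A = (\sum_(k <- ksA A) k.+1)%N.
Proof.
rewrite /wt /ksA big_flatten big_map -(big_mkord xpredT (fun k => (k.+1 * nth 0 A k)%N)).
rewrite /index_iota subn0; apply: eq_bigr => k _.
by rewrite big_nseq iter_addn_0.
Qed.

Lemma qmon_mon (x : nat -> R) t A : good A ->
  qmon x t A = tpi R ^+ size (ksA A) * (ee ((x 1%N)%:C * t) * mon (fun k => (x k)%:C) (ksA A)).
Proof.
move=> hA; rewrite qmonE // -prod_ksA mulrCA; congr (_ * _).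
by elim: (ksA A) => [|k ks IH]; rewrite ?mon_nil ?mulr1 // !mon_cons IH /= exprS; ring.
Qed.

Lemma fsum_hom (I : Type) (y : I -> nat -> R) r x0 (F : (nat -> C) -> C) :
  fsum y r x0 (fun x => F (fun k => (x k)%:C)) = fsum (fun i k => (y i k)%:C) r (fun k => (x0 k)%:C) F.
Proof.
elim: r x0 => [|i r IH] x0 //=; rewrite !IH; congr (_ + fsum _ _ _ _).
by apply/funext => k; rewrite rmorphD.
Qed.

Definition enchi (t : C) (x : nat -> C) : C := ee (x 1%N * t).
Definition ymode (i : bool * nat) (k : nat) : C := (modex i k)%:C.
Definition xiC (k : nat) : C := (xi_exp R k)%:C.

Lemma enchiD t x y : enchi t (fun k => x k + y k) = enchi t x * enchi t y.
Proof. by rewrite /enchi mulrDl eeD. Qed.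

Lemma OmegaN_Zst N t A : good A ->
  OmegaN N t A = tpi R ^+ size (ksA A) * Zst (enchi t) ymode (modes N) xiC (ksA A).
Proof.
move=> hA; rewrite OmegaN_sst // /sst /Zst -fsum_hom /enchi.
elim: (modes N) (@xi_exp R) => [|i r IH] x0 /=; first exact: qmon_mon.
by rewrite !IH mulrDr.
Qed.

Lemma VN_mon N t A : good A ->
  VN N t A = tpi R ^+ size (ksA A) * \sum_(M < N) \sum_(l : {ffun 'I_M -> 'I_M.+1} | is_partition l)
    (ee ((xi_exp R 1 + vx R l 1)%:C * t) * mon (fun k => (xi_exp R k + vx R l k)%:C) (ksA A)).
Proof.
move=> hA; rewrite /VN /smul [RHS]big_distrr /=.
under eq_bigr => B _ do rewrite big_distrr /=.
rewrite exchange_big /=; apply: eq_bigr => M _.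
under eq_bigr => B _ do rewrite big_distrr /=.
rewrite exchange_big big_distrr /=; apply: eq_bigr => l _.
by rewrite -qmon_mon // -smul_qmon.
Qed.

End MultiIndex.

(** * Binomial convolution in one variable *)

Section BinomialConvolution.
Variable K : comNzRingType.
Implicit Types (a b c : nat -> K).

Definition bc a b (n : nat) : K := shc (nseq n 0%N) (fun s => a (size s)) (fun s => b (size s)).

Lemma shc_size ks a b : shc ks (fun s => a (size s)) (fun s => b (size s)) = bc a b (size ks).
Proof.
rewrite /bc; elim: ks a b => [|k ks IH] a b //=.
by rewrite (IH (fun n => a n.+1)) (IH a (fun n => b n.+1)).
Qed.

Lemma bcS a b n : bc a b n.+1 = bc (fun k => a k.+1) b n + bc a (fun k => b k.+1) n.
Proof. by []. Qed.

Lemma bc_ext a a' b b' n : (forall k, a k = a' k) -> (forall k, b k = b' k) -> bc a b n = bc a' b' n.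
Proof. by move=> h1 h2; congr bc; apply/funext. Qed.

Lemma bcE a b n : bc a b n = \sum_(j < n.+1) 'C(n, j)%:R * a j * b (n - j)%N.
Proof.
elim: n a b => [|n IH] a b; first by rewrite /bc /= big_ord_recl big_ord0 bin0 mul1r addr0.
rewrite bcS !IH [RHS]big_ord_recl bin0 /=.
under [X in _ = _ + X]eq_bigr => i _ do rewrite /bump /= add1n binS natrD !mulrDl subSS.
rewrite big_split /= addrA [RHS]addrC; congr (_ + _).
rewrite big_ord_recl bin0 /= [in RHS]big_ord_recr /= bin_small // !mul0r addr0 subn0; congr (_ + _).
by apply: eq_bigr => i _; rewrite /bump /= add1n subnSK.
Qed.

Lemma bcC a b n : bc a b n = bc b a n. Proof. exact: shcC. Qed.
Lemma bcDl a a' b n : bc (fun k => a k + a' k) b n = bc a b n + bc a' b n. Proof. exact: shcDl. Qed.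
Lemma bcDr a b b' n : bc a (fun k => b k + b' k) n = bc a b n + bc a b' n. Proof. exact: shcDr. Qed.
Lemma bcZl x a b n : bc (fun k => x * a k) b n = x * bc a b n. Proof. exact: shcZl. Qed.
Lemma bcZr x a b n : bc a (fun k => x * b k) n = x * bc a b n. Proof. exact: shcZr. Qed.
Lemma bcBl a a' b n : bc (fun k => a k - a' k) b n = bc a b n - bc a' b n.
Proof.
rewrite -mulN1r -bcZl -bcDl; apply: bc_ext => // k; by rewrite mulN1r.
Qed.
Lemma bcBr a b b' n : bc a (fun k => b k - b' k) n = bc a b n - bc a b' n.
Proof. by rewrite bcC bcBl !(bcC a). Qed.

Lemma bcA a b c n : bc (bc a b) c n = bc a (bc b c) n.
Proof.
rewrite /bc; have := shcA (nseq n 0%N) (fun s => a (size s)) (fun s => b (size s)) (fun s => c (size s)).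
rewrite (eq_shc _ (fun s => shc_size s a b) (fun _ => erefl)) => ->.
by rewrite (eq_shc _ (fun _ => erefl) (fun s => shc_size s b c)).
Qed.

(** As exponential generating functions in [z]: [pw x] is [exp(x z)], [dl0] is 1 and [dl1] is
    [z]. *)
Definition pw (x : K) (n : nat) : K := x ^+ n.
Definition dl0 (n : nat) : K := (n == 0%N)%:R.
Definition dl1 (n : nat) : K := (n == 1%N)%:R.

Lemma pwD x y n : bc (pw x) (pw y) n = pw (x + y) n.
Proof.
elim: n => [|n IH]; first by rewrite /bc /= /pw !expr0 mulr1.
rewrite bcS (bc_ext _ (exprS x) (fun _ => erefl)) (bc_ext _ (fun _ => erefl) (exprS y)).
by rewrite bcZl bcZr IH -mulrDl -exprS.
Qed.

Lemma bc0l b n : bc (fun=> 0) b n = 0.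
Proof. by rewrite bcE big1 // => i _; rewrite mulr0 mul0r. Qed.

Lemma bc_dl0 b n : bc dl0 b n = b n.
Proof.
elim: n b => [|n IH] b; first by rewrite /bc /= /dl0 mul1r.
by rewrite bcS IH [X in X + _]bc0l add0r.
Qed.

Lemma bc_dl1 b n : bc dl1 b n = n%:R * b n.-1.
Proof.
elim: n b => [|n IH] b; first by rewrite /bc /= /dl1 !mul0r.
rewrite bcS IH (bc_ext (a' := dl0) (b' := b)) //; rewrite bc_dl0.
case: n {IH} => [|n] /=; first by rewrite mul0r addr0 mul1r.
by rewrite -[n.+2%:R]natr1 mulrDl mul1r addrC.
Qed.

Lemma bc_scale x a b n : bc (fun k => x ^+ k * a k) (fun k => x ^+ k * b k) n = x ^+ n * bc a b n.
Proof.
rewrite !bcE big_distrr /=; apply: eq_bigr => j _.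
have -> : x ^+ n = x ^+ j * x ^+ (n - j) by rewrite -exprD subnKC // -ltnS.
ring.
Qed.

End BinomialConvolution.

(** * Bernoulli numbers and the values [- xi(-k)] *)

Section Bernoulli.
Variable R : realType.
Implicit Types (a b : nat -> R).

Lemma size_bernoulli_list n : size (bernoulli_list n) = n.+1.
Proof. by elim: n => [|n IH] //; rewrite [bernoulli_list _]/= size_rcons IH. Qed.

Lemma nth_bernoulli_list n k : (k <= n)%N -> nth 0 (bernoulli_list n) k = bernoulli k.
Proof.
elim: n => [|n IH] h; first by case: k h.
have [->|kn] := eqVneq k n.+1; first by [].
rewrite [bernoulli_list _]/= nth_rcons size_bernoulli_list.
have -> : (k < n.+1)%N by lia.
by apply: IH; lia.
Qed.

Lemma bernoulliS n : \sum_(k < n.+2) 'C(n.+2, k)%:R * bernoulli k = 0.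
Proof.
rewrite big_ord_recr /=.
have -> : bernoulli n.+1 = - n.+2%:R^-1 * \sum_(k < n.+1) 'C(n.+2, k)%:R * bernoulli k.
  rewrite /bernoulli [bernoulli_list _]/= nth_rcons size_bernoulli_list ltnn eqxx.
  by congr (_ * _); apply: eq_bigr => k _; rewrite (@nth_bernoulli_list n k) // -ltnS ltn_ord.
rewrite binSn mulrA mulrN divff ?pnatr_eq0 // mulN1r.
exact: subrr.
Qed.

Definition bern (n : nat) : R := ratr (bernoulli n).

(** In generating functions: [(exp z - 1) B(z) = z]. *)
Lemma bern_conv n : bc (pw 1) bern n - bern n = dl1 R n.
Proof.
rewrite bcC bcE.
under eq_bigr => k _ do rewrite /pw expr1n mulr1.
rewrite big_ord_recr /= binn mul1r addrK.
case: n => [|[|n]]; first by rewrite big_ord0.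
  by rewrite big_ord_recl big_ord0 bin0 mul1r addr0 /bern /= rmorph1.
transitivity (ratr (\sum_(k < n.+2) 'C(n.+2, k)%:R * bernoulli k) : R); last by rewrite bernoulliS rmorph0.
by rewrite rmorph_sum; apply: eq_bigr => k _; rewrite rmorphM /= ratr_nat.
Qed.

(** Multiplication by [exp z - 1] is injective: once the earlier entries vanish, the relation at
    [n + 1] reads [(n + 1) a n = 0]. *)
Lemma bc_cancel a : (forall n, bc (pw 1) a n - a n = 0) -> forall n, a n = 0.
Proof.
move=> h n; elim/ltn_ind: n => n IH; have := h n.+1.
rewrite bcC bcE big_ord_recr /= binn /pw !expr1n mul1r mulr1 addrK big_ord_recr /= big1.
  by rewrite add0r binSn !expr1n mulr1 => /eqP; rewrite mulf_eq0 pnatr_eq0 /= => /eqP.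
by move=> i _; rewrite IH // mulr0 mul0r.
Qed.

(** Both [B(-z)] and [B(z) + z] become [z exp z] after multiplication by [exp z - 1], so they are
    equal. *)
Lemma bern_odd n : (1 < n)%N -> odd n -> bern n = 0.
Proof.
pose b' n := (-1) ^+ n * bern n.
have h1 m : bc (pw (-1)) b' m - b' m = - dl1 R m.
  have := bc_scale (-1) (pw 1) bern m; rewrite (bc_ext (a' := pw (-1)) (b' := b')) // => [->|k].
    rewrite /b' -mulrBr bern_conv /dl1; case: eqP => [->|_]; rewrite ?mulr0 ?oppr0 //.
    by rewrite expr1 mulr1.
  by rewrite /pw expr1n mulr1.
have h2 m : b' m - bc (pw 1) b' m = - bc (pw 1) (dl1 R) m.
  have -> : b' m = bc (pw 1) (bc (pw (-1)) b') m.
    rewrite -bcA (bc_ext (a' := dl0 R) (b' := b')) ?bc_dl0 // => k.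
    by rewrite pwD subrr /pw /dl0 expr0n.
  rewrite -bcBr (bc_ext (a' := pw 1) (b' := fun k => (-1) * dl1 R k)) ?bcZr ?mulN1r // => k.
  by rewrite h1 mulN1r.
move=> n1 on; have := @bc_cancel (fun k => b' k - bern k - dl1 R k) _ n.
rewrite /b' -signr_odd on expr1 mulN1r /dl1 gtn_eqF // subr0 => /(_ _) e.
have : - bern n - bern n = 0; last by lra.
apply: e => m; rewrite !bcBr.
have := h2 m; have := bern_conv m; rewrite /b' /dl1.
set u := bc _ _ _; set v := bc _ _ _; set w := bc _ _ _; lra.
Qed.

(* [(2 ^ (1 - n) - 1) B_n], the value at 1/2 of the Bernoulli polynomial. *)
Definition bhalf (n : nat) : R := 2 * (2^-1 ^+ n * bern n) - bern n.

(** [2 B(z/2) - B(z)] times [exp z - 1] is [z exp(z/2)], because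
    [exp z - 1 = (exp(z/2) - 1)(exp(z/2) + 1)]. *)
Lemma bhalf_conv n : bc (pw 1) bhalf n - bhalf n = n%:R * 2^-1 ^+ n.-1.
Proof.
pose bh n := 2^-1 ^+ n * bern n.
have h m : bc (pw 2^-1) bh m - bh m = 2^-1 * dl1 R m.
  have := bc_scale 2^-1 (pw 1) bern m; rewrite (bc_ext (a' := pw 2^-1) (b' := bh)) // => [->|k].
    rewrite /bh -mulrBr bern_conv /dl1; case: eqP => [->|_]; rewrite ?mulr0 //.
  by rewrite /pw expr1n mulr1.
have h1 m : bc (pw 1) bh m - bc (pw 2^-1) bh m = 2^-1 * (m%:R * 2^-1 ^+ m.-1).
  have e2 : 2^-1 + 2^-1 = 1 :> R by lra.
  have -> : bc (pw 1) bh m = bc (pw 2^-1) (bc (pw 2^-1) bh) m.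
    by rewrite -bcA; apply: bc_ext => // k; rewrite pwD e2.
  rewrite -bcBr (bc_ext (a' := pw 2^-1) (b' := fun k => 2^-1 * dl1 R k)) // bcZr bcC bc_dl1.
  by [].
have -> : bc (pw 1) bhalf n = 2 * bc (pw 1) bh n - bc (pw 1) bern n by rewrite -bcZr -bcBr.
have := bern_conv n; have := h n; have := h1 n; rewrite /bhalf -/(bh n); lra.
Qed.

(* [vv k] is [- xi(-k)]. *)
Definition vv (k : nat) : R := bhalf k.+1 / k.+1%:R.

Lemma bhalf0 : bhalf 0 = 1.
Proof. rewrite /bhalf /bern /bernoulli /= rmorph1; lra. Qed.

Lemma xi_exp_vv k : xi_exp R k = vv k.
Proof.
rewrite /xi_exp /vv /bhalf; case: ifPn => [ok|ek].
  rewrite /xi_neg /zeta_neg !(rmorphM, rmorphN, rmorphB, fmorphV, rmorphXn, rmorph1) /= !ratr_nat.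
  rewrite -/(bern k.+1) exprS; have h : k.+1%:R != 0 :> R by rewrite pnatr_eq0.
  rewrite -exprVn; set p := _ ^+ k; field; by rewrite nat1r.
case: k ek => [|k] ek; first by rewrite expr1 mulrA divff ?pnatr_eq0 // mul1r subrr mul0r.
by rewrite bern_odd //= ?mulr0 ?subr0 ?mul0r.
Qed.

(** This is [B_(k+1)(x + 1/2) / (k + 1)], the regularized power sum of the Dirac sea of charge
    [x]. *)
Definition vshift (k : nat) (x : R) : R := \sum_(j < k.+1) 'C(k, j)%:R * x ^+ (k - j) * vv j + x ^+ k.+1 / k.+1%:R.

Lemma vshiftE k x : vshift k x = bc (pw x) bhalf k.+1 / k.+1%:R.
Proof.
rewrite bcC bcE big_ord_recl bin0 bhalf0 !mul1r /= subn0 mulrDl addrC /vshift; congr (_ + _).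
rewrite big_distrl /=; apply: eq_bigr => j _; rewrite /bump /= add1n subSS /pw /vv.
have h : k.+1%:R != 0 :> R by rewrite pnatr_eq0.
have h' : j.+1%:R != 0 :> R by rewrite pnatr_eq0.
have e : 'C(k.+1, j.+1)%:R * j.+1%:R = k.+1%:R * 'C(k, j)%:R :> R by rewrite -!natrM mulnC -mul_bin_diag mulnC.
have -> : 'C(k.+1, j.+1)%:R = k.+1%:R * 'C(k, j)%:R / j.+1%:R :> R by rewrite -e mulfK.
by field; rewrite ?nat1r h h'.
Qed.

Lemma vshift0 k : vshift k 0 = vv k.
Proof.
rewrite vshiftE (bc_ext (a' := dl0 R) (b' := bhalf)) ?bc_dl0 // => j.
by rewrite /pw expr0n.
Qed.

Lemma vshiftS k x : vshift k (x + 1) = vshift k x + (x + 2^-1) ^+ k.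
Proof.
have h : k.+1%:R != 0 :> R by rewrite pnatr_eq0.
suff e : bc (pw (x + 1)) bhalf k.+1 = bc (pw x) bhalf k.+1 + (x + 2^-1) ^+ k * k.+1%:R.
  by rewrite !vshiftE e mulrDl mulfK.
have -> : bc (pw (x + 1)) bhalf k.+1 = bc (pw x) (bc (pw 1) bhalf) k.+1.
  by rewrite -bcA; apply: bc_ext => // j; rewrite pwD.
apply/eqP; rewrite addrC -subr_eq; apply/eqP; rewrite -bcBr.
rewrite (bc_ext (a' := pw x) (b' := bc (dl1 R) (pw 2^-1))) // => [|j]; last by rewrite bhalf_conv bc_dl1.
rewrite -bcA (bc_ext (a' := bc (dl1 R) (pw x)) (b' := pw 2^-1)) // => [|j]; last exact: bcC.
by rewrite bcA bc_dl1 /= pwD mulrC.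
Qed.

(** Cumulants for [w = 1]: the coefficients of [exp z / (1 + exp z) = 1 - (B(z) - B(2z)) / z]. *)
Definition cum1 (n : nat) : R := (2 ^+ n.+1 - 1) * bern n.+1 / n.+1%:R + (n == 0%N)%:R.

Lemma cum1P : cumul 1 cum1.
Proof.
pose b2 n := 2 ^+ n * bern n; pose e n := bern n - b2 n.
have h2 m : bc (pw 2) b2 m - b2 m = 2 * dl1 R m.
  have := bc_scale 2 (pw 1) bern m; rewrite (bc_ext (a' := pw 2) (b' := b2)) // => [->|k].
    rewrite /b2 -mulrBr bern_conv /dl1; case: eqP => [->|_]; rewrite ?mulr0 //.
  by rewrite /pw expr1n mulr1.
have e2 : 1 + 1 = 2 :> R by lra.
have pp a m : bc (pw 1) (bc (pw 1) a) m = bc (pw 2) a m.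
  by rewrite -bcA; apply: bc_ext => // k; rewrite pwD e2.
have he m : e m + bc (pw 1) e m = dl1 R m.
  apply/eqP; rewrite -subr_eq0; apply/eqP.
  apply: (@bc_cancel (fun m => e m + bc (pw 1) e m - dl1 R m)) => {}m.
  rewrite bcBr bcDr pp.
  have ee1 a : bc a e m = bc a bern m - bc a b2 m by rewrite -bcBr.
  have pb : bc (pw 2) bern m = bc (pw 1) bern m + bc (pw 1) (dl1 R) m.
    rewrite -pp -bcDr; apply: bc_ext => // k; have := bern_conv k; lra.
  have := h2 m; have := bern_conv m; rewrite !ee1 pb /e; lra.
pose d n := e n.+1 / n.+1%:R.
have hd n : d n + bc (pw 1) d n = dl0 R n.
  have h : n.+1%:R != 0 :> R by rewrite pnatr_eq0.
  apply: (mulIf h); rewrite mulrDl {1}/d divfK //.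
  have ed k : e k = bc (dl1 R) d k.
    rewrite bc_dl1; case: k => [|k]; first by rewrite mul0r /e /b2 expr0 mul1r subrr.
    by rewrite /d mulrC divfK // pnatr_eq0.
  have := he n.+1; rewrite (bc_ext (a' := pw 1) (b' := bc (dl1 R) d)) //.
  rewrite -bcA (bc_ext (a' := bc (dl1 R) (pw 1)) (b' := d)) // => [|k]; last exact: bcC.
  rewrite bcA bc_dl1 /= [X in _ + X]mulrC => ->.
  by rewrite /dl1 /dl0 eqSS; case: eqP => [->|_]; rewrite ?mul1r ?mul0r.
move=> n; have c1 k : cum1 k = dl0 R k - d k.
  by rewrite /cum1 /d /e /b2 /dl0 addrC -[in LHS](opprK (2 ^+ _ - 1)) -mulrA mulNr; congr (_ - _); rewrite mulrA; congr (_ / _); ring.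
have := hd n; rewrite mul1r.
have -> : \sum_(j < n.+1) 'C(n, j)%:R * cum1 j = bc (dl0 R) (pw 1) n - bc (pw 1) d n.
  rewrite (bcC (pw 1)) -bcBl bcE; apply: eq_bigr => j _; by rewrite c1 /pw expr1n mulr1.
by rewrite bc_dl0 /pw expr1n c1; lra.
Qed.

End Bernoulli.

(** * Reordering the modes *)

Section FsumOrder.
Variables (T V : zmodType) (I : Type) (y : I -> nat -> V).
Implicit Types (F G : (nat -> V) -> T).

Lemma fsum_add r x0 F G : fsum y r x0 (fun x => F x + G x) = fsum y r x0 F + fsum y r x0 G.
Proof. by elim: r x0 => [|i r IH] x0 //=; rewrite !IH addrACA. Qed.

Lemma fsum_shift r x0 z F :
  fsum y r (fun k => x0 k + z k) F = fsum y r x0 (fun x => F (fun k => x k + z k)).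
Proof.
elim: r x0 => [|i r IH] x0 //=; rewrite -!IH; congr (_ + fsum _ _ _ _).
by apply/funext => k; rewrite addrAC.
Qed.

Lemma fsum_mid r1 i r2 x0 F :
  fsum y (r1 ++ i :: r2) x0 F = fsum y (r1 ++ r2) x0 F + fsum y (r1 ++ r2) (fun k => x0 k + y i k) F.
Proof.
rewrite !fsum_cat /= fsum_add fsum_shift; congr (_ + fsum _ _ _ _).
Qed.

Lemma fsum_unzip (J : Type) (a b : J -> I) (r : seq J) x0 F :
  fsum y (flatten [seq [:: a n; b n] | n <- r]) x0 F = fsum y (map a r ++ map b r) x0 F.
Proof.
elim: r x0 => [|n r IH] x0 //=.
by rewrite !IH !fsum_mid.
Qed.

End FsumOrder.

(** * Charge and shape of a fermion state *)

Section Sector.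
Variable R : realType.
Local Notation C := R[i].

(** Level [a] of the truncation to [2K] levels has energy [a - K + 1/2]; in the vacuum the levels
    below [K] are occupied. *)
Definition lev (K a k : nat) : R := (a%:R - K%:R + 2^-1) ^+ k.

Lemma modex_lev_up K n k : modex R (true, n) k = lev K (K + n) k.
Proof. by rewrite /modex /= /omx1 /Defs.half /lev natrD; congr (_ ^+ _); lra. Qed.

Lemma modex_lev_down K n k : (n < K)%N -> - modex R (false, n) k = lev K (K - n.+1) k.
Proof.
move=> nK; rewrite /modex /= /omx2 /lev natrB // -natr1.
rewrite exprS mulN1r mulNr opprK -exprMn /Defs.half; congr (_ ^+ _); lra.
Qed.

Lemma lev_base K k : \sum_(n <- iota 0 K) modex R (false, n) k = - \sum_(a < K) lev K a k.
Proof.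
rewrite -(subn0 K) -/(index_iota 0 K) big_mkord subn0 (reindex_inj rev_ord_inj) /= -sumrN.
apply: eq_bigr => i _; rewrite -[LHS]opprK (@modex_lev_down K); last by have := ltn_ord i; lia.
by congr (- lev _ _ _); have := ltn_ord i; lia.
Qed.

Definition xset K (X : {set 'I_(K + K)}) (k : nat) : R :=
  xi_exp R k - \sum_(a < K) lev K a k + \sum_(a in X) lev K a k.

(** A factor of charge -1 empties the level [K - n - 1]. Flipping these modes turns every state into
    its set of occupied levels. *)
Lemma fsum_modes K (F : (nat -> R) -> C) :
  fsum (@modex R) (modes K) (@xi_exp R) F = \sum_(X : {set 'I_(K + K)}) F (xset X).
Proof.
rewrite /modes fsum_unzip fsum_cat.
have -> : (fun x => fsum (@modex R) [seq (false, n) | n <- iota 0 K] x F) =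
  fun x => fsum (fun i : 'I_(K + K) => lev K i) [seq lshift K (rev_ord n) | n <- enum 'I_K]
     (fun k => x k - \sum_(a < K) lev K a k) F.
  apply/funext => x; rewrite fsum_flip -val_enum_ord -map_comp.
  rewrite [LHS]fsum_map [RHS]fsum_map.
  have -> : (fun k => x k + \sum_(i <- [seq (false, nat_of_ord i) | i <- enum 'I_K]) modex R i k) =
     (fun k => x k - \sum_(a < K) lev K a k).
    apply/funext => k; congr (_ + _).
    by rewrite -lev_base -val_enum_ord !big_map.
  apply: fsum_ext => // i k; rewrite /= (@modex_lev_down K) //=; have := ltn_ord i; lia.
pose s : seq 'I_(K + K) := [seq rshift K n | n <- enum 'I_K] ++ [seq lshift K (rev_ord n) | n <- enum 'I_K].
transitivity (fsum (fun i : 'I_(K + K) => lev K i) s (fun k => xi_exp R k - \sum_(a < K) lev K a k) F).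
  rewrite /s fsum_cat fsum_shift -val_enum_ord -map_comp [LHS]fsum_map [RHS]fsum_map.
  by apply: fsum_ext => // i k; rewrite /= (modex_lev_up K).
have us : uniq s.
  rewrite /s cat_uniq; apply/and3P; split.
  - by rewrite map_inj_uniq ?enum_uniq //; exact: rshift_inj.
  - by apply/hasPn => x /mapP[n _ ->]; apply/negP => /mapP[m _ /eqP]; rewrite eq_lrshift.
  - by rewrite map_inj_uniq ?enum_uniq // => a b /lshift_inj /rev_ord_inj.
rewrite fsum_sets //; apply: eq_big => // X; rewrite /=; apply/fintype.subsetP => x _.
rewrite inE /s mem_cat; case: (split_ordP x) => j ->; apply/orP; [right|left].
  by apply/mapP; exists (rev_ord j); rewrite ?mem_enum ?rev_ordK.
by apply/mapP; exists j; rewrite ?mem_enum.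
Qed.

Definition Ph M (l : {ffun 'I_M -> 'I_M.+1}) (k : nat) : R := vv R k + pfrob R l k.

(* [x_k] on the charge-[c] state with shape [l]. *)
Definition xst (c : R) M (l : {ffun 'I_M -> 'I_M.+1}) (k : nat) : R :=
  \sum_(j < k.+1) 'C(k, j)%:R * c ^+ (k - j) * Ph l j + c ^+ k.+1 / k.+1%:R.

Lemma lev_telescope K n k :
  vshift k (n%:R - K%:R) = vshift k (- K%:R) + \sum_(a < n) lev K a k.
Proof.
elim: n => [|n IH]; first by rewrite big_ord0 addr0 sub0r.
by rewrite big_ord_recr /= addrA -IH -natr1 addrAC vshiftS /lev.
Qed.

(** Relative to the sea of charge [c = l0 - K], with regularized power sum [vshift k c], row [i]
    contributes [(lambda_i - i - 1/2 + c)^k - (- i - 1/2 + c)^k]. Expansion in [c] then produces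
    [pfrob]. *)
Lemma xset_beta K l0 M (l : {ffun 'I_M -> 'I_M.+1}) : (l0 <= K + K)%N ->
  is_partition l -> inbox (K + K) l0 l -> xset (beta (K + K) l0 l) = xst (l0%:R - K%:R) l.
Proof.
move=> l0K h1 h2; apply/funext => k; rewrite /xset (@big_beta _ _ l0K R M l (fun a => lev K a k) h1 h2).
set c := l0%:R - K%:R.
have e1 i : (i < l0)%N -> lev K (part l i + (l0.-1 - i)) k = ((part l i)%:R - i%:R - 2^-1 + c) ^+ k.
  move=> il; rewrite /lev /c natrD natrB; last lia.
  have -> : l0%:R = l0.-1%:R + 1 :> R by rewrite natr1 prednK //; lia.
  by congr (_ ^+ _); lra.
have e2 : \sum_(a < l0) lev K a k = \sum_(i < l0) (- i%:R - 2^-1 + c) ^+ k.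
  rewrite (reindex_inj rev_ord_inj) /=; apply: eq_bigr => i _; rewrite /lev /c.
  rewrite natrB ?ltn_ord //.
  have -> : i.+1%:R = i%:R + 1 :> R by rewrite natr1.
  by congr (_ ^+ _); lra.
have e3 : vshift k c = vv R k - \sum_(a < K) lev K a k + \sum_(a < l0) lev K a k.
  rewrite /c lev_telescope; have := lev_telescope K K k; rewrite subrr vshift0; lra.
rewrite (eq_bigr _ (fun (i : 'I_l0) _ => e1 i (ltn_ord i))).
have -> : \sum_(i < l0) ((part l i)%:R - i%:R - 2^-1 + c) ^+ k = \sum_(a < l0) lev K a k +
    \sum_(i < M) (((part l i)%:R - i%:R - 2^-1 + c) ^+ k - (- i%:R - 2^-1 + c) ^+ k).
  rewrite e2 -(@sum_trunc R (fun i => ((part l i)%:R - i%:R - 2^-1 + c) ^+ k - (- i%:R - 2^-1 + c) ^+ k) l0 M).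
  - by rewrite -big_split /=; apply: eq_bigr => i _; rewrite addrC subrK.
  - by move=> i hi; rewrite (inbox_part i h2).1 // sub0r subrr.
  - by move=> i hi; rewrite part_out // sub0r subrr.
rewrite addrA -xi_exp_vv in e3 *; rewrite -e3 /vshift /xst addrAC; congr (_ + _).
have e4 i : ((part l i)%:R - i%:R - 2^-1 + c) ^+ k - (- i%:R - 2^-1 + c) ^+ k =
  \sum_(j < k.+1) 'C(k, j)%:R * c ^+ (k - j) * (((part l i)%:R - i%:R - 2^-1) ^+ j - (- i%:R - 2^-1) ^+ j).
  rewrite ![_ + c]addrC !exprDn -sumrB; apply: eq_bigr => j _.
  by rewrite mulrBr -!(mulrA 'C(k, j)%:R) !(mulr_natl _ 'C(k, j)).
under [X in _ + X]eq_bigr => i _ do rewrite e4.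
rewrite exchange_big /= -big_split /=; apply: eq_bigr => j _.
rewrite -big_distrr /= -mulrDr /Ph pfrobE //; congr (_ * (_ + _)).
by apply: eq_bigr => i _; rewrite part_ord.
Qed.

Lemma fsum_sector K (F : (nat -> R) -> C) :
  fsum (@modex R) (modes K) (@xi_exp R) F =
  \sum_(l0 < (K + K).+1) \sum_(M < ((K + K) * (K + K)).+1)
    \sum_(l : {ffun 'I_M -> 'I_M.+1} | is_partition l && inbox (K + K) l0 l) F (xst (l0%:R - K%:R) l).
Proof.
rewrite fsum_modes.
have cX (X : {set 'I_(K + K)}) : (#|X| < (K + K).+1)%N by rewrite ltnS -[X in (_ <= X)%N](card_ord (K + K)) max_card.
rewrite (partition_big (fun X : {set 'I_(K + K)} => Ordinal (cX X)) xpredT) //=.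
apply: eq_bigr => l0 _; have l0K : (l0 <= K + K)%N by rewrite -ltnS.
have e := @sum_sector _ _ l0K _ (fun X => F (xset X)).
transitivity (\sum_(X : {set 'I_(K + K)} | #|X| == l0) F (xset X)); first by apply: eq_bigl => X; rewrite -val_eqE.
rewrite e; apply: eq_bigr => M _; apply: eq_bigr => l /andP[h1 h2].
by rewrite xset_beta.
Qed.

Lemma Ph0 M (l : {ffun 'I_M -> 'I_M.+1}) : is_partition l -> Ph l 0 = 0.
Proof.
move=> h; rewrite /Ph pfrobE // big1 ?addr0 => [|i _]; last by rewrite !expr0 subrr.
by rewrite /vv /bhalf expr1 mulrA divff ?pnatr_eq0 // mul1r subrr mul0r.
Qed.

Lemma vv1 : vv R 1 = - 24%:R^-1.
Proof.
have b1 : bernoulli 1 = - 2%:R^-1 by rewrite /bernoulli /= big_ord_recl big_ord0 /= bin0; lra.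
have b2 : bernoulli 2 = 6%:R^-1.
  have := bernoulliS 1; rewrite !big_ord_recl big_ord0 /= /bump /= b1 {1}/bernoulli /=.
  have -> : 'C(3, 0) = 1%N by []. have -> : 'C(3, 1) = 3%N by []. have -> : 'C(3, 1 + 1) = 3%N by [].
  by rewrite -[bernoulli (1 + 1)]/(bernoulli 2); lra.
rewrite /vv /bhalf /bern b2 fmorphV /= (_ : ratr 6 = 6 :> R) ?ratr_nat //; lra.
Qed.

Lemma Ph1 M (l : {ffun 'I_M -> 'I_M.+1}) : is_partition l -> Ph l 1 = M%:R - 24%:R^-1.
Proof.
move=> h; rewrite /Ph pfrobE // vv1 addrC; congr (_ - _).
transitivity ((\sum_(i < M) part l i)%:R : R); last by rewrite part_sum.
by rewrite natr_sum; apply: eq_bigr => i _; rewrite part_ord !expr1; lra.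
Qed.

Lemma xst0 c M (l : {ffun 'I_M -> 'I_M.+1}) : is_partition l -> xst c l 0 = c.
Proof. by move=> h; rewrite /xst big_ord_recl big_ord0 Ph0 // mulr0 !addr0 add0r expr1 divr1. Qed.

Lemma xst1 c M (l : {ffun 'I_M -> 'I_M.+1}) : is_partition l ->
  xst c l 1 = c ^+ 2 / 2 + (M%:R - 24%:R^-1).
Proof.
move=> h; rewrite /xst !big_ord_recl big_ord0 Ph0 // mulr0 add0r addr0.
by rewrite (_ : nat_of_ord (lift ord0 ord0) = 1%N) // Ph1 // subnn expr0 binn !mul1r addrC.
Qed.

End Sector.

(** * Growth of partition counts and the Fourier series of V *)

Section PartitionGrowth.
Variable R : realType.
Local Notation C := R[i].

Lemma bdd_poly_iter (c : nat -> R) D : (forall n, 0 <= c n) ->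
  (forall r : R, 0 <= r -> r < 1 -> bdd (fun n => c n * r ^+ n)) ->
  (forall r : R, 0 <= r -> r < 1 -> bdd (fun n => (n.+1%:R ^+ D * c n) * r ^+ n)).
Proof.
move=> c0; elim: D => [|D IH] h r r0 r1.
  by apply: bdd_le (h r r0 r1) => n; rewrite expr0 mul1r.
have c0' n : 0 <= n.+1%:R ^+ D * c n by rewrite mulr_ge0 // exprn_ge0.
have h1 := bdd_poly c0' (IH h) r0 r1.
apply: bdd_le (bddD h1 (IH h r r0 r1)) => n.
rewrite exprS; set p := _ ^+ D; rewrite -(natr1 n) le_eqVlt; apply/orP; left; apply/eqP; ring.
Qed.

Lemma lacunary_bdd (a : nat -> C) (nu : nat -> nat) : (forall j, (j <= nu j)%N) -> growth a ->
  forall r : R, 0 <= r -> r < 1 ->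
  bdd (fun n => (\sum_(j < n.+1) nm (if n == nu j then a j else 0)) * r ^+ n).
Proof.
move=> hn ga r r0 r1; have [B hB] := ga r r0 r1; exists B => N.
apply: le_trans (hB N).
have e n : (n < N)%N -> (\sum_(j < n.+1) nm (if n == nu j then a j else 0)) * r ^+ n <=
   \sum_(j < N) (if n == nu j then nm (a j) * r ^+ n else 0).
  move=> nN; rewrite big_distrl /= (big_ord_widen N (fun j => nm (if n == nu j then a j else 0) * r ^+ n) nN).
  rewrite big_mkcond /=; apply: ler_sum => j _.
  by case: ifP => _; case: ifP; rewrite // ?nm0 ?mul0r ?mulr_ge0 ?nm_ge0 ?exprn_ge0.
apply: le_trans (ler_sum _ (fun (i : 'I_N) _ => e i (ltn_ord i))) _.
rewrite exchange_big /=; apply: ler_sum => j _.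
have [h|h] := ltnP (nu j) N.
  rewrite (bigD1 (Ordinal h)) //= eqxx big1 ?addr0.
    by rewrite ler_wpM2l ?nm_ge0 // -(subnKC (hn j)) exprD ler_piMr ?exprn_ge0 // exprn_ile1 // ltW.
  by move=> i; rewrite -val_eqE /= => /negPf ->.
rewrite big1 ?mulr_ge0 ?nm_ge0 ?exprn_ge0 // => i _.
by rewrite ltn_eqF // (leq_trans (ltn_ord i)).
Qed.

(** Collects the terms of [sum_j a_j u^(nu j)] by exponent; [j <= nu j] is what makes this finite
    range sufficient. *)
Definition lac (a : nat -> C) (nu : nat -> nat) (n : nat) : C := \sum_(j < n.+1) if n == nu j then a j else 0.

Lemma lacunary (a : nat -> C) (nu : nat -> nat) : (forall j, (j <= nu j)%N) -> growth a ->
  growth (lac a nu) /\ forall u, nm u < 1 ->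
    asum (fun j => a j * u ^+ nu j) /\ csum (fun j => a j * u ^+ nu j) = ev (lac a nu) u.
Proof.
move=> hn ga; pose A j n := if n == nu j then a j else 0.
have A0 j n : (n < j)%N -> A j n = 0.
  by move=> h; rewrite /A ltn_eqF // (leq_trans h).
have [gb hc] := ev_triangular A0 (lacunary_bdd hn ga).
split=> // u u1.
have eA j : ev (A j) u = a j * u ^+ nu j.
  rewrite /ev (@csum_finite _ _ (nu j).+1); last by move=> n h; rewrite /A gtn_eqF // mul0r.
  rewrite (bigD1 ord_max) //= /A eqxx big1 ?addr0 // => i; rewrite -val_eqE /= => /negPf ->.
  by rewrite mul0r.
split.
  apply: bdd_le (growth_asum ga u1) => j; rewrite [nm (_ * _)]nmM [nm (a j * u ^+ j)]nmM.
  rewrite ler_wpM2l ?nm_ge0 // [nm (_ ^+ _)]nmX [nm (u ^+ j)]nmX -(subnKC (hn j)) exprD.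
  by rewrite ler_piMr ?exprn_ge0 ?nm_ge0 // exprn_ile1 ?nm_ge0 // ltW.
apply: csum_eqP; apply: cvc_eq (hc u u1) => N.
by apply: eq_bigr => j _; rewrite eA.
Qed.

Definition lterm (a : nat -> C) (nu : nat -> nat) n0 (t : C) (j : nat) : C :=
  a j * ee (((nu j)%:R - n0%:R) / 24%:R * t).

Lemma ltermE a nu n0 t j :
  lterm a nu n0 t j = ee (- (n0%:R / 24%:R) * t) * (a j * q24 t ^+ nu j).
Proof.
rewrite /lterm q24X [RHS]mulrCA -eeD; congr (_ * ee _).
by rewrite -mulrDl [in LHS]mulrBl addrC.
Qed.

Lemma lacunary_sum (a : nat -> C) (nu : nat -> nat) n0 t : (forall j, (j <= nu j)%N) -> growth a -> upper t ->
  asum (lterm a nu n0 t) /\ csum (lterm a nu n0 t) = ee (- (n0%:R / 24%:R) * t) * ev (lac a nu) (q24 t).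
Proof.
move=> hn ga ut; have [gb hb] := lacunary hn ga; have [h <-] := hb _ (nm_q24 ut).
split; first by apply: bdd_le (asumZ (ee (- (n0%:R / 24%:R) * t)) h) => j; rewrite ltermE.
by rewrite -csumZ //; apply: eq_csum => j; rewrite ltermE.
Qed.

Lemma fou_lacunary (a : nat -> C) (nu : nat -> nat) (n0 : nat) : (forall j, (j <= nu j)%N) -> growth a ->
  fou (fun t => csum (lterm a nu n0 t)).
Proof.
move=> hn ga; exists n0, (lac a nu); split=> [|t ut]; first by have [] := lacunary hn ga.
by have [_ ->] := lacunary_sum n0 hn ga ut.
Qed.

Lemma ev_dcoef (b : nat -> C) (u : C) : growth b -> nm u < 1 -> u * ev (dcoef b) u = ev (fun n => n%:R * b n) u.
Proof.
move=> gb u1; rewrite -ev_shift1 //; last exact: growth_dcoef.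
by apply: eq_csum => -[|n] /=; rewrite ?mul0r.
Qed.

Lemma cder_lacunary (a : nat -> C) (nu : nat -> nat) (n0 : nat) t : (forall j, (j <= nu j)%N) ->
  growth a -> growth (fun j => (nu j)%:R * a j) -> upper t ->
  cder (fun t => csum (lterm a nu n0 t)) t
    (tpi R * csum (lterm (fun j => ((nu j)%:R - n0%:R) / 24%:R * a j) nu n0 t)).
Proof.
move=> hn ga gna ut; have q1 := nm_q24 ut.
have [gl _] := lacunary hn ga.
have h1 := cder_comp (cder_eeZ 24%:R^-1 t) (cder_ev gl q1).
have h2 := cderM (cder_eeZ (- (n0%:R / 24%:R)) t) h1.
set l := (X in cder _ _ X) in h2.
apply: (@cder_upper R (fun t => ee (- (n0%:R / 24%:R) * t) * ev (lac a nu) (q24 t))) => // [w uw|].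
  by have [_ ->] := lacunary_sum n0 hn ga uw.
suff -> : tpi R * csum (lterm (fun j => ((nu j)%:R - n0%:R) / 24%:R * a j) nu n0 t) = l by [].
have -> : csum (lterm (fun j => ((nu j)%:R - n0%:R) / 24%:R * a j) nu n0 t) =
  24%:R^-1 * csum (lterm (fun j => (nu j)%:R * a j) nu n0 t) - n0%:R / 24%:R * csum (lterm a nu n0 t).
  have [s1 _] := lacunary_sum n0 hn gna ut; have [s2 _] := lacunary_sum n0 hn ga ut.
  rewrite -!csumZ // -csumB; try exact: asumZ.
  by apply: eq_csum => j; rewrite /lterm; move: (ee _) => E; ring.
have [_ ->] := lacunary_sum n0 hn gna ut; have [_ ->] := lacunary_sum n0 hn ga ut.
have -> : ev (lac (fun j => (nu j)%:R * a j) nu) (q24 t) = q24 t * ev (dcoef (lac a nu)) (q24 t).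
  rewrite ev_dcoef //; apply: eq_csum => n; congr (_ * _).
  by rewrite /lac big_distrr /=; apply: eq_bigr => j _; case: eqP => [h|_]; rewrite ?mulr0 // -h.
rewrite /l -/(q24 t); set E1 := ee _; set q := q24 t; set x1 := ev (dcoef _) q; set x2 := ev _ q.
by move: E1 q x1 x2 => E1 q x1 x2; ring.
Qed.

Definition pcount (M : nat) : R := \sum_(l : {ffun 'I_M -> 'I_M.+1} | is_partition l) 1.

Lemma pcount_ge0 M : 0 <= pcount M. Proof. by apply: sumr_ge0. Qed.

Lemma fsum_exp (a : R) (I : Type) (y : I -> nat -> R) r x0 :
  fsum y r x0 (fun x => expR (- a * x 1%N)) = expR (- a * x0 1%N) * \prod_(i <- r) (1 + expR (- a * y i 1%N)).
Proof.
elim: r x0 => [|i r IH] x0 /=; first by rewrite big_nil mulr1.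
by rewrite !IH big_cons mulrDr expRD; ring.
Qed.

Lemma fsum_RtoC (I : Type) (y : I -> nat -> R) r x0 (F : (nat -> R) -> R) :
  fsum y r x0 (fun x => (F x)%:C) = (fsum y r x0 F)%:C.
Proof. by elim: r x0 => [|i r IH] x0 //=; rewrite !IH rmorphD. Qed.

Lemma modes_prod_le (a : R) K : 0 < a ->
  \prod_(i <- modes K) (1 + expR (- a * modex R i 1%N)) <= expR (2 * (1 - expR (- a))^-1).
Proof.
move=> a0; have r0 : 0 <= expR (- a) by exact: expR_ge0.
have r1 : expR (- a) < 1 by rewrite expR_lt1 oppr_lt0.
have e n b : 1 + expR (- a * modex R (b, n) 1%N) <= expR (expR (- a) ^+ n).
  apply: le_trans (expR_ge1Dx _) _; rewrite ler_expR -expRM_natl ler_expR.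
  have -> : modex R (b, n) 1%N = n%:R + 2^-1.
    by case: b; rewrite /modex /= /omx1 /omx2 /Defs.half ?expr1 // sqrrN expr1n mul1r.
  by rewrite -mulr_natl; nra.
have H (r : seq nat) : \prod_(i <- flatten [seq [:: (true, n); (false, n)] | n <- r]) (1 + expR (- a * modex R i 1%N))
     <= expR (2 * \sum_(n <- r) expR (- a) ^+ n).
  elim: r => [|n r IH]; first by rewrite !big_nil mulr0 expR0.
  rewrite -[flatten _]/((true, n) :: (false, n) :: flatten [seq [:: (true, n); (false, n)] | n <- r]).
  rewrite 2!big_cons [\sum_(n0 <- n :: r) _]big_cons.
  have -> : expR (2 * (expR (- a) ^+ n + \sum_(j <- r) expR (- a) ^+ j)) =
      expR (expR (- a) ^+ n) * (expR (expR (- a) ^+ n) * expR (2 * \sum_(j <- r) expR (- a) ^+ j)).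
    by rewrite -!expRD; congr expR; ring.
  have p0 b : 0 <= 1 + expR (- a * modex R (b, n) 1%N) by rewrite addr_ge0 ?expR_ge0.
  have P0 : 0 <= \prod_(i <- flatten [seq [:: (true, n); (false, n)] | n <- r]) (1 + expR (- a * modex R i 1%N)).
    by apply: prodr_ge0 => i _; rewrite addr_ge0 ?expR_ge0.
  by rewrite ler_pM ?e // ?mulr_ge0 // ler_pM ?e.
apply: le_trans (H _) _; rewrite ler_expR ler_wpM2l // -/(index_iota 0 K) -[iota 0 K]/(iota 0 K).
rewrite -{1}(subn0 K) -/(index_iota 0 K) big_mkord.
have := subrX1 (expR (- a)) K => h.
have h1 : 0 < 1 - expR (- a) by rewrite subr_gt0.
rewrite -[leRHS]mul1r ler_pdivlMr //.
have h2 : 0 <= expR (- a) ^+ K by rewrite exprn_ge0.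
by move: h; rewrite -[(expR (- a) - 1)]opprB => h; nra.
Qed.

Lemma inbox_all M (l : {ffun 'I_M -> 'I_M.+1}) : inbox (M + M) M l.
Proof.
apply/forallP => i; rewrite leqNgt ltn_ord /= addnK -ltnS; exact: ltn_ord.
Qed.

(** With weight [exp(- a x_1)] every state counts positively. At truncation [K = M], the charge-0
    states of size [M] contribute [pcount M exp(- a M)] times the vacuum factor, and the total is a
    product bounded by [modes_prod_le]. *)
Lemma pcount_le (a : R) M : 0 < a -> pcount M * expR (- a) ^+ M <= expR (2 * (1 - expR (- a))^-1).
Proof.
move=> a0; have := @fsum_sector R M (fun x => (expR (- a * x 1%N))%:C).
rewrite fsum_RtoC fsum_exp => /(congr1 (@reC R)); rewrite reC_real !reC_sum => e.
have xi1 : xi_exp R 1 = - 24%:R^-1 by rewrite xi_exp_vv vv1.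
have lb : pcount M * expR (- a * (M%:R - 24%:R^-1)) <=
   expR (- a * xi_exp R 1) * \prod_(i <- modes M) (1 + expR (- a * modex R i 1%N)).
  have hM : (M < (M + M).+1)%N by rewrite ltnS leq_addr.
  have hM2 : (M < ((M + M) * (M + M)).+1)%N by rewrite ltnS; nia.
  rewrite e (bigD1 (Ordinal hM)) //= -[leLHS]addr0 lerD //; last first.
    apply: sumr_ge0 => l0 _; rewrite reC_sum; apply: sumr_ge0 => m _; rewrite reC_sum.
    by apply: sumr_ge0 => l _; rewrite reC_real expR_ge0.
  rewrite reC_sum (bigD1 (Ordinal hM2)) //= -[leLHS]addr0 lerD //; last first.
    by apply: sumr_ge0 => m _; rewrite reC_sum; apply: sumr_ge0 => l _; rewrite reC_real expR_ge0.
  rewrite reC_sum /pcount big_distrl /= le_eqVlt; apply/orP; left; apply/eqP.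
  apply: eq_big => [l|l hl]; first by rewrite inbox_all andbT.
  by rewrite ?reC_real xst1 // subrr expr0n mul0r add0r mul1r.
have h := le_trans lb (ler_wpM2l (expR_ge0 _) (modes_prod_le M a0)).
move: h; rewrite xi1 mulrBr expRD mulrA -mulrN [_ * expR (- a * _)]mulrC ler_pM2l ?expR_gt0 //.
by rewrite [- a * M%:R]mulrC expRM_natl.
Qed.

Lemma pcount_bdd (r : R) : 0 <= r -> r < 1 -> bdd (fun n => pcount n * r ^+ n).
Proof.
move=> r0 r1; pose s := (1 + r) / 2; have s0 : 0 < s by rewrite /s; lra.
have s1 : s < 1 by rewrite /s; lra.
have a0 : 0 < - ln s by rewrite oppr_gt0 ln_lt0 // s0 s1.
have rs : 0 <= r / s by rewrite divr_ge0 // ltW.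
have rs1 : r / s < 1 by rewrite ltr_pdivrMr // mul1r /s; lra.
apply: bdd_le (bddZ (expR_ge0 (2 * (1 - s)^-1)) (bdd_geo rs rs1)) => n.
have := pcount_le n a0; rewrite opprK lnK // => h.
have -> : r ^+ n = s ^+ n * (r / s) ^+ n by rewrite -exprMn mulrC divfK // gt_eqF.
by rewrite mulrA ler_wpM2r // exprn_ge0.
Qed.

Definition Phb k : R := `|vv R k| + 2.

Lemma Ph_le M (l : {ffun 'I_M -> 'I_M.+1}) k : is_partition l -> `|Ph R l k| <= Phb k * M.+1%:R ^+ k.+1.
Proof.
move=> h; rewrite /Ph pfrobE //.
have M1 : 1 <= M.+1%:R ^+ k.+1 :> R by rewrite exprn_ege1 // ler1n.
have hi (i : 'I_M) : `|((l i)%:R - i%:R - 2^-1) ^+ k - (- i%:R - 2^-1) ^+ k| <= 2 * M.+1%:R ^+ k :> R.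
  have a1 : (l i)%:R <= M%:R :> R by rewrite ler_nat -ltnS.
  have a2 : i%:R + 1 <= M%:R :> R by rewrite natr1 ler_nat.
  have a3 : 0 <= (l i)%:R :> R by []. have a4 : 0 <= i%:R :> R by [].
  have a5 : M.+1%:R = M%:R + 1 :> R by rewrite natr1.
  apply: le_trans (ler_normB _ _) _; rewrite [leRHS]mulr_natl [leRHS]mulr2n !normrX.
  by rewrite lerD // lerXn2r ?nnegrE // ler_norml a5; apply/andP; split; lra.
apply: le_trans (ler_normD _ _) _; rewrite /Phb mulrDl lerD //; first by rewrite ler_peMr.
apply: le_trans (ler_norm_sum _ _ _) _; apply: le_trans (ler_sum _ (fun i _ => hi i)) _.
rewrite sumr_const card_ord -[leLHS]mulr_natl exprS [leRHS]mulrCA.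
by apply: ler_wpM2r; rewrite ?mulr_ge0 ?exprn_ge0 // ler_nat.
Qed.

Definition PhC M (l : {ffun 'I_M -> 'I_M.+1}) (k : nat) : C := (Ph R l k)%:C.

Lemma mon_Ph_le ks : exists B D, 0 <= B /\ forall M (l : {ffun 'I_M -> 'I_M.+1}), is_partition l ->
  nm (mon (PhC l) ks) <= B * M.+1%:R ^+ D.
Proof.
elim: ks => [|k ks [B [D [B0 IH]]]].
  by exists 1, 0%N; split=> // M l _; rewrite mon_nil nm1 expr0 mulr1.
have b0 : 0 <= Phb k by rewrite /Phb addr_ge0.
exists (Phb k * B), (k.+1 + D)%N; split=> [|M l h]; first by rewrite mulr_ge0.
rewrite mon_cons [nm (_ * _)]nmM exprD mulrACA ler_pM ?nm_ge0 //; last exact: IH.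
by rewrite nm_real Ph_le.
Qed.

Definition vcoef ks (M : nat) : C := \sum_(l : {ffun 'I_M -> 'I_M.+1} | is_partition l) mon (PhC l) ks.
Definition vterm ks (t : C) (M : nat) : C := ee ((M%:R - 24%:R^-1) * t) * vcoef ks M.
(** Coefficient of V without its power of [2 pi i]. For the empty word it is
    [q^(-1/24) sum_M p(M) q^M = 1/eta], later abbreviated [etai]. *)
Definition Vf ks (t : C) : C := csum (vterm ks t).

(** The majorant serves every subfamily [P] of shapes, because truncation confines the shapes to a
    box that varies with [K]. *)
Lemma vcoef_dom ks : exists2 c : nat -> R, (forall r : R, 0 <= r -> r < 1 -> bdd (fun n => c n * r ^+ n)) &
  forall M (P : pred {ffun 'I_M -> 'I_M.+1}),
    nm (\sum_(l | is_partition l && P l) mon (PhC l) ks) <= c M.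
Proof.
have [B [D [B0 h]]] := mon_Ph_le ks.
exists (fun n => n.+1%:R ^+ D * (B * pcount n)).
  apply: bdd_poly_iter => [n|r r0 r1]; first by rewrite mulr_ge0 ?pcount_ge0.
  by apply: bdd_le (bddZ B0 (pcount_bdd r0 r1)) => n; rewrite mulrA.
move=> M P; apply: le_trans (nm_sum _ _ _) _.
rewrite /pcount !big_distrr /= [leLHS]big_mkcond [leRHS]big_mkcond /=.
apply: ler_sum => l _; case: (boolP (is_partition l)) => //= hl.
have pos : 0 <= M.+1%:R ^+ D * (B * 1) by rewrite mulr1 mulr_ge0 ?exprn_ge0.
by case: ifP => // _; apply: le_trans (h _ _ hl) _; rewrite mulr1 mulrC.
Qed.

Lemma growth_vcoef ks : growth (vcoef ks).
Proof.
have [c hc h] := vcoef_dom ks; apply: growth_le hc => M.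
apply: le_trans (h M xpredT); rewrite /vcoef.
by under [X in _ <= nm X]eq_bigl do rewrite andbT.
Qed.

Lemma vterm_lac ks t : vterm ks t = lterm (vcoef ks) (fun M => (24 * M)%N) 1 t.
Proof.
apply/funext => M; rewrite /vterm /lterm.
have h : 24%:R != 0 :> C by rewrite pnatr_eq0.
have -> : ((24 * M)%N%:R - 1%N%:R) / 24%:R = M%:R - 24%:R^-1 :> C by rewrite natrM mulrBl mulrAC divff // !mul1r.
exact: mulrC.
Qed.

Lemma fou_Vf ks : fou (Vf ks).
Proof.
apply: fou_ext (fou_lacunary 1 _ (growth_vcoef ks)) => [t ut|j]; first by rewrite /Vf vterm_lac.
by rewrite leq_pmull.
Qed.

End PartitionGrowth.

(** * Theta series and their derivatives *)

Section Theta.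
Variable R : realType.
Local Notation C := R[i].
Implicit Types (sg h : bool) (e : nat) (t : C).

Definition sgm sg (m : int) : C := ee ((sg%:R / 2 * m%:~R : R)%:C).
Definition pos h (m : int) : R := m%:~R + h%:R / 2.
Definition thterm sg h e t (m : int) : C := sgm sg m * (pos h m ^+ e)%:C * ee ((pos h m ^+ 2)%:C / 2%:R * t).
(* [th false false 0], [th true false 0], [th false true 0] are theta_3, theta_4, theta_2; the exponent
   [e] inserts [(m + h/2)^e]. *)
Definition th sg h e t : C := zsum (thterm sg h e t).

(** 24 times the exponent [(m + h/2)^2 / 2], for [m = j] here and for [m = - j - 1] in [nuneg]. *)
Definition nupos h (j : nat) : nat := (3 * (2 * j + h) ^ 2)%N.
Definition nuneg h (j : nat) : nat := (3 * (2 * j + 2 - h) ^ 2)%N.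

Lemma nupos_ge h j : (j <= nupos h j)%N. Proof. by rewrite /nupos; nia. Qed.
Lemma nuneg_ge h j : (j <= nuneg h j)%N. Proof. by rewrite /nuneg; case: h; nia. Qed.

Lemma nupos_pos h j : (nupos h j)%:R / 24%:R = (pos h (Posz j) ^+ 2)%:C / 2%:R :> C.
Proof.
rewrite !natC -!fmorph_div /=.
congr (_%:C); rewrite /nupos /pos natrM natrX natrD natrM -pmulrn; by field.
Qed.

Lemma nuneg_pos h j : (nuneg h j)%:R / 24%:R = (pos h (Negz j) ^+ 2)%:C / 2%:R :> C.
Proof.
rewrite !natC -!fmorph_div /=.
congr (_%:C); rewrite /nuneg /pos natrM natrX natrB; last by case: h; lia.
by rewrite natrD natrM NegzE rmorphN /= -pmulrn -natr1; field.
Qed.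

Lemma pos_le h (m : int) : `|pos h m| <= (`|m|%N).+1%:R.
Proof.
rewrite /pos; apply: le_trans (ler_normD _ _) _.
have -> : `|m%:~R| = (`|m|%N)%:R :> R by rewrite -intr_norm -abszE -pmulrn.
have -> : (`|m|%N).+1%:R = (`|m|%N)%:R + 1 :> R by rewrite natr1.
by apply: lerD => //; rewrite ger0_norm; case: h; rewrite /=; lra.
Qed.

Lemma nm_sgm sg m : nm (sgm sg m) = 1. Proof. exact: nm_ee_real. Qed.

Lemma growth_abs (a : nat -> C) (B : R) e : 0 <= B -> (forall j, nm (a j) <= B * j.+2%:R ^+ e) -> growth a.
Proof.
move=> B0 ha; apply: (growth_le (c := fun j => j.+1%:R ^+ e * (B * 2 ^+ e))) => [j|].
  apply: le_trans (ha j) _; rewrite mulrCA ler_wpM2l // -exprMn.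
  rewrite lerXn2r ?nnegrE ?mulr_ge0 // -natrM ler_nat; lia.
apply: bdd_poly_iter => [n|r r0 r1]; first by rewrite mulr_ge0 ?exprn_ge0.
apply: bddZ; last exact: bdd_geo. by rewrite mulr_ge0 ?exprn_ge0.
Qed.

Lemma thterm_pos sg h e t j : thterm sg h e t (Posz j) =
  lterm (fun j => sgm sg (Posz j) * (pos h (Posz j) ^+ e)%:C) (nupos h) 0 t j.
Proof. by rewrite /thterm /lterm subr0 nupos_pos. Qed.

Lemma thterm_neg sg h e t j : thterm sg h e t (Negz j) =
  lterm (fun j => sgm sg (Negz j) * (pos h (Negz j) ^+ e)%:C) (nuneg h) 0 t j.
Proof. by rewrite /thterm /lterm subr0 nuneg_pos. Qed.

Lemma coef_le sg h e (m : int) (j : nat) : (`|m|%N <= j.+1)%N ->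
  nm (sgm sg m * (pos h m ^+ e)%:C) <= 1 * j.+2%:R ^+ e.
Proof.
move=> hj; rewrite [nm (_ * _)]nmM nm_sgm !mul1r nm_real normrX lerXn2r ?nnegrE //.
by apply: le_trans (pos_le h m) _; rewrite ler_nat.
Qed.

Lemma growth_pos sg h e : growth (fun j => sgm sg (Posz j) * (pos h (Posz j) ^+ e)%:C).
Proof. by apply: (@growth_abs _ 1 e) => // j; apply: coef_le; lia. Qed.
Lemma growth_neg sg h e : growth (fun j => sgm sg (Negz j) * (pos h (Negz j) ^+ e)%:C).
Proof. by apply: (@growth_abs _ 1 e) => // j; apply: coef_le; lia. Qed.

Lemma zasum_th sg h e t : upper t -> zasum (thterm sg h e t).
Proof.
move=> ut; split.
  have [s _] := lacunary_sum 0 (nupos_ge h) (growth_pos sg h e) ut.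
  by apply: bdd_le s => j; rewrite thterm_pos.
have [s _] := lacunary_sum 0 (nuneg_ge h) (growth_neg sg h e) ut.
by apply: bdd_le s => j; rewrite thterm_neg.
Qed.

Lemma th_lac sg h e t : upper t -> th sg h e t =
  csum (lterm (fun j => sgm sg (Posz j) * (pos h (Posz j) ^+ e)%:C) (nupos h) 0 t) +
  csum (lterm (fun j => sgm sg (Negz j) * (pos h (Negz j) ^+ e)%:C) (nuneg h) 0 t).
Proof.
move=> ut; have [s1 s2] := zasum_th sg h e ut.
by rewrite /th /zsum csumD // (eq_csum (thterm_pos sg h e t)) (eq_csum (thterm_neg sg h e t)).
Qed.

Lemma fou_th sg h e : fou (th sg h e).
Proof.
apply: fou_ext (fouD (fou_lacunary 0 (nupos_ge h) (growth_pos sg h e)) (fou_lacunary 0 (nuneg_ge h) (growth_neg sg h e))) => t ut.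
by rewrite th_lac.
Qed.

Lemma real_exprSS (x : R) e : (x ^+ e.+2)%:C = (x ^+ e)%:C * (x ^+ 2)%:C :> C.
Proof. by rewrite -rmorphM -exprD addn2. Qed.

(** Differentiation brings down [pi i (m + h/2)^2], hence the jump of [e] by 2. *)
Lemma cder_th sg h e t : upper t -> cder (th sg h e) t (tpi R / 2%:R * th sg h e.+2 t).
Proof.
move=> ut.
have e24 n : (n%:R - 0%:R) / 24%:R = n%:R / 24%:R :> C by rewrite subr0.
have ep j : (nupos h j)%:R / 24%:R * (sgm sg (Posz j) * (pos h (Posz j) ^+ e)%:C) =
   2%:R^-1 * (sgm sg (Posz j) * (pos h (Posz j) ^+ e.+2)%:C).
  rewrite nupos_pos (real_exprSS _ e).
  move: (sgm _ _) ((pos _ _ ^+ e)%:C) ((pos _ _ ^+ 2)%:C) => s x y; ring.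
have en j : (nuneg h j)%:R / 24%:R * (sgm sg (Negz j) * (pos h (Negz j) ^+ e)%:C) =
   2%:R^-1 * (sgm sg (Negz j) * (pos h (Negz j) ^+ e.+2)%:C).
  rewrite nuneg_pos (real_exprSS _ e).
  move: (sgm _ _) ((pos _ _ ^+ e)%:C) ((pos _ _ ^+ 2)%:C) => s x y; ring.
have n24 : 24%:R != 0 :> C by rewrite pnatr_eq0.
have gp : growth (fun j => (nupos h j)%:R * (sgm sg (Posz j) * (pos h (Posz j) ^+ e)%:C)).
  apply: growth_le (growthZ (24%:R / 2%:R) (growth_pos sg h e.+2)) => j.
  by rewrite -[24%:R / 2%:R * _]mulrA -ep [24%:R * _]mulrA [24%:R * (_ / _)]mulrC divfK.
have gn : growth (fun j => (nuneg h j)%:R * (sgm sg (Negz j) * (pos h (Negz j) ^+ e)%:C)).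
  apply: growth_le (growthZ (24%:R / 2%:R) (growth_neg sg h e.+2)) => j.
  by rewrite -[24%:R / 2%:R * _]mulrA -en [24%:R * _]mulrA [24%:R * (_ / _)]mulrC divfK.
have h1 := cderD (cder_lacunary 0 (nupos_ge h) (growth_pos sg h e) gp ut)
                 (cder_lacunary 0 (nuneg_ge h) (growth_neg sg h e) gn ut).
have h2 := cder_upper ut (fun w uw => esym (th_lac sg h e uw)) h1.
suff -> : tpi R / 2%:R * th sg h e.+2 t = tpi R * csum (lterm (fun j => ((nupos h j)%:R - 0%:R) / 24%:R * (sgm sg (Posz j) * (pos h (Posz j) ^+ e)%:C)) (nupos h) 0 t) +
  tpi R * csum (lterm (fun j => ((nuneg h j)%:R - 0%:R) / 24%:R * (sgm sg (Negz j) * (pos h (Negz j) ^+ e)%:C)) (nuneg h) 0 t) by [].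
rewrite th_lac // -mulrDr -mulrA; congr (_ * _); rewrite mulrDr.
have [s1 _] := lacunary_sum 0 (nupos_ge h) (growth_pos sg h e.+2) ut.
have [s2 _] := lacunary_sum 0 (nuneg_ge h) (growth_neg sg h e.+2) ut.
rewrite -!csumZ //; congr (_ + _); apply: eq_csum => j; rewrite /lterm mulrA.
  by rewrite e24 ep.
by rewrite e24 en.
Qed.

End Theta.

(** * Summation over charges and removal of the truncation *)

Section SectorLimit.
Variable R : realType.
Local Notation C := R[i].

Lemma real_exprD (x : R) a b : (x ^+ (a + b))%:C = (x ^+ a)%:C * (x ^+ b)%:C :> C.
Proof. by rewrite -rmorphM -exprD. Qed.

Implicit Types (sg h : bool) (e : nat) (t : C).

(* Sum over the charge [c = l0 - K] and over the shapes that fit in an [l0 x (2K - l0)] box: these are the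
   states of the fermions truncated at level [K]. *)
Definition Sec K (F : R -> forall M, {ffun 'I_M -> 'I_M.+1} -> C) : C :=
  \sum_(l0 < (K + K).+1) \sum_(M < ((K + K) * (K + K)).+1)
    \sum_(l : {ffun 'I_M -> 'I_M.+1} | is_partition l && inbox (K + K) l0 l) F (l0%:R - K%:R) M l.

Lemma Sec_ext K (F G : R -> forall M, {ffun 'I_M -> 'I_M.+1} -> C) :
  (forall c M (l : {ffun 'I_M -> 'I_M.+1}), is_partition l -> F c M l = G c M l) -> Sec K F = Sec K G.
Proof.
move=> H; apply: eq_bigr => l0 _; apply: eq_bigr => M _; apply: eq_bigr => l /andP[hl _]; exact: H.
Qed.

Lemma Sec_add K (F G : R -> forall M, {ffun 'I_M -> 'I_M.+1} -> C) :
  Sec K (fun c M l => F c M l + G c M l) = Sec K F + Sec K G.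
Proof.
rewrite /Sec -big_split /=; apply: eq_bigr => l0 _; rewrite -big_split /=; apply: eq_bigr => M _.
by rewrite -big_split.
Qed.

Lemma Sec_Z K (a : C) (F : R -> forall M, {ffun 'I_M -> 'I_M.+1} -> C) :
  Sec K (fun c M l => a * F c M l) = a * Sec K F.
Proof.
rewrite /Sec big_distrr /=; apply: eq_bigr => l0 _; rewrite big_distrr /=; apply: eq_bigr => M _.
by rewrite big_distrr.
Qed.

Lemma Sec_sum K (I : Type) (r : seq I) (F : I -> R -> forall M, {ffun 'I_M -> 'I_M.+1} -> C) :
  Sec K (fun c M l => \sum_(i <- r) F i c M l) = \sum_(i <- r) Sec K (F i).
Proof.
elim: r => [|i r IH].
  rewrite big_nil -[RHS](mul0r (Sec K (fun _ _ _ => 0))) -Sec_Z.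
  by apply: Sec_ext => c M l _; rewrite big_nil mul0r.
rewrite big_cons -IH -Sec_add; apply: Sec_ext => c M l _; by rewrite big_cons.
Qed.

(** The number of occupied levels at charge [m], as soon as [K >= -m]. *)
Definition lv (K : nat) (m : int) : nat := absz (K%:Z + m).

Definition level_sum ks t K l0 : C := \sum_(M < ((K + K) * (K + K)).+1) (ee ((M%:R - 24%:R^-1) * t) *
    \sum_(l : {ffun 'I_M -> 'I_M.+1} | is_partition l && inbox (K + K) l0 l) mon (PhC R l) ks).

Lemma level_bound ks t : upper t -> exists2 B : R, 0 <= B & forall K l0, nm (level_sum ks t K l0) <= B.
Proof.
move=> ut; have [c hc h] := vcoef_dom R ks.
pose r := nm (ee t); have r1 : r < 1.
  by rewrite /r nm_ee expR_lt1 oppr_lt0 mulr_gt0 // mulr_gt0 // pi_gt0.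
have [B hB] := hc r (nm_ge0 _) r1; pose E := nm (ee (- 24%:R^-1 * t)).
have c0 n : 0 <= c n by apply: le_trans (nm_ge0 _) (h n xpredT).
have B0 : 0 <= B by have := hB 0%N; rewrite big_ord0.
exists (E * B) => [|K l0]; first by rewrite mulr_ge0 ?nm_ge0.
apply: le_trans (nm_sum _ _ _) _; apply: le_trans (ler_wpM2l (nm_ge0 _) (hB ((K + K) * (K + K)).+1)).
rewrite big_distrr /=; apply: ler_sum => M _; rewrite [nm (_ * _)]nmM.
have -> : nm (ee ((M%:R - 24%:R^-1) * t)) = E * r ^+ M.
  by rewrite mulrBl -mulNr addrC eeD [nm (_ * _)]nmM -eeX [nm (_ ^+ _)]nmX.
rewrite -mulrA ler_wpM2l ?nm_ge0 // mulrC ler_wpM2r ?exprn_ge0 ?nm_ge0 //; exact: h.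
Qed.

(** For fixed [m] the box grows in both directions and eventually contains all partitions of a given
    [M]; the majorant does not depend on the box. *)
Lemma level_lim ks t (m : int) : upper t -> cvc (fun K => level_sum ks t K (lv K (m))) (Vf ks t).
Proof.
move=> ut; have [c hc h] := vcoef_dom R ks.
pose r := nm (ee t); have r1 : r < 1.
  by rewrite /r nm_ee expR_lt1 oppr_lt0 mulr_gt0 // mulr_gt0 // pi_gt0.
pose E := nm (ee (- 24%:R^-1 * t)).
have c0 n : 0 <= c n by apply: le_trans (nm_ge0 _) (h n xpredT).
have eE M : nm (ee ((M%:R - 24%:R^-1) * t)) = E * r ^+ M.
  by rewrite mulrBl -mulNr addrC eeD [nm (_ * _)]nmM -eeX [nm (_ ^+ _)]nmX.
apply: (tannery_fin (b := fun M => E * (c M * r ^+ M))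
  (a := fun K M => ee ((M%:R - 24%:R^-1) * t) * \sum_(l : {ffun 'I_M -> 'I_M.+1} | is_partition l && inbox (K + K) (lv K (m)) l) mon (PhC R l) ks)).
- by move=> k; exists k => n hn; nia.
- move=> K M _; rewrite [nm (_ * _)]nmM eE -mulrA ler_wpM2l ?nm_ge0 // mulrC.
  by rewrite ler_wpM2r ?exprn_ge0 ?nm_ge0 //; exact: h.
- by move=> M; rewrite mulr_ge0 ?nm_ge0 // mulr_ge0 ?exprn_ge0 ?nm_ge0.
- by apply: bddZ (hc _ (nm_ge0 _) r1); exact: nm_ge0.
- move=> M; apply: (@cvc_ext _ (fun _ => vterm ks t M) _ _ (M + `|m|)%N) (cvc_cst _) => K hK.
  rewrite /vterm; congr (_ * _); rewrite /vcoef; apply: eq_bigl => l.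
  suff -> : inbox (K + K) (lv K m) l by rewrite andbT.
  rewrite /lv.
  apply/forallP => i; have h1 : (i < M)%N by []. 
  have h2 : (l i <= M)%N by rewrite -ltnS.
  move: (nat_of_ord i) (nat_of_ord (l i)) h1 h2 => {}i j h1 h2.
  apply/andP; split; last lia.
  by apply/implyP => h3; lia.
Qed.

(** A summand in which charge and shape separate: a theta term in [c] times a term of [Vf]. *)
Definition bterm sg h e ks t (c : R) M (l : {ffun 'I_M -> 'I_M.+1}) : C :=
  ee ((sg%:R / 2 * c)%:C) * ((c + h%:R / 2) ^+ e)%:C * ee (((c + h%:R / 2) ^+ 2)%:C / 2%:R * t) *
  (ee ((M%:R - 24%:R^-1) * t) * mon (PhC R l) ks).

Lemma Sec_bterm sg h e ks t K : Sec K (bterm sg h e ks t) =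
  \sum_(j < K.+1) thterm sg h e t (Posz j) * level_sum ks t K (lv K (Posz j)) +
  \sum_(j < K) thterm sg h e t (Negz j) * level_sum ks t K (lv K (Negz j)).
Proof.
have E (m : int) (l0 : nat) : Posz l0 = K%:Z + m -> \sum_(M < ((K + K) * (K + K)).+1)
    \sum_(l : {ffun 'I_M -> 'I_M.+1} | is_partition l && inbox (K + K) l0 l) bterm sg h e ks t (l0%:R - K%:R) l =
    thterm sg h e t m * level_sum ks t K (lv K (m)).
  move=> hm; have -> : l0%:R - K%:R = m%:~R :> R by rewrite -(intrB _ l0 K) /= hm addrAC subrr add0r.
  have -> : lv K m = l0 by rewrite /lv -hm.
  rewrite /level_sum big_distrr /=; apply: eq_bigr => M _; rewrite mulrA big_distrr /=.
  by apply: eq_bigr => l _; rewrite /bterm mulrA.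
rewrite /Sec -(big_mkord xpredT (fun l0 => \sum_(M < ((K + K) * (K + K)).+1)
    \sum_(l : {ffun 'I_M -> 'I_M.+1} | is_partition l && inbox (K + K) l0 l) bterm sg h e ks t (l0%:R - K%:R) l)).
have h1 : (K <= (K + K).+1)%N by lia.
rewrite (big_cat_nat (leq0n K) h1) /= addrC; congr (_ + _).
  rewrite -{1}[K]add0n big_addn subSn ?leq_addl // addnK big_mkord.
  by apply: eq_bigr => j _; apply: E; rewrite PoszD addrC.
rewrite big_mkord (reindex_inj rev_ord_inj) /=; apply: eq_bigr => j _; apply: E.
by have := ltn_ord j; lia.
Qed.

Lemma bterm_lim sg h e ks t : upper t -> cvc (fun K => Sec K (bterm sg h e ks t)) (th sg h e t * Vf ks t).
Proof.
move=> ut; have [B B0 hB] := level_bound ks ut; have [s1 s2] := zasum_th sg h e ut.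
rewrite /th /zsum csumD // mulrDl.
rewrite mulrC -csumZ // [X in _ + X]mulrC -csumZ //.
apply: cvc_eq (fun K => esym (Sec_bterm sg h e ks t K)) _.
apply: cvcD.
  apply: (tannery_fin (b := fun j => B * nm (thterm sg h e t (Posz j)))
     (a := fun K j => thterm sg h e t (Posz j) * level_sum ks t K (lv K (Posz j)))).
  - by move=> k; exists k => n hn; lia.
  - by move=> K n _; rewrite [nm (_ * _)]nmM mulrC ler_wpM2r ?nm_ge0.
  - by move=> j; rewrite mulr_ge0 ?nm_ge0.
  - exact: bddZ.
  - by move=> j; rewrite [X in cvc _ X]mulrC; apply: cvcZ; exact: level_lim.
apply: (tannery_fin (b := fun j => B * nm (thterm sg h e t (Negz j)))
     (a := fun K j => thterm sg h e t (Negz j) * level_sum ks t K (lv K (Negz j))) (k := id)).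
- by move=> k; exists k => n hn; lia.
- by move=> K n _; rewrite [nm (_ * _)]nmM mulrC ler_wpM2r ?nm_ge0.
- by move=> j; rewrite mulr_ge0 ?nm_ge0.
- exact: bddZ.
- by move=> j; rewrite [X in cvc _ X]mulrC; apply: cvcZ; exact: level_lim.
Qed.

(** Expands the factors [xst c l k] one letter at a time: [e] accumulates the power of [c], and
    [ks'] the indices of the factors [Ph]. *)
Fixpoint Glim e (ks' ks : seq nat) t : C :=
  if ks is k :: ks1 then
    \sum_(j < k.+1) 'C(k, j)%:R * Glim (e + (k - j))%N (nat_of_ord j :: ks') ks1 t +
    k.+1%:R^-1 * Glim (e + k.+1)%N ks' ks1 t
  else th false false e t * Vf ks' t.

Lemma Glim_lim e ks' ks t : upper t ->
  cvc (fun K => Sec K (fun c M l => bterm false false e ks' t c l * mon (fun k => (xst c l k)%:C) ks))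
      (Glim e ks' ks t).
Proof.
move=> ut; elim: ks e ks' => [|k ks IH] e ks' /=.
  apply: cvc_eq (bterm_lim false false e ks' ut) => K.
  by apply: Sec_ext => c M l _; rewrite mon_nil mulr1.
pose F e ks' c M (l : {ffun 'I_M -> 'I_M.+1}) := bterm false false e ks' t c l * mon (fun k => (xst c l k)%:C) ks.
have E c M (l : {ffun 'I_M -> 'I_M.+1}) : is_partition l ->
   bterm false false e ks' t c l * mon (fun k => (xst c l k)%:C) (k :: ks) =
   \sum_(j < k.+1) 'C(k, j)%:R * F (e + (k - j))%N (nat_of_ord j :: ks') c M l + k.+1%:R^-1 * F (e + k.+1)%N ks' c M l.
  move=> hl; rewrite mon_cons.
  have -> : (xst c l k)%:C = \sum_(j < k.+1) 'C(k, j)%:R * (c ^+ (k - j))%:C * PhC R l j + k.+1%:R^-1 * (c ^+ k.+1)%:C.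
    rewrite /xst rmorphD rmorph_sum; congr (_ + _); last by rewrite rmorphM fmorphV rmorph_nat mulrC.
    by apply: eq_bigr => j _; rewrite !rmorphM rmorph_nat.
  rewrite mulrDl mulrDr; congr (_ + _).
    rewrite mulrC !big_distrl /=; apply: eq_bigr => j _; rewrite /F /bterm mon_cons.
    rewrite mul0r addr0 (real_exprD _ e).
    by move: (ee _) (ee _) (ee _) (mon _ _) (mon _ _) (PhC _ _ _) (_ ^+ _)%:C (_ ^+ _)%:C => *; ring.
  rewrite /F /bterm mul0r addr0 (real_exprD _ e).
  by move: (ee _) (ee _) (ee _) (mon _ _) (mon _ _) (c ^+ e)%:C (c ^+ k.+1)%:C => *; ring.
apply: (@cvc_eq _ (fun K => \sum_(j < k.+1) 'C(k, j)%:R * Sec K (F (e + (k - j))%N (nat_of_ord j :: ks')) +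
   k.+1%:R^-1 * Sec K (F (e + k.+1)%N ks'))).
  move=> K; rewrite (Sec_ext _ E) Sec_add Sec_sum Sec_Z; congr (_ + _).
  by apply: eq_bigr => j _; rewrite Sec_Z.
apply: cvcD; last by apply: cvcZ; exact: IH.
by apply: cvc_sumI => j; apply: cvcZ; exact: IH.
Qed.

(** Moves the charge from [c] to [c + h/2]: [x_1] gains [h c / 2 + h / 8], which turns [c^2 / 2]
    into [(c + h/2)^2 / 2]. Exponents beyond [x_1] are left alone. *)
Definition tw h (x : nat -> R) (k : nat) : C :=
  (x k + (if k is k'.+1 then if k' is 0%N then h%:R / 2 * x 0%N + h%:R / 8 else 0 else h%:R / 2))%:C.
Definition ymh h (i : bool * nat) (k : nat) : C :=
  (modex R i k + (if k == 1%N then h%:R / 2 * modex R i 0 else 0))%:C.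
Definition xih h : nat -> C := tw h (@xi_exp R).
(** For [sg = true] the charge enters with an alternating sign, which gives theta_4. The pair
    [sg = h = true] would be theta_1; the hypothesis [sg && h = false] below excludes it. *)
Definition chi sg t (x : nat -> C) : C := ee ((sg%:R / 2)%:C * x 0%N) * ee (x 1%N * t).

Lemma chiD sg t x y : chi sg t (fun k => x k + y k) = chi sg t x * chi sg t y.
Proof. by rewrite /chi mulrDr mulrDl !eeD mulrACA. Qed.

Lemma fsum_affine (A : (nat -> R) -> nat -> C) (I : Type) (y : I -> nat -> R) (y' : I -> nat -> C) r x0 (F : (nat -> C) -> C) :
  (forall x i, A (fun k => x k + y i k) = fun k => A x k + y' i k) ->
  fsum y' r (A x0) F = fsum y r x0 (fun x => F (A x)).
Proof. by move=> hA; elim: r x0 => [|i r IH] x0 //=; rewrite -!IH hA. Qed.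

Lemma tw_add h x i : tw h (fun k => x k + modex R i k) = fun k => tw h x k + ymh h i k.
Proof.
apply/funext => k; rewrite /tw /ymh -rmorphD; congr (_%:C).
by case: k => [|[|k]] /=; ring.
Qed.

Lemma Zst_Sec sg h t K ks : Zst (chi sg t) (ymh h) (modes K) (xih h) ks =
  Sec K (fun c M l => chi sg t (tw h (xst c l)) * mon (tw h (xst c l)) ks).
Proof. by rewrite /Zst /xih (fsum_affine _ _ _ (tw_add h)) fsum_sector. Qed.

Lemma tw_xst0 h c M (l : {ffun 'I_M -> 'I_M.+1}) : is_partition l -> tw h (xst c l) 0 = (c + h%:R / 2)%:C.
Proof. by move=> hl; rewrite /tw xst0. Qed.

Lemma chi_xst sg h t c M (l : {ffun 'I_M -> 'I_M.+1}) : sg && h = false -> is_partition l ->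
  chi sg t (tw h (xst c l)) =
  ee ((sg%:R / 2 * c)%:C) * ee (((c + h%:R / 2) ^+ 2)%:C / 2%:R * t) * ee ((M%:R - 24%:R^-1) * t).
Proof.
move=> hsg hl; rewrite /chi tw_xst0 // -[RHS]mulrA -[in RHS]eeD -mulrDl -rmorphM.
have -> : sg%:R / 2 * (c + h%:R / 2) = sg%:R / 2 * c by case: sg h hsg => -[] //= _; ring.
suff -> : tw h (xst c l) 1 = ((c + h%:R / 2) ^+ 2)%:C / 2%:R + (M%:R - 24%:R^-1) by [].
rewrite /tw xst0 // xst1 // !natC -!fmorphV -!rmorphM -rmorphB -rmorphD; congr (_%:C).
by case: h {hsg} => /=; field.
Qed.

(** Words in the letter 0 insert powers of the shifted charge only, so the shapes enter merely
    through their number. *)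
Lemma Zst_th sg h e t : sg && h = false -> upper t ->
  cvc (fun K => Zst (chi sg t) (ymh h) (modes K) (xih h) (nseq e 0%N)) (th sg h e t * Vf [::] t).
Proof.
move=> hsg ut; apply: cvc_eq (bterm_lim sg h e [::] ut) => K; rewrite Zst_Sec.
apply: Sec_ext => c M l hl; rewrite chi_xst // /bterm mon_nil mulr1.
have -> : mon (tw h (xst c l)) (nseq e 0%N) = ((c + h%:R / 2) ^+ e)%:C.
  by rewrite rmorphXn /=; elim: e => [|e IH] /=; rewrite ?mon_nil // mon_cons IH tw_xst0 // exprS.
by move: (ee _) (ee _) (ee _) => *; ring.
Qed.

Lemma chi_false t x : chi false t x = enchi t x.
Proof. by rewrite /chi !mul0r ee0 mul1r. Qed.

Lemma ymh_false : ymh false = @ymode R.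
Proof. by apply/funext => i; apply/funext => k; rewrite /ymh /ymode mul0r mul0r; case: eqP; rewrite addr0. Qed.

Lemma tw_false x : tw false x = fun k => (x k)%:C.
Proof. by apply/funext => -[|[|k]]; rewrite /tw /= ?mul0r ?mul0r !addr0. Qed.

Lemma Zst_Glim ks t : upper t -> cvc (fun K => Zst (enchi t) (@ymode R) (modes K) (@xiC R) ks) (Glim 0 [::] ks t).
Proof.
move=> ut; apply: cvc_eq (Glim_lim 0 [::] ks ut) => K.
have -> : enchi t = chi false t by apply/funext => x; rewrite chi_false.
have -> : @xiC R = xih false by rewrite /xih tw_false.
rewrite -ymh_false Zst_Sec; apply: Sec_ext => c M l hl.
rewrite chi_xst // tw_false /bterm expr0 mon_nil !mulr1.
by move: (ee _) (ee _) (ee _) => *; ring.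
Qed.

End SectorLimit.

(** * Product formulas and [theta_2 theta_3 theta_4 = 2 eta^3] *)

Section Products.
Variable R : realType.
Local Notation C := R[i].
Implicit Types (t q : C).

Lemma Zst_nil (I : Type) (ch : (nat -> C) -> C) (y : I -> nat -> C) r x0 :
  (forall x z, ch (fun k => x k + z k) = ch x * ch z) ->
  Zst ch y r x0 [::] = ch x0 * \prod_(i <- r) (1 + ch (y i)).
Proof.
move=> hc; rewrite /Zst; elim: r x0 => [|i r IH] x0 /=; first by rewrite big_nil mon_nil.
by rewrite !IH big_cons hc mulrA -mulrDl mulrDr mulr1.
Qed.

Lemma prod_modes (F : bool * nat -> C) K :
  \prod_(i <- modes K) F i = \prod_(n < K) (F (true, nat_of_ord n) * F (false, nat_of_ord n)).
Proof.
rewrite /modes -val_enum_ord -map_comp big_flatten big_map big_enum /=.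
by apply: eq_bigr => n _; rewrite !big_cons big_nil mulr1.
Qed.

Definition sgn (sg : bool) : C := if sg then -1 else 1.

Lemma ee_sgn (sg : bool) (x : R) : x = 1 \/ x = -1 -> ee ((sg%:R / 2)%:C * x%:C) = sgn sg.
Proof.
move=> hx; case: sg => /=; last by rewrite mul0r mul0r ee0.
have e2 : (1 / 2 : R)%:C = 2%:R^-1 :> C by rewrite natC -fmorphV div1r.
case: hx => ->; rewrite e2 ?rmorphN rmorph1 ?mulrN mulr1 ?eeN ee_half //.
by rewrite invrN invr1.
Qed.

Lemma chi_ymh (sg h : bool) t (b : bool) n :
  chi sg t (ymh R h (b, n)) = sgn sg * ee ((n%:R + 2%:R^-1 + (if b then h%:R / 2%:R else - (h%:R / 2%:R))) * t).
Proof.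
have y0 : ymh R h (b, n) 0 = (if b then 1 else -1)%:C.
  rewrite /ymh /= addr0 /modex /=; case: b; rewrite /omx1 /omx2 /= ?expr0 ?mulr1 //.
have y1 : ymh R h (b, n) 1 = n%:R + 2%:R^-1 + (if b then h%:R / 2%:R else - (h%:R / 2%:R)).
  rewrite /ymh /= /modex /=; case: b {y0} => /=; rewrite /omx1 /omx2 /Defs.half ?expr0 ?expr1 ?sqrrN ?expr1n ?mul1r ?mulr1.
    by rewrite !natC -!fmorphV -!rmorphM -!rmorphD.
  by rewrite mulrN1 !natC -!fmorphV -!rmorphM -!rmorphD -rmorphB.
by rewrite /chi y0 y1 ee_sgn //; case: b {y0 y1}; [left|right].
Qed.

Lemma chi_xih (sg h : bool) t : sg && h = false ->
  chi sg t (xih R h) = ee ((h%:R / 8%:R - 24%:R^-1) * t).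
Proof.
move=> hsg; have x0 : xih R h 0 = (h%:R / 2)%:C.
  by rewrite /xih /tw xi_exp_vv /vv /bhalf expr1 mulrA divff ?pnatr_eq0 // mul1r subrr mul0r add0r.
have x1 : xih R h 1 = h%:R / 8%:R - 24%:R^-1.
  have xi0 : xi_exp R 0 = 0 by rewrite /xi_exp.
  rewrite /xih /tw xi0 mulr0 add0r xi_exp_vv vv1 addrC.
  by rewrite !natC -!fmorphV -!rmorphM -rmorphB.
rewrite /chi x0 x1 -rmorphM; case: sg h hsg {x0 x1} => -[] //= _.
- by rewrite mul0r mulr0 ee0 mul1r.
- by rewrite mul0r mul0r ee0 mul1r.
- by rewrite mul0r mul0r ee0 mul1r.
Qed.

(** Jacobi's triple product divided by eta: the state sum of the empty word, evaluated once as a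
    product and once by charge and shape. *)
Lemma th_product (sg h : bool) t : sg && h = false -> upper t ->
  cvc (fun K => ee ((h%:R / 8%:R - 24%:R^-1) * t) * \prod_(n < K)
     ((1 + sgn sg * ee ((n%:R + 2%:R^-1 + h%:R / 2%:R) * t)) * (1 + sgn sg * ee ((n%:R + 2%:R^-1 - h%:R / 2%:R) * t))))
  (th sg h 0 t * Vf [::] t).
Proof.
move=> hsg ut; apply: cvc_eq (Zst_th 0 hsg ut) => K.
rewrite Zst_nil; last exact: chiD.
by rewrite chi_xih // prod_modes; congr (_ * _); apply: eq_bigr => n _; rewrite !chi_ymh.
Qed.

Lemma prod_near1 (I : Type) (r : seq I) (z : I -> C) : \sum_(i <- r) nm (z i) <= 2^-1 ->
  nm (\prod_(i <- r) (1 - z i) - 1) <= 2 * \sum_(i <- r) nm (z i).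
Proof.
elim: r => [|i r IH]; first by rewrite !big_nil subrr nm0 mulr0.
rewrite !big_cons => h; have z0 := nm_ge0 (z i).
have {}IH := IH ltac:(lra); set P := \prod_(j <- r) _ in IH *.
have -> : (1 - z i) * P - 1 = (P - 1) - z i * P by ring.
have h1 := nmB (P - 1) (z i * P); rewrite [nm (z i * P)]nmM in h1.
have h2 := nmD (P - 1) 1; rewrite subrK nm1 in h2.
have := nm_ge0 P; nra.
Qed.

Lemma nq_null q : nm q < 1 -> null (fun n => n%:R * nm q ^+ n).
Proof.
move=> q1; have g1 : growth (fun _ : nat => 1 : C).
  by move=> r r0 r1; apply: bdd_le (bdd_geo r0 r1) => n; rewrite nm1 mul1r.
have := cvc_nm (asum_null (growth_asum (growth_poly g1) q1)).
apply: null_le => n; rewrite subr0 mulr1 [nm (_ * _)]nmM nm_nat [nm (_ ^+ _)]nmX //.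
Qed.

(** After multiplication by [prod_(n <= K) (1 - q^n)], the factors [(1 + q^n)(1 - q^n)] become those
    of even exponent and, with the odd ones, fill up [prod_(n <= 2K) (1 - q^n)]. *)
Lemma euler_finite q K :
  (forall n, 1 - q ^+ n.+1 != 0) ->
  \prod_(n < K) ((1 + q ^+ n.+1) * (1 - q ^+ (2 * n + 1))) = \prod_(n < K) (1 - q ^+ (K + n).+1).
Proof.
move=> h; pose D m := \prod_(n < m) (1 - q ^+ n.+1).
have D0 m : D m != 0 by apply/prodf_neq0 => n _.
have eD m n : D (m + n)%N = D m * \prod_(i < n) (1 - q ^+ (m + i).+1).
  elim: n => [|n IH]; first by rewrite addn0 big_ord0 mulr1.
  by rewrite addnS {1}/D big_ord_recr /= -/(D (m + n)%N) IH big_ord_recr /= mulrA.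
have DS m : D m.+1 = D m * (1 - q ^+ m.+1) by rewrite /D big_ord_recr.
apply: (mulfI (D0 K)); rewrite -eD addnn.
elim: K => [|K IH]; first by rewrite /D !big_ord0 mulr1.
rewrite doubleS !DS -IH big_ord_recr /=; set P := \prod_(n < K) _.
have -> : (2 * K + 1 = K.*2.+1)%N by rewrite mul2n addn1.
have -> : q ^+ K.*2.+2 = q ^+ K.+1 * q ^+ K.+1 by rewrite -exprD addnn doubleS.
ring.
Qed.

Lemma euler_limit q : nm q < 1 ->
  cvc (fun K => \prod_(n < K) ((1 + q ^+ n.+1) * (1 - q ^+ (2 * n + 1)))) 1.
Proof.
move=> q1; have h n : 1 - q ^+ n.+1 != 0.
  apply/eqP => /eqP; rewrite subr_eq0 => /eqP/(congr1 (@nm R)); rewrite nm1 [nm (_ ^+ _)]nmX => /esym e.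
  by have := exprn_ilt1 n.+1 (nm_ge0 q) q1; rewrite e ltxx.
have S K : \sum_(n < K) nm (q ^+ (K + n).+1) <= K%:R * nm q ^+ K.
  have -> : K%:R * nm q ^+ K = \sum_(n < K) nm q ^+ K by rewrite sumr_const card_ord mulr_natl.
  apply: ler_sum => n _; rewrite [nm (_ ^+ _)]nmX -addnS exprD ler_piMr ?exprn_ge0 ?nm_ge0 //.
  by rewrite exprn_ile1 ?nm_ge0 // ltW.
have [N0 hN] := nq_null q1 (ltac:(lra) : 0 < 2^-1 :> R).
apply: (@cvc_null_ev _ _ _ (fun K => 2 * (K%:R * nm q ^+ K)) N0).
  move=> K hK; rewrite euler_finite //.
  apply: le_trans (prod_near1 _) _; last by rewrite ler_wpM2l.
  by apply: le_trans (S K) (ltW (hN K hK)).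
by apply: nullZ (nq_null q1) => // n; rewrite mulr_ge0 ?exprn_ge0 ?nm_ge0.
Qed.

Lemma nm_q t : upper t -> nm (ee t) < 1.
Proof. by move=> ut; rewrite nm_ee expR_lt1 oppr_lt0 mulr_gt0 // mulr_gt0 // pi_gt0. Qed.

Notation etai := (Vf (R := R) [::]).

(** In the limit theta_3 and theta_4 combine to [prod (1 - q^(2n-1))^2] and theta_2 gives
    [2 prod (1 + q^n)^2], the 2 being its factor [1 + q^0]; the fractional powers of [q] cancel and
    Euler's identity makes the rest 1. *)
Lemma triple_product t : upper t ->
  th false false 0 t * th true false 0 t * th false true 0 t * etai t ^+ 3 = 2%:R.
Proof.
move=> ut; set q := ee t; have q1 : nm q < 1 := nm_q ut.
have h3 := th_product (erefl : false && false = false) ut.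
have h4 := th_product (erefl : true && false = false) ut.
have h2 := th_product (erefl : false && true = false) ut.
have H := cvcM (cvcM h3 h4) h2.
have qK : cvc (fun K => q ^+ K) 0.
  have g1 : growth (fun _ : nat => 1 : C).
    by move=> r r0 r1; apply: bdd_le (bdd_geo r0 r1) => n; rewrite nm1 mul1r.
  by apply: cvc_eq (asum_null (growth_asum g1 q1)) => n; rewrite mul1r.
have n1 K : 1 + q ^+ K.+1 != 0.
  apply/eqP => /eqP; rewrite addrC addr_eq0 => /eqP/(congr1 (@nm R)); rewrite nmN nm1 [nm (_ ^+ _)]nmX => e.
  by have := exprn_ilt1 K.+1 (nm_ge0 q) q1; rewrite e ltxx.
have L : cvc (fun K => 2%:R * (\prod_(n < K) ((1 + q ^+ n.+1) * (1 - q ^+ (2 * n + 1)))) ^+ 2 * (1 + q ^+ K)^-1) (2%:R * 1 ^+ 2 * 1^-1).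
  apply: cvcM; first by apply: cvcZ; apply: cvcX; exact: euler_limit.
  apply: cvcV; first exact: oner_neq0.
  by rewrite -[X in cvc _ X]addr0; apply: cvcD => //; exact: cvc_cst.
rewrite expr1n invr1 !mulr1 in L.
have -> : th false false 0 t * th true false 0 t * th false true 0 t * etai t ^+ 3 =
  th false false 0 t * etai t * (th true false 0 t * etai t) * (th false true 0 t * etai t).
  by move: (th _ _ _ t) (th _ _ _ t) (th _ _ _ t) (etai t) => *; ring.
apply: (cvc_unique H); apply: (@cvc_ext _ _ _ _ 1%N) L => -[//|K] _.
pose p := ee (2%:R^-1 * t).
have pp n : ee ((n%:R + 2%:R^-1) * t) = p * q ^+ n by rewrite mulrDl addrC eeD eeX.
have p2 : p * p = q.
  by rewrite -eeD -mulrDl (_ : 2%:R^-1 + 2%:R^-1 = 1) ?mul1r //; field.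
have E0 : ee ((0%:R / 8%:R - 24%:R^-1) * t) * ee ((0%:R / 8%:R - 24%:R^-1) * t) * ee ((1%:R / 8%:R - 24%:R^-1) * t) = 1.
  rewrite -!eeD -!mulrDl (_ : (_ + _) = 0) ?mul0r ?ee0 //; by field.
rewrite [RHS](_ : _ = ee ((0%:R / 8%:R - 24%:R^-1) * t) * ee ((0%:R / 8%:R - 24%:R^-1) * t) * ee ((1%:R / 8%:R - 24%:R^-1) * t) *
   (\prod_(n < K.+1) ((1 + p * q ^+ n) * (1 - p * q ^+ n)) ^+ 2 * \prod_(n < K.+1) ((1 + q ^+ n.+1) * (1 + q ^+ n)))); last first.
  have -> : \prod_(n < K.+1) ((1 + p * q ^+ n) * (1 - p * q ^+ n)) ^+ 2 =
     \prod_(n < K.+1) ((1 + p * q ^+ n) * (1 + p * q ^+ n)) * \prod_(n < K.+1) ((1 - p * q ^+ n) * (1 - p * q ^+ n)).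
    by rewrite -big_split /=; apply: eq_bigr => n _; rewrite expr2 mulrACA.
  rewrite /sgn /=; set P3 := (X in _ = _ * (X * _ * _)); set P4 := (X in _ = _ * (_ * X * _)); set P2 := (X in _ = _ * (_ * X)).
  have -> : P3 = \prod_(n < K.+1) ((1 + 1 * ee ((n%:R + 2%:R^-1 + 0%:R / 2%:R) * t)) * (1 + 1 * ee ((n%:R + 2%:R^-1 - 0%:R / 2%:R) * t))).
    by apply: eq_bigr => n _; rewrite mul0r addr0 subr0 mul1r pp.
  have -> : P4 = \prod_(n < K.+1) ((1 + -1 * ee ((n%:R + 2%:R^-1 + 0%:R / 2%:R) * t)) * (1 + -1 * ee ((n%:R + 2%:R^-1 - 0%:R / 2%:R) * t))).
    by apply: eq_bigr => n _; rewrite mul0r addr0 subr0 mulN1r pp.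
  have -> : P2 = \prod_(n < K.+1) ((1 + 1 * ee ((n%:R + 2%:R^-1 + 1%:R / 2%:R) * t)) * (1 + 1 * ee ((n%:R + 2%:R^-1 - 1%:R / 2%:R) * t))).
    apply: eq_bigr => n _; rewrite mul1r mul1r !eeX; congr ((1 + ee _) * (1 + ee _)).
      by rewrite -natr1; congr (_ * _); field.
    by congr (_ * _); field.
  move: (ee _) (ee _) => a b; set A := \prod_(n < K.+1) _; set B := \prod_(n < K.+1) _; set D := \prod_(n < K.+1) _.
  by ring.
rewrite E0 mul1r.
have -> : \prod_(n < K.+1) ((1 + q ^+ n.+1) * (1 + q ^+ n)) = 2%:R * (\prod_(n < K.+1) (1 + q ^+ n.+1)) ^+ 2 * (1 + q ^+ K.+1)^-1.
  rewrite big_split /= [X in _ * X]big_ord_recl expr0 /= [X in X * _]big_ord_recr /=.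
  rewrite [in RHS]big_ord_recr /=; set P := \prod_(i < K) (1 + q ^+ i.+1);
  by field; exact: n1.
rewrite big_split /= prodrXl; set A := \prod_(n < _) (1 + _); set B := \prod_(n < _) (1 - _).
have -> : \prod_(i < K.+1) ((1 + p * q ^+ i) * (1 - p * q ^+ i)) = B.
  apply: eq_bigr => n _; have -> : q ^+ (2 * n + 1) = p * q ^+ n * (p * q ^+ n).
    by rewrite mulrACA p2 -exprD addn1 exprS mul2n addnn.
  ring.
ring.
Qed.

End Products.

(** * Moebius action and generators of SL2(Z) *)

Section Matrices.
Variable R : realType.
Local Notation C := R[i].
Implicit Types (g h : 'M[int]_2) (t : C) (a b c d : int).

Definition mk a b c d : 'M[int]_2 :=
  \matrix_(i < 2, j < 2) (if i == 0 then (if j == 0 then a else b) else (if j == 0 then c else d)).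

Lemma mk00 a b c d : mk a b c d 0 0 = a. Proof. by rewrite mxE. Qed.
Lemma mk01 a b c d : mk a b c d 0 1 = b. Proof. by rewrite mxE. Qed.
Lemma mk10 a b c d : mk a b c d 1 0 = c. Proof. by rewrite mxE. Qed.
Lemma mk11 a b c d : mk a b c d 1 1 = d. Proof. by rewrite mxE. Qed.
Definition mkE := (mk00, mk01, mk10, mk11).

Lemma ord2P (P : 'I_2 -> Prop) : P 0 -> P 1 -> forall i, P i.
Proof.
move=> h0 h1 i; have [->|->] // : i = 0 \/ i = 1.
by case: i => -[|[|//]] hi; [left|right]; apply/val_inj.
Qed.

Lemma mx2_ext g h : g 0 0 = h 0 0 -> g 0 1 = h 0 1 -> g 1 0 = h 1 0 -> g 1 1 = h 1 1 -> g = h.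
Proof.
by move=> h1 h2 h3 h4; apply/matrixP; apply: ord2P; apply: ord2P.
Qed.

Lemma mk_eta g : g = mk (g 0 0) (g 0 1) (g 1 0) (g 1 1).
Proof. by apply: mx2_ext; rewrite mkE. Qed.

Lemma mul2E g h i j : (g *m h) i j = g i 0 * h 0 j + g i 1 * h 1 j.
Proof.
rewrite mxE big_ord_recl big_ord_recl big_ord0 addr0; congr (_ + g i _ * h _ j); exact: val_inj.
Qed.

Lemma det2E g : \det g = g 0 0 * g 1 1 - g 0 1 * g 1 0.
Proof.
rewrite (expand_det_row _ 0) big_ord_recl big_ord_recl big_ord0 addr0 /cofactor !det_mx11 !mxE /=.
rewrite expr0 mul1r (_ : 0 + bump 0 0 = 1)%N // expr1 mulN1r mulrN.
by congr (_ * g _ _ - g _ _ * g _ _); apply/val_inj.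
Qed.

Lemma mk_mul a b c d a' b' c' d' : mk a b c d *m mk a' b' c' d' =
  mk (a * a' + b * c') (a * b' + b * d') (c * a' + d * c') (c * b' + d * d').
Proof. by apply: mx2_ext; rewrite mul2E !mkE. Qed.

Lemma SL2_mul g h : SL2Z g -> SL2Z h -> SL2Z (g *m h).
Proof. by rewrite /SL2Z => hg hh; rewrite det_mulmx hg hh mulr1. Qed.

Lemma SL2_unit g : SL2Z g -> g \in unitmx.
Proof. by rewrite /SL2Z unitmxE => ->; rewrite unitr1. Qed.

Lemma SL2_inv g : SL2Z g -> SL2Z (invmx g).
Proof. by move=> hg; rewrite /SL2Z det_inv hg invr1. Qed.

Definition J g t : C := (g 1 0)%:~R * t + (g 1 1)%:~R.

Lemma intC (m : int) : (m%:~R : C) = (m%:~R : R)%:C.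
Proof. by rewrite rmorph_int. Qed.

Lemma J_neq0 g t : SL2Z g -> upper t -> J g t != 0.
Proof.
rewrite /SL2Z det2E => hg ut; apply/eqP => h.
have e1 : (g 1 0)%:~R * imC t = 0 :> R.
  have := congr1 (@imC R) h; rewrite /J !intC imCD imCMr imC_real addr0 => ->; by [].
have c0 : g 1 0 = 0.
  by move/eqP: e1; rewrite mulf_eq0 (gt_eqF ut) orbF intr_eq0 => /eqP.
have d0 : g 1 1 = 0.
  by move/eqP: h; rewrite /J c0 mul0r add0r intr_eq0 => /eqP.
by move: hg; rewrite c0 d0 !mulr0 subr0.
Qed.

Lemma mob_num g t : SL2Z g -> upper t -> mob g t * J g t = (g 0 0)%:~R * t + (g 0 1)%:~R.
Proof. by move=> hg ut; rewrite /mob divfK // J_neq0. Qed.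

Lemma upper_mob g t : SL2Z g -> upper t -> upper (mob g t).
Proof.
move=> hg ut; have J0 := J_neq0 hg ut; have e := mob_num hg ut; move: (mob g t) e => z e.
have hr : reC z * reC (J g t) - imC z * imC (J g t) = (g 0 0)%:~R * reC t + (g 0 1)%:~R.
  by rewrite -reCM e !intC reCD reCMr.
have hi : reC z * imC (J g t) + imC z * reC (J g t) = (g 0 0)%:~R * imC t.
  by rewrite -imCM e !intC imCD imCMr imC_real addr0.
have e1 : reC (J g t) = (g 1 0)%:~R * reC t + (g 1 1)%:~R by rewrite /J !intC reCD reCMr reC_real.
have e2 : imC (J g t) = (g 1 0)%:~R * imC t by rewrite /J !intC imCD imCMr imC_real addr0.
have det : (g 0 0)%:~R * (g 1 1)%:~R - (g 0 1)%:~R * (g 1 0)%:~R = 1 :> R.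
  by rewrite -!intrM -intrB -det2E hg.
have pos : 0 < reC (J g t) ^+ 2 + imC (J g t) ^+ 2.
  have := J0; rewrite -nm_gt0 => h; have := exprn_gt0 2 h; rewrite /nm sqr_sqrtr //.
  by rewrite addr_ge0 // sqr_ge0.
rewrite /upper in ut *; have : imC (z) * (reC (J g t) ^+ 2 + imC (J g t) ^+ 2) = imC t.
  transitivity (reC (J g t) * (reC (z) * imC (J g t) + imC (z) * reC (J g t)) -
    imC (J g t) * (reC (z) * reC (J g t) - imC (z) * imC (J g t))); first by ring.
  transitivity (((g 0 0)%:~R * (g 1 1)%:~R - (g 0 1)%:~R * (g 1 0)%:~R) * imC t); last by rewrite det mul1r.
  by rewrite hr hi e1 e2; ring.
by move=> h; rewrite -(pmulr_lgt0 _ pos) h.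
Qed.

Lemma J_mul g h t : SL2Z h -> upper t -> J (g *m h) t = J g (mob h t) * J h t.
Proof.
move=> hh ut; rewrite {2}/J mulrDl -mulrA mob_num // /J !mul2E !rmorphD !rmorphM /=; ring.
Qed.

Lemma mob_mul g h t : SL2Z g -> SL2Z h -> upper t -> mob (g *m h) t = mob g (mob h t).
Proof.
move=> hg hh ut; apply: (mulIf (J_neq0 (SL2_mul hg hh) ut)).
rewrite mob_num //; last exact: SL2_mul.
rewrite J_mul // mulrA mob_num //; last exact: upper_mob.
by rewrite mulrDl -mulrA mob_num // /J !mul2E !rmorphD !rmorphM /=; ring.
Qed.

Lemma mob1 t : mob 1%:M t = t.
Proof. by rewrite /mob !mxE /= !mul1r mul0r !addr0 add0r divr1. Qed.

(** Euclidean division on the lower row, by induction on [|c|]. The inverses of both generators are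
    words in the generators, so closure under products suffices. *)
Lemma SL2Z_ind (P : 'M[int]_2 -> Prop) :
  (forall g h, P g -> P h -> P (g *m h)) -> P (mk 0 (-1) 1 0) -> P (mk 1 1 0 1) ->
  forall g, SL2Z g -> P g.
Proof.
move=> PM PS PT.
have PS2 : P (mk (-1) 0 0 (-1)) by have := PM _ _ PS PS; rewrite mk_mul.
have PS3 : P (mk 0 1 (-1) 0) by have := PM _ _ PS2 PS; rewrite mk_mul.
have PTi : P (mk 1 (-1) 0 1).
  by have := PM _ _ PS2 (PM _ _ PS (PM _ _ PT (PM _ _ PS (PM _ _ PT PS)))); rewrite !mk_mul.
have PTn (n : int) : P (mk 1 n 0 1).
  elim: n => [|n IH|n IH].
  - by have := PM _ _ PT PTi; rewrite mk_mul.
  - have := PM _ _ IH PT; rewrite mk_mul; congr (P (mk _ _ _ _)); lia.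
  - have := PM _ _ IH PTi; rewrite mk_mul; congr (P (mk _ _ _ _)); lia.
have H n : forall a b c d, (`|c| <= n)%N -> a * d - b * c = 1 -> P (mk a b c d).
  elim: n => [|n IH] a b c d hc hd.
    have c0 : c = 0 by lia.
    rewrite c0 mulr0 subr0 in hd *.
    have [[-> ->]|[-> ->]] : (a = 1 /\ d = 1) \/ (a = -1 /\ d = -1).
      have : absz (a * d) = 1%N by rewrite hd.
      by rewrite abszM => /eqP; rewrite muln_eq1 => /andP[/eqP h1 /eqP h2]; nia.
    - exact: PTn.
    - have := PM _ _ PS2 (PTn (- b)); rewrite mk_mul; congr (P (mk _ _ _ _)); lia.
  have [c0|c0] := eqVneq c 0; first by apply: IH hd; rewrite c0.
  set q := (d %/ c)%Z; set r := (d %% c)%Z.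
  have e : d = q * c + r by exact: divz_eq.
  have r0 : 0 <= r by exact: modz_ge0.
  have r1 : r < `|c| by exact: ltz_mod.
  have Pr : P (mk (b - q * a) (- a) r (- c)).
    apply: IH; first by lia.
    by rewrite -hd e; ring.
  have := PM _ _ (PM _ _ Pr PS3) (PTn q); rewrite !mk_mul; congr (P (mk _ _ _ _)); rewrite ?e; ring.
move=> g hg; rewrite (mk_eta g); apply: H (leqnn _) _.
by rewrite -det2E.
Qed.

End Matrices.

(** * Transformation of the theta constants and eta under the generators *)

Section Modularity.
Variable R : realType.
Local Notation C := R[i].
Implicit Types (g h : 'M[int]_2) (t : C).
Notation etai := (Vf (R := R) [::]).

(** The order is theta_3, theta_4, theta_2. *)
Definition thi (i : 'I_3) : C -> C :=
  if i == 0 then th false false 0 else if i == 1 then th true false 0 else th false true 0.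

Lemma nonzero t : upper t -> (forall i, thi i t != 0) /\ etai t != 0.
Proof.
move=> ut; have := triple_product ut; set a := th _ _ _ _; set b := th _ _ _ _; set c := th _ _ _ _.
move=> h; have : a * b * c * etai t ^+ 3 != 0 by rewrite h pnatr_eq0.
rewrite mulf_eq0 negb_or mulf_eq0 negb_or mulf_eq0 negb_or expf_eq0 /= => /andP[/andP[/andP[ha hb] hc] he].
split=> // i.
by rewrite /thi; case: ifP => _; [exact: ha | case: ifP => _; [exact: hb | exact: hc]].
Qed.

(** [m^2] and [m] have the same parity, so [t + 1] toggles the sign [(-1)^m]. *)
Lemma th_T0 sg t : upper t -> th sg false 0 (t + 1) = th (~~ sg) false 0 t.
Proof.
move=> ut; apply: eq_zsum => m; rewrite /thterm expr0 /= !mulr1 mulrDr eeD mulr1 [X in _ * X]mulrC mulrA.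
congr (_ * _); rewrite /sgm /pos mul0r addr0.
have -> : ee ((m%:~R ^+ 2)%:C / 2%:R) = ee ((2^-1 * m%:~R)%:C) :> C.
  have [k hk] : exists k : int, m ^+ 2 = m + 2 * k.
    exists ((m * (m - 1)) %/ 2)%Z; have : (2 %| m * (m - 1))%Z.
      rewrite dvdzE abszM Euclid_dvdM // ; lia.
    by move/divzK => e; have : (m * (m - 1) = (m * (m - 1) %/ 2)%Z * 2) := esym e; rewrite expr2; lia.
  have -> : (m%:~R ^+ 2)%:C / 2%:R = (2^-1 * m%:~R)%:C + k%:~R :> C.
    rewrite natC -fmorphV -rmorphM intC -rmorphD; congr (_%:C).
    by rewrite -rmorphXn /= hk rmorphD rmorphM /=; field.
  by rewrite eeD ee_int mulr1.
rewrite -eeD -rmorphD; case: sg => /=.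
  have -> : 1 / 2 * m%:~R + 2^-1 * m%:~R = m%:~R :> R by field.
  by rewrite !mul0r ee0 -intC ee_int.
by rewrite !mul0r add0r div1r.
Qed.

Lemma th_T1 t : upper t -> th false true 0 (t + 1) = ee (8%:R^-1) * th false true 0 t.
Proof.
move=> ut; rewrite /th -zsumZ; last exact: zasum_th.
apply: eq_zsum => m; rewrite /thterm mulrDr eeD mulr1.
have -> : ee ((pos R true m ^+ 2)%:C / 2%:R) = ee (8%:R^-1) :> C.
  have [k hk] : exists k : int, m ^+ 2 + m = 2 * k.
    exists ((m * (m + 1)) %/ 2)%Z; have : (2 %| m * (m + 1))%Z.
      rewrite dvdzE abszM Euclid_dvdM // ; lia.
    by move/divzK => e; have : (m * (m + 1) = (m * (m + 1) %/ 2)%Z * 2) := esym e; rewrite expr2; lia.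
  have -> : (pos R true m ^+ 2)%:C / 2%:R = 8%:R^-1 + k%:~R :> C.
    rewrite !natC -!fmorphV -rmorphM intC -rmorphD; congr (_%:C); rewrite /pos.
    have e : m%:~R ^+ 2 + m%:~R = 2 * k%:~R :> R by rewrite -rmorphXn -rmorphD hk rmorphM.
    have ek : k%:~R = (m%:~R ^+ 2 + m%:~R) / 2 :> R by rewrite e; field.
    by rewrite ek (_ : (true%:R : R) = 1) //; field.
  by rewrite eeD ee_int mulr1.
by move: (sgm _ _ _) (_%:C) (ee _) (ee _) => *; ring.
Qed.

Lemma etai_T t : upper t -> etai (t + 1) = ee (- 24%:R^-1) * etai t.
Proof.
move=> ut; rewrite /Vf -csumZ.
  apply: eq_csum => M; rewrite /vterm mulrDr mulr1 !eeD ee_nat mul1r.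
  by move: (ee _) (ee _) => *; ring.
have [s _] := lacunary_sum 1 (fun j => leq_pmull j (isT : (0 < 24)%N)) (@growth_vcoef R [::]) ut.
by rewrite vterm_lac.
Qed.

Lemma th_thetaS (h : bool) t : th false h 0 t = thetaS (h%:R / 2) t.
Proof. by apply: eq_zsum => m; rewrite /thterm /sgm mul0r mul0r ee0 expr0 !mul1r. Qed.

Lemma th_thetaB (sg : bool) t : th sg false 0 t = thetaB (sg%:R / 2) t.
Proof. by apply: eq_zsum => m; rewrite /thterm /sgm expr0 mulr1 /pos mul0r addr0. Qed.

Lemma mob_S t : mob (mk 0 (-1) 1 0) t = - t^-1.
Proof. by rewrite /mob !mkE mul0r add0r mul1r addr0 mulrN1z mulN1r. Qed.
Lemma mob_T t : mob (mk 1 1 0 1) t = t + 1.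
Proof. by rewrite /mob !mkE mul1r mul0r add0r divr1. Qed.

Lemma SL2_S : SL2Z (mk 0 (-1) 1 0). Proof. by rewrite /SL2Z det2E !mkE. Qed.
Lemma SL2_T : SL2Z (mk 1 1 0 1). Proof. by rewrite /SL2Z det2E !mkE. Qed.

Lemma upper_S t : upper t -> upper (- t^-1).
Proof. by move=> ut; have := upper_mob SL2_S ut; rewrite mob_S. Qed.

(** Differentiating [f^3 = 1] gives [3 f^2 f' = 0]. *)
Lemma cube_const (f : C -> C) : (forall t, upper t -> exists l, cder f t l) ->
  (forall t, upper t -> f t ^+ 3 = 1) -> forall a b, upper a -> upper b -> f a = f b.
Proof.
move=> hd hc; apply: cder0_const => t ut; have [l hl] := hd t ut.
have h3 := cderX 3 hl.
have h0 : cder (fun w => f w ^+ 3) t 0.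
  by apply: (cder_upper ut) (cder_cst 1 t) => w uw; rewrite hc.
have := cder_unique h3 h0.
have f0 : f t != 0.
  by apply/eqP => e; have := hc t ut; rewrite e expr0n => /eqP; rewrite eq_sym oner_eq0.
have n0 : 3%:R * f t ^+ 2 != 0 by rewrite mulf_neq0 ?expf_neq0 ?pnatr_eq0.
by move/eqP; rewrite mulf_eq0 (negPf n0) /= => /eqP e; rewrite -e.
Qed.

(** Poisson summation treats theta_3 and theta_2; theta_4 follows by inverting a second time, at
    [-1/t]. For eta, [f] is the quotient of the values of [theta_3 / eta] at [-1/t] and at [t]: the
    triple product gives [f^3 = 1], so [f] is constant, and it is 1 at the fixed point [i]. *)
Lemma inversion t : upper t -> exists lam : C, [/\ lam ^+ 2 = - 'i%C * t,
  etai t = lam * etai (- t^-1), th false false 0 (- t^-1) = lam * th false false 0 t,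
  th false true 0 (- t^-1) = lam * th true false 0 t &
  th true false 0 (- t^-1) = lam * th false true 0 t].
Proof.
have half : 0 <= (0 : R) / 2 <= 1 / 2 by rewrite mul0r lexx /=; lra.
have half' : 0 <= (1 : R) / 2 <= 1 / 2 by lra.
have A s : upper s -> exists lam : C, [/\ lam ^+ 2 = - 'i%C * s,
    th false false 0 (- s^-1) = lam * th false false 0 s,
    th false true 0 (- s^-1) = lam * th true false 0 s &
    th true false 0 (- s^-1) = lam * th false true 0 s].
  move=> us; have us' := upper_S us; have ss : - (- s^-1)^-1 = s by rewrite invrN opprK invrK.
  have [lam h1 [_ h2]] := theta_inversion us; have [mu _ [_ m2]] := theta_inversion us'.
  have := h2 _ half; have := h2 _ half'; have := m2 _ half; have := m2 _ half'; rewrite ss.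
  rewrite -[0 / 2]/((false%:R : R) / 2) -[1 / 2]/((true%:R : R) / 2) -!th_thetaS -!th_thetaB => e4 e3 e2 e1.
  have n0 := (nonzero us).1 0; have n0' := (nonzero us').1 0; rewrite /thi /= in n0 n0'.
  have lm : lam * mu = 1.
    by apply: (mulIf n0); rewrite mul1r mulrAC -e1 mulrC -e3.
  by exists lam; split; [exact: h1 | exact: e1 | exact: e2 | rewrite e4 mulrA lm mul1r].
pose f t := th false false 0 (- t^-1) * etai (- t^-1) * ((th false false 0 t) ^-1 * (etai t)^-1).
have fl s lam : upper s -> th false false 0 (- s^-1) = lam * th false false 0 s ->
    f s = lam * etai (- s^-1) / etai s.
  move=> us e; have n0 := (nonzero us).1 0; rewrite /thi /= in n0.
  by rewrite /f e; field; rewrite n0 (nonzero us).2.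
have f3 s : upper s -> f s ^+ 3 = 1.
  move=> us; have [lam [h1 h2 h3 h4]] := A s us; rewrite (fl s lam) //.
  have p1 := triple_product us; have p2 := triple_product (upper_S us).
  rewrite h2 h3 h4 -p1 in p2; have [n1 n2] := nonzero us.
  have m0 := n1 0; have m1 := n1 1; have m2 := n1 (@Ordinal 3 2 isT); rewrite /thi /= in m0 m1 m2.
  have n3 := mulf_neq0 (mulf_neq0 m0 m1) m2; move: p2 n3 {p1 h2 h3 h4 m0 m1 m2 n1 fl}.
  move: (th _ _ _ s) (th _ _ _ s) (th _ _ _ s) (etai s) (etai _) n2 => x y z e e' n2 p2 n3.
  rewrite expr_div_n; apply: (mulIf (expf_neq0 3 n2)); rewrite divfK ?expf_neq0 // mul1r.
  apply: (mulfI n3); rewrite -p2 exprMn; ring.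
have fd s : upper s -> exists l, cder f s l.
  move=> us; have n0 := (nonzero us).1 0; rewrite /thi /= in n0.
  have [e' [_ he]] := fou_der (fou_Vf R [::]).
  have hS : cder (fun w : C => - w^-1) s (- - s ^- 2) := cderN (cder_inv (upper_neq0 us)).
  eexists; rewrite /f; apply: cderM; last first.
    apply: cderM; apply: cderV => //; [exact: cder_th | exact: (nonzero us).2 | exact: he].
  by apply: cderM; apply: (cder_comp hS); [exact: cder_th (upper_S us) | exact: he (upper_S us)].
have ui : upper ('i%C : C) by rewrite /upper /= ltr01.
have fi : f 'i%C = 1.
  have e : - ('i%C : C)^-1 = 'i%C.
    have ii : ('i%C : C) * 'i%C = -1 by rewrite -expr2 sqr_i.
    by apply: (mulIf (iC_neq0 R)); rewrite mulNr mulVf ?iC_neq0 // ii.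
  have n0 := (nonzero ui).1 0; rewrite /thi /= in n0.
  by rewrite /f e; field; rewrite n0 (nonzero ui).2.
move=> ut; have [lam [h1 h2 h3 h4]] := A t ut; exists lam; split; try assumption.
have := cube_const fd f3 ut ui; rewrite fi (fl t lam) // => e.
by rewrite -[RHS](divfK (nonzero ut).2) e mul1r.
Qed.

End Modularity.

(** * The finite-index subgroup *)

Section LevelGroup.
Variable R : realType.
Local Notation C := R[i].
Implicit Types (g h r : 'M[int]_2) (t : C).
Notation etai := (Vf (R := R) [::]).

Lemma thi_0 : thi (R := R) 0 = th false false 0. Proof. by []. Qed.
Lemma thi_1 : thi (R := R) 1 = th true false 0. Proof. by []. Qed.
Lemma thi_2 : thi (R := R) (@Ordinal 3 2 isT) = th false true 0. Proof. by []. Qed.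

Definition rt (a : nat) : C := ee (a%:R / 24%:R).

Lemma rtD a b : rt (a + b) = rt a * rt b.
Proof. by rewrite /rt natrD mulrDl eeD. Qed.

Lemma rt0 : rt 0 = 1. Proof. by rewrite /rt mul0r ee0. Qed.
Lemma rt_neq0 a : rt a != 0. Proof. exact: ee_neq0. Qed.

Lemma rt24 : rt 24 = 1. Proof. by rewrite /rt divff ?pnatr_eq0 // ee1. Qed.

Lemma rt_mod a : rt (a %% 24)%N = rt a.
Proof.
rewrite [in RHS](divn_eq a 24) rtD; have -> : rt (a %/ 24 * 24)%N = 1; last by rewrite mul1r.
by elim: (a %/ 24)%N => [|n IH]; rewrite ?mul0n ?rt0 // mulSn rtD IH rt24 mul1r.
Qed.

(* The multiplier of weight 1/2: [eps g t ^ 2 = c t + d] on the group [GG]. *)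
Definition eps g t : C := etai t / etai (mob g t).

Lemma eps_neq0 g t : SL2Z g -> upper t -> eps g t != 0.
Proof.
by move=> hg ut; rewrite mulf_neq0 ?invr_eq0 // (nonzero _).2 //; exact: upper_mob.
Qed.

Lemma eps_mul g h t : SL2Z g -> SL2Z h -> upper t -> eps (g *m h) t = eps g (mob h t) * eps h t.
Proof.
move=> hg hh ut; rewrite /eps mob_mul //; have n0 := (nonzero (upper_mob hh ut)).2.
by rewrite [RHS]mulrC mulrA divfK.
Qed.

(** [k] records the root of unity in [eps^2], while [f] and [p] record those of the theta constants
    and their permutation. Only [k] and [f] modulo 24 matter, so the data range over a finite
    set. *)
Definition RelN g (k : nat) (f : 'I_3 -> nat) (p : {perm 'I_3}) : Prop := forall t, upper t ->
  eps g t ^+ 2 = rt k * J g t /\ forall i, thi i (mob g t) = rt (f i) * eps g t * thi (p i) t.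

Lemma RelN_mul g h k k' f f' p p' : SL2Z g -> SL2Z h -> RelN g k f p -> RelN h k' f' p' ->
  RelN (g *m h) (k + k') (fun i => f i + f' (p i))%N (p * p')%g.
Proof.
move=> hg hh rg rh t ut; have [e1 t1] := rg _ (upper_mob hh ut); have [e2 t2] := rh _ ut.
split=> [|i]; first by rewrite eps_mul // exprMn e1 e2 J_mul // rtD mulrACA.
rewrite (mob_mul hg hh ut) t1 t2 permM (eps_mul hg hh ut) rtD.
by move: (rt _) (rt _) (eps _ _) (eps _ _) (thi _ _) => *; ring.
Qed.

(** The common data of [g] and [g h] cancel; hence two matrices with equal data differ by an element
    of the group. *)
Lemma RelN_quot g h k f p : SL2Z g -> SL2Z h -> RelN g k f p -> RelN (g *m h) k f p ->
  RelN h 0 (fun=> 0%N) 1%g.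
Proof.
move=> hg hh rg rgh t ut; have uh := upper_mob hh ut.
have [e1 t1] := rg _ uh; have [e2 t2] := rgh _ ut; rewrite eps_mul // in e2 t2.
split=> [|j].
  rewrite rt0 mul1r; have n0 : rt k * J g (mob h t) != 0 by rewrite mulf_neq0 ?rt_neq0 ?J_neq0.
  by apply: (mulfI n0); rewrite -{1}e1 -exprMn e2 J_mul // mulrA.
rewrite rt0 mul1r perm1; have := t2 (p^-1%g j); rewrite mob_mul // t1 permKV.
have n0 : rt (f (p^-1%g j)) * eps g (mob h t) != 0 by rewrite mulf_neq0 ?rt_neq0 ?eps_neq0.
by rewrite [in RHS]mulrA -[in RHS]mulrA => /(mulfI n0).
Qed.

Lemma RelN_1 : RelN 1%:M 0 (fun=> 0%N) 1%g.
Proof.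
move=> t ut; have n0 := (nonzero ut).2; rewrite /eps mob1 divff // expr1n rt0 !mul1r.
by split=> [|i]; rewrite /J ?mxE ?mul0r ?add0r ?mul1r ?perm1.
Qed.

(** Here [eps = rt 1]: the exponent 23 cancels it for theta_3 and theta_4, and [2 + 1 = 3] gives the
    factor [exp(2 pi i / 8)] of theta_2. *)
Lemma RelN_T : RelN (mk 1 1 0 1) 2 (fun i => if (i < 2)%N then 23 else 2)%N (tperm 0 1).
Proof.
move=> t ut; rewrite /eps mob_T etai_T //; have n0 := (nonzero ut).2.
have -> : etai t / (ee (- 24%:R^-1) * etai t) = rt 1.
  by rewrite invfM mulrCA divff // mulr1 -eeN opprK /rt mul1r.
split=> [|i]; first by rewrite expr2 -rtD /J !mkE mul0r add0r mulr1.
case: i => -[|[|[|//]]] hi /=.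
- have -> : Ordinal hi = 0 by exact: val_inj.
  by rewrite tpermL thi_0 thi_1 th_T0 // -rtD rt24 mul1r.
- have -> : Ordinal hi = 1 by exact: val_inj.
  by rewrite tpermR thi_0 thi_1 th_T0 // -rtD rt24 mul1r.
- have -> : Ordinal hi = @Ordinal 3 2 isT by exact: val_inj.
  rewrite tpermD // thi_2 th_T1 // -rtD; suff -> : ee (8%:R^-1) = rt (2 + 1) by [].
  by rewrite /rt; congr ee; field.
Qed.

Lemma rt18 : rt 18 = - 'i%C.
Proof.
have e4 : ee ((1 / 4 : R)%:C) = 'i%C.
  have e : 2 * pi * (1 / 4) = pi / 2 :> R by field.
  by apply: C_ext; rewrite ?reC_ee_real ?imC_ee_real e ?cos_pihalf ?sin_pihalf.
have -> : rt 18 = ee ((1 / 4 : R)%:C) * ee (2%:R^-1).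
  rewrite -eeD /rt; congr ee; rewrite !natC -!fmorphV -rmorphM -rmorphD; congr (_%:C); by field.
by rewrite e4 ee_half mulrN1.
Qed.

(** The exponent 18 encodes [- i = exp(2 pi i 18 / 24)], which comes from [lam^2 = - i t]. *)
Lemma RelN_S : RelN (mk 0 (-1) 1 0) 18 (fun=> 0%N) (tperm 1 (@Ordinal 3 2 isT)).
Proof.
move=> t ut; have [lam [h1 h2 h3 h4 h5]] := inversion ut.
have n0 := (nonzero (upper_S ut)).2; rewrite /eps mob_S.
have -> : etai t / etai (- t^-1) = lam by rewrite h2 mulfK.
split=> [|i]; first by rewrite h1 rt18 /J !mkE mul1r addr0.
rewrite rt0 mul1r; case: i => -[|[|[|//]]] hi.
- have -> : Ordinal hi = 0 by exact: val_inj.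
  have -> : tperm 1 (@Ordinal 3 2 isT) 0 = 0 by rewrite tpermD.
  rewrite thi_0; exact: h3.
- have -> : Ordinal hi = 1 by exact: val_inj.
  rewrite tpermL thi_1 thi_2; exact: h5.
- have -> : Ordinal hi = @Ordinal 3 2 isT by exact: val_inj.
  rewrite tpermR thi_1 thi_2; exact: h4.
Qed.

Lemma RelN_exists g : SL2Z g -> exists k f p, RelN g k f p.
Proof.
move=> hg; suff [] : SL2Z g /\ exists k f p, RelN g k f p by [].
move: g hg; apply: SL2Z_ind.
- move=> g h [hg [k [f [p rg]]]] [hh [k' [f' [p' rh]]]]; split; first exact: SL2_mul.
  by do 3 eexists; exact: RelN_mul rg rh.
- by split; [exact: SL2_S | do 3 eexists; exact: RelN_S].
- by split; [exact: SL2_T | do 3 eexists; exact: RelN_T].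
Qed.

Definition GG g : Prop := SL2Z g /\ RelN g 0 (fun=> 0%N) 1%g.

Definition Rel g (d : 'I_24 * {ffun 'I_3 -> 'I_24} * {perm 'I_3}) : Prop :=
  SL2Z g /\ RelN g d.1.1 (fun i => d.1.2 i) d.2.

Lemma Rel_exists g : SL2Z g -> exists d, Rel g d.
Proof.
move=> hg; have [k [f [p h]]] := RelN_exists hg.
exists (inord (k %% 24), [ffun i => inord (f i %% 24)], p); split=> // t ut.
have [e1 e2] := h t ut; split=> [|i] /=; first by rewrite inordK ?ltn_mod // rt_mod.
by rewrite ffunE inordK ?ltn_mod // rt_mod.
Qed.

Lemma GG_quot g h : SL2Z g -> SL2Z h -> (exists k f p, RelN g k f p /\ RelN h k f p) -> GG (invmx g *m h).
Proof.
move=> hg hh [k [f [p [rg rh]]]]; have hi := SL2_inv hg; have hm := SL2_mul hi hh.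
by split=> //; apply: (RelN_quot hg hm rg); rewrite mulKVmx // SL2_unit.
Qed.

(** One representative for each value of the data suffices; [rep] defaults to the identity matrix
    for data that no matrix realizes. *)
Lemma GG_finite_index : finite_index_subgroup GG.
Proof.
split.
- by move=> g [].
- by split; [exact: det1 | exact: RelN_1].
- move=> g h [hg rg] [hh rh]; split; first exact: SL2_mul.
  by have := RelN_mul hg hh rg rh; rewrite mulg1.
- move=> g [hg rg]; rewrite -[invmx g]mulmx1; apply: GG_quot => //; first exact: det1.
  by do 3 eexists; split; [exact: rg | exact: RelN_1].
- pose rep d : 'M[int]_2 := xget 1%:M [set g | Rel g d]%classic.
  exists [seq rep d | d <- enum {: 'I_24 * {ffun 'I_3 -> 'I_24} * {perm 'I_3}}] => g hg.
  have [d hd] := Rel_exists hg; exists (rep d); first by apply/map_f; rewrite mem_enum.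
  have [hr rr] : Rel (rep d) d by exact: (@xgetPex _ 1%:M [set g | Rel g d]%classic (ex_intro _ g hd)).
  by apply: GG_quot => //; do 3 eexists; split; [exact: rr | exact: hd.2].
Qed.

End LevelGroup.

(** * A ring of quasimodular forms closed under differentiation *)

Section QuasiModularRing.
Variable R : realType.
Local Notation C := R[i].
Implicit Types (g : 'M[int]_2) (t : C) (k l : int) (f h : C -> C).
Notation etai := (Vf (R := R) [::]).

(** Integral powers of [eps] express all half-integral weights without choosing a square root. *)
Definition Mod k h : Prop := fou h /\ forall g t, GG R g -> upper t -> h (mob g t) = eps g t ^ k * h t.

Lemma GG_SL2 g : GG R g -> SL2Z g. Proof. by case. Qed.

Lemma eps_sqr g t : GG R g -> upper t -> eps g t ^+ 2 = J g t.
Proof. by move=> [_ h] ut; have [-> _] := h t ut; rewrite rt0 mul1r. Qed.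

Lemma Mod_th (i : 'I_3) : Mod 1 (thi i).
Proof.
split; first by rewrite /thi; case: ifP => _; [|case: ifP => _]; exact: fou_th.
by move=> g t [_ h] ut; have [_ ->] := h t ut; rewrite rt0 mul1r perm1 expr1z.
Qed.

Lemma Mod_etai : Mod (-1) etai.
Proof.
split=> [|g t gg ut]; first exact: fou_Vf.
have n0 := (nonzero ut).2; rewrite exprN1 /eps invf_div divfK //.
Qed.

Lemma Mod_cst (c : C) : Mod 0 (fun _ => c).
Proof. by split=> [|g t gg ut]; [exact: fou_cst | rewrite expr0z mul1r]. Qed.

Definition D f t : C := xget 0 [set l | cder f t l]%classic.

Lemma DP f t (l : C) : cder f t l -> D f t = l.
Proof. by move=> h; apply: cder_unique (h); exact: (@xgetPex _ 0 [set l | cder f t l]%classic (ex_intro _ l h)). Qed.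

Lemma D_fou f : fou f -> fou (D f) /\ forall t, upper t -> cder f t (D f t).
Proof.
move=> hf; have [f' [hf' d]] := fou_der hf; split=> [|t ut]; last by rewrite (DP (d t ut)); exact: d.
by apply: fou_ext hf' => t ut; rewrite (DP (d t ut)).
Qed.

(** eta as a polynomial in the theta constants and 1/eta, so that its expansion requires no division
    of power series. *)
Definition etainv t : C := 2%:R^-1 * (thi 0 t * thi 1 t * thi (@Ordinal 3 2 isT) t * etai t ^+ 2).

Lemma etainvP t : upper t -> etainv t = (etai t)^-1.
Proof.
move=> ut; have n0 := (nonzero ut).2; apply: (mulIf n0); rewrite mulVf // /etainv.
have := triple_product ut; rewrite thi_0 thi_1 thi_2.
move: (th _ _ _ t) (th _ _ _ t) (th _ _ _ t) (etai t) => z y x e h.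
have -> : 2%:R^-1 * (x * y * z * e ^+ 2) * e = 2%:R^-1 * (x * y * z * e ^+ 3) by ring.
by rewrite h mulVf // pnatr_eq0.
Qed.

Lemma fou_etainv : fou etainv.
Proof.
by apply: fouZ; apply: fouM; [apply: fouM; [apply: fouM|]; exact: (Mod_th _).1 | apply: fouX; exact: fou_Vf].
Qed.

(* Twice the logarithmic derivative of eta. *)
Definition phi t : C := - 2%:R * (D etai t * etainv t).

Lemma fou_phi : fou phi.
Proof. by apply: fouZ; apply: fouM fou_etainv; exact: (D_fou (fou_Vf R [::])).1. Qed.

Lemma cder_mob g t : SL2Z g -> upper t -> cder (mob g) t (J g t ^- 2).
Proof.
move=> hg ut; have J0 := J_neq0 hg ut.
have lin (a b : C) : cder (fun w => a * w + b) t a.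
  by have := cderD (cderZ a (cder_id t)) (cder_cst b t); rewrite mulr1 addr0.
have h := cderM (lin (g 0 0)%:~R (g 0 1)%:~R) (cderV (f := fun w => (g 1 0)%:~R * w + (g 1 1)%:~R) J0 (lin _ _)).
suff -> : J g t ^- 2 = (g 0 0)%:~R * (J g t)^-1 + ((g 0 0)%:~R * t + (g 0 1)%:~R) * (- J g t ^- 2 * (g 1 0)%:~R) by [].
have e : (g 0 0)%:~R * (g 1 1)%:~R - (g 0 1)%:~R * (g 1 0)%:~R = 1 :> C.
  by rewrite -!intrM -intrB -det2E hg.
apply: (mulIf (expf_neq0 2 J0)); rewrite mulVf ?expf_neq0 //.
transitivity ((g 0 0)%:~R * J g t - ((g 0 0)%:~R * t + (g 0 1)%:~R) * (g 1 0)%:~R).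
  by rewrite -[LHS]e /J; ring.
by field.
Qed.

(** The second conclusion is the derivative of [eps^2 = c t + d]. *)
Lemma cder_eps g t : GG R g -> upper t -> exists2 e', cder (eps g) t e' & 2%:R * eps g t * e' = (g 1 0)%:~R.
Proof.
move=> gg ut; have hg := GG_SL2 gg; have um := upper_mob hg ut.
have [_ d] := D_fou (fou_Vf R [::]).
have h := cderM (d t ut) (cderV (f := fun w => etai (mob g w)) (nonzero um).2 (cder_comp (cder_mob hg ut) (d _ um))).
eexists; first exact: h.
have lin : cder (J g) t (g 1 0)%:~R.
  by have := cderD (cderZ (g 1 0)%:~R (cder_id t)) (cder_cst (g 1 1)%:~R t); rewrite mulr1 addr0.
have h2 := cderX 2 h; apply: cder_unique lin.
by apply: (cder_upper ut) h2 => w uw; rewrite -/(eps g w) eps_sqr.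
Qed.

Lemma cderXz f t (l : C) k : f t != 0 -> cder f t l -> cder (fun w => f w ^ k) t (k%:~R * f t ^ (k - 1) * l).
Proof.
move=> f0 hf; case: k => n.
  have := cderX n hf; case: n => [|n]; first by rewrite !mul0r.
  by rewrite (_ : Posz n.+1 - 1 = Posz n) //; lia.
have := cderV (f := fun w => f w ^+ n.+1) (expf_neq0 _ f0) (cderX n.+1 hf).
congr (cder _ _ _); rewrite NegzE (_ : - (n.+1%:Z) - 1 = - (n.+2%:Z)); last lia.
rewrite rmorphN /= mulrA; congr (_ * _).
have -> : f t ^ (- n.+2%:Z) = f t ^- n.+2 by rewrite -exprnN.
rewrite -pmulrn; have p0 := expf_neq0 n f0.
by rewrite !exprS; field; rewrite ?f0 ?p0.
Qed.

(** Logarithmic derivative of [eta(g t)^2 = (c t + d) eta(t)^2]; the anomaly is the derivative of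
    [c t + d]. *)
Lemma phi_mob g t : GG R g -> upper t -> phi (mob g t) = J g t ^+ 2 * phi t + (g 1 0)%:~R * J g t.
Proof.
move=> gg ut; have hg := GG_SL2 gg; have um := upper_mob hg ut; have J0 := J_neq0 hg ut.
have [_ d] := D_fou (fou_Vf R [::]).
have [e' he e2] := cder_eps gg ut; have n1 := (nonzero ut).2; have n2 := (nonzero um).2.
have h := cderM (cder_comp (cder_mob hg ut) (d _ um)) he.
have h2 : cder (fun w => etai (mob g w) * eps g w) t (D etai t).
  by apply: (cder_upper ut) (d t ut) => w uw; rewrite /eps mulrC (divfK (nonzero (upper_mob hg uw)).2).
have E := cder_unique h h2; have e0 := eps_neq0 hg ut.
rewrite /phi !etainvP //.
have em : etai (mob g t) = etai t / eps g t by rewrite /eps invf_div mulrC divfK.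
have js := eps_sqr gg ut; rewrite em -js -e2 in E *.
clear he h h2 e2 js em.
move: (D etai (mob g t)) (D etai t) (etai t) (eps g t) e' n1 e0 E => A B x e c n1 e0 E.
rewrite -E; field; by rewrite n1 e0.
Qed.

Lemma D_mob f g t k : fou f -> (forall g t, GG R g -> upper t -> f (mob g t) = eps g t ^ k * f t) ->
  GG R g -> upper t ->
  D f (mob g t) = J g t ^+ 2 * eps g t ^ k * (D f t + k%:~R * ((g 1 0)%:~R / (2%:R * J g t)) * f t).
Proof.
move=> hf mf gg ut; have hg := GG_SL2 gg; have um := upper_mob hg ut; have J0 := J_neq0 hg ut.
have [_ d] := D_fou hf; have [e' he e2] := cder_eps gg ut; have e0 := eps_neq0 hg ut.
have h1 := cder_comp (cder_mob hg ut) (d _ um).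
have h2 := cderM (cderXz k e0 he) (d t ut).
have h3 : cder (fun w => f (mob g w)) t (k%:~R * eps g t ^ (k - 1) * e' * f t + eps g t ^ k * D f t).
  by apply: (cder_upper ut) h2 => w uw; rewrite mf.
have E := cder_unique h1 h3.
have -> : D f (mob g t) = J g t ^+ 2 * (D f (mob g t) * J g t ^- 2).
  by rewrite mulrC divfK // expf_neq0.
rewrite E -e2 -(eps_sqr gg ut); have -> : eps g t ^ (k - 1) = eps g t ^ k / eps g t.
  by rewrite expfzDr // exprN1.
field; by rewrite e0.
Qed.

(** The Serre derivative, with [phi] in the role of E_2: its anomaly cancels that of [D f]. *)
Lemma Mod_serre k f : Mod k f -> Mod (k + 4) (fun t => D f t - k%:~R / 2%:R * (phi t * f t)).
Proof.
move=> [hf mf]; split=> [|g t gg ut].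
  apply: fouD; first exact: (D_fou hf).1.
  by apply: fou_ext (fouZ (- (k%:~R / 2%:R)) (fouM fou_phi hf)) => t _; rewrite mulNr.
have J0 := J_neq0 (GG_SL2 gg) ut; rewrite (D_mob hf mf) // phi_mob // mf // expfzDr ?eps_neq0 //; last exact: GG_SL2.
have -> : eps g t ^ (4 : int) = J g t ^+ 2 by rewrite -(eps_sqr gg ut) -exprM.
by field.
Qed.

(** Analogue of Ramanujan's formula for the derivative of E_2. The index 8 stands for weight 4. *)
Lemma Mod_phi2 : Mod 8 (fun t => D phi t - phi t ^+ 2).
Proof.
split=> [|g t gg ut].
  apply: fouD; first exact: (D_fou fou_phi).1.
  by apply: fou_ext (fouZ (-1) (fouX 2 fou_phi)) => t _; rewrite mulN1r.
have hg := GG_SL2 gg; have um := upper_mob hg ut; have J0 := J_neq0 hg ut.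
have [_ d] := D_fou fou_phi.
have h1 := cder_comp (cder_mob hg ut) (d _ um).
have lin : cder (J g) t (g 1 0)%:~R.
  by have := cderD (cderZ (g 1 0)%:~R (cder_id t)) (cder_cst (g 1 1)%:~R t); rewrite mulr1 addr0.
have h2 := cderD (cderM (cderX 2 lin) (d t ut)) (cderZ (g 1 0)%:~R lin).
have h3 : cder (fun w => phi (mob g w)) t (2%:R * J g t ^+ 1 * (g 1 0)%:~R * phi t + J g t ^+ 2 * D phi t + (g 1 0)%:~R * (g 1 0)%:~R).
  by apply: (cder_upper ut) h2 => w uw; rewrite phi_mob.
have E := cder_unique h1 h3.
have -> : D phi (mob g t) = J g t ^+ 2 * (D phi (mob g t) * J g t ^- 2).
  by rewrite mulrC divfK // expf_neq0.
rewrite E phi_mob //; have -> : eps g t ^ (8 : int) = J g t ^+ 4 by rewrite -(eps_sqr gg ut) -exprM.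
ring.
Qed.

(* Weights are doubled throughout: [QM k] means weight [k/2]. *)
Inductive QM : int -> (C -> C) -> Prop :=
| QM_Mod k f : Mod k f -> QM k f
| QM_phi : QM 4 phi
| QM_add k f h : QM k f -> QM k h -> QM k (fun t => f t + h t)
| QM_mul k l f h : QM k f -> QM l h -> QM (k + l) (fun t => f t * h t)
| QM_ext k f h : (forall t, upper t -> f t = h t) -> QM k f -> QM k h.

Lemma QM_cst (c : C) : QM 0 (fun _ => c). Proof. exact/QM_Mod/Mod_cst. Qed.
Lemma QM_scale k c f : QM k f -> QM k (fun t => c * f t).
Proof. by move=> h; rewrite -[k]add0r; apply: QM_mul h; exact: QM_cst. Qed.
Lemma QM_0 k : QM k (fun _ => 0).
Proof.
apply: QM_Mod; split=> [|g t _ _]; [exact: fou_cst | by rewrite mulr0].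
Qed.
Lemma QM_sub k f h : QM k f -> QM k h -> QM k (fun t => f t - h t).
Proof.
move=> hf hh; apply: (QM_ext (f := fun t => f t + -1 * h t)); first by move=> t _; rewrite mulN1r.
by apply: QM_add => //; exact: QM_scale.
Qed.
Lemma QM_sum k (I : Type) (r : seq I) (F : I -> C -> C) : (forall i, QM k (F i)) ->
  QM k (fun t => \sum_(i <- r) F i t).
Proof.
move=> h; elim: r => [|i r IH].
  by apply: QM_ext (QM_0 k) => t _; rewrite big_nil.
by apply: QM_ext (QM_add (h i) IH) => t _; rewrite big_cons.
Qed.

(** On generators, [D f] is a Serre derivative plus a multiple of [phi f], and [D phi] is a modular
    form plus [phi^2]; the Leibniz rule does the rest. *)
Lemma QM_D k f : QM k f -> QM (k + 4) (D f).
Proof.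
move=> hf; suff [f' h d] : exists2 f', QM (k + 4) f' & forall t, upper t -> cder f t (f' t).
  by apply: QM_ext h => t ut; rewrite (DP (d t ut)).
elim: hf => {k f} [k f mf| |k f h _ [f' hf df] _ [h' hh dh]|k l f h qf [f' hf df] qh [h' hh dh]|k f h e _ [f' hf df]].
- exists (D f); last exact: (D_fou mf.1).2.
  apply: (QM_ext (f := fun t => (D f t - k%:~R / 2%:R * (phi t * f t)) + k%:~R / 2%:R * (phi t * f t))).
    by move=> t _; rewrite subrK.
  apply: QM_add; first exact/QM_Mod/Mod_serre.
  by apply: QM_scale; rewrite addrC; apply: QM_mul QM_phi _; exact: QM_Mod.
- exists (D phi); last exact: (D_fou fou_phi).2.
  apply: (QM_ext (f := fun t => (D phi t - phi t ^+ 2) + phi t * phi t)).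
    by move=> t _; rewrite expr2 subrK.
  apply: QM_add; first exact/QM_Mod/Mod_phi2.
  exact: (QM_mul QM_phi QM_phi).
- by exists (fun t => f' t + h' t) => [|t ut]; [exact: QM_add | apply: cderD; [exact: df | exact: dh]].
- exists (fun t => f' t * h t + f t * h' t) => [|t ut]; last by apply: cderM; [exact: df | exact: dh].
  apply: QM_add; last by rewrite -addrA; exact: QM_mul.
  by rewrite addrAC; exact: QM_mul.
- exists f' => // t ut; apply: (cder_upper ut) (df t ut); exact: e.
Qed.

Definition yinv t : C := ((imC t)^-1)%:C.
Lemma yinvE t : yinv t = ((imC t)%:C)^-1.
Proof. exact: fmorphV. Qed.

(* [p] is the almost holomorphic completion of [f], as a polynomial in [1/y]. *)
Definition completes k f (p : C -> {poly C}) (N : nat) : Prop :=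
  [/\ forall m, fou (fun t => (p t)`_m), forall t, (size (p t) <= N)%N,
      forall t, upper t -> (p t)`_0 = f t &
      forall g t, GG R g -> upper t -> (p (mob g t)).[yinv (mob g t)] = eps g t ^ k * (p t).[yinv t]].

(** [Im(g t) |J|^2 = Im t], with the conjugate of [J] written as [J - 2 i c y]. *)
Lemma imC_mob g t : SL2Z g -> upper t -> (imC (mob g t))%:C * (J g t * (J g t - 2%:R * 'i%C * ((g 1 0)%:~R * (imC t)%:C))) = (imC t)%:C.
Proof.
move=> hg ut; have e := mob_num hg ut; have J0 := J_neq0 hg ut; move: (mob g t) e => z e.
have hr : reC z * reC (J g t) - imC z * imC (J g t) = (g 0 0)%:~R * reC t + (g 0 1)%:~R.
  by rewrite -reCM e !intC reCD reCMr.
have hi : reC z * imC (J g t) + imC z * reC (J g t) = (g 0 0)%:~R * imC t.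
  by rewrite -imCM e !intC imCD imCMr imC_real addr0.
have e1 : reC (J g t) = (g 1 0)%:~R * reC t + (g 1 1)%:~R by rewrite /J !intC reCD reCMr reC_real.
have e2 : imC (J g t) = (g 1 0)%:~R * imC t by rewrite /J !intC imCD imCMr imC_real addr0.
have det : (g 0 0)%:~R * (g 1 1)%:~R - (g 0 1)%:~R * (g 1 0)%:~R = 1 :> R.
  by rewrite -!intrM -intrB -det2E hg.
have conjJ : J g t * (J g t - 2%:R * 'i%C * ((g 1 0)%:~R * (imC t)%:C)) = (reC (J g t) ^+ 2 + imC (J g t) ^+ 2)%:C.
  rewrite intC -rmorphM /= -e2; move: (J g t) => [a b].
  rewrite natC; apply: C_ext; rewrite ?(reCM, imCM, reCB, imCB, reCMr, imCMr) /=; ring.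
rewrite conjJ -rmorphM; congr (_%:C).
transitivity (reC (J g t) * (reC z * imC (J g t) + imC z * reC (J g t)) -
    imC (J g t) * (reC z * reC (J g t) - imC z * imC (J g t))); first by ring.
transitivity (((g 0 0)%:~R * (g 1 1)%:~R - (g 0 1)%:~R * (g 1 0)%:~R) * imC t); last by rewrite det mul1r.
by rewrite hr hi e1 e2; ring.
Qed.

Lemma horner_lin (a c x : C) : (a%:P + c *: 'X).[x] = a + c * x.
Proof. by rewrite hornerD hornerC hornerZ hornerX. Qed.

Lemma QM_completes k f : QM k f -> exists p N, completes k f p N.
Proof.
elim=> {k f} [k f [hf mf]| |k f h _ [p [N [p1 p2 p3 p4]]] _ [q [N' [q1 q2 q3 q4]]]|k l f h _ [p [N [p1 p2 p3 p4]]] _ [q [N' [q1 q2 q3 q4]]]|k f h e _ [p [N [p1 p2 p3 p4]]]].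
- exists (fun t => (f t)%:P), 1%N; split=> [m|t|t _|g t gg ut].
  + by case: m => [|m]; [apply: fou_ext hf | apply: fou_ext (fou_cst 0)] => t _; rewrite coefC.
  + exact: size_polyC_leq1.
  + by rewrite coefC.
  + by rewrite !hornerC mf.
(* Under [g] the function [1/y] becomes [J^2 / y - 2 i c J], so adding [1 / (2 i y)] cancels the
   anomaly [c J] of [phi]. *)
- exists (fun t => (phi t)%:P + (2%:R * 'i%C)^-1 *: 'X), 2%N; split=> [m|t|t _|g t gg ut].
  + case: m => [|[|m]]; [apply: fou_ext fou_phi | apply: fou_ext (fou_cst (2%:R * 'i%C)^-1) | apply: fou_ext (fou_cst 0)] => t _;
      by rewrite coefD coefC coefZ coefX /= ?mulr0 ?mulr1 ?addr0 ?add0r.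
  + apply: leq_trans (size_polyD _ _) _; rewrite geq_max (leq_trans (size_polyC_leq1 _)) //=.
    by apply: leq_trans (size_scale_leq _ _) _; rewrite size_polyX.
  + by rewrite coefD coefC coefZ coefX mulr0 addr0.
  + rewrite (horner_lin (phi (mob g t))) (horner_lin (phi t)) (phi_mob gg ut).
    have hg := GG_SL2 gg; have := imC_mob hg ut; have J0 := J_neq0 hg ut.
    have um := upper_mob hg ut.
    have y0 : (imC t)%:C != 0 :> C by rewrite -[0]/(0%:C) (inj_eq (@complexI _)) gt_eqF.
    have y1 : (imC (mob g t))%:C != 0 :> C by rewrite -[0]/(0%:C) (inj_eq (@complexI _)) gt_eqF.
    have -> : eps g t ^ (4 : int) = J g t ^+ 2 by rewrite -(eps_sqr gg ut) -exprM.
    rewrite !yinvE; set y := (imC t)%:C; set y' := (imC (mob g t))%:C => E.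
    have i0 := iC_neq0 R; have ii : ('i%C : C) * 'i%C = -1 by rewrite -expr2 sqr_i.
    set K := J g t * (J g t - _) in E; have K0 : K != 0.
      by apply/eqP => K0; move/eqP: y0; apply; rewrite -/y -E K0 mulr0.
    have -> : y'^-1 = K / y by rewrite -E; field; rewrite K0 y1.
    rewrite /K; have two : 2%:R != 0 :> C by rewrite pnatr_eq0.
    by field; rewrite y0 i0.
- exists (fun t => p t + q t), (maxn N N'); split=> [m|t|t ut|g t gg ut].
  + by apply: fou_ext (fouD (p1 m) (q1 m)) => t _; rewrite coefD.
  + by apply: leq_trans (size_polyD _ _) _; rewrite geq_max !leq_max p2 q2 orbT.
  + by rewrite coefD p3 // q3.
  + by rewrite !hornerD p4 // q4 // mulrDr.
- exists (fun t => p t * q t), (N + N')%N; split=> [m|t|t ut|g t gg ut].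
  + apply: fou_ext (fou_sum (index_enum 'I_m.+1) (fun i : 'I_m.+1 => fouM (p1 i) (q1 (m - i)%N))) => t _.
    by rewrite coefM.
  + apply: leq_trans (size_polyMleq _ _) _; apply: leq_trans (leq_pred _) _; exact: leq_add.
  + by rewrite coefM big_ord_recl big_ord0 addr0 p3 // q3.
  + by rewrite !hornerM p4 // q4 // expfzDr ?eps_neq0 //; [rewrite mulrACA | exact: GG_SL2].
- by exists p, N; split=> // t ut; rewrite p3 // e.
Qed.

(* [eps] and [sqrtc J] are square roots of the same function, so they differ by a locally constant sign. *)
Lemma eps_sqrtc g : GG R g -> exists s : C, s ^+ 2 = 1 /\ forall t, upper t -> eps g t = s * sqrtc (J g t).
Proof.
move=> gg; have hg := GG_SL2 gg; pose w t := eps g t / sqrtc (J g t).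
have s0 t : upper t -> sqrtc (J g t) != 0.
  move=> ut; have := J_neq0 hg ut; apply: contraNneq => e.
  by rewrite -[J g t]sqr_sqrtc e expr0n.
have w2 t : upper t -> w t ^+ 2 = 1.
  by move=> ut; rewrite expr_div_n eps_sqr // sqr_sqrtc divff // J_neq0.
have ui : upper ('i%C : C) by rewrite /upper /= ltr01.
suff wc : forall t, upper t -> cder w t 0.
  exists (w 'i%C); split=> [|t ut]; first exact: w2.
  by rewrite (cder0_const wc ui ut) divfK // s0.
move=> t ut; have [c0|c0] := eqVneq (g 1 0) 0.
  have [e' he e2] := cder_eps gg ut; rewrite c0 in e2.
  have e0 : e' = 0.
    have n0 : 2%:R * eps g t != 0 by rewrite mulf_neq0 ?pnatr_eq0 ?eps_neq0.
    by move/eqP: e2; rewrite mulf_eq0 (negPf n0) /= => /eqP.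
  have := cderM he (cder_cst (sqrtc (J g t))^-1 t); rewrite e0 mul0r mulr0 addr0.
  by apply: cder_eq => z; rewrite /w /J c0 !mul0r !add0r.
(* For [c] nonzero [J] is never real, so its principal root has positive real part, and a jump of
   sign would contradict the continuity of [eps]. *)
have res (z : C) : upper z -> 0 < reC (sqrtc (J g z)).
  move=> uz; have r0 : 0 <= reC (sqrtc (J g z)) by case: (J g z) => a b; exact: sqrtr_ge0.
  rewrite lt_def r0 andbT; apply/eqP => e.
  have := congr1 (@imC R) (sqr_sqrtc (J g z)); rewrite expr2 imCM e !mul0r mulr0 addr0 /J !intC imCD imCMr imC_real addr0.
  by move/esym/eqP; rewrite mulf_eq0 intr_eq0 (negPf c0) gt_eqF.
have [e' he _] := cder_eps gg ut; have [d d0 hd] := cder_lip he.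
have sgw (z : C) : upper z -> w z = 1 \/ w z = -1.
  by move=> uz; have /eqP := w2 z uz; rewrite sqrf_eq1 => /orP[/eqP|/eqP]; [left|right].
have ew (z : C) : upper z -> eps g z = w z * sqrtc (J g z) by move=> uz; rewrite divfK // s0.
have rt := res t ut; set B := nm e' + 1 in hd; have B0 : 0 < B by rewrite /B; have := nm_ge0 e'; lra.
pose r := Num.min d (Num.min (imC t) (reC (sqrtc (J g t)) / B)).
have r0 : 0 < r by rewrite !lt_min d0 divr_gt0 //; rewrite /upper in ut; rewrite ut.
apply: (@cder_loc _ (fun _ => w t) _ _ _ r r0) (cder_cst _ _) => h.
rewrite /r !lt_min => /and3P[h1 h2 h3].
have uh : upper (t + h).
  have := imC_le h; rewrite ler_norml => /andP[h4 _]; rewrite /upper imCD; lra.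
have := hd h h1; rewrite ltr_pdivlMr // mulrC in h3 => h4.
have h5 := le_lt_trans h4 h3; have := le_lt_trans (reC_le _) h5.
rewrite reCB !ew // ltr_norml => /andP[h6 h7]; have r1 := res _ uh.
move: h6 h7; case: (sgw t ut) => ->; case: (sgw _ uh) => -> //; rewrite ?mul1r ?mulN1r ?reCN => h6 h7; exfalso; lra.
Qed.

Lemma eps_exprz g t k : GG R g -> upper t -> eps g t ^ k = J g t ^ (k %/ 2)%Z * (if (k %% 2 == 0)%Z then 1 else eps g t).
Proof.
move=> gg ut; have e0 := eps_neq0 (GG_SL2 gg) ut.
rewrite {1}(divz_eq k 2) expfzDr // [(_ %/ _)%Z * _]mulrC -exprz_exp.
rewrite -(eps_sqr gg ut); congr (_ * _).
have := modz_ge0 k (isT : (2 : int) != 0); have := ltz_pmod k (isT : (0 : int) < 2).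
by case: (k %% 2)%Z => -[|[|n]] //; lia.
Qed.

(** For odd [k] the multiplier is the sign that relates [eps] to the principal root in [halfpow]. *)
Lemma QM_quasimodular k f : QM k f -> quasimodular k f.
Proof.
move=> hf; have [p [N [p1 p2 p3 p4]]] := QM_completes hf.
pose nu g : C := if (k %% 2 == 0)%Z then 1 else
  xget 1 [set s : C | s ^+ 2 = 1 /\ forall t, upper t -> eps g t = s * sqrtc (J g t)]%classic.
have nuP g : GG R g -> (k %% 2 == 0)%Z = false -> nu g ^+ 2 = 1 /\ forall t, upper t -> eps g t = nu g * sqrtc (J g t).
  move=> gg hk; rewrite /nu hk; have [s hs] := eps_sqrtc gg.
  exact: (@xgetPex _ 1 [set s : C | s ^+ 2 = 1 /\ forall t, upper t -> eps g t = s * sqrtc (J g t)]%classic (ex_intro _ s hs)).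
exists (GG R), nu, N, (fun m t => (p t)`_m); split.
- exact: GG_finite_index.
- move=> g gg; case: ifPn => [hk|/negPf hk]; first by rewrite /nu hk.
  have [/eqP] := nuP g gg hk; rewrite sqrf_eq1 => /orP[] /eqP -> _; by rewrite ?normrN normr1.
- by move=> m _; exact: fou_fourier.
- by move=> t ut; rewrite p3.
move=> F g t gg ut.
have FE z : F z = (p z).[yinv z].
  rewrite /F (@horner_coef_wide _ N.+1); last exact: leq_trans (p2 z) _.
  by apply: eq_bigr => m _; rewrite /yinv -exprVn rmorphXn.
rewrite !FE p4 // eps_exprz //; congr (_ * _); rewrite /jfac /halfpow -/(J g t).
case hk : (k %% 2 == 0)%Z; first by rewrite /nu hk mul1r.
by have [_ ->] := nuP g gg hk; rewrite // mulrCA.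
Qed.

End QuasiModularRing.

(** * Lambert series *)

Section Lambert.
Variable R : realType.
Local Notation C := R[i].
Implicit Types (a b : nat -> C) (u w t : C).

Definition polyb a : Prop := exists (B : R) (e : nat), 0 <= B /\ forall n, nm (a n) <= B * n.+1%:R ^+ e.

Lemma polyb_growth a : polyb a -> growth a.
Proof.
move=> [B [e [B0 h]]]; apply: (growth_le (c := fun n => n.+1%:R ^+ e * B)).
  by move=> n; rewrite mulrC.
apply: bdd_poly_iter => // r r0 r1; exact: bddZ (bdd_geo r0 r1).
Qed.

Lemma polyb_succ a : polyb a -> polyb (fun n => n.+1%:R * a n).
Proof.
move=> [B [e [B0 h]]]; exists B, e.+1; split=> // n.
by rewrite [nm (_ * _)]nmM nm_nat exprS mulrCA ler_wpM2l.
Qed.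

Lemma polyb_cst c : polyb (fun _ => c).
Proof. by exists (nm c), 0%N; split=> [|n]; rewrite ?nm_ge0 // expr0 mulr1. Qed.

Lemma polyb_if a (P : pred nat) : polyb a -> polyb (fun n => if P n then a n else 0).
Proof.
move=> [B [e [B0 h]]]; exists B, e; split=> // n; case: ifP => // _.
by rewrite nm0 mulr_ge0 // exprn_ge0.
Qed.

Lemma polyb_ext a b : a =1 b -> polyb a -> polyb b.
Proof. by move=> e [B [d [B0 h]]]; exists B, d; split=> // n; rewrite -e. Qed.

(** The index [d] stands for the positive integer [d + 1], here and in the coefficient sequences
    below. *)
Definition gser b w : C := csum (fun d => b d * w ^+ d.+1).

Lemma asum_gser b w : growth b -> nm w < 1 -> asum (fun d => b d * w ^+ d.+1).
Proof.
move=> gb w1; apply: bdd_le (growth_asum gb w1) => d.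
rewrite exprSr mulrA [nm (_ * w)]nmM ler_piMr ?nm_ge0 // ltW //.
Qed.

(* Coefficients of the Lambert series [sum a_n b_d u^((n+1)(d+1))]. *)
Definition tc a b (N : nat) : C :=
  \sum_(n < N) \sum_(d < N) if (n.+1 * d.+1 == N)%N then a n * b d else 0.

Lemma tcC a b N : tc a b N = tc b a N.
Proof.
rewrite /tc exchange_big /=; apply: eq_bigr => n _; apply: eq_bigr => d _.
by rewrite mulnC; case: ifP => // _; rewrite mulrC.
Qed.

Lemma tc_lac a b N : tc a b N = \sum_(n < N.+1) lac (fun d => a n * b d) (fun d => (d.+1 * n.+1)%N) N.
Proof.
rewrite /tc big_ord_recr /= [X in _ = _ + X](_ : _ = 0) ?addr0.
  apply: eq_bigr => n _; rewrite /lac big_ord_recr /=.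
  rewrite [X in _ = _ + X]ifN ?addr0; last by apply/eqP; nia.
  by apply: eq_bigr => d _; rewrite eq_sym mulnC.
by rewrite /lac big1 // => d _; rewrite ifN //; apply/eqP; nia.
Qed.

(** The [n]-th summand starts at order at least [n], and the absolute sum of the contributions to
    order [N] is polynomially bounded in [N], so the double series may be rearranged. *)
Lemma lambert a b : polyb a -> polyb b -> growth (tc a b) /\
  forall u, nm u < 1 -> cvc (fun M => \sum_(n < M) a n * gser b (u ^+ n.+1)) (ev (tc a b) u).
Proof.
move=> pa pb; have gb := polyb_growth pb; move: (pa) (pb) => [B [e [B0 hB]]] [E [f [E0 hE]]].
pose A n N := lac (fun d => a n * b d) (fun d => (d.+1 * n.+1)%N) N.
have A0 n N : (N < n)%N -> A n N = 0.
  by move=> h; rewrite /A /lac big1 // => d _; rewrite ifN //; apply/eqP; nia.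
have bA n N : (n <= N)%N -> nm (A n N) <= N.+1%:R ^+ (e + f).+1 * (B * E).
  move=> nN; apply: le_trans (nm_sum _ _ _) _.
  have -> : N.+1%:R ^+ (e + f).+1 * (B * E) = \sum_(d < N.+1) (N.+1%:R ^+ e * B) * (N.+1%:R ^+ f * E).
    by rewrite sumr_const card_ord -mulr_natl exprS exprD; ring.
  apply: ler_sum => d _; case: ifP => _; last by rewrite nm0 !mulr_ge0 ?exprn_ge0.
  rewrite [nm (_ * _)]nmM ler_pM ?nm_ge0 //.
    by apply: le_trans (hB n) _; rewrite mulrC ler_wpM2r // lerXn2r ?nnegrE // ler_nat.
  by apply: le_trans (hE d) _; rewrite mulrC ler_wpM2r // lerXn2r ?nnegrE // ler_nat.
have bd (r : R) : 0 <= r -> r < 1 -> bdd (fun N => (\sum_(n < N.+1) nm (A n N)) * r ^+ N).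
  move=> r0 r1; have BE0 : 0 <= B * E by rewrite mulr_ge0.
  have := bdd_poly_iter (e + f).+2 (c := fun _ => B * E) (fun _ => BE0) (fun r r0 r1 => bddZ BE0 (bdd_geo r0 r1)) r0 r1.
  apply: bdd_le => N; rewrite ler_wpM2r ?exprn_ge0 //.
  have -> : N.+1%:R ^+ (e + f).+2 * (B * E) = \sum_(n < N.+1) N.+1%:R ^+ (e + f).+1 * (B * E).
    by rewrite sumr_const card_ord -mulr_natl exprS; ring.
  by apply: ler_sum => n _; apply: bA; rewrite -ltnS.
have [g h] := ev_triangular A0 bd.
have eT : tc a b = fun N => \sum_(n < N.+1) A n N by apply/funext => N; exact: tc_lac.
rewrite eT; split=> // u u1; apply: cvc_eq (h u u1) => M; apply: eq_bigr => n _.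
have ga : growth (fun d => a n * b d) by exact: growthZ.
have [_ L] := @lacunary R _ (fun d => (d.+1 * n.+1)%N) (fun j => ltac:(nia)) ga.
have [_ <-] := L u u1; rewrite /gser -csumZ.
  by apply: eq_csum => d; rewrite -exprM mulnC mulrA.
apply: asum_gser => //; rewrite [nm (_ ^+ _)]nmX exprn_ilt1 ?nm_ge0 //.
Qed.

(** A Lambert series in [q^(1/2)], since [12 N / 24 = N / 2]. *)
Definition TT a b t : C := csum (lterm (tc a b) (fun N => (12 * N)%N) 0 t).

Lemma ge12 j : (j <= 12 * j)%N. Proof. by rewrite leq_pmull. Qed.

Definition ph t : C := ee (2%:R^-1 * t).

Lemma nm_ph t : upper t -> nm (ph t) < 1.
Proof.
move=> ut; rewrite nm_ee expR_lt1 oppr_lt0 mulr_gt0 // ?mulr_gt0 ?pi_gt0 //.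
by rewrite natC -fmorphV imCMr mulr_gt0 // invr_gt0.
Qed.

Lemma phX t n : ph t ^+ n = ee (n%:R / 2%:R * t).
Proof. by rewrite eeX mulrA. Qed.

Lemma TT_ev a b t : TT a b t = ev (tc a b) (ph t).
Proof.
apply: eq_csum => N; rewrite /lterm phX subr0; suff -> : (12 * N)%N%:R / 24%:R = N%:R / 2%:R :> C by [].
by rewrite natrM; field.
Qed.

Lemma tc_succ a b N : tc (fun n => n.+1%:R * a n) (fun d => d.+1%:R * b d) N = N%:R * tc a b N.
Proof.
rewrite /tc big_distrr /=; apply: eq_bigr => n _; rewrite big_distrr /=; apply: eq_bigr => d _.
case: eqP => [h|_]; rewrite ?mulr0 //.
have -> : N%:R = n.+1%:R * d.+1%:R :> C by rewrite -natrM h.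
by rewrite mulrACA.
Qed.

Lemma cder_TT a b t : polyb a -> polyb b -> upper t ->
  cder (TT a b) t (tpi R / 2%:R * TT (fun n => n.+1%:R * a n) (fun d => d.+1%:R * b d) t).
Proof.
move=> pa pb ut; have g := (lambert pa pb).1; have g' := (lambert (polyb_succ pa) (polyb_succ pb)).1.
have e24 N : ((12 * N)%N%:R - 0%:R) / 24%:R * tc a b N = 2%:R^-1 * tc (fun n => n.+1%:R * a n) (fun d => d.+1%:R * b d) N.
  by rewrite tc_succ natrM subr0; field.
have gn : growth (fun N => (12 * N)%N%:R * tc a b N).
  by apply: growth_le (growthZ 12%:R (growth_poly g)) => N; rewrite natrM mulrA.
have := cder_lacunary 0 ge12 g gn ut; suff -> : csum (lterm (fun j => ((12 * j)%N%:R - 0%:R) / 24%:R * tc a b j) (fun N => (12 * N)%N) 0 t) =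
   2%:R^-1 * TT (fun n => n.+1%:R * a n) (fun d => d.+1%:R * b d) t by rewrite mulrA.
have [s _] := lacunary_sum 0 ge12 g' ut.
by rewrite /TT -csumZ //; apply: eq_csum => N; rewrite /lterm e24 mulrA.
Qed.

Lemma TT_lim a b t : polyb a -> polyb b -> upper t ->
  cvc (fun M => \sum_(n < M) a n * gser b (ph t ^+ n.+1)) (TT a b t).
Proof. by move=> pa pb ut; rewrite TT_ev; exact: (lambert pa pb).2 (nm_ph ut). Qed.

Lemma TT_C a b t : TT a b t = TT b a t.
Proof. by rewrite !TT_ev; apply: eq_csum => N; rewrite tcC. Qed.

Lemma TT_lin a b c d x y t : polyb a -> polyb b -> polyb c -> upper t ->
  (forall n, d n = x * a n + y * b n) -> TT d c t = x * TT a c t + y * TT b c t.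
Proof.
move=> pa pb pc ut e; have u1 := nm_ph ut; rewrite !TT_ev.
have ga := (lambert pa pc).1; have gb := (lambert pb pc).1.
rewrite -evZ // -(evZ y) // -evD //; try exact: growthZ.
apply: eq_csum => N; congr (_ * _); rewrite /tc !big_distrr -big_split /=; apply: eq_bigr => n _.
rewrite !big_distrr -big_split /=; apply: eq_bigr => m _.
by case: ifP => _; rewrite ?mulr0 ?addr0 // e mulrDl !mulrA.
Qed.

(** In terms of the integer [n + 1]: supported on the even integers, with the value of [a] at half
    the integer. *)
Definition dil a (n : nat) : C := if odd n then a n./2 else 0.

Lemma sum_dil (F : nat -> C) K : \sum_(n < K.*2) (if odd n then F n else 0) = \sum_(n < K) F n.*2.+1.
Proof.
elim: K => [|K IH]; first by rewrite !big_ord0.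
by rewrite doubleS !big_ord_recr /= IH odd_double /= addr0.
Qed.

Lemma sum_nodil (F : nat -> C) K : \sum_(n < K.*2) (if odd n then 0 else F n) = \sum_(n < K) F n.*2.
Proof.
elim: K => [|K IH]; first by rewrite !big_ord0.
by rewrite doubleS !big_ord_recr /= IH odd_double /= addr0.
Qed.

Lemma double_cof m : exists N, forall n, (N <= n)%N -> (m <= n.*2)%N.
Proof. by exists m => n hn; lia. Qed.

Lemma asum_even a : asum (fun n => if odd n then a n else 0) -> csum (fun n => if odd n then a n else 0) = csum (fun n => a n.*2.+1).
Proof.
move=> s; have h := cvc_sub (k := double) double_cof (asum_cvc s).
by apply/esym/csum_eqP; apply: cvc_eq h => K; rewrite sum_dil.
Qed.

Lemma polyb_dil a : polyb a -> polyb (dil a).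
Proof.
move=> [B [e [B0 h]]]; exists B, e; split=> // n; rewrite /dil; case: ifP => _.
  by apply: le_trans (h _) _; rewrite ler_wpM2l // lerXn2r ?nnegrE // ler_nat; lia.
by rewrite nm0 mulr_ge0 // exprn_ge0.
Qed.

Lemma gser_dil b w : polyb b -> nm w < 1 -> gser (dil b) w = gser b (w ^+ 2).
Proof.
move=> pb w1; have s := asum_gser (polyb_growth (polyb_dil pb)) w1.
have e n : dil b n * w ^+ n.+1 = if odd n then b n./2 * w ^+ n.+1 else 0.
  by rewrite /dil; case: ifP; rewrite ?mul0r.
rewrite /gser (eq_csum e) asum_even; last by apply: bdd_le s => n; rewrite -e.
apply: eq_csum => n; rewrite -exprM.
by have -> : n.*2.+1./2 = n; [lia | congr (_ * _ ^+ _); lia].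
Qed.

(** Both sides collect the products [a_m b_d] at the power [2 m d]: the factor 2 may sit on either
    variable. *)
Lemma TT_dil a b t : polyb a -> polyb b -> upper t -> TT (dil a) b t = TT a (dil b) t.
Proof.
move=> pa pb ut; have u1 := nm_ph ut.
have h1 := cvc_sub (k := double) double_cof (TT_lim (polyb_dil pa) pb ut).
apply: (cvc_unique h1); apply: cvc_eq (TT_lim pa (polyb_dil pb) ut) => K.
have -> : \sum_(n < K.*2) dil a n * gser b (ph t ^+ n.+1) = \sum_(n < K.*2) if odd n then a n./2 * gser b (ph t ^+ n.+1) else 0.
  by apply: eq_bigr => n _; rewrite /dil; case: ifP; rewrite ?mul0r.
rewrite (sum_dil (fun n => a n./2 * gser b (ph t ^+ n.+1))); apply: eq_bigr => n _.
have -> : n.*2.+1./2 = n by lia.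
have w1 : nm (ph t ^+ n.+1) < 1 by rewrite [nm (_ ^+ _)]nmX exprn_ilt1 ?nm_ge0.
rewrite (gser_dil pb w1) -exprM; have -> : (n.+1 * 2 = n.*2.+2)%N by lia.
by [].
Qed.

Definition pown (r n : nat) : C := n.+1%:R ^+ r.
Definition alt (r n : nat) : C := (-1) ^+ n * n.+1%:R ^+ r.
Definition odds a (n : nat) : C := if odd n then 0 else a n.

Lemma polyb_pown r : polyb (pown r).
Proof. by exists 1, r; split=> // n; rewrite [nm _]nmX nm_nat mul1r. Qed.

Lemma polyb_alt r : polyb (alt r).
Proof.
exists 1, r; split=> // n; rewrite [nm (_ * _)]nmM [nm (_ ^+ n)]nmX [nm (_ ^+ r)]nmX nm_nat.
by rewrite nmN nm1 expr1n.
Qed.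

Lemma polyb_odds a : polyb a -> polyb (odds a).
Proof.
move=> h; apply: polyb_ext (polyb_if (fun n => ~~ odd n) h) => n.
by rewrite /odds; case: odd.
Qed.

Lemma alt_dil r n : alt r n = pown r n - 2%:R ^+ r.+1 * dil (pown r) n.
Proof.
rewrite /alt /pown /dil -signr_odd; case: (boolP (odd n)) => h; last by rewrite expr0 mul1r mulr0 subr0.
rewrite expr1 mulN1r exprS -mulrA -exprMn -natrM.
have -> : (2 * n./2.+1 = n.+1)%N by lia.
by set x := _ ^+ r; ring.
Qed.

Lemma odds_dil r n : odds (pown r) n = pown r n - 2%:R ^+ r * dil (pown r) n.
Proof.
rewrite /odds /pown /dil; case: (boolP (odd n)) => h; last by rewrite mulr0 subr0.
rewrite -exprMn -natrM; have -> : (2 * n./2.+1 = n.+1)%N by lia.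
by rewrite subrr.
Qed.

(** Expansion in [w] of the derivative of order [r + 1] of [log (1 + w exp z)] at [z = 0]. *)
Definition cm (r : nat) w : C := gser (alt r) w.

Lemma cm_cumul w : nm w < 1 -> cumul w (fun n => cm n w).
Proof.
move=> w1 n; have s r := asum_gser (polyb_growth (polyb_alt r)) w1.
have -> : \sum_(j < n.+1) 'C(n, j)%:R * cm j w = csum (fun d => (-1) ^+ d * d.+2%:R ^+ n * w ^+ d.+1).
  rewrite /cm /gser; apply/esym.
  apply: csum_eqP; have h := @cvc_sumI R _ (index_enum 'I_n.+1) _ _ (fun j : 'I_n.+1 => cvcZ 'C(n, j)%:R (asum_cvc (s j))).
  apply: cvc_eq h => N; under eq_bigr => j _ do rewrite big_distrr /=.
  rewrite exchange_big /=; apply: eq_bigr => d _.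
  rewrite -[d.+2%:R]nat1r exprDn big_distrr big_distrl /=; apply: eq_bigr => j _.
  rewrite /alt expr1n mul1r -mulr_natl; ring.
rewrite /cm /gser csum_head // /alt expr0 expr1n !mul1r expr1.
have pb : polyb (fun d => (-1) ^+ d * d.+2%:R ^+ n : C).
  exists (2 ^+ n), n; split=> [|d]; first exact: exprn_ge0.
  rewrite [nm (_ * _)]nmM [nm (_ ^+ d)]nmX [nm (_ ^+ n)]nmX nm_nat nmN nm1 expr1n mul1r -exprMn.
  by rewrite lerXn2r ?nnegrE ?mulr_ge0 // -natrM ler_nat; lia.
have s2 := asum_gser (polyb_growth pb) w1; have s1 := asumZ w s2.
rewrite -csumZ //; have -> : csum (fun d => (-1) ^+ d.+1 * d.+2%:R ^+ n * w ^+ d.+2) = - csum (fun d => w * ((-1) ^+ d * d.+2%:R ^+ n * w ^+ d.+1)).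
  by rewrite -[RHS]mulN1r -csumZ //; apply: eq_csum => d; rewrite !exprS; ring.
by rewrite addrNK.
Qed.

Lemma cm_neg r w : nm w < 1 -> cm r (- w) = - gser (pown r) w.
Proof.
move=> w1; rewrite -[RHS]mulN1r /gser -csumZ; last exact: asum_gser (polyb_growth (polyb_pown r)) w1.
apply: eq_csum => d; rewrite /alt /pown -[- w]mulN1r exprMn exprS.
have -> : (-1) ^+ d * d.+1%:R ^+ r * (-1 * (-1) ^+ d * w ^+ d.+1) = ((-1) ^+ d * (-1) ^+ d) * (-1 * (d.+1%:R ^+ r * w ^+ d.+1)) by ring.
by rewrite -exprMn mulrNN mulr1 expr1n mul1r.
Qed.

Lemma gser_null b t : polyb b -> upper t -> cvc (fun K => gser b (ph t ^+ K.+1)) 0.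
Proof.
move=> pb ut; have h := TT_lim (polyb_cst 1) pb ut.
rewrite -(subrr (TT (fun _ => 1) b t)); apply: cvc_eq (cvcB (cvc_shift 1 h) h) => K.
by rewrite addn1 big_ord_recr /= addrAC subrr add0r mul1r.
Qed.

End Lambert.

(** * Cumulants of the theta constants *)

Section Cumulants.
Variable R : realType.
Local Notation C := R[i].
Implicit Types (sg h : bool) (t : C) (r : nat).
Notation etai := (Vf (R := R) [::]).

Lemma TT_lim_odds (a b : nat -> C) t : polyb a -> polyb b -> upper t ->
  cvc (fun K => \sum_(n < K) a n.*2 * gser b (ph t ^+ n.*2.+1)) (TT (odds a) b t).
Proof.
move=> pa pb ut; apply: cvc_eq (cvc_sub double_cof (TT_lim (polyb_odds pa) pb ut)) => K.
have -> : \sum_(n < K.*2) odds a n * gser b (ph t ^+ n.+1) = \sum_(n < K.*2) if odd n then 0 else a n * gser b (ph t ^+ n.+1).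
  by apply: eq_bigr => n _; rewrite /odds; case: ifP; rewrite ?mul0r.
by rewrite (sum_nodil (fun n => a n * gser b (ph t ^+ n.+1))).
Qed.

Lemma TT_lim_dil (a b : nat -> C) t : polyb a -> polyb b -> upper t ->
  cvc (fun K => \sum_(n < K) a n * gser b (ph t ^+ n.*2.+2)) (TT (dil a) b t).
Proof.
move=> pa pb ut; apply: cvc_eq (cvc_sub double_cof (TT_lim (polyb_dil pa) pb ut)) => K.
have -> : \sum_(n < K.*2) dil a n * gser b (ph t ^+ n.+1) = \sum_(n < K.*2) if odd n then a n./2 * gser b (ph t ^+ n.+1) else 0.
  by apply: eq_bigr => n _; rewrite /dil; case: ifP; rewrite ?mul0r.
rewrite (sum_dil (fun n => a n./2 * gser b (ph t ^+ n.+1))); apply: eq_bigr => n _.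
by have -> : n.*2.+1./2 = n by lia.
Qed.

Lemma sum_modes (F : bool * nat -> C) K :
  \sum_(i <- modes K) F i = \sum_(n < K) (F (true, nat_of_ord n) + F (false, nat_of_ord n)).
Proof.
rewrite /modes -val_enum_ord -map_comp big_flatten big_map big_enum /=.
by apply: eq_bigr => n _; rewrite !big_cons big_nil addr0.
Qed.

Lemma cvc_unshift (u : nat -> C) l : cvc (fun K => u K.+1) l -> cvc u l.
Proof.
move=> h; have hp m : exists N, forall n, (N <= n)%N -> (m <= n.-1)%N by exists m.+1 => n hn; lia.
apply: (@cvc_ext _ (fun K => u K.-1.+1) u _ 1%N) (cvc_sub hp h) => K hK.
by rewrite prednK.
Qed.

Lemma chi_ph sg t b n : chi sg t (ymh R false (b, n)) = sgn R sg * ph t ^+ n.*2.+1.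
Proof.
rewrite chi_ymh phX; congr (_ * _); suff -> : n%:R + 2%:R^-1 + (if b then false%:R / 2%:R else - (false%:R / 2%:R)) = n.*2.+1%:R / 2%:R :> C by [].
by rewrite -[n.*2.+1]addn1 natrD -mul2n natrM; case: b; rewrite mul0r ?oppr0 addr0; field.
Qed.

Lemma chi_ph2 t b n : chi false t (ymh R true (b, n)) = ph t ^+ (if b then n.*2.+2 else n.*2).
Proof.
rewrite chi_ymh mul1r phX; suff -> : n%:R + 2%:R^-1 + (if b then true%:R / 2%:R else - (true%:R / 2%:R)) = (if b then n.*2.+2 else n.*2)%:R / 2%:R :> C by [].
have t1 : (true%:R : C) = 1 by [].
by case: b; rewrite t1 -?[n.*2.+2]addn2 ?natrD -mul2n natrM; field.
Qed.

Lemma pown0 n : pown R 0 n = 1. Proof. exact: expr0. Qed.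

(* For [h = true] one mode is weightless, so its Lambert series diverges; [cum1] is its cumulant. *)
Definition cc sg h t (i : bool * nat) r : C :=
  if h && (i == (false, 0%N)) then (cum1 R r)%:C else cm r (chi sg t (ymh R h i)).

Lemma cc_cumul sg h t i : sg && h = false -> upper t -> cumul (chi sg t (ymh R h i)) (cc sg h t i).
Proof.
move=> hsg ut; have p1 := nm_ph ut; have pw n : nm (ph t ^+ n.+1) < 1.
  by rewrite [nm (_ ^+ _)]nmX exprn_ilt1 ?nm_ge0.
case: i => b n; case: h hsg => [|_].
  rewrite andbT => ->; rewrite chi_ph2 /cc /=; case: eqP => [[-> ->]|ne].
    rewrite expr0 => m; transitivity ((cum1 R m + 1 * \sum_(j < m.+1) 'C(m, j)%:R * cum1 R j)%:C); last by rewrite cum1P.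
    rewrite !mul1r [RHS]rmorphD [X in _ = _ + X]rmorph_sum; congr (_ + _).
    by apply: eq_bigr => j _; rewrite rmorphM rmorph_nat.
  rewrite chi_ph2; apply: cm_cumul; case: b ne => // ne; case: n ne => // n _.
  by rewrite doubleS.
rewrite /cc /=; apply: cm_cumul; rewrite chi_ph [nm (_ * _)]nmM.
suff -> : nm (sgn R sg) = 1 by rewrite mul1r.
by case: sg; rewrite /sgn ?nmN nm1.
Qed.

Lemma ymh0 h b n : ymh R h (b, n) 0 = if b then 1 else -1.
Proof. by rewrite /ymh /= addr0 /modex; case: b; rewrite /omx1 /omx2 /= ?expr0 ?mulr1 // rmorphN. Qed.

Lemma xih0 h : xih R h 0 = (h%:R / 2)%:C.
Proof. by rewrite /xih /tw /xi_exp add0r. Qed.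

(** The truncated cumulant of order [r + 1] of the charge, which is the exponent of index 0. *)
Definition AK sg h t r K : C := Lcum (ymh R h) (cc sg h t) (modes K) (xih R h) 0 (nseq r 0%N).

Lemma AK_E sg h t r K : AK sg h t r K = (h%:R / 2)%:C * (r == 0%N)%:R +
  \sum_(n < K) (cc sg h t (true, nat_of_ord n) r + (-1) ^+ r.+1 * cc sg h t (false, nat_of_ord n) r).
Proof.
rewrite /AK /Lcum xih0 sum_modes; congr (_ * _ + _).
  by rewrite /del0; case: r.
have mn b n : mon (ymh R h (b, n)) (nseq r 0%N) = (if b then 1 else -1) ^+ r.
  by elim: r => [|r IH] /=; rewrite ?mon_nil // mon_cons IH ymh0 exprS.
by apply: eq_bigr => n _; rewrite !mn !ymh0 size_nseq expr1n !mul1r mulrA -exprS.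
Qed.

(** The limits of the truncated cumulants. Those of odd order ([r] even) vanish by the symmetry of
    the charge; for theta_2 the constant comes from the weightless mode. *)
Definition A sg h r t : C :=
  if odd r then
    if h then (cum1 R r)%:C + 2%:R * TT (dil (pown R 0)) (alt R r) t
    else if sg then - 2%:R * TT (odds (pown R 0)) (pown R r) t
    else 2%:R * TT (odds (pown R 0)) (alt R r) t
  else 0.

Lemma cum1_even r : odd r = false -> cum1 R r = (r == 0%N)%:R / 2.
Proof.
case: r => [_|r hr].
  have b1 : bernoulli 1 = - 2%:R^-1 by rewrite /bernoulli /= big_ord_recl big_ord0 /= bin0; lra.
  rewrite /cum1 /bern b1 rmorphN fmorphV /= (_ : ratr 2 = 2 :> R) ?ratr_nat //; lra.
rewrite /cum1 bern_odd //=; last by rewrite -[odd r]negbK -/(odd r.+1) hr.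
by rewrite mulr0 !mul0r addr0.
Qed.

(** For even [r] the two charges cancel. When [h = true] they match only after a shift by one mode:
    the unmatched term tends to 0, and the weightless mode cancels the initial charge [h / 2]. *)
Lemma AK_lim sg h t r : sg && h = false -> upper t -> cvc (AK sg h t r) (A sg h r t).
Proof.
move=> hsg ut; have E K := AK_E sg h t r K.
apply: cvc_eq (fun K => esym (E K)) _; rewrite /A -signr_odd /=.
case: h hsg {E} => [|_].
  rewrite andbT => ->.
  have lim := TT_lim_dil (polyb_pown R 0) (polyb_alt R r) ut.
  have ccT n : cc false true t (true, n) r = gser (alt R r) (ph t ^+ n.*2.+2) by rewrite /cc /= chi_ph2.
  have ccF n : cc false true t (false, n.+1) r = gser (alt R r) (ph t ^+ n.*2.+2) by rewrite /cc /= chi_ph2.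
  have ccZ : cc false true t (false, 0%N) r = (cum1 R r)%:C by [].
  apply: cvc_unshift; case: (boolP (odd r)) => hr /=.
    apply: (@cvc_eq _ (fun K => (cum1 R r)%:C + (\sum_(n < K.+1) pown R 0 n * gser (alt R r) (ph t ^+ n.*2.+2) +
        \sum_(n < K) pown R 0 n * gser (alt R r) (ph t ^+ n.*2.+2)))).
      move=> K; rewrite (_ : (r == 0%N)%:R = 0) ?mulr0 ?add0r; last by case: (r) hr.
      rewrite big_split /= addrCA; congr (_ + _).
        by apply: eq_bigr => n _; rewrite ccT pown0 mul1r.
      rewrite big_ord_recl [X in _ = X + _](_ : _ = (cum1 R r)%:C); last by rewrite expr0 mul1r.
      apply: (@f_equal C C (fun z => (cum1 R r)%:C + z)); apply: eq_bigr => n _.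
      by rewrite lift0 ccF expr0 pown0 !mul1r.
    apply: cvcD; first exact: cvc_cst.
    rewrite mulr_natl mulr2n; apply: cvcD; last exact: lim.
    by apply: cvc_eq (cvc_shift 1 lim) => K; rewrite addn1.
  have z := cvc_sub double_cof (cvc_shift 1 (gser_null (polyb_alt R r) ut)).
  apply: cvc_eq z => K; rewrite addn1 expr1 big_split /= big_ord_recr /=.
  rewrite -big_distrr /= [X in _ = _ + (_ + _ * X)]big_ord_recl ccZ cum1_even; last exact: negbTE.
  rewrite [X in _ = _ + (_ + _ * (_ + X))](_ : _ = \sum_(i < K) cc false true t (true, nat_of_ord i) r); last first.
    by apply: eq_bigr => n _; rewrite lift0 ccF ccT.
  rewrite ccT; have -> : ((r == 0%N)%:R / 2 : R)%:C = (1 / 2)%:C * (r == 0%N)%:R.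
    by case: eqP => _; rewrite ?mulr1 // mul0r mulr0.
  by move: (_%:C) (gser _ _) (\sum_(i < K) _) => *; ring.
rewrite mul0r mul0r; case: sg => /=.
  have ccE b n : cc true false t (b, n) r = - gser (pown R r) (ph t ^+ n.*2.+1).
    rewrite /cc /= chi_ph mulN1r cm_neg // [nm (_ ^+ _)]nmX exprn_ilt1 ?nm_ge0 //; exact: nm_ph.
  case: (boolP (odd r)) => hr /=.
    have := cvcZ (- 2%:R) (TT_lim_odds (polyb_pown R 0) (polyb_pown R r) ut); apply: cvc_eq => K.
    rewrite add0r mulr_sumr; apply: eq_bigr => n _; rewrite !ccE expr0 pown0 !mul1r; ring.
  by apply: cvc_eq (cvc_cst 0) => K; rewrite add0r big1 // => n _; rewrite !ccE expr1; ring.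
have ccE b n : cc false false t (b, n) r = gser (alt R r) (ph t ^+ n.*2.+1).
  by rewrite /cc /= chi_ph mul1r.
case: (boolP (odd r)) => hr /=.
  have := cvcZ 2%:R (TT_lim_odds (polyb_pown R 0) (polyb_alt R r) ut); apply: cvc_eq => K.
  rewrite add0r mulr_sumr; apply: eq_bigr => n _; rewrite !ccE expr0 pown0 !mul1r; ring.
by apply: cvc_eq (cvc_cst 0) => K; rewrite add0r big1 // => n _; rewrite !ccE expr1; ring.
Qed.

Lemma shc_nseq (F G : seq nat -> C) e : shc (nseq e 0%N) F G =
  bc (fun r => F (nseq r 0%N)) (fun r => G (nseq r 0%N)) e.
Proof.
by elim: e F G => [|e IH] F G //=; rewrite bcS !IH.
Qed.

(** The moment-cumulant recursion for the charge; the factor 1/eta is common to all moments and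
    cancels. *)
Lemma theta_cumulants sg h e t : sg && h = false -> upper t ->
  th sg h e.+1 t = \sum_(j < e.+1) 'C(e, j)%:R * A sg h j t * th sg h (e - j) t.
Proof.
move=> hsg ut; have n0 := (nonzero ut).2; apply: (mulIf n0).
have h1 := Zst_th e.+1 hsg ut.
apply: (cvc_unique h1); rewrite big_distrl /=.
apply: (@cvc_eq _ (fun K => \sum_(j < e.+1) 'C(e, j)%:R * AK sg h t j K * Zst (chi sg t) (ymh R h) (modes K) (xih R h) (nseq (e - j) 0%N))).
  move=> K; rewrite (Zst_rec (@chiD R sg t) _ _ (fun i => cc_cumul i hsg ut)) -[nseq e 0]/(nseq e 0%N).
  by rewrite shc_nseq bcE.
apply: cvc_sumI => j; rewrite -[X in cvc _ X]mulrA.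
exact: cvcM (cvcZ _ (AK_lim j hsg ut)) (Zst_th (e - j) hsg ut).
Qed.

Lemma th_odd sg h e t : sg && h = false -> upper t -> odd e -> th sg h e t = 0.
Proof.
move=> hsg ut; elim/ltn_ind: e => -[//|e] IH oe; rewrite theta_cumulants // big1 // => j _.
rewrite /A; case: ifPn => oj; last by rewrite mulr0 mul0r.
by rewrite [th _ _ _ _]IH ?mulr0 //; have := ltn_ord j; lia.
Qed.

(** The triple product also supplies inverses: [1/theta_i] is half the product of the other two
    theta constants and [eta^-3]. *)
Lemma QM_th0 sg h : sg && h = false -> QM (R := R) 1 (th sg h 0) /\ QM (R := R) (-1) (fun t => (th sg h 0 t)^-1).
Proof.
have e3 : QM (-3 : int) (fun t : C => 2%:R^-1 * etai t ^+ 3).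
  apply: (QM_ext (f := fun t => 2%:R^-1 * (etai t * etai t * etai t))); first by move=> t _; rewrite !exprS expr0 mulr1 mulrA.
  by apply: QM_scale; apply: (@QM_mul _ (-2) (-1)); [apply: (@QM_mul _ (-1) (-1))|]; exact/QM_Mod/Mod_etai.
have H (i j k : 'I_3) : (forall t, upper t -> thi i t * thi j t * thi k t * etai t ^+ 3 = 2%:R) ->
    QM 1 (thi (R := R) i) /\ QM (-1) (fun t : C => (thi i t)^-1).
  move=> e; split; first exact/QM_Mod/Mod_th.
  apply: (QM_ext (f := fun t => thi j t * thi k t * (2%:R^-1 * etai t ^+ 3))).
    move=> t ut; have n0 := (nonzero ut).1 i; apply: (mulfI n0); rewrite divff // -[RHS](divff (_ : 2%:R != 0)) ?pnatr_eq0 //.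
    by rewrite -(e t ut); move: (thi _ _) (thi _ _) (thi _ _) (etai t) => *; ring.
  by apply: (@QM_mul _ 2 (-3)) => //; apply: (@QM_mul _ 1 1); exact/QM_Mod/Mod_th.
have T t : upper t -> thi 0 t * thi 1 t * thi (@Ordinal 3 2 isT) t * etai t ^+ 3 = 2%:R.
  by move=> ut; rewrite thi_0 thi_1 thi_2; exact: triple_product.
case: h => [|_]; first rewrite andbT => ->.
  rewrite -thi_2; apply: (H _ 0 1) => t ut; rewrite -(T t ut).
  by move: (thi _ _) (thi _ _) (thi _ _) (etai t) => *; ring.
case: sg.
  rewrite -thi_1; apply: (H _ 0 (@Ordinal 3 2 isT)) => t ut; rewrite -(T t ut).
  by move: (thi _ _) (thi _ _) (thi _ _) (etai t) => *; ring.
rewrite -thi_0; exact: (H _ 1 (@Ordinal 3 2 isT)).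
Qed.

Lemma QM_wt k l (f : C -> C) : k = l -> QM k f -> QM l f.
Proof. by move=> ->. Qed.

Lemma QM_th sg h e : sg && h = false -> QM (R := R) (1 + 2 * e%:Z) (th sg h e).
Proof.
move=> hsg; case: (boolP (odd e)) => oe.
  by apply: QM_ext (QM_0 _ _) => t ut; rewrite th_odd.
rewrite -[e]odd_double_half (negPf oe) add0n; elim: (e./2) => [|m IH].
  rewrite double0; exact: (QM_th0 hsg).1.
apply: (QM_ext (f := fun t => 2%:R / tpi R * D (th sg h m.*2) t)).
  move=> t ut; rewrite (DP (cder_th sg h m.*2 ut)) mulrA.
  have -> : 2%:R / tpi R * (tpi R / 2%:R) = 1 by field; exact: tpi_neq0.
  by rewrite mul1r.
by apply: QM_scale; apply: QM_wt (QM_D IH); lia.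
Qed.

Lemma th_neq0 sg h t : sg && h = false -> upper t -> th sg h 0 t != 0.
Proof.
move=> hsg ut; have n := (nonzero ut).1; move: (n 0) (n 1) (n (@Ordinal 3 2 isT)).
rewrite thi_0 thi_1 thi_2 => h0 h1 h2; case: h hsg => [|_]; last by case: sg; [exact: h1 | exact: h0].
rewrite andbT => ->; exact: h2.
Qed.

(** The moment-cumulant recursion is solved for its last cumulant, whose coefficient [th sg h 0] is
    invertible in the ring. *)
Lemma QM_A sg h r : sg && h = false -> QM (2 * r.+1%:Z) (A sg h r).
Proof.
move=> hsg; elim/ltn_ind: r => r IH.
apply: (QM_ext (f := fun t => (th sg h r.+1 t - \sum_(j < r) 'C(r, j)%:R * (A sg h j t * th sg h (r - j) t)) * (th sg h 0 t)^-1)).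
  move=> t ut; rewrite theta_cumulants // big_ord_recr /= binn mul1r subnn.
  have n0 := th_neq0 hsg ut.
  rewrite addrC; set S := (X in _ - X); have -> : \sum_(i < r) 'C(r, i)%:R * A sg h i t * th sg h (r - i) t = S.
    by apply: eq_bigr => j _; rewrite mulrA.
  by rewrite addrK mulfK.
apply: (@QM_wt (1 + 2 * r.+1%:Z + -1)); first lia.
apply: QM_mul; last exact: (QM_th0 hsg).2.
apply: QM_sub; first exact: QM_th.
apply: QM_sum => j; apply: QM_scale.
apply: QM_wt (QM_mul (IH j (ltn_ord j)) (QM_th (r - j) hsg)).
by have := ltn_ord j; lia.
Qed.

(** The series [sum (n/2)^s (-1)^(d-1) d^r q^(n d / 2)] over odd [n >= 1] and all [d >= 1]. *)
Definition EE s r t : C := 2%:R ^- s * TT (odds (pown R s)) (alt R r) t.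

Lemma cder_EE s r t : upper t -> cder (EE s r) t (tpi R * EE s.+1 r.+1 t).
Proof.
move=> ut; have := cderZ (2%:R ^- s) (cder_TT (polyb_odds (polyb_pown R s)) (polyb_alt R r) ut).
have -> : (fun n => n.+1%:R * odds (pown R s) n) = odds (pown R s.+1).
  by apply/funext => n; rewrite /odds /pown; case: ifP => _; rewrite ?mulr0 // -exprS.
have -> : (fun d => d.+1%:R * alt R r d) = alt R r.+1.
  by apply/funext => n; rewrite /alt mulrCA -exprS.
suff -> : 2%:R ^- s * (tpi R / 2%:R * TT (odds (pown R s.+1)) (alt R r.+1) t) = tpi R * EE s.+1 r.+1 t by [].
rewrite /EE exprS invfM; move: (TT _ _ _) (_ ^- s) => *; ring.
Qed.

Definition L1 r t : C := (vv R r)%:C + 2%:R * EE r 0 t.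

(* Level-two relation expressing the Eisenstein series [L1] through the three theta cumulants. *)
Lemma L1_A r : odd r -> exists x2 x3 x4 : C, forall t, upper t ->
  L1 r t = x2 * A false true r t + x3 * A false false r t + x4 * A true false r t.
Proof.
move=> hr; pose Y : C := 2%:R ^+ r; pose one := pown R 0; pose N := pown R r.
have Y0 : Y != 0 by rewrite expf_neq0 // pnatr_eq0.
have Y1 : 1 - 2%:R * Y != 0.
  have -> : 2%:R * Y = (2 ^ r.+1)%N%:R by rewrite natrX exprS.
  rewrite subr_eq0 eq_sym pnatr_eq1 expnS; have := expn_gt0 2 r; set x := (2 ^ r)%N; lia.
(* Comparing the coefficients of [d], [c] and [a] below determines [x2], [x3] and [x4 = x3 - 1/Y] in
   turn; the constant terms then agree by [cst]. *)
pose x2 := (Y - 1) / (Y * (1 - 2%:R * Y)); pose x3 := (x2 + (1 + Y) / Y) / (2%:R * Y).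
exists x2, x3, (x3 - Y^-1) => t ut; rewrite /A hr /L1 /EE.
have po := polyb_pown R 0; have pN := polyb_pown R r.
have [a [b [c [d [ea eb ec ed]]]]] : exists a b c d : C, [/\ TT (odds one) N t = a, TT (dil one) N t = b, TT (odds one) (dil N) t = c & TT (dil one) (dil N) t = d].
  by do 4 eexists; split.
have hb : b = c + d.
  rewrite -eb TT_dil // -ec -ed -[X in X + _]mul1r -[X in _ + X]mul1r; apply/esym.
  apply/esym/TT_lin => //; try exact: polyb_odds; try exact: polyb_dil.
  by move=> n; rewrite !mul1r /odds /dil /one !pown0; case: odd; rewrite ?add0r ?addr0.
have altE x : polyb x -> TT x (alt R r) t = TT x N t + - (2%:R * Y) * TT x (dil N) t.
  move=> px; rewrite !(TT_C x) -[X in X + _]mul1r; apply: TT_lin => //; first exact: polyb_dil.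
  by move=> n; rewrite mul1r alt_dil exprS mulNr.
rewrite !altE //; try exact: polyb_odds; try exact: polyb_dil.
have -> : TT (odds (pown R r)) (alt R 0) t = a - b - Y * c + Y * d.
  have h1 : TT (odds N) (alt R 0) t = 1 * TT N (alt R 0) t + - Y * TT (dil N) (alt R 0) t.
    apply: TT_lin => //; [exact: polyb_dil | exact: polyb_alt | move=> n].
    by rewrite mul1r odds_dil mulNr.
  have h2 x : polyb x -> TT x (alt R 0) t = 1 * TT (odds one) x t + -1 * TT (dil one) x t.
    move=> px; rewrite TT_C; apply: TT_lin => //; [exact: polyb_odds | exact: polyb_dil | move=> n].
    rewrite /odds /dil /one !pown0 /alt expr0 mulr1 -signr_odd.
    by case: odd; rewrite ?expr1 ?expr0 ?mulr0 ?mulr1 ?add0r ?addr0.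
  rewrite h1 !h2 //; last exact: polyb_dil.
  rewrite ea eb ec ed; ring.
have cst : x2 * (cum1 R r)%:C = (vv R r)%:C.
  have YE : Y = ((2 ^+ r : R))%:C by rewrite /Y natC -rmorphXn.
  have y0 : 2 ^+ r != 0 :> R by rewrite expf_neq0 // pnatr_eq0.
  have y1 : 1 - 2 * 2 ^+ r != 0 :> R.
    by apply/eqP => h; move/eqP: Y1; apply; rewrite YE natC -rmorphM -rmorphB h.
  have -> : x2 = ((2 ^+ r - 1) / (2 ^+ r * (1 - 2 * 2 ^+ r)))%:C.
    by rewrite /x2 YE natC !(rmorphM, rmorphB, fmorphV, rmorph1).
  rewrite -rmorphM; congr (_%:C); rewrite /cum1 /vv /bhalf.
  have -> : (r == 0%N)%:R = 0 :> R by case: (r) hr.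
  rewrite addr0 !exprS; have n0 : r.+1%:R != 0 :> R by rewrite pnatr_eq0.
  have -> : (2^-1 : R) ^+ r = (2 ^+ r)^-1 by rewrite exprVn.
  by field; rewrite ?nat1r ?n0 ?y0 ?y1.
rewrite ea eb ec ed -cst hb /x3.
have -> : 2%:R ^- r = Y^-1 by [].
move: (cum1 R r)%:C => u; rewrite /x2; field; by rewrite Y0 Y1.
Qed.

End Cumulants.

(** * Quasimodularity of the coefficients of Omega and V *)

Section Conclusion.
Variable R : realType.
Local Notation C := R[i].
Implicit Types (t : C) (k r s : nat) (ks : seq nat).
Notation etai := (Vf (R := R) [::]).
Notation QM := (@QM R).

Lemma QM_L1 r : odd r -> QM (2 * r.+1%:Z) (L1 r).
Proof.
move=> hr; have [x2 [x3 [x4 h]]] := L1_A R hr.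
apply: (QM_ext (f := fun t => x2 * A false true r t + x3 * A false false r t + x4 * A true false r t)).
  by move=> t ut; rewrite h.
by apply: QM_add; [apply: QM_add|]; apply: QM_scale; exact: QM_A.
Qed.

(** Up to a factor this is the derivative of order [p + 1] of [L1 r], whose constant term disappears
    at the first differentiation. *)
Lemma QM_EE_diag r p : odd r -> QM (2 * r.+1%:Z + 4 * p.+1%:Z) (EE (R := R) (r + p.+1) p.+1).
Proof.
move=> hr; have t0 := tpi_neq0 R; elim: p => [|p IH].
  apply: (QM_ext (f := fun t => (2%:R * tpi R)^-1 * D (L1 r) t)).
    move=> t ut; have h := cderD (cder_cst ((vv R r)%:C) t) (cderZ 2%:R (cder_EE r 0 ut)).
    rewrite (DP h) add0r addn1 [2%:R * (tpi R * _)]mulrA mulKf // mulf_neq0 // pnatr_eq0 //.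
  by apply: QM_scale; apply: QM_wt (QM_D (QM_L1 hr)); lia.
apply: (QM_ext (f := fun t => (tpi R)^-1 * D (EE (r + p.+1) p.+1) t)).
  by move=> t ut; rewrite (DP (cder_EE _ _ ut)) mulKf // !addnS.
by apply: QM_scale; apply: QM_wt (QM_D IH); lia.
Qed.

(** Up to a factor this is the [p]-th derivative of half the theta_3 cumulant, which is [EE 0 r]. *)
Lemma QM_EE_theta r p : odd r -> QM (2 * r.+1%:Z + 4 * p%:Z) (EE (R := R) p (r + p)).
Proof.
move=> hr; have t0 := tpi_neq0 R; elim: p => [|p IH].
  apply: (QM_ext (f := fun t => 2%:R^-1 * A false false r t)).
    move=> t ut; rewrite /A hr addn0 /EE expr0 invr1 mul1r mulKf ?pnatr_eq0 //.
  by apply: QM_scale; apply: QM_wt (@QM_A R false false r erefl); rewrite mulr0 addr0.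
apply: (QM_ext (f := fun t => (tpi R)^-1 * D (EE p (r + p)) t)).
  by move=> t ut; rewrite (DP (cder_EE _ _ ut)) mulKf // !addnS.
by apply: QM_scale; apply: QM_wt (QM_D IH); lia.
Qed.

(** Limit of the logarithmic derivative along [k :: ks]. The two modes of equal energy add up or
    cancel according to parity, and [- xi(-k)] is present only when [ks] is empty. *)
Definition Lc k ks t : C := xiC R k * del0 C ks +
  (if odd (k + sumn ks + size ks) then 2%:R * EE (k + sumn ks) (size ks) t else 0).

Lemma mon_ymode b n ks : mon (ymode R (b, n)) ks =
  (if b then 1 else (-1) ^+ (sumn ks + size ks)) * (2%:R ^- sumn ks * pown R (sumn ks) n.*2).
Proof.
have hE : (Defs.half R n)%:C = 2%:R^-1 * n.*2.+1%:R.
  rewrite /Defs.half rmorphD rmorph_nat fmorphV rmorph_nat -[n.*2.+1]addn1 natrD -mul2n natrM; by field.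
elim: ks => [|k ks IH]; first by rewrite mon_nil /pown /= !expr0 invr1 !mulr1; case: b.
rewrite mon_cons IH /ymode /modex /pown /=; set S := sumn ks.
have -> : 2%:R ^- (k + S) = 2%:R^-1 ^+ k * 2%:R ^- S :> C by rewrite exprD invfM exprVn.
have -> : n.*2.+1%:R ^+ (k + S) = n.*2.+1%:R ^+ k * n.*2.+1%:R ^+ S :> C by rewrite exprD.
case: b {IH} => /=.
  have -> : (omx1 R n k)%:C = (2%:R^-1 * n.*2.+1%:R) ^+ k by rewrite /omx1 rmorphXn /= hE.
  by rewrite exprMn; move: (_ ^+ k) (_ ^+ k) => *; ring.
have -> : (omx2 R n k)%:C = (-1) ^+ k.+1 * (2%:R^-1 * n.*2.+1%:R) ^+ k.
  by rewrite /omx2 rmorphM !rmorphXn /= rmorphN1 hE.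
have -> : (k + S + (size ks).+1 = k.+1 + (S + size ks))%N by lia.
rewrite exprMn (exprD (-1) k.+1); set a := (-1) ^+ k.+1; set b := (-1) ^+ _; set c := _ ^+ k; set d := _ ^+ k.
by set e := 2%:R ^- S; set f := _ ^+ S; move: a b c d e f => a b c d e f; ring.
Qed.

Lemma Lc_lim k ks t : upper t ->
  cvc (fun K => Lcum (@ymode R) (cc false false t) (modes K) (@xiC R) k ks) (Lc k ks t).
Proof.
move=> ut; have lim := TT_lim_odds (polyb_pown R (k + sumn ks)) (polyb_alt R (size ks)) ut.
apply: (@cvc_eq _ (fun K => xiC R k * del0 C ks + (1 + (-1) ^+ (k + sumn ks + (size ks).+1)) * (2%:R ^- (k + sumn ks) *
   \sum_(n < K) pown R (k + sumn ks) n.*2 * gser (alt R (size ks)) (ph t ^+ n.*2.+1)))).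
  move=> K; rewrite /Lcum sum_modes; congr (_ + _).
  rewrite mulr_sumr mulr_sumr; apply: eq_bigr => n _.
  have e b : cc false false t (b, nat_of_ord n) (size ks) = gser (alt R (size ks)) (ph t ^+ n.*2.+1).
    by rewrite /cc /= chi_ph mul1r.
  rewrite !e !mulrA -!mon_cons !mon_ymode /=.
  by move: (gser _ _) (pown _ _ _) (_ ^- _) (_ ^+ _) => *; ring.
rewrite /Lc; apply: cvcD; first exact: cvc_cst.
have -> : (if odd (k + sumn ks + size ks) then 2%:R * EE (k + sumn ks) (size ks) t else 0) =
   (1 + (-1) ^+ (k + sumn ks + (size ks).+1)) * (2%:R ^- (k + sumn ks) * TT (odds (pown R (k + sumn ks))) (alt R (size ks)) t).
  rewrite /EE -signr_odd addnS /=; case: odd; rewrite ?expr0 ?expr1 ?subrr ?mul0r //.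
apply: cvcZ; exact: cvcZ.
Qed.

Definition W ks : int := \sum_(k <- ks) (2 * k.+1%:Z).

Lemma W_cons k ks : W (k :: ks) = 2 * k.+1%:Z + W ks. Proof. by rewrite /W big_cons. Qed.

Lemma W_E ks : W ks = 2 * (sumn ks + size ks)%N%:Z.
Proof. by elim: ks => [|k ks IH]; rewrite ?W_cons ?IH ?/W ?big_nil //=; lia. Qed.

Lemma QM_Lc k ks : QM (W (k :: ks)) (Lc k ks).
Proof.
have We : W (k :: ks) = 2 * (k + sumn ks + (size ks).+1)%N%:Z by rewrite W_E /=; lia.
rewrite We; case: ks We => [|k' ks] _ /=.
  rewrite addn0; case: (boolP (odd k)) => hk.
    apply: QM_ext (QM_wt _ (QM_L1 hk)) => [t ut|]; last by lia.
    by rewrite /Lc /= !addn0 hk /L1 /del0 eqxx mulr1 /xiC xi_exp_vv.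
  apply: QM_ext (QM_0 _ _) => t ut.
  by rewrite /Lc /= !addn0 (negPf hk) /del0 eqxx mulr1 addr0 /xiC /xi_exp (negPf hk).
set s := (k + (k' + sumn ks))%N; set r := (size ks).+1.
have e t : Lc k (k' :: ks) t = if odd (s + r) then 2%:R * EE s r t else 0.
  by rewrite /Lc /del0 /= mulr0 add0r.
case: (boolP (odd (s + r))) => ho; last first.
  by apply: QM_ext (QM_0 _ _) => t ut; rewrite e (negPf ho).
apply: (QM_ext (f := fun t => 2%:R * EE s r t)); first by move=> t _; rewrite e ho.
(* The larger of [s] and [r] decides which of the two families contains [EE s r]; in both cases the
   difference is odd. *)
apply: QM_scale; have [sr|sr] := ltnP r s.
  have ho' : odd (s - r) by rewrite oddB 1?ltnW // -oddD.
  have := QM_EE_diag (size ks) ho'; rewrite -/r subnK 1?ltnW //; apply: QM_wt; lia.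
have ho' : odd (r - s) by rewrite oddB // -oddD addnC.
have := QM_EE_theta s ho'; rewrite subnK //; apply: QM_wt; lia.
Qed.

Lemma QM_shc n ks (F G : seq nat -> C -> C) (c c' : int) : (size ks <= n)%N ->
  (forall a, (size a <= n)%N -> QM (c + W a) (F a)) -> (forall b, (size b <= n)%N -> QM (c' + W b) (G b)) ->
  QM (c + c' + W ks) (fun t => shc ks (fun a => F a t) (fun b => G b t)).
Proof.
elim: ks n F G c c' => [|k ks IH] n F G c c' hn hF hG /=.
  rewrite /W big_nil addr0; have := QM_mul (hF [::] isT) (hG [::] isT).
  by apply: QM_wt; rewrite /W big_nil; lia.
case: n hn hF hG => [//|n] hn hF hG; apply: QM_add.
  apply: (QM_wt (k := (c + 2 * k.+1%:Z) + c' + W ks)); first by rewrite W_cons; lia.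
  apply: (IH n (fun a => F (k :: a)) G) => // [a ha|b hb].
    by apply: QM_wt (hF (k :: a) ha); rewrite W_cons; lia.
  by apply: hG; exact: leqW.
apply: (QM_wt (k := c + (c' + 2 * k.+1%:Z) + W ks)); first by rewrite W_cons; lia.
apply: (IH n F (fun b => G (k :: b))) => // [a ha|b hb].
  by apply: hF; exact: leqW.
by apply: QM_wt (hG (k :: b) hb); rewrite W_cons; lia.
Qed.

Definition Om ks t : C := Glim 0 [::] ks t.

Lemma cvc_shc ks (F G : nat -> seq nat -> C) (f g : seq nat -> C) :
  (forall a, cvc (fun K => F K a) (f a)) -> (forall b, cvc (fun K => G K b) (g b)) ->
  cvc (fun K => shc ks (F K) (G K)) (shc ks f g).
Proof.
elim: ks F G f g => [|k ks IH] F G f g hF hG /=; first exact: cvcM.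
by apply: cvcD; apply: (IH (fun K a => _) (fun K b => _)).
Qed.

Lemma Om_rec k ks t : upper t -> Om (k :: ks) t = shc ks (fun a => Lc k a t) (fun b => Om b t).
Proof.
move=> ut; apply: (cvc_unique (Zst_Glim (k :: ks) ut)).
apply: cvc_eq (cvc_shc ks (fun a => Lc_lim k a ut) (fun b => Zst_Glim b ut)) => K.
have hc i : cumul (enchi t (@ymode R i)) (cc false false t i).
  by have := cc_cumul i (erefl : false && false = false) ut; rewrite ymh_false chi_false.
by rewrite (Zst_rec (@enchiD R t) _ _ hc).
Qed.

Lemma QM_Om ks : QM (W ks) (Om ks).
Proof.
have [n] := ubnP (size ks); elim: n ks => // n IH [|k ks] hn.
  apply: (QM_ext (f := fun t => th false false 0 t * etai t)); first by move=> t _.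
  rewrite /W big_nil; apply: (@QM_mul _ 1 (-1)); first exact: (QM_th0 R (erefl : false && false = false)).1.
  exact/QM_Mod/Mod_etai.
apply: (QM_ext (f := fun t => shc ks (fun a => Lc k a t) (fun b => Om b t))).
  by move=> t ut; rewrite Om_rec.
apply: (QM_wt (k := 2 * k.+1%:Z + 0 + W ks)); first by rewrite W_cons addr0.
apply: (@QM_shc (size ks)) => // [a ha|b hb].
  by rewrite -W_cons; exact: QM_Lc.
by rewrite add0r; apply: IH; rewrite /= in hn; lia.
Qed.

(** Half of [W]; the measure of the induction that recovers V from Omega. *)
Definition mu (a : seq nat) : nat := (sumn a + size a)%N.

Lemma mu_catrev ks a : mu (catrev ks a) = (mu a + mu ks)%N.
Proof. by rewrite /mu; elim: ks a => [|x s ih] b /=; rewrite ?addn0 // ih /=; lia. Qed.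

(* Removing the leading term [th e * Vf] leaves only shapes of smaller size [mu]. *)
Lemma QM_Glim_rest n e ks' ks : (mu ks' + mu ks <= n)%N ->
  (forall a, (mu a < n)%N -> QM (-1 + W a) (Vf a)) ->
  QM (1 - 1 + 2 * e%:Z + W ks' + W ks) (fun t => Glim e ks' ks t - th false false e t * Vf (catrev ks ks') t).
Proof.
move=> + IHn; elim: ks e ks' => [|k ks IH] e ks' hn.
  by apply: QM_ext (QM_0 _ _) => t _; rewrite /= subrr.
(* The choice [j = k] keeps the whole letter and carries the leading term; every other choice lowers
   [mu]. *)
apply: (QM_ext (f := fun t => \sum_(j < k) 'C(k, j)%:R * Glim (e + (k - j))%N (nat_of_ord j :: ks') ks t +
   k.+1%:R^-1 * Glim (e + k.+1)%N ks' ks t + (Glim e (k :: ks') ks t - th false false e t * Vf (catrev ks (k :: ks')) t))).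
  move=> t _ /=; rewrite [in RHS]big_ord_recr /= binn mul1r subnn addn0.
  by rewrite addrA (addrAC _ _ (Glim e (k :: ks') ks t)).
have full e' a : (mu a + mu ks < n)%N -> QM (2 * e'%:Z + W a + W ks) (Glim e' a ks).
  move=> ha; apply: (QM_ext (f := fun t => (Glim e' a ks t - th false false e' t * Vf (catrev ks a) t) + th false false e' t * Vf (catrev ks a) t)).
    by move=> t _; rewrite subrK.
  apply: QM_add; first by apply: QM_wt (IH e' a (ltnW ha)); lia.
  have h := IHn (catrev ks a) ltac:(rewrite mu_catrev; lia).
  apply: QM_wt (QM_mul (QM_th R e' (erefl : false && false = false)) h).
  by have := mu_catrev ks a; rewrite !W_E /mu; lia.
rewrite /mu /= in hn; apply: QM_add; first apply: QM_add.
- apply: QM_sum => j; apply: QM_scale; have hj := ltn_ord j.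
  apply: QM_wt (full (e + (k - j))%N (nat_of_ord j :: ks') _); last by rewrite /mu /=; lia.
  by rewrite !W_cons; lia.
- apply: QM_scale; apply: QM_wt (full (e + k.+1)%N ks' _); last by rewrite /mu; lia.
  by rewrite !W_cons; lia.
- by apply: QM_wt (IH e (k :: ks') _); rewrite ?W_cons /mu /=; lia.
Qed.

(** The leading term of [Om (rev ks)] is solved for [Vf ks] by dividing by theta_3. The reversal
    compensates the [catrev] built up by [Glim]. *)
Lemma QM_Vf ks : QM (-1 + W ks) (Vf ks).
Proof.
have [n] := ubnP (mu ks); elim: n ks => // n IH ks hn.
have h := @QM_Glim_rest n 0 [::] (rev ks) _ IH.
have e : mu (rev ks) = mu ks.
  have := mu_catrev ks [::]; rewrite -/(rev ks) => ->; by rewrite /mu.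
have h0 : QM (W ks) (fun t => Glim 0 [::] (rev ks) t - th false false 0 t * Vf ks t).
  have := h ltac:(rewrite /mu /= -/(mu _) e; lia); rewrite -[catrev _ _]/(rev (rev ks)) revK.
  by apply: QM_wt; rewrite !W_E -/(mu _) -/(mu _) e /mu /=; lia.
apply: (QM_ext (f := fun t => (th false false 0 t)^-1 * (Om (rev ks) t - (Glim 0 [::] (rev ks) t - th false false 0 t * Vf ks t)))).
  move=> t ut; rewrite /Om opprB addrCA subrr addr0 mulKf //; exact: th_neq0.
apply: QM_mul; first exact: (QM_th0 R (erefl : false && false = false)).2.
apply: QM_sub h0; apply: QM_wt (QM_Om (rev ks)); by rewrite !W_E -/(mu _) -/(mu _) e.
Qed.

Lemma W_ksA (B : seq nat) : W (ksA B) = (2 * wt B)%N%:Z.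
Proof.
by rewrite /W wt_ksA; elim: (ksA B) => [|k ks IH]; rewrite ?big_nil ?muln0 // !big_cons IH; lia.
Qed.

End Conclusion.

Theorem theorem4p1 (R : realType) :
  (forall A : seq nat, nth 0%N A 1 = 0%N ->
     exists f : R[i] -> R[i],
       (forall t, upper t -> cvgC (fun N => OmegaN N t A) (f t)) /\
       quasimodular (2 * wt A)%N%:Z f) /\
  (forall A : seq nat, nth 0%N A 0 = 0%N -> nth 0%N A 1 = 0%N ->
     exists f : R[i] -> R[i],
       (forall t, upper t -> cvgC (fun N => VN N t A) (f t)) /\
       quasimodular ((2 * wt A)%N%:Z - 1) f).
Proof.
split=> [A hA|A hA0 hA].
  exists (fun t => tpi R ^+ size (ksA A) * Om (ksA A) t); split=> [t ut|].
    apply/cvcE; apply: cvc_eq (cvcZ _ (Zst_Glim (ksA A) ut)) => K.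
    by rewrite OmegaN_Zst.
  by apply: QM_quasimodular; apply: QM_scale; rewrite -W_ksA; exact: QM_Om.
exists (fun t => tpi R ^+ size (ksA A) * Vf (ksA A) t); split=> [t ut|]; last first.
  by apply: QM_quasimodular; apply: QM_scale; rewrite -W_ksA addrC; exact: QM_Vf.
apply/cvcE.
have [s _] := lacunary_sum 1 (fun j => leq_pmull j (isT : (0 < 24)%N)) (@growth_vcoef R (ksA A)) ut.
rewrite -vterm_lac in s; apply: cvc_eq (cvcZ _ (asum_cvc s)) => N.
rewrite VN_mon //; congr (_ * _); apply: eq_bigr => M _; rewrite /vterm /vcoef big_distrr /=.
apply: eq_bigr => l hl; congr (_ * _).
  by rewrite /vx /= xi_exp_vv -/(Ph R l 1) Ph1 // rmorphB rmorph_nat fmorphV rmorph_nat.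
(* The word has only nonzero letters, and for these [vx] is the power sum [pfrob]. *)
have : 0%N \notin ksA A.
  apply/negP => /flattenP[s' /mapP[k]]; rewrite mem_iota add0n => /andP[_ hk] -> /nseqP[e].
  by rewrite -e hA0.
elim: (ksA A) => [|k ks IH]; first by rewrite !mon_nil.
rewrite in_cons negb_or => /andP[k0 /IH e]; rewrite !mon_cons e; congr (_ * _).
by rewrite /PhC /Ph /vx xi_exp_vv eq_sym (negPf k0).
Qed.
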